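(* Let $m\ge2$, $n\geq1$, $r=m/2$, let $\mathfrak g=\mathfrak{osp}(m|2n)$ and let $V=OSP_{m|2n}$ be its standard representation. With $\omega,L_\omega,\Omega,H_d$ as in the context, the $\mathfrak g$-modules $S^dV$ have the following structure. (A) Suppose $m$ is odd or $m>2n$. Then for every $d\ge0$ $$S^dV=H_d\oplus L_\omega H_{d-2}\oplus L_\omega^2H_{d-4}\oplus\cdots,$$ and each $H_d$ is irreducible. Moreover $S^\bullet V/(1-\omega)\cong\bigoplus_{d\ge0}H_d$. (B) Suppose $n-r\in\mathbb Z_{\ge0}$. (B1) For $0\le d\le n-r+1$, $S^dV=H_d\oplus L_\omega H_{d-2}\oplus\cdots$ and $H_d$ is irreducible. (B2) For $n-r+2\le d\le 2(n-r)+2$ put $s=d-(n-r)-1$. There are $\mathfrak g$-submodules $W_{d-2}\subseteq S^{d-2}V$ and $A_d\subseteq S^dV$ with $$S^{d-2}V=L_\omega^{s-1}H_{d-2s}\oplus W_{d-2},\qquad S^dV=A_d\oplus L_\omega W_{d-2},$$ such that $\Omega L_\omega$ restricts to an isomorphism $W_{d-2}\to W_{d-2}$ and $H_d\subseteq A_d$. The module $A_d$ is self-dual and indecomposable, with irreducible head and irreducible socle, both isomorphic to $H_{d-2s}$, and with a three-step socle filtration whose layers from top to bottom are $H_{d-2s}$, $Q_d$, $H_{d-2s}$, where $Q_d=H_d/L_\omega^sH_{d-2s}$. Here $H_{d-2s}\cong L_{\mathfrak b}((d-2s)\epsilon_1)$; if $r\ge2$ then $Q_d\cong L_{\mathfrak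 b}(d\epsilon_1)$; if $r=1$ then $Q_d\cong L_{\mathfrak b}(d\epsilon_1)\oplus L_{\mathfrak b}(-\epsilon_1+\delta_1+\dots+\delta_{d-2s+1})$. (B3) For $d>2(n-r)+2$, with $t=\left\lfloor\frac{d-2(n-r)-3}{2}\right\rfloor$ and $A_{n-r+1}:=H_{n-r+1}$, $$S^dV=\bigoplus_{i=0}^{t}L_\omega^iH_{d-2i}\ \oplus\bigoplus_{j=t+1}^{\left\lfloor\frac{d-(n-r)-1}{2}\right\rfloor}L_\omega^jA_{d-2j}.$$ In this range $H_d$ is irreducible if $r\ge2$, and if $r=1$ it is the direct sum of two irreducible modules with highest weights $d\epsilon_1$ and $(2n-d)\epsilon_1$ with respect to $\mathfrak b$. (B4) $S^\bullet V/(1-\omega)\cong\bigoplus_{d=n-r+1}^{2(n-r)+2}A_d\oplus\bigoplus_{d>2(n-r)+2}H_d$.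
   Context: Everything is over $\mathbb C$; $V=\mathbb C^{m|2n}$ and $S^\bullet V$ is its supersymmetric algebra. Let $(-,-)\in S^2V^*$ be a nondegenerate $\mathfrak g$-invariant supersymmetric even form on $V$; it induces $V\cong V^*$, a dual element $\omega\in S^2V$, and a nondegenerate $\mathfrak g$-invariant form on each $S^dV$. $L_\omega:S^dV\to S^{d+2}V$ is multiplication by $\omega$, and $\Omega:S^dV\to S^{d-2}V$ is its adjoint, $(\Omega x,y)=(x,\omega y)$ (the Laplacian; it is surjective), normalized so that $[\Omega,-L_\omega]=(n-r)-\mathcal E$ with $\mathcal E$ acting by $d$ on $S^dV$. Put $H_d=\ker(\Omega:S^dV\to S^{d-2}V)$, with $S^dV=0$ and $H_d=0$ for $d<0$. The quotient $S^\bullet V/(1-\omega)$ is the algebra of functions on the complex supersphere $OSP(m|2n)/OSP(m-1|2n)$. In case (B), $m=2r$ is even; $\epsilon_1,\dots,\epsilon_r,\delta_1,\dots,\delta_n$ is the standard basis of the dual of a Cartan subalgebra of $\mathfrak g_{\overline0}$, $\mathfrak b$ is the Borel subalgebra with simple roots $\epsilon_1-\epsilon_2,\dots,\epsilon_{r-1}-\epsilon_r,\epsilon_r-\delta_1,\delta_1-\delta_2,\dots,\delta_{n-1}-\delta_n,2\delta_n$, and $L_{\mathfrak b}(\lambda)$ denotes the irreducible $\mathfrak g$-module with even highest weight vector of weight $\lambda$ with respect to $\mathfrak b$.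
   Formalization: In (B2) for r=1, the second summand of Q_d is L_b(-ε1+δ1+…+δ_{d-2s+1}) up to parity: its highest weight vector has the parity of d-2s+1, hence is odd when d-2s+1 is odd (e.g. osp(2|2), d=2), not always even. *)

(* Defs.v *)
From HB Require Import structures.
From mathcomp Require Import all_boot all_order all_algebra.
From mathcomp Require Import reals complex mpoly.

Set Implicit Arguments.
Unset Strict Implicit.
Unset Printing Implicit Defensive.

Import GRing.Theory.
Local Open Scope ring_scope.
Local Open Scope complex_scope.

(* S(V) = S(V_0) (x) Lambda(V_1) for V = C^{m|2n}: the component at I is the   *)
(* coefficient of theta_I, the product of the odd generators theta_j (j in I)  *)
(* in increasing order.                                                        *)
Definition superSym (R : realType) (m n : nat) : Type :=
  {ffun {set 'I_(n + n)} -> {mpoly R[i][m]}}.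

(* The complex numbers are R[i], for R a model of the real numbers. *)
Section OrthosymplecticModules.

Variables (R : realType) (m n : nat).

Local Notation C := (R[i]).
Local Notation SV := (superSym R m n).
Local Notation E := {set 'I_(n + n)}.
Local Notation dimV := (m + (n + n))%N.
Local Notation gl := ('M[C]_dimV).
Local Notation sub := (SV -> Prop).

(* theta_I * theta_J = (-1)^(inversions I J) theta_(I :|: J) for disjoint I, J *)
Definition inversions (I J : E) : nat :=
  (\sum_(i in I) #|[set j in J | (j < i)%N]|)%N.

Definition smul (f g : SV) : SV :=
  [ffun K : E => \sum_(I : E | I \subset K)
    (-1) ^+ inversions I (K :\: I) * (f I * g (K :\: I))].

Definition sone : SV := [ffun I : E => if I == set0 then 1 else 0].

Definition gen (a : 'I_dimV) : SV :=
  match split a with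
  | inl i => [ffun I : E => if I == set0 then 'X_i else 0]
  | inr j => [ffun I : E => if I == [set j] then 1 else 0]
  end.

(* the left superderivation d/de_b *)
Definition sder (b : 'I_dimV) (f : SV) : SV :=
  match split b with
  | inl i => [ffun I : E => mderiv i (f I)]
  | inr j => [ffun I : E => if j \in I then 0
                 else (-1) ^+ #|[set k in I | (k < j)%N]| * f (j |: I)]
  end.

Definition Sd (d : nat) : sub := fun f =>
  forall I : E, ((#|I| <= d)%N -> f I \is (d - #|I|)%N.-homog)
             /\ ((d < #|I|)%N -> f I = 0).

Definition spart (p : bool) (f : SV) : SV :=
  [ffun I : E => if odd #|I| == p then f I else 0].

Definition shomog (p : bool) (f : SV) : Prop :=
  forall I : E, odd #|I| != p -> f I = 0.

Definition vpar (a : 'I_dimV) : bool :=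
  if split a is inr _ then true else false.

(* X : gl acts on V by e_b |-> \sum_a X a b e_a *)
Definition glhomog (p : bool) (X : gl) : Prop :=
  forall a b, X a b != 0 -> vpar a (+) vpar b = p.

(* (X e_a, e_b) + (-1)^(|X||e_a|) (e_a, X e_b) = 0, where (e_a, e_b) = B a b *)
Definition preserves (p : bool) (X B : gl) : Prop :=
  forall a b, \sum_c X c a * B c b
    + (-1) ^+ (p && vpar a) * \sum_c B a c * X c b = 0.

Definition stdform : gl :=
  block_mx (\matrix_(i < m, j < m) (i == rev_ord j)%:R) 0
           0 (\matrix_(i < n + n, j < n + n)
                if i == rev_ord j then (-1) ^+ (n <= i)%N else 0).

(* osp true consists of the odd elements, osp false of the even ones. *)
Definition osp (p : bool) (X : gl) : Prop :=
  glhomog p X /\ preserves p X stdform.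

(* the superderivation of S(V) that extends X *)
Definition act (X : gl) (f : SV) : SV :=
  \sum_a \sum_b X a b *: smul (gen a) (sder b f).

(* B is the Gram matrix of the form in the basis e_a of V. *)
Record invariant_form (B : gl) : Prop := InvariantForm {
  form_even : glhomog false B;
  form_supersymmetric :
    forall a b, B b a = (-1) ^+ (vpar a && vpar b) * B a b;
  form_nondegenerate : B \in unitmx;
  form_invariant : forall p X, osp p X -> preserves p X B }.

(* the superderivation with value (e_a, v) at v : V *)
Definition contract (B : gl) (a : 'I_dimV) (f : SV) : SV :=
  \sum_b B a b *: sder b f.

(* The contractions by the factors of the monomial 'X_[k] * theta_I, the last  *)
(* factor acting first.                                                        *)
Definition contract_mon (B : gl) (k : 'X_{1..m}) (I : E) (f : SV) : SV :=
  foldr (fun i g => iter (k i) (contract B (lshift (n + n) i)) g)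
    (foldr (fun j g => contract B (rshift m j) g) f (enum I)) (enum 'I_m).

(* The form induced on S(V): S^c V and S^d V are orthogonal for c <> d, and    *)
(* (x_1 ... x_d, y_1 ... y_d) is the sum over the permutations s of            *)
(* +/- (x_1, y_(s 1)) ... (x_d, y_(s d)), the sign being + for s reversing     *)
(* the order: (f x, g) = (f, contraction of g by x).                           *)
Definition sform (B : gl) (f g : SV) : C :=
  \sum_(I : E) \sum_(k <- msupp (f I))
    (f I)@_k * (contract_mon B k I g set0)@_0%MM.

(* The dual element: \sum_c invmx B a c *: e_c is the vector v_a such that     *)
(* (v_a, e_b) is 1 if a = b and 0 otherwise. With the factor 1/2, omega        *)
(* represents the form, that is, sform B omega (u v) = (u, v) for u, v in V,   *)
(* and the exact adjoint Omega of L_omega for sform satisfies                  *)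
(* [Omega, - L_omega] = (n - m / 2) - d on S^d V.                              *)
Definition omega (B : gl) : SV :=
  2^-1 *: \sum_a \sum_c invmx B a c *: smul (gen a) (gen c).

Definition Lomega (B : gl) : SV -> SV := smul (omega B).

Definition is_laplacian (B : gl) (Omega : {linear SV -> SV}) : Prop :=
  forall x y, sform B (Omega x) y = sform B x (Lomega B y).

(* H_d; Omega vanishes on S^0 V and S^1 V *)
Definition harm (Omega : {linear SV -> SV}) (d : nat) : sub :=
  fun u => Sd d u /\ Omega u = 0.

(* omega is even, hence central, so this is the two-sided ideal of 1 - omega *)
Definition ideal_one_sub_omega (B : gl) : sub :=
  fun u => exists v, u = smul (sone - omega B) v.

Definition zeroS : sub := fun u => u = 0.
Definition fullS : sub := fun _ => True.
Definition incl (N M : sub) : Prop := forall u, N u -> M u.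
Definition same (N M : sub) : Prop := forall u, N u <-> M u.

Record is_submod (M : sub) : Prop := IsSubmod {
  submod0 : M 0;
  submod_lin : forall (c : C) u v, M u -> M v -> M (c *: u + v);
  submod_graded : forall p u, M u -> M (spart p u);
  submod_act : forall p X u, osp p X -> M u -> M (act X u) }.

Definition Lpow (B : gl) (i : nat) (M : sub) : sub :=
  fun u => exists2 v, M v & u = iter i (Lomega B) v.

(* M / N is a module; the predicates below on pairs M, N are about M / N *)
Definition is_subquot (M N : sub) : Prop :=
  [/\ is_submod M, is_submod N & incl N M].

(* M / N is the direct sum of the P i / N *)
Definition dsum (I : finType) (M N : sub) (P : I -> sub) : Prop :=
  [/\ forall i, incl N (P i),
      forall u, M u <->
        exists2 f : I -> SV, (forall i, P i (f i)) & N (u - \sum_i f i)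
    & forall f : I -> SV, (forall i, P i (f i)) -> N (\sum_i f i) ->
        forall i, N (f i)].

Definition dsum2 (M N P Q : sub) : Prop :=
  dsum M N (fun b : bool => if b then P else Q).

(* The sum of the N d. For N d included in S^d V it is direct. *)
Definition infsum (N : nat -> sub) : sub := fun u =>
  exists k (f : nat -> SV),
    (forall d, N d (f d)) /\ u = \sum_(d < k) f d.

(* phi induces an even isomorphism of modules from M1 / N1 onto M2 / N2 *)
Record induces_iso (phi : SV -> SV) (M1 N1 M2 N2 : sub) : Prop := InducesIso {
  iso_dom : is_subquot M1 N1;
  iso_cod : is_subquot M2 N2;
  iso_map : forall u, M1 u -> M2 (phi u);
  iso_lin : forall (c : C) u v, M1 u -> M1 v ->
    N2 (phi (c *: u + v) - (c *: phi u + phi v));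
  iso_even : forall p u, M1 u -> shomog p u ->
    exists2 w, shomog p w & N2 (phi u - w);
  iso_act : forall p X u, osp p X -> M1 u ->
    N2 (phi (act X u) - act X (phi u));
  iso_inj : forall u, M1 u -> (N2 (phi u) <-> N1 u);
  iso_surj : forall w, M2 w -> exists2 u, M1 u & N2 (w - phi u) }.

Definition sqiso (M1 N1 M2 N2 : sub) : Prop :=
  exists phi, induces_iso phi M1 N1 M2 N2.

Definition irreducible (M N : sub) : Prop :=
  [/\ is_subquot M N, ~ incl M N
    & forall P, is_submod P -> incl N P -> incl P M -> same P N \/ same P M].

Definition indecomposable (M N : sub) : Prop :=
  [/\ is_subquot M N, ~ incl M N
    & forall P Q, is_submod P -> is_submod Q -> dsum2 M N P Q ->
        same P N \/ same Q N].

(* the intersection of M with its maximal submodules; the head is M / radical M *)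
Definition radical (M : sub) : sub := fun u =>
  M u /\ forall P, irreducible M P -> P u.

(* the preimage in M of the socle of M / N, the sum of the simple submodules *)
Definition socle (M N : sub) : sub := fun u =>
  exists k (P : 'I_k -> sub) (f : 'I_k -> SV),
    (forall i, [/\ irreducible (P i) N, incl (P i) M & P i (f i)])
    /\ N (u - \sum_i f i).

(* the socle filtration 0 = soc_0 <= soc_1 <= ... of M *)
Definition socfil (M : sub) (i : nat) : sub := iter i (socle M) zeroS.

Definition linear_on (M : sub) (f : SV -> C) : Prop :=
  forall c u v, M u -> M v -> f (c *: u + v) = c * f u + f v.

(* u |-> beta u _ is an even isomorphism of modules from M to its dual *)
Definition selfdual (M : sub) : Prop :=
  is_submod M /\ exists beta : SV -> SV -> C,
  [/\ forall u, M u -> linear_on M (beta u) /\ linear_on M (beta^~ u),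
      forall p q u v, M u -> M v -> shomog p u -> shomog q v -> p != q ->
        beta u v = 0,
      forall p q X u v, osp p X -> M u -> M v -> shomog q u ->
        beta (act X u) v + (-1) ^+ (p && q) * beta u (act X v) = 0,
      forall u, M u -> (forall v, M v -> beta u v = 0) -> u = 0
    & forall f, linear_on M f ->
        exists2 u, M u & forall v, M v -> beta u v = f v].

Definition cartan (H : gl) : Prop := osp false H /\ is_diag_mx H.

Definition diag_entry (k : nat) (H : gl) : C :=
  if (insub k : option 'I_dimV) is Some a then H a a else 0.

(* Restricted to the Cartan subalgebra these are the basis elements epsilon_i  *)
(* (1 <= i <= m / 2) and delta_j (1 <= j <= n); indices start from 1. For m    *)
(* even the elements of the Cartan subalgebra are the diagonal matrices        *)
(* (h_1, .., h_r, - h_r, .., - h_1 | t_1, .., t_n, - t_n, .., - t_1).          *)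
Definition eps (i : nat) (H : gl) : C := diag_entry i.-1 H.
Definition delta (j : nat) (H : gl) : C := diag_entry (m + j.-1) H.

(* the simple roots of the Borel subalgebra b, for m = 2 r with r, n >= 1 *)
Inductive simple_root (r : nat) : (gl -> C) -> Prop :=
| SimpleEps i of (1 <= i < r)%N :
    simple_root r (fun H => eps i H - eps i.+1 H)
| SimpleEpsDelta : simple_root r (fun H => eps r H - delta 1 H)
| SimpleDelta j of (1 <= j < n)%N :
    simple_root r (fun H => delta j H - delta j.+1 H)
| SimpleLong : simple_root r (fun H => 2 * delta n H).

Definition root_vector (alpha : gl -> C) (p : bool) (X : gl) : Prop :=
  osp p X /\
  forall H, cartan H -> H *m X - X *m H = alpha H *: X.

(* v represents a highest weight vector of M / N, of weight lambda and parity p *)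
Definition hwvector (r : nat) (lambda : gl -> C) (p : bool) (M N : sub)
    (v : SV) : Prop :=
  [/\ M v, ~ N v, shomog p v,
      forall alpha q X, simple_root r alpha -> root_vector alpha q X ->
        N (act X v)
    & forall H, cartan H -> N (act H v - lambda H *: v)].

(* M / N is isomorphic to L_b(lambda), the irreducible module with a highest   *)
(* weight vector of weight lambda that is even (p = false), or to its parity   *)
(* shift (p = true).                                                           *)
Definition is_Lb (r : nat) (p : bool) (lambda : gl -> C) (M N : sub) : Prop :=
  irreducible M N /\ exists v, hwvector r lambda p M N v.

End OrthosymplecticModules.

Arguments Sd {R m n} d _.
Arguments zeroS {R m n} _.
Arguments fullS {R m n} _.

(* Main.v *)
(** Let m_a and d_a be multiplication by e_a and the derivation d/de_a.  Their
    (super)commutation relations suffice for everything that follows.  The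
    operators F_ab = m_a (e_b, -) - (-1)^(|a||b|) m_b (e_a, -) span the action of
    osp and commute with L, Omega and the degree, which generate an sl2.  Hence
    T = L Omega is annihilated on S^d by the product of the T - lam d i, where
    lam d i = i (d - i - 1 - rho) and rho = n - m/2.  If these numbers are distinct
    the eigenspaces of T are the L^i H_(d-2i); in general lam d i = lam d j forces
    i + j = d - 1 - rho, eigenvalues collide in pairs, and the generalized
    eigenspaces are L^i A_(d-2i) with A_d = ker (Omega L Omega).

    Let p be an even isotropic index and f of weight w < d with F_pb f divisible
    by omega^s for all b different from p and its dual p*.  Summing over b one finds
    that (d - w) x_p f is divisible by omega, and by induction that f is divisible
    by omega^s or is a multiple of some L^j x_p^(d-2j).  A
    quadratic raising operator in the F_pb carries x_p*^d to x_p^d, or to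
    L^s x_p^(d-2s) in a critical degree.  Since the form pairs x_p^d with x_p*^d,
    a proper submodule and its orthogonal cannot both be nonzero: this gives the
    irreducibility of H_d, and the head and the socle of A_d.

    For m = 2 a harmonic vector of weight 0 lies in L^s H_(d-2s), by the hard
    Lefschetz theorem in the exterior algebra, or vanishes if d > 2n; the two
    summands of the quotient are its parts of positive and of negative weight.

    Modulo 1 - omega a vector can be multiplied by powers of L, so it suffices to
    decompose S^d for large d; a relation sum_d f_d = v - omega v telescopes to
    sum_i L^i f_(d-2i) = 0 for large d. *)

Require Import Defs.
From HB Require Import structures.
From mathcomp Require Import all_boot all_order all_algebra.
From mathcomp Require Import reals complex mpoly.
From mathcomp Require Import boolp ring lra zify.

Set Implicit Arguments.
Unset Strict Implicit.
Unset Printing Implicit Defensive.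

Import Order.TTheory GRing.Theory Num.Theory.
Local Open Scope ring_scope.
Local Open Scope complex_scope.

(** Everything is done with one even index p whose dual index ps differs from p; it exists because m
    is at least 2 and the standard form is antidiagonal. Signs of the concrete model are met once,
    when S(V) is shown to satisfy the axioms of [fock]. The obstacle is division by omega. From x_p
    f = omega g one must conclude that x_p divides g. If an even index other than p and ps exists,
    omega is not a zero divisor modulo x_p. For m = 2 it is nilpotent there, and positivity of the
    weight of g has to replace the argument. This is the origin of the alternative
    [inner X p \/ 0 <= w] and of the exchange of p and ps when a weight is negative. It also shows
    why the case m = 2 is different. The raising operator carries x_ps^d to x_p^d with a coefficient
    containing the factors j - rho - 1 for j < d, so it vanishes when rho is a natural number and d
    > rho + 1. With a further even index both powers are reached directly in every nonzero submodule
    of a regular H_d; without one, the halves of positive and negative weight come apart. *)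

(* The square-zero extension of K by V turns identities between linear         *)
(* combinations of vectors into polynomial identities.                         *)
Definition sqz (K : comNzRingType) (V : lmodType K) : Type := (K * V)%type.

Section SquareZero.
Variables (K : comNzRingType) (V : lmodType K).
Implicit Types x y z : sqz V.

HB.instance Definition _ := GRing.Zmodule.on (sqz V).
HB.instance Definition _ := GRing.Zmodule.copy (sqz V) (K * V)%type.

Definition sqz_mul x y : sqz V := (x.1 * y.1, x.1 *: y.2 + y.1 *: x.2).
Definition sqz_one : sqz V := (1, 0).
Fact sqz_mulA : associative sqz_mul.
Proof.
move=> [a u] [b v] [c w]; congr (_, _); rewrite /= ?mulrA // !scalerDr !scalerA addrA.
by congr (_ + _ + _); rewrite mulrC.
Qed.
Fact sqz_mulC : commutative sqz_mul.
Proof. by move=> [a u] [b v]; congr (_, _); rewrite /= 1?mulrC 1?addrC. Qed.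
Fact sqz_mul1 : left_id sqz_one sqz_mul.
Proof. by move=> [a u]; congr (_, _); rewrite /= ?mul1r // scale1r scaler0 addr0. Qed.
Fact sqz_mulDl : left_distributive sqz_mul +%R.
Proof.
move=> [a u] [b v] [c w]; congr (_, _); rewrite /= ?mulrDl // !scalerDl !scalerDr.
by rewrite addrACA.
Qed.
Fact sqz_one_neq0 : sqz_one != 0.
Proof. by apply/eqP => -[] /eqP; rewrite oner_eq0. Qed.
HB.instance Definition _ := GRing.Zmodule_isComNzRing.Build (sqz V)
  sqz_mulA sqz_mulC sqz_mul1 sqz_mulDl sqz_one_neq0.

Definition sqz_c (k : K) : sqz V := (k, 0).
Fact sqz_c_additive : zmod_morphism sqz_c.
Proof. by move=> a b; congr (_, _); rewrite /= subr0. Qed.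
Fact sqz_c_multiplicative : monoid_morphism sqz_c.
Proof. by split=> // a b; congr (_, _); rewrite /= !scaler0 addr0. Qed.
HB.instance Definition _ := GRing.isZmodMorphism.Build K (sqz V) sqz_c sqz_c_additive.
HB.instance Definition _ := GRing.isMonoidMorphism.Build K (sqz V) sqz_c sqz_c_multiplicative.

Definition sqz_v (v : V) : sqz V := (0, v).
Lemma sqz_v_inj u v : sqz_v u = sqz_v v -> u = v. Proof. by case. Qed.
Lemma sqz_vD u v : sqz_v (u + v) = sqz_v u + sqz_v v.
Proof. by congr (_, _); rewrite /= addr0. Qed.
Lemma sqz_vN u : sqz_v (- u) = - sqz_v u.
Proof. by congr (_, _); rewrite /= oppr0. Qed.
Lemma sqz_vZ k u : sqz_v (k *: u) = sqz_c k * sqz_v u.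
Proof. by congr (_, _); rewrite /= ?mulr0 // scale0r addr0. Qed.
Lemma sqz_v0 : sqz_v 0 = 0. Proof. by []. Qed.
Lemma sqz_vMn u n : sqz_v (u *+ n) = sqz_v u *+ n.
Proof. by elim: n => // n IH; rewrite !mulrS sqz_vD IH. Qed.
Definition sqzE := (sqz_vD, sqz_vN, sqz_vZ, sqz_v0, sqz_vMn).
End SquareZero.

Ltac lmod := apply: sqz_v_inj; rewrite ?sqzE; ring.

(** * Subspaces, separation by a pairing, polynomials in an operator *)

Section LinearAlgebra.
Variables (K : fieldType) (V : lmodType K).
Implicit Types (u v w x g : V) (k : K) (l : seq V) (p : {poly K}).

Definition subsp (M : V -> Prop) := M 0 /\ forall k u v, M u -> M v -> M (k *: u + v).

Section Subspace.
Variables (M : V -> Prop) (hM : subsp M).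
Lemma subsp0 : M 0. Proof. by case: hM. Qed.
Lemma subspL k u v : M u -> M v -> M (k *: u + v). Proof. by case: hM => _; apply. Qed.
Lemma subspZ k u : M u -> M (k *: u).
Proof. by move=> hu; rewrite -[_ *: _]addr0; apply: subspL => //; apply: subsp0. Qed.
Lemma subspD u v : M u -> M v -> M (u + v).
Proof. by move=> hu hv; rewrite -[u]scale1r; apply: subspL. Qed.
Lemma subspN u : M u -> M (- u).
Proof. by move=> hu; rewrite -scaleN1r; apply: subspZ. Qed.
Lemma subspB u v : M u -> M v -> M (u - v).
Proof. by move=> hu hv; apply: subspD => //; apply: subspN. Qed.
Lemma subsp_sum (I : Type) (r : seq I) (Q : pred I) (F : I -> V) :
  (forall i, Q i -> M (F i)) -> M (\sum_(i <- r | Q i) F i).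
Proof.
by move=> h; elim/big_rec: _ => [|i y Qi hy]; [apply: subsp0|apply: subspD => //; apply: h].
Qed.
Lemma subsp_cancel k u : k != 0 -> M (k *: u) -> M u.
Proof. by move=> k0 /(subspZ k^-1); rewrite scalerA mulVf // scale1r. Qed.
End Subspace.

Fixpoint lsp l v : Prop := if l is e :: l' then exists k, lsp l' (v - k *: e) else v = 0.

Lemma lsp_sub l : subsp (lsp l).
Proof.
elim: l => [|e l IH]; first by split=> //= k u v -> ->; rewrite scaler0 addr0.
split=> [|k u v] /=; first by exists 0; rewrite scale0r subr0; apply: subsp0.
move=> [a ha] [b hb]; exists (k * a + b).
by rewrite (_ : _ - _ = k *: (u - a *: e) + (v - b *: e)); [apply: subspL|lmod].
Qed.

Lemma lsp_mem l e : e \in l -> lsp l e.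
Proof.
elim: l => //= a l IH; rewrite inE => /orP[/eqP ->|/IH h].
  by exists 1; rewrite scale1r subrr; apply: subsp0; apply: lsp_sub.
by exists 0; rewrite scale0r subr0.
Qed.

Lemma lsp_min l (M : V -> Prop) : subsp M -> (forall e, e \in l -> M e) -> forall v, lsp l v -> M v.
Proof.
move=> hM; elim: l => [|a l IH] h v /=; first by move=> ->; apply: subsp0.
move=> [k hk]; rewrite -(subrK (k *: a) v); apply: subspD => //.
  by apply: IH => // e el; apply: h; rewrite inE el orbT.
by apply: subspZ => //; apply: h; rewrite inE eqxx.
Qed.

(** One spanning vector is eliminated at a time: a single u in M with nonzero coordinate along e
    suffices, since subtracting multiples of it brings the rest of M into the span of [es]. *)
Lemma subsp_fin es (M : V -> Prop) : subsp M -> (forall v, M v -> lsp es v) ->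
  exists l, forall v, M v <-> lsp l v.
Proof.
elim: es M => [|e es IH] M hM Mes.
  exists [::] => v; split; first by move/Mes.
  by move=> ->; apply: subsp0.
have hM' : subsp (fun v => M v /\ lsp es v).
  split; first by split; apply: subsp0 => //; apply: lsp_sub.
  by move=> k u v [h1 h2] [h3 h4]; split; apply: subspL => //; apply: lsp_sub.
have [l hl] := IH _ hM' (fun v h => h.2).
have [[u [k [Mu k0 hu]]]|no] := EM (exists u k, [/\ M u, k != 0 & lsp es (u - k *: e)]).
  exists (u :: l) => v /=; split=> [Mv|[c hc]].
    have [c hc] := Mes _ Mv; exists (c / k); apply/hl; split.
      by apply: subspB => //; apply: subspZ.
    rewrite (_ : _ - _ = (v - c *: e) - (c / k) *: (u - k *: e)).
      by apply: (subspB (lsp_sub _)) => //; apply: (subspZ (lsp_sub _)).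
    by rewrite scalerBr scalerA mulfVK // opprB addrA addrNK.
  by rewrite -(subrK (c *: u) v); apply: subspD; [|case/hl: hc|apply: subspZ].
exists l => v; split=> [Mv|/hl[]//]; apply/hl; split=> //.
have [k hk] := Mes _ Mv; have [k0|k0] := eqVneq k 0; last by case: no; exists v, k.
by move: hk; rewrite k0 scale0r subr0.
Qed.

Section Separation.
Variables (b : V -> V -> K) (S : V -> Prop).
Hypotheses (bl : forall k u v w, b (k *: u + v) w = k * b u w + b v w)
  (br : forall k u v w, b w (k *: u + v) = k * b w u + b w v)
  (hS : subsp S) (nd : forall x, S x -> (forall g, S g -> b x g = 0) -> x = 0).

Let b0r w : b w 0 = 0.
Proof. by have := br (-1) 0 0 w; rewrite scaler0 addr0 mulN1r addNr. Qed.
Let b0l w : b 0 w = 0.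
Proof. by have := bl (-1) 0 0 w; rewrite scaler0 addr0 mulN1r addNr. Qed.

Lemma separ_list l x : (forall e, e \in l -> S e) -> S x -> ~ lsp l x ->
  exists g, [/\ S g, forall e, e \in l -> b e g = 0 & b x g != 0].
Proof.
elim: l x => [|e l IH] x lS Sx nx.
  apply: contrapT => no; apply: nx; apply: nd => // g Sg.
  by apply/eqP/negPn/negP => bx; apply: no; exists g.
have lS' e' : e' \in l -> S e' by move=> h; apply: lS; rewrite inE h orbT.
have Se : S e by apply: lS; rewrite inE eqxx.
have [el|ne] := EM (lsp l e).
  have [|g [Sg gl gx]] := IH x lS' Sx.
    by move=> h; apply: nx; exists 0; rewrite scale0r subr0.
  exists g; split=> // e'; rewrite inE => /orP[/eqP->|/gl //].
  apply: (@lsp_min l (fun e => b e g = 0)) => //.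
  by split=> // k u v hu hv; rewrite bl hu hv mulr0 addr0.
have [g0 [Sg0 g0l g0e]] := IH e lS' Se ne.
(* This c makes x - c e orthogonal to [g0], so g can be corrected by a multiple of [g0] that kills e
   without changing its value on x - c e. *)
pose c := b x g0 / b e g0.
have [|g [Sg gl gx]] := IH (x - c *: e) lS' (subspB hS Sx (subspZ hS _ Se)).
  by move=> h; apply: nx; exists c.
exists ((- (b e g / b e g0)) *: g0 + g); split.
- by apply: subspL.
- move=> e'; rewrite inE br => /orP[/eqP->|h]; last by rewrite (g0l _ h) (gl _ h) mulr0 addr0.
  by rewrite mulNr mulfVK // addNr.
move: gx; rewrite br addrC -scaleNr bl.
suff -> : - c * b e g + b x g = - (b e g / b e g0) * b x g0 + b x g by [].
by rewrite /c; ring.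
Qed.

Lemma separ es (M : V -> Prop) x : (forall v, S v -> lsp es v) -> subsp M ->
  (forall u, M u -> S u) -> S x -> ~ M x ->
  exists g, [/\ S g, forall u, M u -> b u g = 0 & b x g != 0].
Proof.
move=> Ses hM MS Sx nMx.
have [l hl] := subsp_fin hM (fun v h => Ses v (MS v h)).
have [||g [Sg gl gx]] := @separ_list l x _ Sx.
- by move=> e el; apply: MS; apply/hl; apply: lsp_mem.
- by move/hl.
exists g; split=> // u /hl; apply: (@lsp_min l (fun e => b e g = 0)) => //.
by split=> // k v w hv hw; rewrite bl hv hw mulr0 addr0.
Qed.
End Separation.

Section PolyAction.
Variable T : {linear V -> V}.

Definition pact p v := \sum_(i < size p) p`_i *: iter i T v.

Lemma pact_wide n p v : (size p <= n)%N -> pact p v = \sum_(i < n) p`_i *: iter i T v.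
Proof.
move=> pn; rewrite /pact (big_ord_widen n (fun i => p`_i *: iter i T v)) // big_mkcond.
apply: eq_bigr => i _; case: ltnP => // h.
by rewrite nth_default // scale0r.
Qed.

Lemma iterTP n k u v : iter n T (k *: u + v) = k *: iter n T u + iter n T v.
Proof. by elim: n => //= n ->; rewrite linearP. Qed.

Lemma pact_lin p k u v : pact p (k *: u + v) = k *: pact p u + pact p v.
Proof.
rewrite /pact scaler_sumr -big_split; apply: eq_bigr => i _ /=.
by rewrite iterTP; lmod.
Qed.
Lemma pact0 p : pact p 0 = 0.
Proof. by have := pact_lin p (-1) 0 0; rewrite scaler0 addr0 scaleN1r addNr. Qed.
Lemma pactVD p u v : pact p (u + v) = pact p u + pact p v.
Proof. by rewrite -{1}[u]scale1r pact_lin scale1r. Qed.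
Lemma pact_sum p (I : Type) (r : seq I) (Q : pred I) (F : I -> V) :
  pact p (\sum_(i <- r | Q i) F i) = \sum_(i <- r | Q i) pact p (F i).
Proof. by elim/big_rec2: _ => [|i y x _ <-]; rewrite ?pact0 ?pactVD. Qed.

Lemma pactD p r v : pact (p + r) v = pact p v + pact r v.
Proof.
pose n := maxn (size p) (size r).
rewrite !(@pact_wide n) ?leq_maxl ?leq_maxr ?size_polyD // -big_split.
by apply: eq_bigr => i _; rewrite coefD scalerDl.
Qed.

Lemma pactC k v : pact k%:P v = k *: v.
Proof. by rewrite (@pact_wide 1) ?size_polyC_leq1 // big_ord1 coefC. Qed.

Lemma pactMX p v : pact (p * 'X) v = pact p (T v).
Proof.
rewrite (@pact_wide (size p).+1).
  rewrite big_ord_recl coefMX scale0r add0r; apply: eq_bigr => i _.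
  by rewrite coefMX /= -iterS iterSr.
have [->|p0] := eqVneq p 0; first by rewrite mul0r size_poly0.
by rewrite size_mulX.
Qed.

Lemma pactT p v : pact p (T v) = T (pact p v).
Proof.
rewrite /pact linear_sum; apply: eq_bigr => i _ /=.
by rewrite linearZ -iterS -iterSr.
Qed.

Lemma pactM p r v : pact (p * r) v = pact p (pact r v).
Proof.
elim/poly_ind: p v => [|p k IH] v; first by rewrite mul0r /pact size_poly0 !big_ord0.
rewrite mulrDl !pactD pactMX -mulrA ['X * r]mulrC mulrA pactMX IH pactT pactC.
congr (_ + _); rewrite mul_polyC (@pact_wide (size r)) ?size_scale_leq // /pact scaler_sumr.
by apply: eq_bigr => i _; rewrite coefZ scalerA.
Qed.

Lemma pact1 v : pact 1 v = v.
Proof. by rewrite -polyC1 pactC scale1r. Qed.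

Lemma pact_XsubC k v : pact ('X - k%:P) v = T v - k *: v.
Proof. by rewrite -polyCN pactD pactC scaleNr -['X]mul1r pactMX pact1. Qed.

Lemma pact_stable (M : V -> Prop) p v : subsp M -> (forall u, M u -> M (T u)) -> M v -> M (pact p v).
Proof.
move=> hM hT hv; apply: subsp_sum => // i _; apply: subspZ => //.
by elim: (i : nat) => //= n IH; apply: hT.
Qed.

Lemma pact_dvd p r v : p %| r -> pact p v = 0 -> pact r v = 0.
Proof. by move=> /dvdpP[c ->] h; rewrite pactM h pact0. Qed.

Lemma pact_coprime p r v : coprimep p r -> pact p v = 0 -> pact r v = 0 -> v = 0.
Proof.
move=> /Bezout_eq1_coprimepP[[a c] /= h] hp hr.
by rewrite -[v]pact1 -h pactD !pactM hp hr !pact0 addr0.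
Qed.

(** A Bezout relation between [r ord0] and the product of the other factors splits v in two; both
    parts are polynomials in T applied to v, hence remain in M. *)
Lemma primary n (r : 'I_n -> {poly K}) (M : V -> Prop) v :
  subsp M -> (forall u, M u -> M (T u)) -> M v ->
  (forall i j, i != j -> coprimep (r i) (r j)) -> pact (\prod_i r i) v = 0 ->
  exists f : 'I_n -> V, [/\ forall i, M (f i), forall i, pact (r i) (f i) = 0 & v = \sum_i f i].
Proof.
move=> hM hT; elim: n r v => [|n IH] r v Mv co.
  rewrite big_ord0 pact1 => ->; exists (fun _ => 0); split=> [i|i|]; last by rewrite big_ord0.
    exact: subsp0.
  exact: pact0.
rewrite big_ord_recl => h.
have : coprimep (r ord0) (\prod_(i < n) r (lift ord0 i)).
  by elim/big_ind: _ => [|x y hx hy|j hj]; rewrite ?coprimep1 ?coprimepMr ?hx // co.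
move=> /Bezout_eq1_coprimepP[[a c] /= hac].
pose s := \prod_(i < n) r (lift ord0 i); rewrite -/s in h hac.
have [|||f [Mf rf vf]] := IH (fun i => r (lift ord0 i)) (pact (a * r ord0) v).
- exact: pact_stable.
- by move=> i j ij; apply: co; rewrite (inj_eq lift_inj).
- by rewrite -pactM -/s mulrCA [s * _]mulrC pactM h pact0.
exists (fun i => if unlift ord0 i is Some j then f j else pact (c * s) v); split.
- by move=> i; case: unliftP => [j _|_]; [apply: Mf|apply: pact_stable].
- by move=> i; case: unliftP => [j ->|->]; [apply: rf|rewrite -pactM mulrCA pactM h pact0].
rewrite big_ord_recl unlift_none; under eq_bigr do rewrite liftK.
by rewrite -vf -pactD addrC hac pact1.
Qed.

Lemma primary_uniq n (r : 'I_n -> {poly K}) (f : 'I_n -> V) :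
  (forall i j, i != j -> coprimep (r i) (r j)) -> (forall i, pact (r i) (f i) = 0) ->
  \sum_i f i = 0 -> forall i, f i = 0.
Proof.
move=> co rf f0 i; apply: (@pact_coprime (r i) (\prod_(j | j != i) r j)).
- by elim/big_ind: _ => [|x y hx hy|j hj]; rewrite ?coprimep1 ?coprimepMr ?hx // co // eq_sym.
- exact: rf.
have : pact (\prod_(j | j != i) r j) (\sum_j f j) = 0 by rewrite f0 pact0.
rewrite [X in pact _ X](bigD1 i) //= pactVD pact_sum [X in _ + X]big1 ?addr0 // => j ji.
by rewrite (bigD1 j) //= mulrC pactM rf pact0.
Qed.
End PolyAction.
End LinearAlgebra.

(** * Commutation relations and the form *)

(* [st a] is the index paired with a by the form, [bet a] = (e_a, e_(st a)), [par_op] is *)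
(* the parity automorphism, [vac] the constant coefficient.                            *)
Structure fock (K : numFieldType) (D : nat) (V : lmodType K) := Fock {
  par : 'I_D -> bool;
  st : 'I_D -> 'I_D;
  bet : 'I_D -> K;
  mul : 'I_D -> {linear V -> V};
  der : 'I_D -> {linear V -> V};
  par_op : {linear V -> V};
  one : V;
  vac : V -> K;
  sf : V -> V -> K;
  stK : involutive st;
  par_st : forall a, par (st a) = par a;
  bet_neq0 : forall a, bet a != 0;
  bet_st : forall a, bet (st a) = (-1) ^+ par a * bet a;
  der_mul : forall a b f, der a (mul b f) =
    (a == b)%:R *: f + (-1) ^+ (par a && par b) *: mul b (der a f);
  mul_mul : forall a b f, mul a (mul b f) = (-1) ^+ (par a && par b) *: mul b (mul a f);
  der_der : forall a b f, der a (der b f) = (-1) ^+ (par a && par b) *: der b (der a f);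
  par_mul : forall a f, par_op (mul a f) = (-1) ^+ par a *: mul a (par_op f);
  par_der : forall a f, par_op (der a f) = (-1) ^+ par a *: der a (par_op f);
  par_opK : forall f, par_op (par_op f) = f;
  par_one : par_op one = one;
  der_one : forall a, der a one = 0;
  fock_ind : forall Q : V -> Prop, Q one ->
    (forall c u v, Q u -> Q v -> Q (c *: u + v)) ->
    (forall a u, Q u -> Q (mul a u)) -> forall u, Q u;
  vac_lin : forall c u v, vac (c *: u + v) = c * vac u + vac v;
  vac_one : vac one = 1;
  vac_mul : forall a f, vac (mul a f) = 0;
  sf_linl : forall c u v w, sf (c *: u + v) w = c * sf u w + sf v w;
  sf_linr : forall c u v w, sf w (c *: u + v) = c * sf w u + sf w v;
  sf_one : forall g, sf one g = vac g;
  sf_mul : forall a f g, sf (mul a f) g =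
    sf (if par a then par_op f else f) (bet a *: der (st a) g) }.

(** The only nonzero entry in row a of the inverse Gram matrix; with it [Lo] is multiplication by
    the dual element omega. *)
HB.lock Definition gam (K : numFieldType) (D : nat) (V : lmodType K) (X : fock D V) (a : 'I_D) : K :=
  (bet X (st X a))^-1.
HB.lock Definition Lo (K : numFieldType) (D : nat) (V : lmodType K) (X : fock D V) (f : V) : V :=
  2^-1 *: \sum_a gam X a *: mul X a (mul X (st X a) f).
HB.lock Definition Lap (K : numFieldType) (D : nat) (V : lmodType K) (X : fock D V) (f : V) : V :=
  2^-1 *: \sum_a bet X a *: der X (st X a) (der X a f).
HB.lock Definition Eu (K : numFieldType) (D : nat) (V : lmodType K) (X : fock D V) (f : V) : V :=
  \sum_a mul X a (der X a f).
HB.lock Definition ksgn (K : numFieldType) (D : nat) (V : lmodType K) (X : fock D V) (a b : 'I_D) : K :=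
  (-1) ^+ (par X a && par X b).
HB.lock Definition Fo (K : numFieldType) (D : nat) (V : lmodType K) (X : fock D V) (a b : 'I_D) (f : V) : V :=
  bet X b *: mul X a (der X (st X b) f) - (ksgn X a b * bet X a) *: mul X b (der X (st X a) f).
HB.lock Definition rho (K : numFieldType) (D : nat) (V : lmodType K) (X : fock D V) : K :=
  - (2^-1 * \sum_a (-1) ^+ par X a).

Arguments fock_ind {K D V} f0 Q _ _ _ u.

Section Fock.
Variables (K : numFieldType) (D : nat) (V : lmodType K) (X : fock D V).
Implicit Types (a b c e : 'I_D) (f g h u v w : V) (k : K).

Local Notation mu := (mul X).
Local Notation de := (der X).
Local Notation "a ^s" := (st X a) (at level 2, format "a ^s").
Local Notation be := (bet X).
Local Notation P := (par_op X).
Local Notation one := (one X).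

Local Notation q := (ksgn X).
Local Notation gam := (gam X).
Local Notation Lo := (Lo X).
Local Notation Lap := (Lap X).
Local Notation Eu := (Eu X).
Local Notation Fo := (Fo X).
Local Notation rho := (rho X).

Lemma ksgnK a b : q a b * q a b = 1. Proof. by rewrite unlock -expr2 sqrr_sign. Qed.
Lemma ksgnKs a b v : q a b *: (q a b *: v) = v. Proof. by rewrite scalerA ksgnK scale1r. Qed.
Lemma ksgnC a b : q a b = q b a. Proof. by rewrite unlock andbC. Qed.
Lemma ksgns a b : q a b^s = q a b. Proof. by rewrite unlock par_st. Qed.
Lemma ksgnsl a b : q a^s b = q a b. Proof. by rewrite unlock par_st. Qed.
Lemma ksgn_e a b : par X a = false -> q a b = 1. Proof. by rewrite unlock => ->. Qed.

Lemma dm a b f : de a (mu b f) = (a == b)%:R *: f + q a b *: mu b (de a f).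
Proof. rewrite unlock; exact: der_mul. Qed.
Lemma mm a b f : mu a (mu b f) = q a b *: mu b (mu a f). Proof. rewrite unlock; exact: mul_mul. Qed.
Lemma dd a b f : de a (de b f) = q a b *: de b (de a f). Proof. rewrite unlock; exact: der_der. Qed.

Lemma muZ a k f : mu a (k *: f) = k *: mu a f. Proof. exact: linearZ. Qed.
Lemma muD a f g : mu a (f + g) = mu a f + mu a g. Proof. exact: linearD. Qed.
Lemma muN a f : mu a (- f) = - mu a f. Proof. exact: linearN. Qed.
Lemma mu0 a : mu a 0 = 0. Proof. exact: linear0. Qed.
Lemma mu_sum a (I : Type) r (Q : pred I) (F : I -> V) :
  mu a (\sum_(i <- r | Q i) F i) = \sum_(i <- r | Q i) mu a (F i).
Proof. exact: linear_sum. Qed.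
Lemma deZ a k f : de a (k *: f) = k *: de a f. Proof. exact: linearZ. Qed.
Lemma deD a f g : de a (f + g) = de a f + de a g. Proof. exact: linearD. Qed.
Lemma deN a f : de a (- f) = - de a f. Proof. exact: linearN. Qed.
Lemma de0 a : de a 0 = 0. Proof. exact: linear0. Qed.
Lemma de_sum a (I : Type) r (Q : pred I) (F : I -> V) :
  de a (\sum_(i <- r | Q i) F i) = \sum_(i <- r | Q i) de a (F i).
Proof. exact: linear_sum. Qed.
Definition linE := (muZ, muD, muN, mu0, deZ, deD, deN, de0).

Lemma gam_neq0 a : gam a != 0. Proof. by rewrite unlock invr_eq0 bet_neq0. Qed.
Lemma gambe a : gam a * be a = (-1) ^+ par X a.
Proof.
rewrite unlock bet_st invfM -mulrA mulVf ?bet_neq0 // mulr1.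
by case: par => /=; rewrite ?expr1 ?expr0 ?invr1 // invrN1.
Qed.
Lemma gambes a : gam a^s * be a = 1.
Proof. by rewrite unlock stK mulVf ?bet_neq0. Qed.
Lemma gambes' a : gam a * be a^s = 1.
Proof. by rewrite unlock mulVf ?bet_neq0. Qed.
Lemma gam_st a : gam a^s = (-1) ^+ par X a * gam a.
Proof.
rewrite unlock stK bet_st invfM mulrA; case: par => /=;
by rewrite ?expr1 ?expr0 ?invr1 ?invrN1 ?mulrNN ?mulr1 mul1r.
Qed.

Lemma LoE f : Lo f = 2^-1 *: \sum_a gam a *: mu a (mu a^s f). Proof. by rewrite unlock. Qed.
Lemma LapE f : Lap f = 2^-1 *: \sum_a be a *: de a^s (de a f). Proof. by rewrite unlock. Qed.
Lemma EuE f : Eu f = \sum_a mu a (de a f). Proof. by rewrite unlock. Qed.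
Lemma rhoE : rho = - (2^-1 * \sum_a (-1) ^+ par X a). Proof. by rewrite unlock. Qed.
Lemma FoE a b f : Fo a b f = be b *: mu a (de b^s f) - (q a b * be a) *: mu b (de a^s f).
Proof. by rewrite unlock. Qed.

Lemma scl2 k u v : k *: (2^-1 *: u) + 2^-1 *: v = 2^-1 *: (k *: u + v).
Proof. lmod. Qed.

Lemma half2 u : 2^-1 *: (u + u) = u.
Proof. by rewrite -mulr2n -scaler_nat scalerA mulVf ?scale1r // pnatr_eq0. Qed.

Fact Lo_linear : linear Lo.
Proof.
move=> k f g; rewrite unlock scl2; congr (_ *: _).
rewrite scaler_sumr -big_split; apply: eq_bigr => a _ /=.
by rewrite !linE; lmod.
Qed.
HB.instance Definition _ := GRing.isLinear.Build K V V _ Lo Lo_linear.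
Fact Lap_linear : linear Lap.
Proof.
move=> k f g; rewrite unlock scl2; congr (_ *: _).
rewrite scaler_sumr -big_split; apply: eq_bigr => a _ /=.
by rewrite !linE; lmod.
Qed.
HB.instance Definition _ := GRing.isLinear.Build K V V _ Lap Lap_linear.
Fact Eu_linear : linear Eu.
Proof.
move=> k f g; rewrite unlock scaler_sumr -big_split; apply: eq_bigr => a _ /=.
by rewrite !linE.
Qed.
HB.instance Definition _ := GRing.isLinear.Build K V V _ Eu Eu_linear.
Fact Fo_linear a b : linear (Fo a b).
Proof. by move=> k f g; rewrite !FoE !linE; lmod. Qed.
HB.instance Definition _ a b := GRing.isLinear.Build K V V _ (Fo a b) (Fo_linear a b).

Lemma LoZ k f : Lo (k *: f) = k *: Lo f. Proof. exact: linearZ. Qed.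
Lemma LoD f g : Lo (f + g) = Lo f + Lo g. Proof. exact: linearD. Qed.
Lemma LoN f : Lo (- f) = - Lo f. Proof. exact: linearN. Qed.
Lemma Lo0 : Lo 0 = 0. Proof. exact: linear0. Qed.
Lemma Lo_sum (I : Type) r (Q : pred I) (F : I -> V) :
  Lo (\sum_(i <- r | Q i) F i) = \sum_(i <- r | Q i) Lo (F i).
Proof. exact: linear_sum. Qed.
Lemma LapZ k f : Lap (k *: f) = k *: Lap f. Proof. exact: linearZ. Qed.
Lemma LapD f g : Lap (f + g) = Lap f + Lap g. Proof. exact: linearD. Qed.
Lemma LapN f : Lap (- f) = - Lap f. Proof. exact: linearN. Qed.
Lemma Lap0 : Lap 0 = 0. Proof. exact: linear0. Qed.
Lemma Lap_sum (I : Type) r (Q : pred I) (F : I -> V) :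
  Lap (\sum_(i <- r | Q i) F i) = \sum_(i <- r | Q i) Lap (F i).
Proof. exact: linear_sum. Qed.
Lemma EuZ k f : Eu (k *: f) = k *: Eu f. Proof. exact: linearZ. Qed.
Lemma EuD f g : Eu (f + g) = Eu f + Eu g. Proof. exact: linearD. Qed.
Lemma EuN f : Eu (- f) = - Eu f. Proof. exact: linearN. Qed.
Lemma Eu0 : Eu 0 = 0. Proof. exact: linear0. Qed.
Lemma Eu_sum (I : Type) r (Q : pred I) (F : I -> V) :
  Eu (\sum_(i <- r | Q i) F i) = \sum_(i <- r | Q i) Eu (F i).
Proof. exact: linear_sum. Qed.
Lemma FoZ a b k f : Fo a b (k *: f) = k *: Fo a b f. Proof. exact: linearZ. Qed.
Lemma FoD a b f g : Fo a b (f + g) = Fo a b f + Fo a b g. Proof. exact: linearD. Qed.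
Lemma FoN a b f : Fo a b (- f) = - Fo a b f. Proof. exact: linearN. Qed.
Lemma Fo0 a b : Fo a b 0 = 0. Proof. exact: linear0. Qed.
Lemma Fo_sum a b (I : Type) r (Q : pred I) (F : I -> V) :
  Fo a b (\sum_(i <- r | Q i) F i) = \sum_(i <- r | Q i) Fo a b (F i).
Proof. exact: linear_sum. Qed.
Definition opE := (linE, (LoZ, LoD, LoN, Lo0), (LapZ, LapD, LapN, Lap0),
  (EuZ, EuD, EuN, Eu0), (FoZ, FoD, FoN, Fo0)).

Lemma sum_delta (F : 'I_D -> V) b : \sum_a (a == b)%:R *: F a = F b.
Proof.
rewrite (bigD1 b) //= eqxx scale1r big1 ?addr0 // => a /negPf->; exact: scale0r.
Qed.

Lemma st_eq a b : (a^s == b) = (a == b^s).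
Proof. by rewrite -{1}(stK X b) (inj_eq (can_inj (stK X))). Qed.

Lemma mul_Lo b f : mu b (Lo f) = Lo (mu b f).
Proof.
rewrite !LoE muZ mu_sum; congr (_ *: _); apply: eq_bigr => a _ /=.
rewrite muZ [mu b (mu a _)]mm [mu b (mu a^s _)]mm muZ ksgns.
by rewrite [q _ _ *: (_ *: _)]scalerA ksgnK scale1r.
Qed.

Lemma ksgn_self b : q b b * (-1) ^+ par X b = 1.
Proof. by rewrite unlock andbb -expr2 sqrr_sign. Qed.

Lemma der_Lo b f : de b (Lo f) = Lo (de b f) + gam b *: mu b^s f.
Proof.
rewrite !LoE deZ de_sum.
under eq_bigr => a _.
  rewrite deZ !dm muD !muZ ksgns eq_sym [b == _]eq_sym st_eq !scalerDr ksgnKs.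
  rewrite (_ : _ + _ = (a == b)%:R *: (gam a *: mu a^s f) +
    ((a == b^s)%:R *: (q b a *: (gam a *: mu a f)) + gam a *: mu a (mu a^s (de b f)))); last by lmod.
  over.
rewrite big_split big_split /= !sum_delta !scalerDr ksgns gam_st.
rewrite -[gam b *: mu b^s f in RHS]half2.
have := ksgn_self b; set s := (-1) ^+ _ => qs.
have -> : q b b *: ((s * gam b) *: mu b^s f) = gam b *: mu b^s f by rewrite scalerA mulrA qs mul1r.
lmod.
Qed.

Lemma Lap_mul b f : Lap (mu b f) = mu b (Lap f) + be b *: de b^s f.
Proof.
rewrite !LapE muZ mu_sum.
under eq_bigr => a _.
  rewrite !dm deD !deZ dm st_eq !scalerDr ksgnsl [q a b]ksgnC.
  rewrite ksgnKs -!muZ (_ : _ + _ = (a == b)%:R *: (be a *: de a^s f) +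
    ((a == b^s)%:R *: (q b a *: (be a *: de a f)) + mu b (be a *: de a^s (de a f)))); last by rewrite !linE; lmod.
  over.
rewrite big_split big_split /= !sum_delta !scalerDr ksgns bet_st.
rewrite -[be b *: de b^s f in RHS]half2.
have := ksgn_self b; set s := (-1) ^+ _ => qs.
have -> : q b b *: ((s * be b) *: de b^s f) = be b *: de b^s f by rewrite scalerA mulrA qs mul1r.
lmod.
Qed.

Lemma Lap_der b f : Lap (de b f) = de b (Lap f).
Proof.
rewrite !LapE deZ de_sum; congr (_ *: _); apply: eq_bigr => a _ /=.
rewrite deZ [de b (de a^s _)]dd [de b (de a _)]dd deZ ksgns.
by rewrite [q _ _ *: (_ *: _)]scalerA ksgnK scale1r.
Qed.

(** The commutators of the two terms of [Fo a b] with [Lo] are m_a m_b and (-1)^(|a||b|) m_b m_a,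
    which cancel by supercommutativity. *)
Lemma Fo_Lo a b f : Fo a b (Lo f) = Lo (Fo a b f).
Proof.
rewrite !FoE !der_Lo !opE !mul_Lo !stK [mu a (mu b f)]mm.
have := gambes a; have := gambes b; move: (gam b^s) (gam a^s) => x y hx hy.
apply: sqz_v_inj; rewrite ?sqzE.
transitivity (sqz_c V (be b) * sqz_v (Lo (mu a (de b^s f))) - sqz_c V (q a b * be a) * sqz_v (Lo (mu b (de a^s f)))
  + (sqz_c V (x * be b) - sqz_c V (y * be a)) * sqz_c V (q a b) * sqz_v (mu b (mu a f))); first by ring.
rewrite hx hy; ring.
Qed.

Lemma Fo_Lap a b f : Fo a b (Lap f) = Lap (Fo a b f).
Proof.
rewrite !FoE !opE !Lap_mul !Lap_der [de a^s (de b^s f)]dd ksgns ksgnsl.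
lmod.
Qed.

Lemma Eu_mul b f : Eu (mu b f) = mu b (Eu f) + mu b f.
Proof.
rewrite !EuE mu_sum /= -{2}(sum_delta (fun a => mu a f) b) -big_split /=.
apply: eq_bigr => a _; rewrite dm !linE [mu b (mu a _)]mm addrC ksgnC; congr (_ + _).
Qed.

Lemma Eu_der b f : Eu (de b f) = de b (Eu f) - de b f.
Proof.
apply/eqP; rewrite eq_sym subr_eq; apply/eqP.
rewrite !EuE de_sum /= -{2}(sum_delta (fun a => de a f) b) -big_split /=.
apply: eq_bigr => a _; rewrite dm [de b (de a f)]dd muZ scalerA ksgnK scale1r addrC eq_sym.
by congr (_ + _); case: eqP => [->|]; rewrite ?scale0r.
Qed.

Lemma Eu_Lo f : Eu (Lo f) = Lo (Eu f) + 2 *: Lo f.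
Proof.
rewrite !LoE EuZ [_ *: (_ *: _)]scalerA [2 * _]mulrC -scalerA -scalerDr; congr (_ *: _).
rewrite [Eu (\sum__ _)]raddf_sum scaler_sumr -big_split /=; apply: eq_bigr => a _.
by rewrite EuZ !Eu_mul muD; lmod.
Qed.

Lemma Lap_Eu f : Lap (Eu f) = Eu (Lap f) + 2 *: Lap f.
Proof.
rewrite !LapE EuZ [_ *: (_ *: _)]scalerA [2 * _]mulrC -scalerA -scalerDr; congr (_ *: _).
rewrite [Eu (\sum__ _)]raddf_sum scaler_sumr -big_split /=; apply: eq_bigr => a _.
by rewrite EuZ !Eu_der !linE; lmod.
Qed.

(** Each summand of omega contributes m_a d_a, its image under [st], and a sign. With the factor 1/2
    the first two add up to the Euler operator, and the signs add up to the superdimension, which is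
    -2 rho. *)
Lemma Lap_Lo f : Lap (Lo f) = Lo (Lap f) + Eu f - rho *: f.
Proof.
rewrite !LoE LapZ Lap_sum.
have h a : Lap (gam a *: mu a (mu a^s f)) = gam a *: mu a (mu a^s (Lap f)) + mu a (de a f)
  + ((-1) ^+ par X a *: f + mu a^s (de a^s f)).
  rewrite LapZ !Lap_mul !linE !dm eqxx scale1r stK !scalerDr !scalerA gambes' gambe.
  by rewrite ksgns ksgnsl mulrC ksgn_self !scale1r.
rewrite (eq_bigr _ (fun a _ => h a)) !big_split /=.
have -> : \sum_i mu i^s (de i^s f) = Eu f.
  by rewrite EuE [RHS](reindex_inj (can_inj (stK X))).
rewrite -EuE -scaler_suml.
by rewrite -[X in _ + X - _]half2 rhoE; lmod.
Qed.

Lemma Fo_Eu a b f : Fo a b (Eu f) = Eu (Fo a b f).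
Proof. rewrite !FoE !opE !Eu_mul !Eu_der !opE; lmod. Qed.

Lemma PZ k f : P (k *: f) = k *: P f. Proof. exact: linearZ. Qed.
Lemma PD f g : P (f + g) = P f + P g. Proof. exact: linearD. Qed.
Lemma PN f : P (- f) = - P f. Proof. exact: linearN. Qed.
Lemma P0 : P 0 = 0. Proof. exact: linear0. Qed.
Definition PE := (PZ, PD, PN, P0).

Lemma par_Lo f : P (Lo f) = Lo (P f).
Proof.
rewrite !LoE PZ raddf_sum; congr (_ *: _); apply: eq_bigr => a _ /=.
by rewrite /= PZ !par_mul !linE par_st [_ *: (_ *: mu _ _)]scalerA -expr2 sqrr_sign scale1r.
Qed.

Lemma par_Lap f : P (Lap f) = Lap (P f).
Proof.
rewrite !LapE PZ raddf_sum; congr (_ *: _); apply: eq_bigr => a _ /=.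
by rewrite /= PZ !par_der !linE par_st [_ *: (_ *: de _ _)]scalerA -expr2 sqrr_sign scale1r.
Qed.

Lemma par_Eu f : P (Eu f) = Eu (P f).
Proof.
rewrite !EuE raddf_sum; apply: eq_bigr => a _ /=.
by rewrite !par_mul par_der linE scalerA -expr2 sqrr_sign scale1r.
Qed.

Lemma par_Fo a b f : P (Fo a b f) = (-1) ^+ (par X a (+) par X b) *: Fo a b (P f).
Proof.
rewrite !FoE !PE !par_mul !par_der !par_st !linE signr_addb; lmod.
Qed.

Lemma sf0l g : sf X 0 g = 0.
Proof. by have := sf_linl X 1 0 0 g; rewrite scaler0 addr0 mul1r => /eqP; rewrite -subr_eq0 opprD addNKr oppr_eq0 => /eqP. Qed.
Lemma sf0r g : sf X g 0 = 0.
Proof. by have := sf_linr X 1 0 0 g; rewrite scaler0 addr0 mul1r => /eqP; rewrite -subr_eq0 opprD addNKr oppr_eq0 => /eqP. Qed.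
Lemma sfZl k f g : sf X (k *: f) g = k * sf X f g.
Proof. by rewrite -[k *: f]addr0 sf_linl sf0l addr0. Qed.
Lemma sfZr k f g : sf X f (k *: g) = k * sf X f g.
Proof. by rewrite -[k *: g]addr0 sf_linr sf0r addr0. Qed.
Lemma sfDl f g h : sf X (f + g) h = sf X f h + sf X g h.
Proof. by rewrite -{1}[f]scale1r sf_linl mul1r. Qed.
Lemma sfDr f g h : sf X h (f + g) = sf X h f + sf X h g.
Proof. by rewrite -{1}[f]scale1r sf_linr mul1r. Qed.
Lemma sfNl f h : sf X (- f) h = - sf X f h.
Proof. by rewrite -scaleN1r sfZl mulN1r. Qed.
Lemma sfNr f h : sf X h (- f) = - sf X h f.
Proof. by rewrite -scaleN1r sfZr mulN1r. Qed.
Definition sfE := (sf0l, sf0r, sfZl, sfZr, sfDl, sfDr, sfNl, sfNr).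
Lemma sf_suml (I : Type) r (Q : pred I) (F : I -> V) g :
  sf X (\sum_(i <- r | Q i) F i) g = \sum_(i <- r | Q i) sf X (F i) g.
Proof. by elim/big_rec2: _ => [|i y x _ <-]; rewrite ?sf0l ?sfDl. Qed.
Lemma sf_sumr (I : Type) r (Q : pred I) (F : I -> V) g :
  sf X g (\sum_(i <- r | Q i) F i) = \sum_(i <- r | Q i) sf X g (F i).
Proof. by elim/big_rec2: _ => [|i y x _ <-]; rewrite ?sf0r ?sfDr. Qed.

Lemma vac_par f : vac X (P f) = vac X f.
Proof.
elim/(fock_ind X): f => [|c u v Hu Hv|a u _]; first by rewrite par_one.
  by rewrite !PE !vac_lin Hu Hv.
by rewrite par_mul -muZ !vac_mul.
Qed.

Lemma sf_par f g : sf X (P f) (P g) = sf X f g.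
Proof.
elim/(fock_ind X): f g => [|c u v Hu Hv|a u Hu] g.
- by rewrite par_one !sf_one vac_par.
- by rewrite !PE !sfE Hu Hv.
rewrite par_mul sfZl !sf_mul !sfE.
suff -> : sf X (if par X a then P (P u) else P u) (der X a^s (P g)) =
  (-1) ^+ par X a * sf X (if par X a then P u else u) (der X a^s g).
  by rewrite mulrCA signrMK.
have -> : de a^s (P g) = (-1) ^+ par X a *: P (de a^s g).
  by rewrite par_der par_st scalerA -expr2 sqrr_sign scale1r.
rewrite sfZr; congr (_ * _); case: (par X a); last exact: Hu.
by rewrite par_opK -Hu par_opK.
Qed.

Lemma sf_parC f g : sf X (P f) g = sf X f (P g).
Proof. by rewrite -{1}(par_opK X g) sf_par. Qed.

Definition pe (t : bool) f := if t then P f else f.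
Implicit Types t : bool.
Lemma peK t f : pe t (pe t f) = f. Proof. by case: t; rewrite /= ?par_opK. Qed.
Lemma peZ t k f : pe t (k *: f) = k *: pe t f. Proof. by case: t; rewrite /= ?PE. Qed.
Lemma peD t f g : pe t (f + g) = pe t f + pe t g. Proof. by case: t; rewrite /= ?PE. Qed.
Lemma pe_mu t a f : pe t (mu a f) = (-1) ^+ (t && par X a) *: mu a (pe t f).
Proof. by case: t; rewrite /= ?par_mul // expr0 scale1r. Qed.
Lemma pe_de t a f : pe t (de a f) = (-1) ^+ (t && par X a) *: de a (pe t f).
Proof. by case: t; rewrite /= ?par_der // expr0 scale1r. Qed.
Lemma sf_pe t f g : sf X (pe t f) g = sf X f (pe t g).
Proof. by case: t; rewrite //= sf_parC. Qed.
Lemma sf_mu a f g : sf X (mu a f) g = be a * sf X (pe (par X a) f) (de a^s g).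
Proof. by rewrite sf_mul sfZr. Qed.

Lemma sign_par a b : (-1) ^+ (par X a && par X b) = q a b. Proof. by rewrite unlock. Qed.

(* The adjoint of multiplication by e_a in the second argument is a right      *)
(* superderivation, written here through the left one and the parity.          *)
Lemma sf_mul_r a f g :
  sf X f (mu a g) = (-1) ^+ par X a * be a^s * sf X (de a^s (pe (par X a) f)) g.
Proof.
elim/(fock_ind X): f g => [|c u v Hu Hv|b u Hu] g.
- by rewrite sf_one vac_mul /pe par_one if_same der_one sf0l mulr0.
- by rewrite peD peZ !linE !sfE Hu Hv; ring.
have pb h : sf X (pe (par X b) u) (mu a h) =
  (-1) ^+ par X a * be a^s * sf X (de a^s (pe (par X b) (pe (par X a) u))) h.
  rewrite sf_pe pe_mu sfZr Hu -sf_pe pe_de par_st sfE mulrCA; congr (_ * _).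
  by rewrite signrMK.
rewrite sf_mu dm !sfE st_eq pb pe_mu linE dm !sfE sf_mu !sign_par pe_de par_st !sign_par sfE.
rewrite !ksgnsl [q b a]ksgnC.
case: (altP (b =P a^s)) => [->|ne].
  rewrite stK eqxx mul1r par_st; have := ksgn_self a; rewrite ksgns => hq.
  rewrite [in RHS]mulrDr -[in RHS]mulrA; move: (sf X (de _ _) _) (sf _ _ _) hq => x y hq.
  have := ksgnK a a; move: (q a a) ((-1) ^+ par X a) hq => z t h1 h2.
  have ht : t = z by rewrite -[t]mul1r -h2 -mulrA h1 mulr1.
  rewrite ht /= mulr1n; ring: h2.
rewrite [a^s == b]eq_sym (negPf ne) !mul0r !add0r.
have := ksgnK a b; move: (q a b) (sf _ _ _) => x y hx; ring: hx.
Qed.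

Lemma bes_be a : be a^s = (-1) ^+ par X a * be a. Proof. exact: bet_st. Qed.

Lemma ksgn_aa a : q a a = (-1) ^+ par X a.
Proof. by rewrite unlock andbb. Qed.

Lemma sf_Lap f g : sf X (Lap f) g = sf X f (Lo g).
Proof.
rewrite LapE LoE !(sf_suml, sf_sumr, sfE); congr (_ * _); apply: eq_bigr => a _.
rewrite sfZl sfZr /= !sf_mul_r par_st stK pe_de par_st andbb peK linE (dd a a^s) !sfE ksgns ksgn_aa.
have := gambes' a; have := sqrr_sign K (par X a); rewrite expr2.
move: (gam a) ((-1) ^+ _) (be a^s) (sf _ _ _) => x y z t h1 h2.
transitivity ((x * z) * (y * y) * (y * y) * be a * t); last by ring.
by rewrite h2 h1 !mul1r.
Qed.

Lemma sf_Lo f g : sf X (Lo f) g = sf X f (Lap g).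
Proof.
rewrite LapE LoE !(sf_suml, sf_sumr, sfE); congr (_ * _); apply: eq_bigr => a _.
rewrite sfZl sfZr /= sf_mu pe_mu par_st andbb sfE sf_mu par_st stK peK (dd a a^s) !sfE ksgns ksgn_aa.
have := gambes' a; have := sqrr_sign K (par X a); rewrite expr2.
move: (gam a) ((-1) ^+ _) (be a^s) (sf _ _ _) => x y z t h1 h2.
transitivity ((x * z) * (y * y) * be a * t); first by ring.
by rewrite h2 h1 !mul1r.
Qed.

(** Under the form the first term of [Fo a b] on one side matches the second term on the other, so
    the operator is skew up to the parity twist. This is the invariance of the form under osp. *)
Lemma sf_Fo a b f g :
  sf X (Fo a b f) g = - sf X (pe (par X a (+) par X b) f) (Fo a b g).
Proof.
have h c e : sf X (mu c (de e^s f)) g = be c * sf X (pe (par X c) (de e^s f)) (de c^s g).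
  by rewrite sf_mu.
have h' c e : par X c (+) par X e = par X a (+) par X b -> sf X (pe (par X a (+) par X b) f) (mu c (de e^s g))
   = be c * q c e * sf X (pe (par X e) (de c^s f)) (de e^s g).
  move=> <-; rewrite sf_mul_r -sign_par pe_de par_st [in RHS]andbC sfE !mulrA -[_ * be c^s * _]mulrA.
  rewrite [be c^s]bes_be !mulrA -expr2 sqrr_sign mul1r.
  rewrite andbC -!mulrA signrMK; congr (_ * sf _ (de _ _) _).
  by case: (par X c); case: (par X e); rewrite /= ?par_opK.
rewrite !FoE !sfE !h !h' //; last by rewrite addbC.
rewrite [q b a]ksgnC; have := ksgnK a b; move: (q a b) (sf _ _ _) (sf _ _ _) => x y z hx; ring: hx.
Qed.

End Fock.

HB.lock Definition wtop (K : numFieldType) (D : nat) (V : lmodType K) (X : fock D V) (p : 'I_D) (f : V) : V :=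
  mul X p (der X p f) - mul X (st X p) (der X (st X p) f).

(** * Monomials and weights *)

Section Words.
Variables (K : numFieldType) (D : nat) (V : lmodType K) (X : fock D V).
Implicit Types (a b c e : 'I_D) (f g h u v : V) (k : K) (s : seq 'I_D).

Local Notation mu := (mul X).
Local Notation de := (der X).
Local Notation "a ^s" := (st X a) (at level 2, format "a ^s").
Local Notation be := (bet X).
Local Notation P := (par_op X).
Local Notation one := (one X).
Local Notation q := (ksgn X).
Local Notation gam := (gam X).
Local Notation Lo := (Lo X).
Local Notation Lap := (Lap X).
Local Notation Eu := (Eu X).
Local Notation Fo := (Fo X).

Definition wd s : V := foldr (fun a f => mu a f) one s.

Lemma dm_self a f : par X a = false -> de a (mu a f) = f + mu a (de a f).
Proof. by move=> ha; rewrite dm eqxx ksgn_e // !scale1r. Qed.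
Lemma dm_evenl a b f : par X a = false -> a != b -> de a (mu b f) = mu b (de a f).
Proof. by move=> ha /negPf ab; rewrite dm ab ksgn_e // scale0r add0r scale1r. Qed.
Lemma dm_evenr a b f : par X b = false -> a != b -> de a (mu b f) = mu b (de a f).
Proof. by move=> ha /negPf ab; rewrite dm ab ksgnC ksgn_e // scale0r add0r scale1r. Qed.
Lemma mm_even a b f : par X a = false -> mu a (mu b f) = mu b (mu a f).
Proof. by move=> ha; rewrite mm ksgn_e // scale1r. Qed.
Lemma mem_count a s : (a \in s) = (0 < count_mem a s)%N.
Proof. by rewrite -has_pred1 has_count. Qed.

Lemma wd_decomp f : exists l : seq (K * seq 'I_D), f = \sum_(x <- l) x.1 *: wd x.2.
Proof.
elim/(fock_ind X): f => [|c u v [l ->] [l' ->]|a u [l ->]].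
- by exists [:: (1, [::])]; rewrite big_seq1 scale1r.
- exists ([seq (c * x.1, x.2) | x <- l] ++ l'); rewrite big_cat big_map /= scaler_sumr.
  by congr (_ + _); apply: eq_bigr => x _; rewrite scalerA.
exists [seq (x.1, a :: x.2) | x <- l]; rewrite big_map mu_sum.
by apply: eq_bigr => x _; rewrite muZ.
Qed.

Definition shiftl (T : V -> V) (ts : seq K) f := foldr (fun t g => T g - t *: g) f ts.

Lemma shiftl_eigen (T : V -> V) ts t f : (forall k u, T (k *: u) = k *: T u) ->
  T f = t *: f -> shiftl T ts f = (\prod_(x <- ts) (t - x)) *: f.
Proof.
move=> TZ Tf; elim: ts => [|x ts IH] /=; first by rewrite big_nil scale1r.
by rewrite IH TZ Tf big_cons; lmod.
Qed.

Lemma shiftl_sum (T : {linear V -> V}) ts (I : Type) (r : seq I) (F : I -> V) :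
  shiftl T ts (\sum_(i <- r) F i) = \sum_(i <- r) shiftl T ts (F i).
Proof.
elim: ts => [|x ts IH] //=.
by rewrite IH linear_sum scaler_sumr -sumrB.
Qed.

(** The product of the T - y over the other eigenvalues y preserves M, kills the other terms and
    multiplies the wanted ones by a nonzero scalar. *)
Lemma eigen_part (T : {linear V -> V}) (tau : seq 'I_D -> K) (M : V -> Prop)
    (l : seq (K * seq 'I_D)) t :
  (forall s, T (wd s) = tau s *: wd s) -> M 0 ->
  (forall k u v, M u -> M v -> M (k *: u + v)) -> (forall u, M u -> M (T u)) ->
  M (\sum_(x <- l) x.1 *: wd x.2) -> M (\sum_(x <- l | tau x.2 == t) x.1 *: wd x.2).
Proof.
move=> Tw M0 ML MT Mf.
pose ts := [seq y <- [seq tau x.2 | x <- l] | y != t].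
have Ms f : M f -> M (shiftl T ts f).
  move=> Mf'; elim: ts => [|y ts IH] //=.
  by rewrite addrC -scaleNr; apply: ML => //; apply: MT.
have := Ms _ Mf; rewrite shiftl_sum.
have c0 : \prod_(y <- ts) (t - y) != 0.
  rewrite prodf_seq_neq0; apply/allP => y; rewrite mem_filter => /andP[yt _] /=.
  by rewrite subr_eq0 eq_sym.
rewrite (eq_big_seq (fun x => if tau x.2 == t then (\prod_(y <- ts) (t - y)) *: (x.1 *: wd x.2) else 0)); last first.
  move=> x xl /=; rewrite (@shiftl_eigen _ _ (tau x.2)); last first.
  - by rewrite linearZ /= Tw !scalerA mulrC.
  - by move=> k u; rewrite linearZ.
  case: eqP => [->//|ne]; suff -> : \prod_(y <- ts) (tau x.2 - y) = 0 by rewrite scale0r.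
  apply/eqP; rewrite prodf_seq_eq0; apply/hasP; exists (tau x.2); rewrite ?subrr ?eqxx //.
  by rewrite mem_filter map_f // andbT; apply/eqP.
rewrite -big_mkcond -scaler_sumr /= => h.
by have := ML (\prod_(y <- ts) (t - y))^-1 _ _ h M0; rewrite addr0 scalerA mulVf // scale1r.
Qed.

(** Words are linearly dependent, so terms with the wrong eigenvalue cannot be discarded one by one.
    Their sum is however an eigenvector for t and is annihilated by a product of T - y with all y
    different from t, so it is 0. *)
Lemma eigen_words (T : {linear V -> V}) (tau : seq 'I_D -> K) f (Q : pred (seq 'I_D)) l t :
  (forall s, T (wd s) = tau s *: wd s) -> T f = t *: f -> f = \sum_(x <- l | Q x.2) x.1 *: wd x.2 ->
  f = \sum_(x <- l | Q x.2 && (tau x.2 == t)) x.1 *: wd x.2.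
Proof.
move=> Tw Tf fl; pose M g := exists k, g = k *: f.
have Mf : M (\sum_(x <- [seq x <- l | Q x.2] | tau x.2 == t) x.1 *: wd x.2).
  apply: (@eigen_part T tau) => //.
  - by exists 0; rewrite scale0r.
  - by move=> k _ _ [k1 ->] [k2 ->]; exists (k * k1 + k2); lmod.
  - by move=> _ [k ->]; exists (k * t); rewrite linearZ /= Tf scalerA.
  - by exists 1; rewrite scale1r big_filter.
have Mf' : T (f - \sum_(x <- l | Q x.2 && (tau x.2 == t)) x.1 *: wd x.2) =
  t *: (f - \sum_(x <- l | Q x.2 && (tau x.2 == t)) x.1 *: wd x.2).
  rewrite linearB /= Tf linear_sum scalerBr /= scaler_sumr; congr (_ - _).
  by apply: eq_bigr => x /andP[_ /eqP xt]; rewrite linearZ /= Tw xt !scalerA mulrC.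
have fE : f - \sum_(x <- l | Q x.2 && (tau x.2 == t)) x.1 *: wd x.2 =
  \sum_(x <- [seq x <- l | Q x.2 && (tau x.2 != t)]) x.1 *: wd x.2.
  rewrite {1}fl big_filter (bigID (fun x => tau x.2 == t)) /= addrC addrK.
  by [].
move: Mf'; rewrite fE; set g := \sum_(x <- _) _ => Tg.
have : shiftl T [seq tau x.2 | x <- [seq x <- l | Q x.2 && (tau x.2 != t)]] g = 0.
  rewrite shiftl_sum big_seq big1 // => x xl.
  rewrite (@shiftl_eigen _ _ (tau x.2)); last first.
  - by rewrite linearZ /= Tw !scalerA mulrC.
  - by move=> k u; rewrite linearZ.
  rewrite (_ : \prod_(y <- _) _ = 0) ?scale0r //.
  apply/eqP; rewrite prodf_seq_eq0; apply/hasP; exists (tau x.2); rewrite ?subrr ?eqxx //.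
  by rewrite map_f.
rewrite (@shiftl_eigen _ _ t) //; last by move=> k u; rewrite linearZ.
move=> /eqP; rewrite scaler_eq0 prodf_seq_eq0 => /orP[/hasP[y /mapP[x]]|/eqP g0].
  by rewrite mem_filter => /andP[/andP[_ xt] _] ->; rewrite /= subr_eq0 eq_sym (negPf xt).
by apply/eqP; rewrite -subr_eq0 fE -/g g0.
Qed.

Lemma Eu_wd s : Eu (wd s) = (size s)%:R *: wd s.
Proof.
elim: s => [|a s IH] /=.
  by rewrite EuE big1 ?scale0r // => a _; rewrite der_one mu0.
by rewrite Eu_mul IH muZ mulrSr; lmod.
Qed.

Definition Sdg (d : nat) f := Eu f = d%:R *: f.

Lemma Sdg_words d f : Sdg d f <->
  exists l : seq (K * seq 'I_D), f = \sum_(x <- l | size x.2 == d) x.1 *: wd x.2.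
Proof.
split=> [fd|[l ->]]; last first.
  rewrite /Sdg Eu_sum scaler_sumr; apply: eq_bigr => x /eqP <-.
  by rewrite EuZ Eu_wd !scalerA mulrC.
have [l fl] := wd_decomp f; exists l.
rewrite [LHS](@eigen_words Eu (fun s => (size s)%:R) f predT l d%:R) //; last exact: Eu_wd.
by apply: eq_bigl => x; rewrite /= eqr_nat.
Qed.

Lemma Sdg_lin d k u v : Sdg d u -> Sdg d v -> Sdg d (k *: u + v).
Proof. by rewrite /Sdg => hu hv; rewrite EuD EuZ hu hv; lmod. Qed.
Lemma Sdg0 d : Sdg d 0. Proof. by rewrite /Sdg Eu0 scaler0. Qed.
Lemma SdgZ d k u : Sdg d u -> Sdg d (k *: u).
Proof. by move=> hu; rewrite -[_ *: _]addr0; apply: Sdg_lin => //; apply: Sdg0. Qed.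
Lemma SdgD d u v : Sdg d u -> Sdg d v -> Sdg d (u + v).
Proof. by move=> hu hv; rewrite -[u]scale1r; apply: Sdg_lin. Qed.
Lemma SdgB d u v : Sdg d u -> Sdg d v -> Sdg d (u - v).
Proof. by move=> hu hv; rewrite addrC -scaleN1r; apply: Sdg_lin. Qed.
Lemma Sdg_sum d (I : Type) (r : seq I) (Q : pred I) (F : I -> V) :
  (forall i, Q i -> Sdg d (F i)) -> Sdg d (\sum_(i <- r | Q i) F i).
Proof.
by move=> h; elim/big_rec: _ => [|i x Qi hx]; [apply: Sdg0|apply: SdgD => //; apply: h].
Qed.
Lemma Sdg_mu d a f : Sdg d f -> Sdg d.+1 (mu a f).
Proof. by rewrite /Sdg Eu_mul => ->; rewrite muZ mulrSr; lmod. Qed.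
Lemma Sdg_Lo d f : Sdg d f -> Sdg d.+2 (Lo f).
Proof. by rewrite /Sdg Eu_Lo => ->; rewrite LoZ -[d.+2]addn2 natrD; lmod. Qed.
Lemma Sdg_Fo d a b f : Sdg d f -> Sdg d (Fo a b f).
Proof. by rewrite /Sdg -Fo_Eu => ->; rewrite FoZ. Qed.
Lemma Sdg_P d f : Sdg d f -> Sdg d (P f).
Proof. by rewrite /Sdg -par_Eu => ->; rewrite PZ. Qed.

Lemma Sdg_neg k f : Eu f = k *: f -> (forall d : nat, k != d%:R) -> f = 0.
Proof.
move=> fk h; have [l fl] := wd_decomp f.
rewrite [LHS](@eigen_words Eu (fun s => (size s)%:R) f predT l k) //; last exact: Eu_wd.
by rewrite big1 // => x /=; rewrite eq_sym (negPf (h _)).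
Qed.

Lemma Sdg_de d a f : Sdg d.+1 f -> Sdg d (de a f).
Proof. by rewrite /Sdg Eu_der => ->; rewrite deZ mulrSr; lmod. Qed.
Lemma Sdg_Lap d f : Sdg d.+2 f -> Sdg d (Lap f).
Proof.
rewrite /Sdg => h; have := Lap_Eu X f; rewrite h LapZ -[d.+2]addn2 natrD => h'.
by apply: (addIr (2 *: Lap f)); rewrite -h'; lmod.
Qed.
Lemma Lap_low d f : (d < 2)%N -> Sdg d f -> Lap f = 0.
Proof.
move=> d2 fd; apply: (@Sdg_neg (d%:R - 2)).
  by have := Lap_Eu X f; rewrite fd LapZ => h; apply: (addIr (2 *: Lap f)); rewrite -h; lmod.
move=> e; rewrite subr_eq -natrD eqr_nat; lia.
Qed.

Lemma Sdg0_one f : Sdg 0 f -> exists k, f = k *: one.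
Proof.
move=> /Sdg_words[l ->]; exists (\sum_(x <- l | size x.2 == 0%N) x.1).
by rewrite scaler_suml; apply: eq_bigr => x /nilP ->.
Qed.

Section Weights.
Variable p : 'I_D.
Hypotheses (hp : par X p = false) (hpp : p^s != p).
Local Notation wo := (wtop X p).
Local Notation ps := (p^s).

Lemma woE f : wo f = mu p (de p f) - mu ps (de ps f). Proof. by rewrite unlock. Qed.

Lemma bps : be ps = be p. Proof. by rewrite bet_st hp mul1r. Qed.

(** Up to a nonzero scalar the weight operator is itself one of the F_ab; therefore every submodule
    is stable under it and contains the weight components of its vectors. *)
Lemma Fo_wo f : Fo p ps f = be p *: wo f.
Proof. by rewrite FoE woE stK (ksgn_e _ hp) bps mul1r scalerBr. Qed.

Fact wo_linear : linear wo.
Proof. by move=> k f g; rewrite !woE !linE; lmod. Qed.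
HB.instance Definition _ := GRing.isLinear.Build K V V _ wo wo_linear.
Lemma woZ k f : wo (k *: f) = k *: wo f. Proof. exact: linearZ. Qed.
Lemma woD f g : wo (f + g) = wo f + wo g. Proof. exact: linearD. Qed.

Definition wt a : int := (a == p)%:Z - (a == ps)%:Z.
Definition wts s : int := (count_mem p s)%:Z - (count_mem ps s)%:Z.

Lemma wt_st a : wt a^s = - wt a.
Proof. by rewrite /wt st_eq (inj_eq (can_inj (stK X))) opprB. Qed.

Lemma wo_mu a f : wo (mu a f) = mu a (wo f) + (wt a)%:~R *: mu a f.
Proof.
have qp b : q p b = 1 by rewrite ksgn_e.
have qps b : q ps b = 1 by rewrite ksgnsl ksgn_e.
rewrite !woE !dm !linE qp qps !scale1r [mu a (mu p _)]mm [mu a (mu ps _)]mm.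
rewrite [q a p]ksgnC [q a ps]ksgnC qp qps !scale1r /wt.
rewrite [p == a]eq_sym [ps == a]eq_sym.
by case: (altP (a =P p)) => [->|_]; [rewrite eq_sym (negPf hpp)|case: (altP (a =P ps)) => [->|_]];
  rewrite /= ?mulr0n ?mulr1n ?rmorphB /= ?(mulr0z, mulr1z); lmod.
Qed.

Lemma wo_de a f : wo (de a f) = de a (wo f) - (wt a)%:~R *: de a f.
Proof.
have qp b : q b p = 1 by rewrite ksgnC ksgn_e.
have qps b : q b ps = 1 by rewrite ksgns ksgnC ksgn_e.
rewrite !woE !linE !dm [de a (de p f)]dd [de a (de ps f)]dd !qp !qps !scale1r /wt.
by case: (altP (a =P p)) => [->|_]; [rewrite eq_sym (negPf hpp)|case: (altP (a =P ps)) => [->|_]];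
  rewrite /= ?mulr0n ?mulr1n ?rmorphB /= ?(mulr0z, mulr1z); lmod.
Qed.

Lemma wo_Fo a b f : wo (Fo a b f) = Fo a b (wo f) + (wt a + wt b)%:~R *: Fo a b f.
Proof.
rewrite !FoE linearB /= !woZ !wo_mu !wo_de !linE !wt_st.
move: (wt a) (wt b) => x y; rewrite !intrD !intrN; lmod.
Qed.

Lemma wo_Lo f : wo (Lo f) = Lo (wo f).
Proof.
have b0 := bet_neq0 X p.
by apply: (scalerI b0); rewrite -LoZ -!Fo_wo Fo_Lo.
Qed.
Lemma wo_wd s : wo (wd s) = (wts s)%:~R *: wd s.
Proof.
elim: s => [|a s IH] /=.
  by rewrite woE !der_one !mu0 subrr scale0r.
rewrite wo_mu IH muZ -scalerDl -rmorphD /=; congr (_%:~R *: _).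
by rewrite /wts /wt /= !PoszD; lia.
Qed.

Definition Wt (w : int) f := wo f = w%:~R *: f.

Lemma Wt_words d w f : Sdg d f -> Wt w f ->
  exists l : seq (K * seq 'I_D), f = \sum_(x <- l | (size x.2 == d) && (wts x.2 == w)) x.1 *: wd x.2.
Proof.
move=> /Sdg_words[l fl] fw; exists l.
rewrite {1}(@eigen_words wo (fun s => (wts s)%:~R) f (fun s => size s == d) l w%:~R) //; last exact: wo_wd.
by apply: eq_bigl => x; rewrite eqr_int.
Qed.

Lemma wts_bound s : (`|wts s| <= size s)%N.
Proof.
have : (count_mem p s + count_mem ps s <= size s)%N.
  by elim: s => //= a s IH; case: (altP (a =P p)) => [->|]; [rewrite eq_sym (negPf hpp)|case: eqP]; lia.
by rewrite /wts; lia.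
Qed.

Lemma Wt_bound d w f : Sdg d f -> Wt w f -> (d < `|w|)%N -> f = 0.
Proof.
move=> fd fw dw; have [l ->] := Wt_words fd fw.
by rewrite big1 // => x /andP[/eqP xd /eqP xw]; move: (wts_bound x.2); rewrite xd xw; lia.
Qed.

Lemma wd_rem a s : par X a = false -> a \in s -> wd s = mu a (wd (rem a s)).
Proof.
move=> ha; elim: s => //= b s IH; rewrite inE.
case: (altP (b =P a)) => [-> //|ne]; rewrite eq_sym (negPf ne) /= => /IH ->.
by rewrite -mm_even.
Qed.

Lemma Wt_div d w f : Sdg d f -> Wt w f -> 0 < w -> exists g, f = mu p g.
Proof.
move=> fd fw w0; have [l ->] := Wt_words fd fw.
exists (\sum_(x <- l | (size x.2 == d) && (wts x.2 == w)) x.1 *: wd (rem p x.2)).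
rewrite mu_sum; apply: eq_bigr => x /andP[_ /eqP xw]; rewrite muZ -wd_rem //.
by rewrite mem_count; move: xw w0; rewrite /wts; lia.
Qed.

Lemma de_wd a s : a \notin s -> de a (wd s) = 0.
Proof.
elim: s => [|b s IH] /=; first by rewrite der_one.
rewrite inE negb_or => /andP[/negPf ab /IH h].
by rewrite dm ab h mu0 scale0r scaler0 addr0.
Qed.

Lemma Wt_top d f : Sdg d f -> Wt d f -> exists k, f = k *: iter d (mu p) one.
Proof.
move=> fd fw; have [l ->] := Wt_words fd fw.
exists (\sum_(x <- l | (size x.2 == d) && (wts x.2 == d)) x.1).
rewrite scaler_suml; apply: eq_bigr => x /andP[/eqP xd /eqP xw]; congr (_ *: _).
have : all (pred1 p) x.2.
  have := count_size (pred1 p) x.2; rewrite all_count xd; move: xw; rewrite /wts; lia.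
by rewrite -xd; elim: x.2 => //= b s' IH /andP[/eqP-> /IH ->].
Qed.
End Weights.

Lemma iter_de_Sdg a d n f : Sdg d f -> iter n (de a) f = 0 \/ Sdg (d - n) (iter n (de a) f) /\ (n <= d)%N.
Proof.
move=> fd; elim: n => [|n [IH|[IH nd]]] /=; first by right; rewrite subn0.
  by left; rewrite IH de0.
have [dn|dn] := leqP d n.
  left; have : Sdg 0 (iter n (de a) f) by rewrite (_ : 0%N = (d - n)%N) //; lia.
  by move=> /Sdg0_one[k ->]; rewrite deZ der_one scaler0.
right; split; last by lia.
by apply: Sdg_de; rewrite (_ : (d - n.+1).+1 = (d - n)%N) //; lia.
Qed.

Lemma de_nilp a f : exists n, iter n (de a) f = 0.
Proof.
have [l ->] := wd_decomp f; elim: l => [|x l [n IH]].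
  by exists 0%N; rewrite big_nil.
exists ((size x.2).+1 + n)%N; rewrite big_cons iterTP [in X in _ + X]iterD IH.
have -> : iter (size x.2).+1 (de a) 0 = 0 by elim: _.+1 => //= m' ->; rewrite de0.
rewrite addnC iterD.
have [->|[_]] := iter_de_Sdg a (size x.2).+1 (Eu_wd x.2); last by lia.
by rewrite addr0; elim: n {IH} => //= [|j IH]; rewrite ?scaler0 // -deZ IH de0.
Qed.

(** A substitute for leading coefficients: the last iterated derivative of f outside J plays the
    role of the leading coefficient of f in the variable e_a, modulo J. *)
Lemma nil_min a (J : V -> Prop) f : J 0 -> ~ J f -> exists2 n, ~ J (iter n (de a) f) & J (iter n.+1 (de a) f).
Proof.
move=> J0 nJ; have [n nf] := de_nilp a f.
have : J (iter n (de a) f) by rewrite nf.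
elim: n {nf} => [//|n IH] h.
by have [/IH//|h'] := EM (J (iter n (de a) f)); exists n.
Qed.

Lemma iter_de_mu a f n : par X a = false ->
  iter n.+1 (de a) (mu a f) = mu a (iter n.+1 (de a) f) + n.+1%:R *: iter n (de a) f.
Proof.
move=> ha; elim: n => [|n IH].
  by rewrite /= dm_self //; lmod.
rewrite iterS IH deD deZ dm_self // -!iterS [n.+2%:R]mulrSr; lmod.
Qed.

Lemma mu_inj a f : par X a = false -> mu a f = 0 -> f = 0.
Proof.
move=> ha h; apply: contrapT => f0.
have [n h1 h2] := @nil_min a (fun g => g = 0) f erefl f0.
have := iter_de_mu f n ha; rewrite h h2 mu0 add0r.
have -> : iter n.+1 (de a) 0 = 0 by elim: n.+1 => //= j ->; rewrite de0.
by move/esym/eqP; rewrite scaler_eq0 pnatr_eq0 /= => /eqP.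
Qed.

Lemma iter_de_Lo c f n : par X c = false -> c^s != c ->
  iter n.+1 (de c) (Lo f) = Lo (iter n.+1 (de c) f) + (n.+1%:R * gam c) *: mu c^s (iter n (de c) f).
Proof.
move=> hc cc; elim: n => [|n IH]; first by rewrite /= der_Lo mul1r.
rewrite iterS IH deD deZ der_Lo dm_evenl 1?eq_sym // -!iterS [n.+2%:R]mulrSr; lmod.
Qed.

(** After one derivative more than the last nonzero one along p, only a nonzero multiple of e_ps
    times that last derivative is left of omega f. *)
Lemma Lo_inj p f : par X p = false -> p^s != p -> Lo f = 0 -> f = 0.
Proof.
move=> hp hpp h; apply: contrapT => f0.
have [n h1 h2] := @nil_min p (fun g => g = 0) f erefl f0.
have := iter_de_Lo f n hp hpp; rewrite h h2 Lo0 add0r.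
have -> : iter n.+1 (de p) 0 = 0 by elim: n.+1 => //= j ->; rewrite de0.
move/esym/eqP; rewrite scaler_eq0 mulf_eq0 (negPf (gam_neq0 _ _)) pnatr_eq0 /= => /eqP h3.
by apply: h1; apply: (@mu_inj p^s); rewrite ?par_st.
Qed.

(** In the model a self-dual even index is the middle one for m odd. Omega then contains its square,
    so the second derivative of omega along c is a nonzero constant; this produces the binomial
    term, and two further derivatives are needed to isolate it. *)
Lemma iter_de_Lo_self c f n : par X c = false -> c^s = c ->
  iter n.+2 (de c) (Lo f) = Lo (iter n.+2 (de c) f) + (n.+2%:R * gam c) *: mu c (iter n.+1 (de c) f)
    + (('C(n.+2, 2))%:R * gam c) *: iter n (de c) f.
Proof.
move=> hc cc; elim: n => [|n IH].
  by rewrite /= !der_Lo cc deD deZ der_Lo dm_self // cc binn; lmod.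
rewrite iterS IH !deD !deZ der_Lo dm_self // cc -!iterS [in RHS]binS bin1 natrD [n.+3%:R]mulrSr; lmod.
Qed.

Section Divisibility.
Variables (p c : 'I_D).
Hypotheses (hp : par X p = false) (hc : par X c = false) (cp : c != p) (cps : c != p^s).

Definition dvp f := exists g, f = mu p g.
Lemma dvp0 : dvp 0. Proof. by exists 0; rewrite mu0. Qed.
Lemma dvp_lin k f g : dvp f -> dvp g -> dvp (k *: f + g).
Proof. by move=> [f' ->] [g' ->]; exists (k *: f' + g'); rewrite !linE. Qed.
Lemma dvpZ k f : dvp f -> dvp (k *: f).
Proof. by move=> [f' ->]; exists (k *: f'); rewrite !linE. Qed.
Lemma dvp_mu a f : dvp f -> dvp (mu a f).
Proof. by move=> [g ->]; exists (mu a g); rewrite mm ksgnC ksgn_e // scale1r. Qed.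
Lemma dvp_Lo f : dvp f -> dvp (Lo f).
Proof. by move=> [g ->]; exists (Lo g); rewrite mul_Lo. Qed.
Lemma dvp_de f n : dvp f -> dvp (iter n (de c) f).
Proof.
move=> hf; elim: n => //= n [g ->]; exists (de c g).
by rewrite dm_evenl.
Qed.
Lemma dvp_cancel k f g : k != 0 -> dvp (g + k *: f) -> dvp g -> dvp f.
Proof.
move=> k0 h1 h2; rewrite (_ : f = k^-1 *: (- 1 *: g + (g + k *: f))).
  by apply: dvpZ; apply: dvp_lin.
by rewrite scaleN1r addKr scalerA mulVf // scale1r.
Qed.

End Divisibility.

Lemma dvp_mu_inv p c f : par X p = false -> par X c = false -> c != p -> dvp p (mu c f) -> dvp p f.
Proof.
move=> hp hc cp h; apply: contrapT => nf.
have [n h1 h2] := @nil_min c (dvp p) f (dvp0 p) nf; apply: h1.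
have := dvp_de hc cp n.+1 h; rewrite iter_de_mu // => h3.
by apply: (dvp_cancel _ h3); rewrite ?pnatr_eq0 //; apply: dvp_mu.
Qed.

(** Omega is not a zero divisor modulo x_p: the last derivative along c outside the ideal of x_p
    would have to be multiplied into it by e_(st c), or by a nonzero constant if c is self-dual. *)
Lemma dvp_Lo_inv p c f : par X p = false -> par X c = false -> c != p -> c != p^s ->
  dvp p (Lo f) -> dvp p f.
Proof.
move=> hp hc cp cps h; apply: contrapT => nf.
have [n h1 h2] := @nil_min c (dvp p) f (dvp0 p) nf; apply: h1.
have [cc|cc] := eqVneq c^s c.
  have := dvp_de hc cp n.+2 h; rewrite iter_de_Lo_self // => h3.
  apply: (dvp_cancel _ h3); first by rewrite mulf_neq0 ?gam_neq0 ?pnatr_eq0 // -lt0n bin_gt0.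
  rewrite addrC; apply: dvp_lin; first exact: dvp_mu.
  apply: dvp_Lo; apply: (dvp_de hc cp 1) h2.
have := dvp_de hc cp n.+1 h; rewrite iter_de_Lo // => h3.
apply: (@dvp_mu_inv _ c^s) => //; rewrite ?par_st ?st_eq //.
apply: (dvp_cancel _ h3); first by rewrite mulf_neq0 ?gam_neq0 ?pnatr_eq0.
exact: dvp_Lo.
Qed.

End Words.

(** * The decomposition of S^d *)

Section Sl2.
Variables (K : numFieldType) (D : nat) (V : lmodType K) (X : fock D V).
Implicit Types (a b c e : 'I_D) (f g h u v : V) (k : K).

Local Notation mu := (mul X).
Local Notation de := (der X).
Local Notation "a ^s" := (st X a) (at level 2, format "a ^s").
Local Notation be := (bet X).
Local Notation P := (par_op X).
Local Notation one := (one X).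
Local Notation Lo := (Lo X).
Local Notation Lap := (Lap X).
Local Notation Eu := (Eu X).
Local Notation rho := (rho X).
Local Notation wd := (wd X).
Local Notation Sdg := (Sdg X).
Local Notation sf := (sf X).

Lemma sf_Eu f g : sf (Eu f) g = sf f (Eu g).
Proof.
rewrite !EuE sf_suml sf_sumr [RHS](reindex_inj (can_inj (stK X))) /=.
apply: eq_bigr => a _; rewrite sf_mu sf_mul_r par_st stK pe_de andbb sfE mulrA.
by rewrite [be a * _]mulrC.
Qed.

Lemma sf_deg (c d : nat) f g : Sdg c f -> Sdg d g -> c != d -> sf f g = 0.
Proof.
move=> fc gd ne; have := sf_Eu f g; rewrite fc gd !sfE => /eqP.
by rewrite -subr_eq0 -mulrBl mulf_eq0 subr_eq0 eqr_nat (negPf ne) => /eqP.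
Qed.

Lemma Sdg_subsp d : subsp (Sdg d).
Proof. by split; [apply: Sdg0|move=> *; apply: Sdg_lin]. Qed.

(** S(V) is irreducible under multiplications and derivations: by Euler's formula a vector of
    positive degree whose derivatives all vanish is 0, so by induction on the degree only constants
    could survive in J. *)
Lemma stable_zero (J : V -> Prop) : subsp J -> (forall a f, J f -> J (mu a f)) ->
  (forall a f, J f -> J (de a f)) -> (forall k, J (k *: one) -> k = 0) ->
  forall f, J f -> f = 0.
Proof.
move=> hJ Jm Jd J1.
have hom d f : Sdg d f -> J f -> f = 0.
  elim: d f => [|d IH] f fd Jf.
    by have [k fk] := Sdg0_one fd; rewrite fk (J1 k) ?scale0r // -fk.
  have d0 a : de a f = 0 by apply: IH; [apply: Sdg_de|apply: Jd].
  have := fd; rewrite /(Sdg _ _) EuE big1 => [/esym/eqP|a _]; last by rewrite d0 mu0.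
  by rewrite scaler_eq0 pnatr_eq0 => /eqP.
move=> f Jf; have [l fl] := wd_decomp X f.
have part (t : K) : J (\sum_(x <- l | (size x.2)%:R == t) x.1 *: wd x.2).
  apply: (@eigen_part _ _ _ X Eu (fun s => (size s)%:R) J l t) => //.
  - exact: Eu_wd.
  - by case: hJ.
  - by case: hJ.
  - by move=> u Ju /=; rewrite EuE; apply: subsp_sum => // a _; apply: Jm; apply: Jd.
  - by rewrite -fl.
have part0 (d : nat) : \sum_(x <- l | size x.2 == d) x.1 *: wd x.2 = 0.
  apply: (hom d); first by apply/Sdg_words; exists l.
  by have := part d%:R; under eq_bigl do rewrite eqr_nat.
pose n := (\max_(x <- l) size x.2).+1.
have -> : f = \sum_(d < n) \sum_(x <- l | size x.2 == d) x.1 *: wd x.2.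
  rewrite fl (exchange_big_dep predT) //= big_seq [RHS]big_seq; apply: eq_bigr => x xl.
  have xn : (size x.2 < n)%N by rewrite ltnS (leq_bigmax_seq _ xl).
  by rewrite (big_pred1 (Ordinal xn)) // => i; rewrite -val_eqE /= eq_sym.
by rewrite big1 // => i _; apply: part0.
Qed.

Lemma sf_lrad f : (forall g, sf f g = 0) -> f = 0.
Proof.
move=> hf; apply: (@stable_zero (fun f => forall g, sf f g = 0)) hf => [|a u hu g|a u hu g|k hk].
- by split=> [g|k u v hu hv g]; rewrite !sfE // hu hv mulr0 addr0.
- by rewrite sf_mu sf_pe hu mulr0.
- have := hu (mu a^s (pe X (par X a) g)); rewrite sf_mul_r par_st stK -sf_pe pe_de peK sfE => /eqP.
  by rewrite !mulf_eq0 !signr_eq0 (negPf (bet_neq0 _ _)) => /eqP.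
by have := hk one; rewrite sfE sf_one vac_one mulr1.
Qed.

Lemma sf_rrad g : (forall f, sf f g = 0) -> g = 0.
Proof.
move=> hg; apply: (@stable_zero (fun g => forall f, sf f g = 0)) hg => [|a u hu f|a u hu f|k hk].
- by split=> [f|k u v hu hv f]; rewrite !sfE // hu hv mulr0 addr0.
- by rewrite sf_mul_r hu mulr0.
- have := hu (mu a^s (pe X (par X a) f)); rewrite sf_mu stK par_st peK => /eqP.
  by rewrite mulf_eq0 (negPf (bet_neq0 _ _)) => /eqP.
by have := hk one; rewrite sfE sf_one vac_one mulr1.
Qed.

Lemma sum_deg f : exists n (F : 'I_n -> V), (forall i : 'I_n, Sdg i (F i)) /\ f = \sum_i F i.
Proof.
have [l fl] := wd_decomp X f; pose n := (\max_(x <- l) size x.2).+1.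
exists n, (fun d : 'I_n => \sum_(x <- l | size x.2 == d) x.1 *: wd x.2); split.
  by move=> i; apply/Sdg_words; exists l.
rewrite fl (exchange_big_dep predT) //= big_seq [RHS]big_seq; apply: eq_bigr => x xl.
have xn : (size x.2 < n)%N by rewrite ltnS (leq_bigmax_seq _ xl).
by rewrite (big_pred1 (Ordinal xn)) // => i; rewrite -val_eqE /= eq_sym.
Qed.

Lemma sf_ndl d x : Sdg d x -> (forall g, Sdg d g -> sf x g = 0) -> x = 0.
Proof.
move=> xd h; apply: sf_lrad => g; have [n [F [Fd ->]]] := sum_deg g.
rewrite sf_sumr big1 // => i _; have [di|di] := eqVneq d i; first by apply: h; rewrite di.
exact: sf_deg xd (Fd i) di.
Qed.

Lemma sf_ndr d x : Sdg d x -> (forall g, Sdg d g -> sf g x = 0) -> x = 0.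
Proof.
move=> xd h; apply: sf_rrad => g; have [n [F [Fd ->]]] := sum_deg g.
rewrite sf_suml big1 // => i _; have [di|di] := eqVneq d i; first by apply: h; rewrite di.
by apply: sf_deg (Fd i) xd _; rewrite eq_sym.
Qed.

Lemma Sdg_fin d f : Sdg d f -> lsp [seq wd (val t) | t <- enum {: d.-tuple 'I_D}] f.
Proof.
move=> /Sdg_words[l ->]; apply: subsp_sum; first exact: lsp_sub.
move=> x xd; apply: subspZ; first exact: lsp_sub.
apply: lsp_mem; apply/mapP; exists (Tuple xd) => //.
by rewrite mem_enum.
Qed.

Lemma separL d (M : V -> Prop) x : subsp M -> (forall u, M u -> Sdg d u) -> Sdg d x -> ~ M x ->
  exists g, [/\ Sdg d g, forall u, M u -> sf u g = 0 & sf x g != 0].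
Proof.
move=> hM MS xd nx.
apply: (@separ _ _ sf (Sdg d) (sf_linl X) (sf_linr X) (Sdg_subsp d) (@sf_ndl d)
  [seq wd (val t) | t <- enum {: d.-tuple 'I_D}] M x) => //; exact: Sdg_fin.
Qed.

Lemma separR d (M : V -> Prop) x : subsp M -> (forall u, M u -> Sdg d u) -> Sdg d x -> ~ M x ->
  exists g, [/\ Sdg d g, forall u, M u -> sf g u = 0 & sf g x != 0].
Proof.
move=> hM MS xd nx.
apply: (@separ _ _ (fun u v => sf v u) (Sdg d) (sf_linr X) _ (Sdg_subsp d) (@sf_ndr d)
  [seq wd (val t) | t <- enum {: d.-tuple 'I_D}] M x) => //; [|exact: Sdg_fin].
by move=> k u v w; apply: sf_linl.
Qed.

Section Isotropic.
Variable p : 'I_D.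
Hypotheses (hp : par X p = false) (hpp : p^s != p).

Lemma LoI f g : Lo f = Lo g -> f = g.
Proof.
move=> h; apply/eqP; rewrite -subr_eq0; apply/eqP; apply: (Lo_inj hp hpp).
by rewrite LoD LoN h subrr.
Qed.

(** Adjoint to the injectivity of [Lo]: if g is orthogonal to the image, [Lo g] is orthogonal to all
    of S^(d+2), hence 0. *)
Lemma Lap_surj d f : Sdg d f -> exists2 g, Sdg d.+2 g & Lap g = f.
Proof.
move=> fd; apply: contrapT => no.
pose M u := exists2 g, Sdg d.+2 g & Lap g = u.
have [|||g [gd gM gf]] := @separL d M f _ _ fd.
- split; first by exists 0; [apply: Sdg0|rewrite Lap0].
  by move=> k _ _ [u ud <-] [v vd <-]; exists (k *: u + v); [apply: Sdg_lin|rewrite LapD LapZ].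
- by move=> _ [u ud <-]; apply: Sdg_Lap.
- by [].
case/negP: gf; have -> : g = 0; last by rewrite sfE.
apply: (Lo_inj hp hpp); apply: (sf_ndr (Sdg_Lo gd)) => u ud.
by rewrite -sf_Lap; apply: gM; exists u.
Qed.

End Isotropic.

Definition T0 : {linear V -> V} := (Lo \o Lap)%FUN.
Definition T1 : {linear V -> V} := (Lap \o Lo)%FUN.
Lemma T0E f : T0 f = Lo (Lap f). Proof. by []. Qed.
Lemma T1E f : T1 f = Lap (Lo f). Proof. by []. Qed.

Lemma T1_T0 d f : Sdg d f -> T1 f = T0 f + (d%:R - rho) *: f.
Proof. by move=> fd; rewrite T1E T0E Lap_Lo fd; lmod. Qed.

Lemma T0_Lo d f : Sdg d f -> T0 (Lo f) = Lo (T0 f) + (d%:R - rho) *: Lo f.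
Proof. by move=> fd; rewrite T0E -T1E (T1_T0 fd) LoD LoZ. Qed.

Lemma Sdg_T0 d f : Sdg d f -> Sdg d (T0 f).
Proof.
case: d => [|[|d]] fd; rewrite T0E; last by apply: Sdg_Lo; apply: Sdg_Lap.
  by rewrite (Lap_low _ fd) // Lo0; apply: Sdg0.
by rewrite (Lap_low _ fd) // Lo0; apply: Sdg0.
Qed.
Lemma Sdg_T1 d f : Sdg d f -> Sdg d (T1 f).
Proof. by move=> fd; apply: Sdg_Lap; apply: Sdg_Lo. Qed.

Lemma Sdg_pact0 d r f : Sdg d f -> Sdg d (pact T0 r f).
Proof. by move=> fd; apply: pact_stable => //; [apply: Sdg_subsp|apply: Sdg_T0]. Qed.
Lemma Sdg_pact1 d r f : Sdg d f -> Sdg d (pact T1 r f).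
Proof. by move=> fd; apply: pact_stable => //; [apply: Sdg_subsp|apply: Sdg_T1]. Qed.

Lemma pact_Lo d (rs : seq K) f : Sdg d f ->
  pact T0 (\prod_(t <- rs) ('X - t%:P)) (Lo f) =
  Lo (pact T0 (\prod_(t <- rs) ('X - (t - (d%:R - rho))%:P)) f).
Proof.
move=> fd; elim: rs => [|t rs IH]; first by rewrite !big_nil !pact1.
rewrite !big_cons !pactM IH !pact_XsubC (T0_Lo (Sdg_pact0 _ fd)) LoD LoN LoZ; lmod.
Qed.

Lemma pact_T1 d (rs : seq K) f : Sdg d f ->
  pact T1 (\prod_(t <- rs) ('X - (t + (d%:R - rho))%:P)) f =
  pact T0 (\prod_(t <- rs) ('X - t%:P)) f.
Proof.
move=> fd; elim: rs => [|t rs IH]; first by rewrite !big_nil !pact1.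
rewrite !big_cons !pactM IH !pact_XsubC (T1_T0 (Sdg_pact0 _ fd)); lmod.
Qed.

(* the eigenvalue of T0 on L^i H_(d-2i) *)
Definition lam (d i : nat) : K := i%:R * (d%:R - i%:R - 1 - rho).

Lemma lamS d i : lam d.+2 i.+1 - (d%:R - rho) = lam d i.
Proof. by rewrite /lam -[d.+2]addn2 natrD mulrSr; ring. Qed.

(** Induction by two degrees: the factor for i = 0 turns f into [Lo (Lap f)], and moving the
    remaining factors across [Lo] shifts each lam (d+2) (i+1) to lam d i. *)
Lemma kill0 d f : Sdg d f -> pact T0 (\prod_(i < d./2.+1) ('X - (lam d i)%:P)) f = 0.
Proof.
have [n] := ubnP d; elim: n d f => // n IH [|[|d]] f dn fd.
- by rewrite big_ord1 /lam mul0r pact_XsubC T0E (Lap_low _ fd) // Lo0; lmod.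
- by rewrite big_ord1 /lam mul0r pact_XsubC T0E (Lap_low _ fd) // Lo0; lmod.
rewrite /= big_ord_recl {1}/lam mul0r mulrC pactM pact_XsubC scale0r subr0 T0E.
rewrite -(big_mkord xpredT (fun i => 'X - (lam d.+2 i.+1)%:P)) -(big_map (fun i => lam d.+2 i.+1) xpredT (fun t => 'X - t%:P)).
rewrite (pact_Lo _ (Sdg_Lap fd)) big_map.
under eq_bigr do rewrite lamS.
by rewrite big_mkord IH ?Lo0 //; [lia|apply: Sdg_Lap].
Qed.

Lemma kill1 d f : Sdg d f ->
  pact T1 (\prod_(i < d./2.+1) ('X - (i.+1%:R * (d%:R - i%:R - rho))%:P)) f = 0.
Proof.
move=> fd; have := kill0 fd.
rewrite -(big_mkord xpredT (fun i => 'X - (lam d i)%:P)) -(big_map (fun i => lam d i) xpredT (fun t => 'X - t%:P)).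
rewrite -(pact_T1 _ fd) big_map -(big_mkord xpredT (fun i => 'X - (i.+1%:R * (d%:R - i%:R - rho))%:P)) => <-.
by congr (pact _ _ _); apply: eq_bigr => i _; congr ('X - _%:P); rewrite /lam mulrSr; ring.
Qed.

End Sl2.

Section Decomp.
Variables (K : numFieldType) (D : nat) (V : lmodType K) (X : fock D V).
Implicit Types (a b c e : 'I_D) (f g h u v : V) (k : K).

Local Notation "a ^s" := (st X a) (at level 2, format "a ^s").
Local Notation P := (par_op X).
Local Notation Lo := (Lo X).
Local Notation Lap := (Lap X).
Local Notation Fo := (Fo X).
Local Notation rho := (rho X).
Local Notation Sdg := (Sdg X).
Local Notation sf := (sf X).

Local Notation T0 := (T0 X).
Local Notation T1 := (T1 X).
Local Notation lam := (lam X).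

Definition Hd d f := Sdg d f /\ Lap f = 0.
Definition Ad d f := Sdg d f /\ Lap (Lo (Lap f)) = 0.
(** In a critical degree this image of [Lap \o Lo] is a complement of the kernel of the same
    operator; see [crit_Wsplit] and [crit_W0]. *)
Definition Wd d f := exists2 g, Sdg d g & f = Lap (Lo g).

Lemma Hd_subsp d : subsp (Hd d).
Proof.
split; first by split; [apply: Sdg0|rewrite Lap0].
by move=> k u v [h1 h2] [h3 h4]; split; [apply: Sdg_lin|rewrite LapD LapZ h2 h4; lmod].
Qed.
Lemma Ad_subsp d : subsp (Ad d).
Proof.
split; first by split; [apply: Sdg0|rewrite !(Lap0, Lo0)].
move=> k u v [h1 h2] [h3 h4]; split; first exact: Sdg_lin.
by rewrite !(LapD, LapZ, LoD, LoZ) h2 h4; lmod.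
Qed.
Lemma Wd_subsp d : subsp (Wd d).
Proof.
split; first by exists 0; [apply: Sdg0|rewrite !(Lap0, Lo0)].
move=> k u v [u' h1 ->] [v' h2 ->]; exists (k *: u' + v'); first exact: Sdg_lin.
by rewrite !(LapD, LapZ, LoD, LoZ).
Qed.

Lemma iter_LoZ n k u : iter n Lo (k *: u) = k *: iter n Lo u.
Proof. by elim: n => //= n ->; rewrite LoZ. Qed.
Lemma iter_LoD n u v : iter n Lo (u + v) = iter n Lo u + iter n Lo v.
Proof. by elim: n => //= n ->; rewrite LoD. Qed.
Lemma iter_Lo0 n : iter n Lo 0 = 0.
Proof. by elim: n => //= n ->; rewrite Lo0. Qed.
Lemma Fo_iter_Lo a b n f : Fo a b (iter n Lo f) = iter n Lo (Fo a b f).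
Proof. by elim: n => //= n IH; rewrite Fo_Lo IH. Qed.
Lemma par_iter_Lo n f : P (iter n Lo f) = iter n Lo (P f).
Proof. by elim: n => //= n IH; rewrite par_Lo IH. Qed.

Lemma Sdg_iter_Lo n d f : Sdg d f -> Sdg (d + 2 * n) (iter n Lo f).
Proof.
move=> fd; elim: n => [|n IH] /=; first by rewrite muln0 addn0.
by rewrite mulnS addnCA add2n; apply: Sdg_Lo.
Qed.

Lemma Lap_iter_Lo (n d : nat) f : Sdg d f ->
  Lap (iter n.+1 Lo f) = iter n.+1 Lo (Lap f) + (n.+1%:R * (d%:R + n%:R - rho)) *: iter n Lo f.
Proof.
move=> fd; elim: n => [|n IH].
  by rewrite /= Lap_Lo fd; lmod.
rewrite iterS Lap_Lo IH (Sdg_iter_Lo n.+1 fd) LoD LoZ -!iterS natrD natrM [n.+2%:R]mulrSr.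
rewrite [n.+1%:R]mulrSr; lmod.
Qed.

Lemma Lap_iter_H (n d : nat) f : Hd d f ->
  Lap (iter n.+1 Lo f) = (n.+1%:R * (d%:R + n%:R - rho)) *: iter n Lo f.
Proof. by move=> [fd f0]; rewrite (Lap_iter_Lo _ fd) f0 iter_Lo0 add0r. Qed.

Lemma LapLo_inj (d : nat) f : (forall i : nat, (i <= d./2)%N -> (d - i)%:R != rho) ->
  Sdg d f -> Lap (Lo f) = 0 -> f = 0.
Proof.
move=> h fd f0; have := kill1 fd.
suff e (I : Type) (r : seq I) (F : I -> K) : pact T1 (\prod_(i <- r) ('X - (F i)%:P)) f = (\prod_(i <- r) - F i) *: f.
  rewrite e => /eqP; rewrite scaler_eq0 => /orP[|/eqP //].
  rewrite prodf_seq_eq0 => /hasP[i _ /=]; rewrite oppr_eq0 mulf_eq0 pnatr_eq0 /= subr_eq0.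
  have id : (i <= d./2)%N by rewrite -ltnS.
  by rewrite -natrB ?(negPf (h _ id)) //; lia.
elim: r => [|i r IH]; first by rewrite !big_nil pact1 scale1r.
rewrite !big_cons pactM IH pact_XsubC T1E LoZ LapZ f0; lmod.
Qed.

(** No root of the annihilating polynomial in [kill1] is 0, so a Bezout relation with X inverts
    [Lap \o Lo]. *)
Lemma LapLo_surj (d : nat) f : (forall i : nat, (i <= d./2)%N -> (d - i)%:R != rho) ->
  Sdg d f -> exists2 g, Sdg d g & Lap (Lo g) = f.
Proof.
move=> h fd; have := kill1 fd; set r := \prod_(i < _) _ => hr.
have : coprimep 'X r.
  rewrite /r; elim/big_ind: _ => [|x y hx hy|i _]; rewrite ?coprimep1 ?coprimepMr ?hx //.
  rewrite coprimep_XsubC rootX mulf_neq0 ?pnatr_eq0 // subr_eq0.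
  have id : (i <= d./2)%N by rewrite -ltnS.
  by rewrite -natrB ?h //; lia.
move=> /Bezout_eq1_coprimepP[[a c] /= hac].
exists (pact T1 a f); first exact: Sdg_pact1.
rewrite -T1E -pactT -[f in RHS](pact1 T1) -hac pactD !pactM hr pact0 addr0.
by rewrite -['X]mul1r pactMX pact1.
Qed.

Section Isotropic.
Variable p : 'I_D.
Hypotheses (hp : par X p = false) (hpp : p^s != p).
Local Notation LoI := (LoI hp hpp).

Lemma iter_Lo_inj n f g : iter n Lo f = iter n Lo g -> f = g.
Proof. by elim: n => //= n IH /LoI/IH. Qed.

Lemma Lo_eq0 f : Lo f = 0 -> f = 0.
Proof. exact: (Lo_inj hp hpp). Qed.

(* Under the condition no eigenvalue of Lap \o Lo on S^(d-2) vanishes. *)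
Definition regular (d : nat) := forall j : nat, (1 <= j <= d./2)%N -> (d - 1 - j)%:R != rho.

Lemma regular_shift d : regular d.+2 -> forall i : nat, (i <= d./2)%N -> (d - i)%:R != rho.
Proof.
move=> h i id; have := h i.+1; rewrite /= ltnS id => /(_ isT).
by rewrite (_ : (d.+2 - 1 - i.+1)%N = (d - i)%N) //; lia.
Qed.

Lemma Ad_regular d f : regular d -> Ad d f -> Lap f = 0.
Proof.
case: d => [|[|d]] h [fd f0]; try by apply: Lap_low fd.
apply: (@LapLo_inj d) => //; first exact: regular_shift.
exact: Sdg_Lap.
Qed.

Lemma split_regular d f : regular d.+2 -> Sdg d.+2 f ->
  exists h g, [/\ Hd d.+2 h, Sdg d g & f = h + Lo g].
Proof.
move=> h fd; have [g gd gf] := LapLo_surj (regular_shift h) (Sdg_Lap fd).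
exists (f - Lo g), g; rewrite subrK; split=> //; split.
  by apply: SdgB => //; apply: Sdg_Lo.
by rewrite LapD LapN gf subrr.
Qed.

(** A nonzero eigenvalue allows division by [Lo]: f is [Lo] of a multiple of [Lap f]. Each division
    lowers (d, j) to (d - 2, j - 1), and the last hypothesis says that the eigenvalues met before j
    = 0 do not vanish. *)
Lemma eig1 (d j : nat) f : (2 * j <= d)%N -> Sdg d f -> T0 f = lam d j *: f ->
  (forall i : nat, (i < j)%N -> (d%:R - i%:R - j%:R - 1 : K) != rho) ->
  exists2 h, Hd (d - 2 * j) h & f = iter j Lo h.
Proof.
elim: j d f => [|j IH] d f jd fd fe c3.
  exists f => //; rewrite muln0 subn0; split=> //; apply: Lo_eq0.
  by rewrite -T0E fe /lam mul0r scale0r.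
case: d jd fd fe c3 => [|[|d]] jd fd fe c3; try lia.
have l0 : lam d.+2 j.+1 != 0.
  rewrite /lam mulf_neq0 ?pnatr_eq0 // subr_eq0; have := c3 0%N isT.
  by rewrite subr0.
pose x := (lam d.+2 j.+1)^-1 *: Lap f.
have fx : f = Lo x by rewrite LoZ -T0E fe scalerA mulVf // scale1r.
have xd : Sdg d x by apply: SdgZ; apply: Sdg_Lap.
have [|||h hh xh] := IH d x _ xd.
- lia.
- apply: LoI; move: x fx xd => x fx xd; rewrite -lamS; move: fe; rewrite fx (T0_Lo xd) => fe.
  by rewrite -(addrK ((d%:R - rho) *: Lo x) (Lo _)) fe !LoZ; lmod.
- move=> i ij; have := c3 i.+1 ij; apply: contra => /eqP <-; apply/eqP.
  by rewrite -[d.+2]addn2 natrD [j.+1%:R]mulrSr [i.+1%:R]mulrSr; ring.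
exists h; last by rewrite fx xh.
by rewrite (_ : (d.+2 - 2 * j.+1)%N = (d - 2 * j)%N) //; lia.
Qed.

Definition Gq (t : K) : {poly K} := ('X - t%:P) * ('X - t%:P).

Lemma pact_Gq t f : pact T0 (Gq t) f = T0 (T0 f) - (2 * t) *: T0 f + (t * t) *: f.
Proof. by rewrite /Gq pactM !pact_XsubC !T0E !(LapD, LapN, LapZ, LoD, LoN, LoZ); lmod. Qed.

Lemma pact_Gq_Lo (d : nat) t f : Sdg d f ->
  pact T0 (Gq t) (Lo f) = Lo (pact T0 (Gq (t - (d%:R - rho))) f).
Proof.
move=> fd; have := pact_Lo [:: t; t] fd.
by rewrite !big_cons !big_nil !mulr1.
Qed.

Lemma eig2 (d j : nat) f : (2 * j <= d)%N -> Sdg d f -> pact T0 (Gq (lam d j)) f = 0 ->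
  (forall i : nat, (i < j)%N -> (d%:R - i%:R - j%:R - 1 : K) != rho) ->
  exists2 h, Ad (d - 2 * j) h & f = iter j Lo h.
Proof.
elim: j d f => [|j IH] d f jd fd fe c3.
  exists f => //; rewrite muln0 subn0; split=> //; apply: Lo_eq0.
  by move: fe; rewrite pact_Gq /lam mul0r !mulr0 !scale0r subr0 addr0.
case: d jd fd fe c3 => [|[|d]] jd fd fe c3; try lia.
have l0 : lam d.+2 j.+1 != 0.
  rewrite /lam mulf_neq0 ?pnatr_eq0 // subr_eq0; have := c3 0%N isT.
  by rewrite subr0.
set l := lam _ _ in fe l0.
(* Since (T0 - l)^2 f = 0, the vector l^2 f equals 2 l T0 f - T0^2 f, which is visibly in the image
   of [Lo]. *)
pose x := (l * l)^-1 *: ((2 * l) *: Lap f - Lap (T0 f)).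
have fx : f = Lo x.
  move/eqP: fe; rewrite pact_Gq addrC addr_eq0 => /eqP fe.
  rewrite /x LoZ LoD LoN LoZ -!T0E (_ : _ - _ = (l * l) *: f); last by rewrite fe; lmod.
  by rewrite scalerA mulVf ?scale1r // mulf_neq0.
have xd : Sdg d x.
  by apply: SdgZ; apply: SdgB; [apply: SdgZ|]; apply: Sdg_Lap => //; apply: Sdg_T0.
have [|||h hh xh] := IH d x _ xd.
- lia.
- by apply: Lo_eq0; rewrite -lamS -/l -(pact_Gq_Lo _ xd) -fx.
- move=> i ij; have := c3 i.+1 ij; apply: contra => /eqP <-; apply/eqP.
  by rewrite -[d.+2]addn2 natrD [j.+1%:R]mulrSr [i.+1%:R]mulrSr; ring.
exists h; last by rewrite fx xh.
by rewrite (_ : (d.+2 - 2 * j.+1)%N = (d - 2 * j)%N) //; lia.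
Qed.

Lemma eig2_inv (d j : nat) h : (2 * j <= d)%N -> Ad (d - 2 * j) h ->
  Sdg d (iter j Lo h) /\ pact T0 (Gq (lam d j)) (iter j Lo h) = 0.
Proof.
move=> jd [hd h0]; split.
  by have := Sdg_iter_Lo j hd; rewrite subnK.
elim: j d jd hd => [|j IH] d jd hd.
  by rewrite pact_Gq /lam mul0r !mulr0 !scale0r subr0 addr0 !T0E h0 Lo0.
case: d jd hd => [|[|d]] jd hd; try lia.
have hd' : Sdg (d - 2 * j) h.
  by move: hd; rewrite (_ : (d.+2 - 2 * j.+1)%N = (d - 2 * j)%N) //; lia.
have jd' : (2 * j <= d)%N by lia.
have := Sdg_iter_Lo j hd'; rewrite subnK // => hj.
by rewrite iterS (pact_Gq_Lo _ hj) lamS IH // Lo0.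
Qed.

Section Decomposition.
Variables (d k : nat).
Hypotheses (kd : (k <= d./2.+1)%N)
  (c3 : forall i j : nat, (i < j < k)%N -> (d%:R - i%:R - j%:R - 1 : K) != rho).

Lemma lam_neq (i j : nat) : (i < j < k)%N -> lam d i != lam d j.
Proof.
move=> ij; have := c3 ij; apply: contra; rewrite -subr_eq0.
rewrite (_ : lam d i - lam d j = (i%:R - j%:R) * (d%:R - i%:R - j%:R - 1 - rho)); last first.
  by rewrite /lam; ring.
by rewrite mulf_eq0 !subr_eq0 eqr_nat => /orP[/eqP e|//]; lia.
Qed.

Lemma Gq_coprime (i j : 'I_k) : i != j -> coprimep (Gq (lam d i)) (Gq (lam d j)).
Proof.
move=> ij; have h : lam d i != lam d j.
  have := ij; rewrite -val_eqE /= neq_ltn => /orP[] h; last rewrite eq_sym;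
  by apply: lam_neq; rewrite h /= ltn_ord.
by rewrite /Gq !coprimepMl !coprimepMr coprimep_XsubC root_XsubC eq_sym h.
Qed.

(** The squared factors are pairwise coprime by [c3], so [primary] applies, and [eig2] identifies
    the generalized eigenspaces. Squares are needed because the remaining eigenvalues, those with
    index at least k, may repeat earlier ones. *)
Lemma decomp f :
  \prod_(i < d./2.+1) ('X - (lam d i)%:P) %| \prod_(j < k) Gq (lam d j) -> Sdg d f ->
  exists a : 'I_k -> V, (forall j : 'I_k, Ad (d - 2 * j) (a j)) /\ f = \sum_(j < k) iter j Lo (a j).
Proof.
move=> c2 fd; have := pact_dvd c2 (kill0 fd).
move=> /(primary (Sdg_subsp X d) (@Sdg_T0 _ _ _ X d) fd Gq_coprime)[F [Fd FG ->]].
have h (j : 'I_k) : exists a : V, Ad (d - 2 * j) a /\ F j = iter j Lo a.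
  have jd : (2 * j <= d)%N by have := ltn_ord j; lia.
  have [|a h1 h2] := @eig2 d j (F j) jd (Fd j) (FG j); last by exists a.
  by move=> i ij; apply: c3; rewrite ij ltn_ord.
have [a ha] := choice h; exists a; split=> [j|]; first by case: (ha j).
by apply: eq_bigr => j _; case: (ha j).
Qed.

Lemma decomp_uniq (a : 'I_k -> V) : (forall j : 'I_k, Ad (d - 2 * j) (a j)) ->
  \sum_(j < k) iter j Lo (a j) = 0 -> forall j, a j = 0.
Proof.
move=> ha h0 j; apply: (@iter_Lo_inj j); rewrite iter_Lo0; move: j.
apply: (primary_uniq (T := T0) Gq_coprime) h0 => j.
by apply: (@eig2_inv d j _ _ (ha j)).2; have := ltn_ord j; lia.
Qed.
End Decomposition.

Lemma dvd_full d : \prod_(i < d./2.+1) ('X - (lam d i)%:P) %| \prod_(j < d./2.+1) Gq (lam d j).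
Proof. by rewrite /Gq big_split dvdp_mulr. Qed.

(** The reflection i -> d - 1 - N - i preserves lam d i and carries the indices from k to d/2 to
    indices below k. Those upper eigenvalues are distinct among themselves, so each factor occurs at
    most twice. *)
Lemma dvd_half (N d : nat) : rho = N%:R -> (2 * N < d)%N ->
  \prod_(i < d./2.+1) ('X - (lam d i)%:P) %| \prod_(j < ((d - N - 1) %/ 2).+1) Gq (lam d j).
Proof.
move=> hN dN; set k := (_ %/ 2).+1.
have kd : (k <= d./2.+1)%N by rewrite /k; lia.
rewrite -(big_mkord xpredT (fun i => 'X - (lam d i)%:P)) (big_cat_nat (n := k)) //=.
rewrite /Gq big_split /= dvdp_mul ?big_mkord //.
rewrite -(big_map (lam d) xpredT (fun t => 'X - t%:P)).
apply: uniq_roots_dvdp.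
  apply/allP => y /mapP [j]; rewrite mem_index_iota => /andP[kj jd] ->.
  have jk : (d - 1 - N - j < k)%N by rewrite /k; lia.
  rewrite rootE horner_prod; apply/prodf_eq0; exists (Ordinal jk) => //=.
  rewrite -rootE root_XsubC; apply/eqP; rewrite /lam hN !natrB; try lia.
  by ring.
rewrite uniq_rootsE map_inj_in_uniq ?iota_uniq // => i j.
rewrite !mem_index_iota => hi hj /eqP; rewrite -subr_eq0.
rewrite (_ : lam d i - lam d j = (i%:R - j%:R) * (d%:R - i%:R - j%:R - 1 - rho)); last first.
  by rewrite /lam; ring.
rewrite mulf_eq0 subr_eq0 eqr_nat => /orP[/eqP //|].
move=> /eqP h; have : (d%:R : K) == (i + j + 1 + N)%:R.
  by rewrite !natrD -hN -subr_eq0 -h; apply/eqP; ring.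
by rewrite eqr_nat => /eqP; move: hi hj; rewrite /k; lia.
Qed.

(** * The critical degrees d = f0 + 2, in which s = t + 1 and d - 2s = e = 2N - f0 *)

Section Critical.
Variables (N f0 : nat).
Hypotheses (hN : rho = N%:R) (hf : (N <= f0 <= 2 * N)%N).
Local Notation t := (f0 - N)%N.
Local Notation e := (f0 - 2 * t)%N.

(** On the kernel of [Lap \o Lo] the operator T0 is the scalar rho - f0 = -t, which is exactly lam
    f0 t, so [eig1] applies. *)
Lemma crit_ker y : Sdg f0 y -> Lap (Lo y) = 0 -> exists2 h, Hd e h & y = iter t Lo h.
Proof.
move=> yd y0; apply: eig1 => //; first by lia.
  have := T1_T0 yd; rewrite T1E y0 => /esym/eqP; rewrite addr_eq0 => /eqP ->.
  rewrite -scaleNr; congr (_ *: _); rewrite /lam hN natrB; last by lia.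
  by ring.
move=> i it; rewrite hN; apply/eqP => h.
have : (f0%:R : K) == (N + i + t + 1)%:R by rewrite !natrD -h; apply/eqP; ring.
by rewrite eqr_nat => /eqP; lia.
Qed.

(** Here e + t = N, so the scalar of [Lap_iter_H] contains the factor e + t - rho = 0. *)
Lemma crit_top h : Hd e h -> Hd f0.+2 (iter t.+1 Lo h).
Proof.
move=> hh; split.
  have := Sdg_iter_Lo t.+1 hh.1; rewrite (_ : (e + 2 * t.+1)%N = f0.+2) //; lia.
rewrite (Lap_iter_H _ hh) hN -natrD -natrB; last by lia.
have -> : (e + t - N)%N = 0%N by lia.
by rewrite mulr0 scale0r.
Qed.

(** The polynomial of [kill1] without its factor for i = t. That factor is X itself and no other
    root is 0, so 0 is a simple root: kernel and image of [Lap \o Lo] are complementary in degree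
    f0. *)
Let Rp : {poly K} := \prod_(i < f0./2.+1 | i != t :> nat) ('X - (i.+1%:R * (f0%:R - i%:R - rho))%:P).

Lemma crit_coprime : coprimep 'X Rp.
Proof.
rewrite /Rp; elim/big_ind: _ => [|x y hx hy|i it]; rewrite ?coprimep1 ?coprimepMr ?hx //.
rewrite coprimep_XsubC rootX mulf_neq0 ?pnatr_eq0 // hN; apply/eqP => h.
have : (f0%:R : K) == (N + i)%:R by rewrite natrD -subr_eq0 -h; apply/eqP; ring.
by rewrite eqr_nat => /eqP; lia.
Qed.

Lemma crit_kill y : Sdg f0 y -> pact T1 (Rp * 'X) y = 0.
Proof.
move=> yd; rewrite -(kill1 yd) /Rp.
have tf : (t < f0./2.+1)%N by lia.
rewrite [in RHS](bigD1 (Ordinal tf)) //= mulrC; congr (pact _ (_ * _) _).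
rewrite (_ : f0%:R - t%:R - rho = 0) ?mulr0 ?polyC0 ?subr0 // hN natrB; [by ring|lia].
Qed.

Lemma crit_inj y : Sdg f0 y -> Lap (Lo (Lap (Lo y))) = 0 -> Lap (Lo y) = 0.
Proof.
move=> yd y0; apply: (@pact_coprime _ _ T1 'X Rp _ crit_coprime).
  by rewrite -['X]mul1r pactMX pact1 T1E.
by have := crit_kill yd; rewrite pactMX T1E.
Qed.

Lemma crit_Wsplit y : Sdg f0 y -> exists h w, [/\ Hd e h, Wd f0 w & y = iter t Lo h + w].
Proof.
move=> yd; have /Bezout_eq1_coprimepP[[a c] /= hac] := crit_coprime.
have [|h hh hy] := @crit_ker (pact T1 (c * Rp) y) (Sdg_pact1 _ yd).
  by rewrite -T1E -pactT -pactMX -mulrA pactM crit_kill // pact0.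
exists h, (Lap (Lo (pact T1 a y))); split=> //.
  by exists (pact T1 a y) => //; apply: Sdg_pact1.
rewrite -hy -T1E -pactT -pactMX -[LHS](pact1 T1) -hac pactD addrC; congr (_ + _).
Qed.

Lemma crit_Winj w : Wd f0 w -> Lap (Lo w) = 0 -> w = 0.
Proof. by move=> [y yd ->]; apply: crit_inj. Qed.

Lemma Wd_Sdg d w : Wd d w -> Sdg d w.
Proof. by move=> [y yd ->]; apply: Sdg_T1. Qed.

Lemma crit_LapLo h : Hd e h -> Lap (Lo (iter t Lo h)) = 0.
Proof. by move=> /crit_top[]. Qed.

Lemma crit_W0 h w : Hd e h -> Wd f0 w -> iter t Lo h + w = 0 -> h = 0 /\ w = 0.
Proof.
move=> hh ww /eqP; rewrite addr_eq0 => /eqP hw.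
have w0 : w = 0.
  apply: crit_Winj => //; rewrite -[w]opprK -hw LoN LapN crit_LapLo //.
  by rewrite oppr0.
by split=> //; apply: (@iter_Lo_inj t); rewrite hw w0 iter_Lo0 oppr0.
Qed.

Lemma crit_Wsurj w : Wd f0 w -> exists2 w', Wd f0 w' & Lap (Lo w') = w.
Proof.
move=> [y yd ->]; have [h [w' [hh ww ->]]] := crit_Wsplit yd.
by exists w' => //; rewrite LoD LapD crit_LapLo // add0r.
Qed.

(** The W-part of [Lap x] is lifted through the bijection [Lap \o Lo] of W; once [Lo] of the lift is
    subtracted, [Lap x] lies in the kernel L^t H_e of [Lap \o Lo]. *)
Lemma crit_Asplit x : Sdg f0.+2 x -> exists (a w : V), [/\ Ad f0.+2 a, Wd f0 w & x = a + Lo w].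
Proof.
move=> xd; have [h [w [hh ww hx]]] := crit_Wsplit (Sdg_Lap xd).
have [w' ww' hw'] := crit_Wsurj ww.
exists (x - Lo w'), w'; rewrite subrK; split=> //; split.
  by apply: SdgB => //; apply: Sdg_Lo; apply: Wd_Sdg.
by rewrite LapD LapN hw' hx addrK crit_LapLo.
Qed.

Lemma crit_AW0 w : Wd f0 w -> Ad f0.+2 (Lo w) -> w = 0.
Proof.
move=> ww [_ h]; apply: crit_Winj => //; apply: crit_inj => //; exact: Wd_Sdg.
Qed.

Lemma crit_ALap x : Ad f0.+2 x -> exists2 h, Hd e h & Lap x = iter t Lo h.
Proof. by move=> [xd x0]; apply: crit_ker => //; apply: Sdg_Lap. Qed.

Lemma crit_Asurj h : Hd e h -> exists2 x, Ad f0.+2 x & Lap x = iter t Lo h.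
Proof.
move=> hh; have hd : Sdg f0 (iter t Lo h).
  have := Sdg_iter_Lo t hh.1; rewrite (_ : (e + 2 * t)%N = f0) //; lia.
have [x xd hx] := Lap_surj hp hpp hd; exists x => //; split=> //.
by rewrite hx crit_LapLo.
Qed.

Lemma crit_perp_r x w : Ad f0.+2 x -> Wd f0 w -> sf x (Lo w) = 0.
Proof.
move=> [xd x0] [y yd ->].
by rewrite -sf_Lap -sf_Lo -sf_Lap x0 sfE.
Qed.

Lemma crit_perp_l x w : Ad f0.+2 x -> Wd f0 w -> sf (Lo w) x = 0.
Proof.
move=> [xd x0] [y yd ->].
by rewrite sf_Lo sf_Lap sf_Lo x0 sfE.
Qed.

(** Moving one [Lo] across the form multiplies by (i+1)(e + i - N), and this is nonzero for i < t
    because e + t = N. *)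
Lemma crit_pair h h' : Hd e h -> Hd e h' ->
  exists2 c : K, c != 0 & sf (iter t Lo h) (iter t Lo h') = c * sf h h'.
Proof.
move=> hh hh'; suff : forall i : nat, (i <= t)%N ->
   exists2 c : K, c != 0 & sf (iter i Lo h) (iter i Lo h') = c * sf h h' by apply.
elim=> [|i IH] it; first by exists 1; rewrite ?oner_eq0 // mul1r.
have [|c c0 hc] := IH; first by lia.
exists (i.+1%:R * (e%:R + i%:R - rho) * c).
  rewrite mulf_neq0 // mulf_neq0 ?pnatr_eq0 // hN -natrD subr_eq0 eqr_nat; lia.
by rewrite [iter i.+1 Lo h]iterS sf_Lo (Lap_iter_H _ hh') sfE hc mulrA.
Qed.

Lemma regular_low d : (d <= N.+1)%N -> regular d.
Proof. by move=> dN j jd; rewrite hN eqr_nat; lia. Qed.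

Lemma regular_high d : (2 * N + 2 < d)%N -> regular d.
Proof. by move=> dN j jd; rewrite hN eqr_nat; lia. Qed.

Lemma Hd_nd d h : regular d -> Hd d h -> (forall g, Hd d g -> sf g h = 0) -> h = 0.
Proof.
case: d => [|[|d]] rg hh h0.
- apply: (sf_ndr hh.1) => g gd; apply: h0; split=> //; exact: Lap_low gd.
- apply: (sf_ndr hh.1) => g gd; apply: h0; split=> //; exact: Lap_low gd.
apply: (sf_ndr hh.1) => g gd; have [g1 [g2 [hg1 _ ->]]] := split_regular rg gd.
by rewrite sfDl h0 // sf_Lo hh.2 sfE addr0.
Qed.

Lemma Hd_ndl d h : regular d -> Hd d h -> (forall g, Hd d g -> sf h g = 0) -> h = 0.
Proof.
case: d => [|[|d]] rg hh h0.
- apply: (sf_ndl hh.1) => g gd; apply: h0; split=> //; exact: Lap_low gd.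
- apply: (sf_ndl hh.1) => g gd; apply: h0; split=> //; exact: Lap_low gd.
apply: (sf_ndl hh.1) => g gd; have [g1 [g2 [hg1 _ ->]]] := split_regular rg gd.
by rewrite sfDr h0 // -sf_Lap hh.2 sfE addr0.
Qed.

End Critical.
End Isotropic.
End Decomp.

(** * Singular vectors *)

Section Singular.
Variables (K : numFieldType) (D : nat) (V : lmodType K) (X : fock D V).
Implicit Types (a b c e : 'I_D) (f g h u v : V) (k : K).

Local Notation mu := (mul X).
Local Notation de := (der X).
Local Notation "a ^s" := (st X a) (at level 2, format "a ^s").
Local Notation be := (bet X).
Local Notation P := (par_op X).
Local Notation one := (one X).
Local Notation q := (ksgn X).
Local Notation gam := (gam X).
Local Notation Lo := (Lo X).
Local Notation Lap := (Lap X).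
Local Notation Eu := (Eu X).
Local Notation Fo := (Fo X).
Local Notation rho := (rho X).
Local Notation wd := (wd X).
Local Notation Sdg := (Sdg X).
Local Notation sf := (sf X).

Local Notation T0 := (T0 X).
Local Notation lam := (lam X).
Local Notation Hd := (Hd X).
Local Notation Ad := (Ad X).
Local Notation Wd := (Wd X).

(** Graded submodules in terms of the operators F_ab and the parity automorphism; [submodE]
    identifies them with the osp-submodules of the statement. *)
Definition smod (M : V -> Prop) := [/\ subsp M, forall u, M u -> M (P u) & forall a b u, M u -> M (Fo a b u)].

Lemma smod_sub M : smod M -> subsp M. Proof. by case. Qed.

Lemma smod_pe M t u : smod M -> M u -> M (pe X t u).
Proof. by move=> [_ h _]; case: t => //= /h. Qed.

Lemma smod_Hd d : smod (Hd d).
Proof.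
split; first exact: Hd_subsp.
  by move=> u [h1 h2]; split; [apply: Sdg_P|rewrite -par_Lap h2 P0].
by move=> a b u [h1 h2]; split; [apply: Sdg_Fo|rewrite -Fo_Lap h2 Fo0].
Qed.
Lemma smod_Ad d : smod (Ad d).
Proof.
split; first exact: Ad_subsp.
  by move=> u [h1 h2]; split; [apply: Sdg_P|rewrite -par_Lap -par_Lo -par_Lap h2 P0].
by move=> a b u [h1 h2]; split; [apply: Sdg_Fo|rewrite -Fo_Lap -Fo_Lo -Fo_Lap h2 Fo0].
Qed.
Lemma smod_Wd d : smod (Wd d).
Proof.
split; first exact: Wd_subsp.
  by move=> _ [u h1 ->]; exists (P u); [apply: Sdg_P|rewrite par_Lap par_Lo].
by move=> a b _ [u h1 ->]; exists (Fo a b u); [apply: Sdg_Fo|rewrite Fo_Lap Fo_Lo].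
Qed.
Lemma smod_iter n M : smod M -> smod (fun u => exists2 h, M h & u = iter n Lo h).
Proof.
move=> [hM hP hF]; split.
- split; first by exists 0; [apply: subsp0|rewrite iter_Lo0].
  by move=> k _ _ [u hu ->] [v hv ->]; exists (k *: u + v); [apply: subspL|rewrite iter_LoD iter_LoZ].
- by move=> _ [u hu ->]; exists (P u); [apply: hP|rewrite par_iter_Lo].
by move=> a b _ [u hu ->]; exists (Fo a b u); [apply: hF|rewrite Fo_iter_Lo].
Qed.
Lemma smod_preiter n M N : smod M -> smod N -> smod (fun u => N u /\ M (iter n Lo u)).
Proof.
move=> [hM hP hF] [hN hNP hNF]; split.
- split; first by split; [apply: subsp0|rewrite iter_Lo0; apply: subsp0].
  by move=> k u v [h1 h2] [h3 h4]; split; [apply: subspL|rewrite iter_LoD iter_LoZ; apply: subspL].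
- by move=> u [h1 h2]; split; [apply: hNP|rewrite -par_iter_Lo; apply: hP].
by move=> a b u [h1 h2]; split; [apply: hNF|rewrite -Fo_iter_Lo; apply: hF].
Qed.

Lemma sf_Fo_r a b u v : sf u (Fo a b v) = - sf (Fo a b (pe X (par X a (+) par X b) u)) v.
Proof. by rewrite sf_Fo peK opprK. Qed.

Lemma smod_perp M N : smod M -> smod N -> smod (fun v => N v /\ forall u, M u -> sf u v = 0).
Proof.
move=> hM [hN hNP hNF]; split.
- split; first by split; [apply: subsp0|move=> u _; rewrite sfE].
  move=> k u v [h1 h2] [h3 h4]; split; first exact: subspL.
  by move=> w hw; rewrite !sfE h2 // h4 // mulr0 addr0.
- move=> v [h1 h2]; split; first exact: hNP.
  by move=> u hu; rewrite -sf_parC h2 //; case: hM => _ hMP _; apply: hMP.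
move=> a b v [h1 h2]; split; first exact: hNF.
move=> u hu; rewrite sf_Fo_r h2 ?oppr0 //; case: (hM) => _ _; apply; exact: smod_pe.
Qed.

Definition xp (p : 'I_D) n : V := iter n (mu p) one.

Lemma Sdg_xp p n : Sdg n (xp p n).
Proof.
elim: n => [|n IH]; last exact: Sdg_mu.
by rewrite /Sdg /xp /= EuE big1 ?scale0r // => a _; rewrite der_one mu0.
Qed.

Lemma de_xp p a n : par X p = false -> a != p -> de a (xp p n) = 0.
Proof.
move=> hp ap; elim: n => [|n IH]; first by rewrite /xp der_one.
by rewrite /xp iterS dm_evenr // -/(xp p n) IH mu0.
Qed.

Lemma de_xp_self p n : par X p = false -> de p (xp p n.+1) = n.+1%:R *: xp p n.
Proof.
move=> hp; elim: n => [|n IH]; first by rewrite /xp /= dm_self // der_one mu0; lmod.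
by rewrite /xp iterS dm_self // -/(xp p n.+1) IH muZ [n.+2%:R]mulrSr; lmod.
Qed.

Lemma sf_xp p n : par X p = false -> sf (xp p^s n) (xp p n) != 0.
Proof.
move=> hp; have hps : par X p^s = false by rewrite par_st.
elim: n => [|n IH]; first by rewrite /xp /= sf_one vac_one oner_eq0.
rewrite {1}/xp iterS -/(xp p^s n) sf_mu hps /= stK de_xp_self // sfE.
by rewrite !mulf_neq0 ?bet_neq0 ?pnatr_eq0.
Qed.

Lemma xp_neq0 p n : par X p = false -> xp p n <> 0.
Proof. by move=> hp h; have := sf_xp n hp; rewrite h sfE eqxx. Qed.

Section Isotropic.
Variable p : 'I_D.
Hypotheses (hp : par X p = false) (hpp : p^s != p).
Local Notation ps := (p^s).
Local Notation wo := (wtop X p).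
Local Notation Wt := (Wt X p).
Local Notation LoI := (LoI hp hpp).

Let hps : par X ps = false. Proof. by rewrite par_st. Qed.
Let hpps : p != ps. Proof. by rewrite eq_sym. Qed.
Let b0 : be p != 0. Proof. exact: bet_neq0. Qed.

Lemma Lap_xp n : Lap (xp p n) = 0.
Proof.
elim: n => [|n IH]; first by apply: (@Lap_low _ _ _ _ 0) => //; apply: (Sdg_xp p 0).
by rewrite /xp iterS Lap_mul -/(xp p n) IH mu0 de_xp ?scaler0 ?addr0.
Qed.

Lemma Hd_xp n : Hd n (xp p n).
Proof. by split; [apply: Sdg_xp|apply: Lap_xp]. Qed.

Lemma Lo_sum_st f : \sum_b gam b^s *: mu b^s (mu b f) = 2 *: Lo f.
Proof.
rewrite LoE scalerA divff ?pnatr_eq0 // scale1r [RHS](reindex_inj (can_inj (stK X))) /=.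
by apply: eq_bigr => b _; rewrite stK.
Qed.

Lemma Fo_pp f : Fo p p f = 0.
Proof. by rewrite FoE ksgn_e // mul1r subrr. Qed.

Lemma sum_inner (F : 'I_D -> V) :
  \sum_b F b = F p + F ps + \sum_(b | (b != p) && (b != ps)) F b.
Proof. by rewrite (bigD1 p) //= (bigD1 ps) ?hpp //= addrA. Qed.

(* If f has weight w < d and all F_pb f vanish modulo omega, this shows that   *)
(* e_p f is divisible by omega.                                                *)
Lemma sum_Fo f : \sum_(b | (b != p) && (b != ps)) gam b^s *: mu b^s (Fo p b f) =
  mu p (Eu f - wo f) - (2 * be p) *: Lo (de ps f).
Proof.
have all : \sum_b gam b^s *: mu b^s (Fo p b f) = mu p (Eu f) - (2 * be p) *: Lo (de ps f).
  under eq_bigr => b _.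
    rewrite FoE ksgn_e // mul1r !linE scalerDr !scalerA gambes scale1r.
    rewrite -(mm_even _ _ hp) scalerN scalerA mulrC -scalerA; over.
  rewrite big_split /= -mu_sum sumrN -scaler_sumr Lo_sum_st [(2 * _)]mulrC -scalerA; congr (mu p _ - _).
  by rewrite EuE [RHS](reindex_inj (can_inj (stK X))).
apply/eqP; rewrite eq_sym -subr_eq0; apply/eqP.
move: all; rewrite sum_inner Fo_pp mu0 scaler0 add0r (Fo_wo hp) muZ stK scalerA gambe hp scale1r => all.
apply/eqP; rewrite subr_eq0 muD muN addrAC -all addrAC subrr add0r eqxx.
by [].
Qed.

Lemma wt_neq b : b != p -> b != ps -> wt X p b = 0.
Proof. by move=> /negPf h1 /negPf h2; rewrite /wt h1 h2. Qed.

Lemma wt_p : wt X p p = 1.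
Proof. by rewrite /wt eqxx eq_sym (negPf hpp). Qed.

Lemma Wt_Fo w b f : Wt w f -> b != p -> b != ps -> Wt (w + 1) (Fo p b f).
Proof.
move=> fw b1 b2; rewrite /Wt wo_Fo // fw FoZ -scalerDl -rmorphD /= wt_p (wt_neq b1 b2).
by congr (_%:~R *: _).
Qed.

(** True for m at least 3. It supplies the index c of [dvp_Lo_inv], hence cancellation of omega
    modulo x_p. *)
Definition inner := exists2 c, par X c = false & (c != p) && (c != ps).

(** The point is that x_p divides g: by cancellation of omega modulo x_p if an inner even index
    exists, and otherwise because g has positive weight w + 1. Cancelling x_p then gives the
    claim. *)
Lemma Lo_div (d : nat) w f g : inner \/ 0 <= w -> Sdg d f -> Wt w f -> mu p f = Lo g -> exists f', f = Lo f'.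
Proof.
move=> cond fd fw fg.
have [g' gg'] : dvp X p g.
  case: cond => [[c hc /andP[c1 c2]]|w0].
    by apply: (dvp_Lo_inv hp hc c1 c2); exists f.
  have gw : Wt (w + 1) g.
    apply: LoI; rewrite -wo_Lo // -fg wo_mu // fw wt_p muZ LoZ -fg intrD; lmod.
  (* The relation forces degree d - 1 on g; for d = 0 this is -1, so g = 0. *)
  case: d fd => [|d] fd.
    have -> : g = 0; last by exists 0; rewrite mu0.
    apply: (@Sdg_neg _ _ _ X (-1)); last first.
      by move=> e; rewrite eq_sym -subr_eq0 opprK -mulrSr pnatr_eq0.
    apply: LoI; apply: (addIr (2 *: Lo g)); rewrite -Eu_Lo -fg Eu_mul fd LoZ -fg.
    by rewrite scale0r mu0; lmod.
  have gd : Sdg d g.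
    apply: LoI; apply: (addIr (2 *: Lo g)); rewrite -Eu_Lo -fg Eu_mul fd muZ LoZ -fg [d.+1%:R]mulrSr; lmod.
  by apply: (Wt_div hp hpp gd gw); lia.
exists g'; apply/eqP; rewrite -subr_eq0; apply/eqP; apply: (mu_inj hp).
by rewrite muD muN fg gg' mul_Lo subrr.
Qed.

Lemma Lo_homog (d : nat) f : Sdg d (Lo f) -> f = 0 \/ exists2 d', d = d'.+2 & Sdg d' f.
Proof.
move=> h; have fe : Eu f = (d%:R - 2) *: f.
  by apply: LoI; apply: (addIr (2 *: Lo f)); rewrite -Eu_Lo h LoZ; lmod.
case: d h fe => [|[|d]] h fe.
- left; apply: (Sdg_neg fe) => e; rewrite subr_eq -natrD eqr_nat; lia.
- left; apply: (Sdg_neg fe) => e; rewrite subr_eq -natrD eqr_nat; lia.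
by right; exists d => //; rewrite /Sdg fe -[d.+2]addn2 natrD addrK.
Qed.

Lemma singular s (d : nat) w f : inner \/ 0 <= w -> Sdg d f -> Wt w f ->
  (forall b, b != p -> b != ps -> exists g, Fo p b f = iter s Lo g) ->
  (exists2 g, (2 * s <= d)%N /\ Sdg (d - 2 * s) g & f = iter s Lo g) \/
  (exists j k, [/\ (j < s)%N, (2 * j <= d)%N & f = k *: iter j Lo (xp p (d - 2 * j))]).
Proof.
move=> cond; elim: s d f => [|s IH] d f fd fw fF.
  by left; exists f => //; rewrite muln0 subn0.
(* In weight d only multiples of x_p^d exist; otherwise d - w is invertible and [sum_Fo] makes x_p f
   divisible by omega. *)
have [wd|wd] := eqVneq w d%:Z.
  right; exists 0%N; have [|k fk] := @Wt_top _ _ _ X p hp hpp d f fd; first by rewrite -wd.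
  by exists k; rewrite muln0 subn0.
have [G hG] : exists G : 'I_D -> V, forall b, b != p -> b != ps -> Fo p b f = iter s.+1 Lo (G b).
  suff hc : forall b : 'I_D, exists g, b != p -> b != ps -> Fo p b f = iter s.+1 Lo g.
    by have [G hG] := choice hc; exists G.
  move=> b; have [b1|b1] := boolP (b != p); last by exists 0.
  have [b2|b2] := boolP (b != ps); last by exists 0.
  by have [g hg] := fF b b1 b2; exists g.
have [f' ff'] : exists f', f = Lo f'.
  have k0 : (d%:R - w%:~R : K) != 0.
    by rewrite subr_eq0 -[d%:R]/((d%:Z)%:~R) eqr_int eq_sym.
  have := sum_Fo f; rewrite fd fw -scalerBl.
  rewrite (eq_bigr (fun b => Lo (gam b^s *: mu b^s (iter s Lo (G b))))); last first.
    by move=> b /andP[b1 b2]; rewrite hG // iterS mul_Lo LoZ.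
  rewrite -Lo_sum => /esym/eqP; rewrite subr_eq -LoZ -LoD muZ => /eqP h.
  apply: (@Lo_div d w f ((d%:R - w%:~R)^-1 *: (\sum_(b | (b != p) && (b != ps)) gam b^s *: mu b^s (iter s Lo (G b))
     + (2 * be p) *: de ps f))) => //.
  by rewrite LoZ -h scalerA mulVf // scale1r.
have [f0|[d' dd' fd']] : f' = 0 \/ exists2 d', d = d'.+2 & Sdg d' f'.
  by apply: Lo_homog; rewrite -ff'.
  by right; exists 0%N, 0; rewrite ff' f0 Lo0 scale0r.
have fw' : Wt w f' by apply: LoI; rewrite -wo_Lo // -ff' fw ff' LoZ.
have [|[g [sd gd] fg]|[j [k [js jd fk]]]] := IH d' f' fd' fw'.
- by move=> b b1 b2; exists (G b); apply: LoI; rewrite -Fo_Lo -ff' hG.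
- left; exists g; last by rewrite ff' fg.
  by rewrite dd'; split; [lia|rewrite (_ : (d'.+2 - 2 * s.+1)%N = (d' - 2 * s)%N) //; lia].
right; exists j.+1, k; split; [lia|lia|].
rewrite ff' fk LoZ dd' (_ : (d'.+2 - 2 * j.+1)%N = (d' - 2 * j)%N) //; lia.
Qed.

(** Each F_pb with b different from p and ps raises the weight by 1, and weights in degree d are at
    most d, so raising modulo Z has to stop. *)
Lemma raise (M Z : V -> Prop) (d : nat) w u : smod M -> subsp Z -> (forall v, M v -> Sdg d v) ->
  M u -> ~ Z u -> Wt w u -> exists u' w', [/\ M u', ~ Z u', Wt w' u', w <= w'
    & forall b, b != p -> b != ps -> Z (Fo p b u')].
Proof.
move=> hM hZ MS; have [n] := ubnP (`|d%:Z - w|%N); elim: n w u => // n IH w u dn Mu nZ uw.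
have wd : w <= d%:Z.
  rewrite leNgt; apply/negP => wd; apply: nZ; rewrite (Wt_bound hp hpp (MS _ Mu) uw); last by lia.
  exact: subsp0.
have [[b [b1 b2 nb]]|no] := EM (exists b, [/\ b != p, b != ps & ~ Z (Fo p b u)]).
  have wF := Wt_Fo uw b1 b2; have MF : M (Fo p b u) by case: hM => _ _; apply.
  have wd' : w + 1 <= d%:Z.
    rewrite leNgt; apply/negP => wd'; apply: nb; rewrite (Wt_bound hp hpp (MS _ MF) wF); last by lia.
    exact: subsp0.
  have [|u' [w' [h1 h2 h3 h4 h5]]] := IH (w + 1) _ _ MF nb wF; first by lia.
  by exists u', w'; split=> //; lia.
exists u, w; split=> // b b1 b2; apply: contrapT => nb; apply: no.
by exists b.
Qed.

(** M contains the weight components of u, and they cannot all lie in the subspace Z since their sum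
    does not. *)
Lemma weight_vec (M Z : V -> Prop) (d : nat) u : smod M -> subsp Z -> (forall v, M v -> Sdg d v) ->
  M u -> ~ Z u -> exists u' w, [/\ M u', ~ Z u' & Wt w u'].
Proof.
move=> hM hZ MS Mu nZ; have [l ul] := wd_decomp X u.
have part (t : K) : M (\sum_(x <- l | (wts X p x.2)%:~R == t) x.1 *: wd x.2).
  apply: (@eigen_part _ _ _ X wo (fun s => (wts X p s)%:~R) M l t) => //.
  - by move=> s; apply: wo_wd.
  - by case: hM => -[].
  - by case: hM => -[].
  - move=> v Mv; apply: (@subsp_cancel _ _ M _ (be p)) => //; first by case: hM.
    by rewrite -[be p *: _](Fo_wo hp); case: hM => _ _; apply.
  - by rewrite -ul.
pose n := (\max_(x <- l) size x.2)%N.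
pose F (i : 'I_(2 * n).+1) := \sum_(x <- l | wts X p x.2 == i%:Z - n%:Z) x.1 *: wd x.2.
have uF : u = \sum_i F i.
  rewrite /F ul (exchange_big_dep predT) //= big_seq [RHS]big_seq; apply: eq_bigr => x xl.
  have xn : (size x.2 <= n)%N by rewrite (leq_bigmax_seq _ xl).
  have xb := wts_bound hp hpp x.2.
  have xi : (`|(wts X p x.2 + n%:Z)%R| < (2 * n).+1)%N.
    by move: (wts X p x.2) (size x.2) (n) xb xn => z a c; lia.
  rewrite (big_pred1 (Ordinal xi)) // => i; apply/eqP/eqP => [h|->] /=.
    have aux : forall (z : int) (a c j : nat), (a <= c)%N -> (`|z| <= a)%N -> z = j%:Z - c%:Z -> j = `|(z + c%:Z)%R|%N by lia.
    by apply: val_inj; apply: aux xn xb h.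
  have aux : forall (z : int) (a c : nat), (a <= c)%N -> (`|z| <= a)%N -> z = `|(z + c%:Z)%R|%N%:Z - c%:Z by lia.
  exact: aux xn xb.
have [[i ni]|no] := EM (exists i, ~ Z (F i)).
  exists (F i), (i%:Z - n%:Z); split=> //.
    by have := part (i%:Z - n%:Z)%:~R; under eq_bigl do rewrite eqr_int.
  rewrite /Wt linear_sum scaler_sumr; apply: eq_bigr => x /eqP xi /=.
  by rewrite woZ wo_wd // xi !scalerA mulrC.
case: nZ; rewrite uF; apply: subsp_sum => // i _; apply: contrapT => nF.
by apply: no; exists i.
Qed.

Lemma wo_xp n : Wt n%:Z (xp p n).
Proof.
elim: n => [|n IH]; first by rewrite /Wt /xp /= (woE X p) !der_one !mu0; lmod.
by rewrite /Wt /xp iterS wo_mu // -/(xp p n) IH wt_p muZ -addn1 PoszD intrD; lmod.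
Qed.

Lemma singular0 (M : V -> Prop) (d : nat) w u : smod M -> (forall v, M v -> Sdg d v) ->
  M u -> u <> 0 -> Wt w u -> inner \/ 0 <= w ->
  exists2 j, (2 * j <= d)%N & M (iter j Lo (xp p (d - 2 * j))).
Proof.
move=> hM MS Mu u0 uw cond.
have hZ : subsp (fun v : V => v = 0) by split=> // k _ _ -> ->; lmod.
have [u' [w' [Mu' nu' uw' ww' hF]]] := raise hM hZ MS Mu u0 uw.
have cond' : inner \/ 0 <= w' by case: cond; [left|right; lia].
(* Zero is divisible by every power of omega; the choice s = d + 1 excludes the first alternative by
   degree. *)
have [|[g [hd _] _]|[j [k [js jd uk]]]] := singular (s := d.+1) cond' (MS _ Mu') uw'.
- by move=> b b1 b2; exists 0; rewrite hF // iter_Lo0.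
- lia.
exists j => //; apply: (@subsp_cancel _ _ M (smod_sub hM) k); last by rewrite -uk.
by apply: contra_notN nu' => /eqP k0; rewrite uk k0 scale0r.
Qed.

Lemma T0_xp (d j : nat) : (2 * j <= d)%N -> T0 (iter j Lo (xp p (d - 2 * j))) =
  lam d j *: iter j Lo (xp p (d - 2 * j)).
Proof.
move=> jd; rewrite T0E; case: j jd => [|j] jd; first by rewrite /= Lap_xp Lo0 /lam mul0r scale0r.
rewrite (Lap_iter_H _ (Hd_xp _)) LoZ -iterS; congr (_ *: _).
by rewrite /lam natrB // natrM [j.+1%:R]mulrSr; ring.
Qed.

Lemma iter_xp_neq0 j n : iter j Lo (xp p n) <> 0.
Proof. by move=> h; apply: (@xp_neq0 p n hp); apply: (iter_Lo_inj hp hpp (n := j)); rewrite h iter_Lo0. Qed.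

(* Qo is invariant under the Levi subalgebra of p, p*; it raises the weight by 2. *)
Definition Qo f := \sum_(b | (b != p) && (b != ps)) gam b^s *: Fo p b^s (Fo p b f).

Lemma smod_Qo M u : smod M -> M u -> M (Qo u).
Proof.
move=> [hM _ hF] Mu; apply: subsp_sum => // b _; apply: subspZ => //.
exact: (hF _ _ _ (hF _ _ _ Mu)).
Qed.

(* omega^j x_p^l x_p*^k *)
Definition uo (k l j : nat) := iter j Lo (iter l (mu p) (xp ps k)).

Lemma Fo_mu p' b c f : par X p' = false -> Fo p' b (mu c f) = q b c *: mu c (Fo p' b f)
  + ((b^s == c)%:R * be b) *: mu p' f - ((p'^s == c)%:R * be p') *: mu b f.
Proof.
move=> hp'; rewrite !FoE ksgn_e // mul1r !dm !linE !ksgnsl [q p' c]ksgn_e //.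
rewrite -(mm_even c _ hp') [mu b (mu c _)]mm; lmod.
Qed.

Lemma Fo_one a b : Fo a b one = 0.
Proof. by rewrite FoE !der_one !mu0; lmod. Qed.

Section Inner.
Variable b : 'I_D.
Hypotheses (b1 : b != p) (b2 : b != ps).

Lemma Fo_mup f : Fo p b (mu p f) = mu p (Fo p b f).
Proof.
rewrite Fo_mu // [q b p]ksgnC ksgn_e // st_eq (negPf b2) (negPf hpp) /= mulr0n; lmod.
Qed.

Lemma Fo_mups f : Fo p b (mu ps f) = mu ps (Fo p b f) - be p *: mu b f.
Proof.
rewrite Fo_mu // [q b ps]ksgnC ksgnsl ksgn_e // (inj_eq (can_inj (stK X))) (negPf b1) eqxx /= mulr0n mulr1n; lmod.
Qed.

Lemma Fo_xps (k' : nat) : Fo p b (xp ps k'.+1) = - (k'.+1%:R * be p) *: mu b (xp ps k').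
Proof.
elim: k' => [|j IH]; first by rewrite /xp Fo_mups Fo_one mu0; lmod.
rewrite /xp iterS -/(xp ps j.+1) Fo_mups IH muZ (mm_even _ _ hps) [j.+2%:R]mulrSr.
by rewrite /xp iterS -/(xp ps j); lmod.
Qed.

Lemma Fo_uo (k' l j : nat) : Fo p b (uo k'.+1 l j) = - (k'.+1%:R * be p) *: mu b (uo k' l j).
Proof.
rewrite /uo Fo_iter_Lo; have -> : Fo p b (iter l (mu p) (xp ps k'.+1)) =
    - (k'.+1%:R * be p) *: mu b (iter l (mu p) (xp ps k')).
  elim: l => [|l IH]; first by rewrite Fo_xps.
  by rewrite !iterS Fo_mup IH muZ (mm_even _ _ hp).
rewrite iter_LoZ; congr (_ *: _); elim: j => // j IH.
by rewrite !iterS IH mul_Lo.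
Qed.

Lemma Fo_uo0 l j : Fo p b (uo 0 l j) = 0.
Proof.
rewrite /uo Fo_iter_Lo; have -> : Fo p b (iter l (mu p) (xp ps 0)) = 0.
  elim: l => [|l IH]; first by rewrite /xp Fo_one.
  by rewrite !iterS Fo_mup IH mu0.
by rewrite iter_Lo0.
Qed.

Lemma Fo_mub f : Fo p b^s (mu b f) = q b b *: mu b (Fo p b^s f) + be b^s *: mu p f.
Proof.
rewrite Fo_mu // ksgnsl stK eqxx [ps == b]eq_sym (negPf b2) /= mulr0n mulr1n; lmod.
Qed.
End Inner.
Lemma uo_Lo (k l j : nat) : Lo (uo k l j) = uo k l j.+1. Proof. by []. Qed.
Lemma uo_mup (k l j : nat) : mu p (uo k l j) = uo k l.+1 j.
Proof.
rewrite /uo iterS; elim: j => // j IH.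
by rewrite !iterS -IH mul_Lo.
Qed.
Lemma uo_mups (k l j : nat) : mu ps (uo k l j) = uo k.+1 l j.
Proof.
rewrite /uo; have -> : iter l (mu p) (xp ps k.+1) = mu ps (iter l (mu p) (xp ps k)).
  by elim: l => // l IH; rewrite !iterS IH (mm_even _ _ hps).
by elim: j => // j IH; rewrite !iterS -IH mul_Lo.
Qed.

Lemma inner_st b : (b^s != p) && (b^s != ps) = (b != p) && (b != ps).
Proof. by rewrite !st_eq stK andbC. Qed.

Lemma sum_inner_sgn : \sum_(b | (b != p) && (b != ps)) (-1) ^+ par X b = - 2 * rho - 2 :> K.
Proof.
have : \sum_b (-1) ^+ par X b = - 2 * rho.
  by rewrite rhoE; field.
rewrite (bigD1 p) //= (bigD1 ps) ?hpp //= hp hps => <-; rewrite !expr0; ring.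
Qed.

Lemma sum_inner_Lo f : \sum_(b | (b != p) && (b != ps)) gam b *: mu b (mu b^s f) =
  2 *: Lo f - (2 / be p) *: mu p (mu ps f).
Proof.
have : \sum_b gam b *: mu b (mu b^s f) = 2 *: Lo f.
  by rewrite LoE scalerA divff ?scale1r // pnatr_eq0.
rewrite (bigD1 p) //= (bigD1 ps) ?hpp //= stK (mm_even _ _ hps) => <-.
have gp : gam p = (be p)^-1.
  by apply: (mulIf b0); rewrite gambe hp mulVf.
by rewrite gam_st hp gp; lmod.
Qed.

(** Each F_pb removes one factor x_ps and inserts e_b. The sum of the products e_b e_(st b) over the
    inner b is omega up to its x_p x_ps term, and the signs of the inner b sum to -2 rho - 2; these
    produce the two terms. *)
Lemma Qo_uo (k l j : nat) : Qo (uo k l j) = (2 * k%:R * (k%:R - 1) * be p ^+ 2) *: uo (k - 2) l j.+1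
  - (2 * k%:R * be p * (k%:R - rho - 2)) *: uo (k - 1) l.+1 j.
Proof.
rewrite /Qo; case: k => [|k].
  rewrite big1 ?mulr0 ?mul0r; first by lmod.
  by move=> b /andP[b1 b2]; rewrite Fo_uo0 // Fo0 scaler0.
have h b : (b != p) && (b != ps) -> gam b^s *: Fo p b^s (Fo p b (uo k.+1 l j)) =
   - (k.+1%:R * be p) *: ((-1) ^+ par X b *: mu p (uo k l j) + (gam b^s * q b b) *: mu b (Fo p b^s (uo k l j))).
  move=> /andP[b1 b2]; rewrite Fo_uo // FoZ Fo_mub // scalerDr !scalerDr !scalerA.
  have := gambe X b^s; rewrite par_st => <-; lmod.
rewrite (eq_bigr _ h) -scaler_sumr big_split /= -scaler_suml sum_inner_sgn uo_mup.
rewrite (_ : (k.+1 - 1)%N = k); last by lia.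
case: k h => [|k] h.
  rewrite big1; first by lmod.
  by move=> b; rewrite -inner_st => /andP[b1 b2]; rewrite Fo_uo0 // mu0 scaler0.
have h2 b : (b != p) && (b != ps) -> (gam b^s * q b b) *: mu b (Fo p b^s (uo k.+1 l j)) =
    - (k.+1%:R * be p) *: (gam b *: mu b (mu b^s (uo k l j))).
  rewrite -inner_st => /andP[b1 b2]; rewrite Fo_uo // muZ gam_st.
  have := ksgn_self X b; move: (q b b) (_ ^+ _) => x y xy.
  by rewrite !scalerA; congr (_ *: _); transitivity (x * y * gam b * - (k.+1%:R * be p)); [ring|rewrite xy; ring].
rewrite (eq_bigr _ h2) -scaler_sumr sum_inner_Lo uo_mups uo_mup uo_Lo.
rewrite (_ : (k.+2 - 2)%N = k); last by lia.
have bK : be p * (be p)^-1 = 1 by rewrite divff.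
rewrite scalerBr !scalerDr !scalerA.
have -> : - (k.+1%:R * be p) * (2 / be p) = - (k.+1%:R * 2).
  by transitivity (- (k.+1%:R * 2) * (be p * (be p)^-1)); [ring|rewrite bK mulr1].
rewrite [k.+2%:R]mulrSr [k.+1%:R]mulrSr expr2; lmod.
Qed.

(* These coefficients solve the recursion on t given by [Qo_uo]. *)
Definition qc (d t i : nat) : K := 2 ^+ t * be p ^+ (2 * t - i) * (-1) ^+ i * 'C(t, i)%:R
  * (d ^_ (2 * t - i))%:R * \prod_(j < i) (d%:R - t%:R - rho - 1 + j%:R).

Lemma iter_Qo d t : iter t Qo (xp ps d) =
  \sum_(i < t.+1) qc d t i *: uo (d - (2 * t - i)) i (t - i).
Proof.
elim: t => [|t IH].
  rewrite big_ord1 /qc /= muln0 bin0 big_ord0 !expr0 ffactn0 subn0.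
  by rewrite /uo /= subn0; lmod.
rewrite iterS IH.
have QoS (I : finType) (F : I -> V) : Qo (\sum_i F i) = \sum_i Qo (F i).
  rewrite /Qo exchange_big /=; apply: eq_bigr => b _.
  by rewrite !Fo_sum scaler_sumr.
have QoZ k f : Qo (k *: f) = k *: Qo f.
  by rewrite /Qo scaler_sumr; apply: eq_bigr => b _; rewrite !FoZ; lmod.
rewrite QoS.
pose A (i : nat) : K := 2 * be p ^+ 2 * (2 ^+ t * be p ^+ (2 * t - i) * (-1) ^+ i * 'C(t, i)%:R
  * (d ^_ (2 * t - i).+2)%:R * \prod_(j < i) (d%:R - t%:R - rho - 1 + j%:R)).
pose B (i : nat) : K := - 2 * be p * (d%:R - (2 * t)%:R + i%:R - rho - 2) * (2 ^+ t * be p ^+ (2 * t - i) * (-1) ^+ i * 'C(t, i)%:R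
  * (d ^_ (2 * t - i).+1)%:R * \prod_(j < i) (d%:R - t%:R - rho - 1 + j%:R)).
have step (i : 'I_t.+1) : Qo (qc d t i *: uo (d - (2 * t - i)) i (t - i)) =
   A i *: uo (d - (2 * t.+1 - i)) i (t.+1 - i) + B i *: uo (d - (2 * t.+1 - i.+1)) i.+1 (t.+1 - i.+1).
  have it : (i <= t)%N by rewrite -ltnS.
  rewrite QoZ Qo_uo.
  rewrite (_ : (d - (2 * t - i) - 2)%N = (d - (2 * t.+1 - i))%N); last by lia.
  rewrite (_ : (d - (2 * t - i) - 1)%N = (d - (2 * t.+1 - i.+1))%N); last by lia.
  rewrite (_ : (t - i).+1 = (t.+1 - i)%N); last by lia.
  rewrite (_ : (t.+1 - i.+1)%N = (t - i)%N); last by lia.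
  rewrite scalerBr !scalerA -scaleNr; congr (_ *: _ + _ *: _).
    rewrite /qc /A [(_ ^_ _.+2)]ffactnSr [(_ ^_ _.+1)]ffactnSr !natrM.
    have [h|h] := leqP d (2 * t - i).
      by rewrite (_ : (d - (2 * t - i))%N = 0%N) ?mulr0 ?mul0r ?mulr0 //; [ring|lia].
    rewrite (_ : (d - (2 * t - i).+1)%:R = (d - (2 * t - i))%:R - 1 :> K); first by ring.
    by rewrite -[1]/(1%:R) -natrB; [congr _%:R|]; lia.
  rewrite /qc /B [(_ ^_ _.+1)]ffactnSr [(d ^_ _ * _)%:R]natrM.
  have [h|h] := leqP d (2 * t - i).
    by rewrite (_ : (d - (2 * t - i))%N = 0%N) ?mulr0 ?mul0r ?mulr0 //; [ring|lia].
  have -> : d%:R - (2 * t)%:R + i%:R = (d - (2 * t - i))%:R :> K.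
    by rewrite natrB 1?ltnW // natrB; [ring|lia].
  by ring.
rewrite (eq_bigr _ (fun i _ => step i)) big_split /=.
rewrite [RHS]big_ord_recl [X in X + _]big_ord_recl -addrA; congr (_ + _).
  rewrite /A /qc !big_ord0 !bin0 !subn0 !expr0 /=; congr (_ *: _).
  rewrite (_ : (2 * t.+1)%N = (2 * t).+2) //; last by lia.
  have aux (n : nat) (x : K) : 2 * be p ^+ 2 * (2 ^+ t * be p ^+ n * 1 * 1 * x * 1) =
      2 ^+ t.+1 * be p ^+ n.+2 * 1 * 1 * x * 1.
    by rewrite [2 ^+ t.+1]exprS [be p ^+ n.+2]exprS [be p ^+ n.+1]exprS; move: (2 ^+ t) => y; ring.
  exact: aux.
have -> : \sum_(i < t) A (lift ord0 i) *: uo (d - (2 * t.+1 - lift ord0 i)) (lift ord0 i) (t.+1 - lift ord0 i) =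
   \sum_(i < t.+1) A (lift ord0 i) *: uo (d - (2 * t.+1 - lift ord0 i)) (lift ord0 i) (t.+1 - lift ord0 i).
  rewrite [RHS]big_ord_recr /= [A _](_ : _ = 0) ?scale0r ?addr0 //.
  by rewrite /A /bump /= bin_small ?mulr0 ?mul0r ?mulr0 // add1n.
rewrite -big_split /=; apply: eq_bigr => i _; rewrite /bump /= add1n -scalerDl; congr (_ *: _).
have it : (i <= t)%N by rewrite -ltnS.
(* Together with Pascal's rule this identity reduces the sum of the two contributions, from i and
   from i + 1, to the closed form [qc]. *)
have hb : (t%:R - i%:R) * 'C(t, i)%:R = i.+1%:R * 'C(t, i.+1)%:R :> K.
  by rewrite -natrB // -!natrM mul_bin_left.
rewrite /A /B /qc binS natrD.
(* The case i = t is separate: there C(t, i + 1) vanishes, and 2t - (i + 1) would be truncated for t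
   = 0. *)
have [ti|ti] := eqVneq (i : nat) t.
  have c0 : 'C(t, t.+1)%:R = 0 :> K by rewrite bin_small.
  rewrite ti c0 binn (_ : (2 * t.+1 - t.+1)%N = (2 * t - t).+1); last by lia.
  rewrite [in RHS]big_ord_recl /= [in RHS](eq_bigr (fun j : 'I_t => d%:R - t%:R - rho - 1 + j%:R)); last first.
    by move=> j _; rewrite /bump /= add1n [t.+1%:R]mulrSr [j.+1%:R]mulrSr; ring.
  rewrite [2 ^+ t.+1]exprS [be p ^+ (2 * t - t).+1]exprS [(-1) ^+ t.+1]exprS [t.+1%:R]mulrSr natrM.
  move: (2 ^+ t) (be p ^+ (2 * t - t)) ((-1) ^+ t) ((d ^_ (2 * t - t).+1)%:R : K) (\prod_(j < t) _) => y1 y2 y3 y4 y5.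
  by move: (be p ^+ (2 * t - t.+1)) (\prod_(j < t.+1) _) ((d ^_ (2 * t - t.+1).+2)%:R : K) => z1 z2 z3; ring.
have e1 : (2 * t - i = (2 * t - i.+1).+1)%N by lia.
rewrite (_ : (2 * t.+1 - i.+1)%N = (2 * t - i.+1).+2); last by lia.
rewrite e1 [in RHS]big_ord_recl /= [X in _ = _ * (_ * X)](eq_bigr (fun j : 'I_i => d%:R - t%:R - rho - 1 + j%:R)); last first.
  by move=> j _; rewrite /bump /= add1n [t.+1%:R]mulrSr [j.+1%:R]mulrSr; ring.
rewrite [\prod_(j < i.+1) _]big_ord_recr /= natrM.
rewrite [2 ^+ t.+1]exprS [be p ^+ (2 * t - i.+1).+2]exprS [be p ^+ (2 * t - i.+1).+1]exprS [(-1) ^+ i.+1]exprS [t.+1%:R]mulrSr.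
move: (\prod_(j < i) _) hb => pr; move: ('C(t, i)%:R : K) ('C(t, i.+1)%:R : K) => x y hb.
have hb' : t%:R * x = i.+1%:R * y + i%:R * x by rewrite -hb; ring.
rewrite [i.+1%:R]mulrSr in hb'.
move: (2 ^+ t) (be p ^+ (2 * t - i.+1)) ((-1) ^+ i) ((d ^_ (2 * t - i.+1).+2)%:R : K) => y1 y2 y3 y4.
by ring: hb'.
Qed.
End Isotropic.
End Singular.

(** * Irreducibility by duality *)

Section Irreducibility.
Variables (K : numFieldType) (D : nat) (V : lmodType K) (X : fock D V).
Implicit Types (a b c e : 'I_D) (f g h u v : V) (k : K).

Local Notation "a ^s" := (st X a) (at level 2, format "a ^s").
Local Notation be := (bet X).
Local Notation Lo := (Lo X).
Local Notation Lap := (Lap X).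
Local Notation rho := (rho X).
Local Notation Sdg := (Sdg X).
Local Notation sf := (sf X).

Local Notation T0 := (T0 X).
Local Notation lam := (lam X).
Local Notation Hd := (Hd X).
Local Notation Ad := (Ad X).
Local Notation smod := (smod X).
Local Notation xp := (xp X).
Local Notation regular := (regular X).

Section OneVector.
Variable p : 'I_D.
Hypotheses (hp : par X p = false) (hpp : p^s != p).
Local Notation ps := (p^s).
Local Notation Qo := (Qo X p).
Local Notation Wt := (Wt X p).

Lemma iter_Qo_mem M t u : smod M -> M u -> M (iter t Qo u).
Proof. by move=> hM Mu; elim: t => //= t IH; apply: smod_Qo. Qed.

(** After d applications of [Qo] the falling factorial kills every term but i = d, which is x_p^d
    times a nonzero scalar and the product of the j - rho - 1 for j < d. *)
Lemma xp_swap M (d : nat) : smod M -> (forall j : nat, (j < d)%N -> j%:R != rho + 1) ->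
  M (xp ps d) -> M (xp p d).
Proof.
move=> hM hj /(iter_Qo_mem d hM); rewrite (iter_Qo hp hpp) big_ord_recr /= big1 ?add0r; last first.
  move=> i _; rewrite /qc ffact_small ?mulr0 ?mul0r ?scale0r //.
  by have := ltn_ord i; lia.
rewrite mulnC -[(d * 2 - d)%N]/(_) (_ : (d * 2 - d)%N = d); last by lia.
rewrite !subnn => h; suff : M (xp p d) by []; apply: (subsp_cancel (smod_sub hM) _ h).
have -> : qc X p d d d = 2 ^+ d * be p ^+ d * (-1) ^+ d * d`!%:R *
    \prod_(j < d) (d%:R - d%:R - rho - 1 + j%:R).
  by rewrite /qc (_ : (2 * d - d)%N = d) ?binn ?ffactnn ?mulr1 //; lia.
have Hp : \prod_(j < d) (d%:R - d%:R - rho - 1 + j%:R) != 0.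
  rewrite prodf_seq_neq0; apply/allP => j _ /=.
  have := hj j (ltn_ord j); apply: contra => /eqP h0; rewrite -subr_eq0 -h0; apply/eqP; ring.
by rewrite !mulf_neq0 ?expf_neq0 ?pnatr_eq0 ?oppr_eq0 ?oner_eq0 ?bet_neq0 // -lt0n fact_gt0.
Qed.

(** With s = f0 - N + 1 applications in degree d = f0 + 2, the factor d - s - rho - 1 in [qc] is 0,
    so only the term i = 0 remains: a nonzero multiple of omega^s x_ps^(d - 2s). *)
Lemma xp_to_low M (N f0 : nat) : rho = N%:R -> (N <= f0 <= 2 * N)%N -> smod M ->
  M (xp ps f0.+2) -> M (iter (f0 - N).+1 Lo (xp ps (f0 - 2 * (f0 - N)))).
Proof.
move=> hN hf hM /(iter_Qo_mem (f0 - N).+1 hM); rewrite (iter_Qo hp hpp) big_ord_recl /=.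
rewrite [X in _ + X]big1 ?addr0; last first.
  move=> i _; rewrite /qc big_ord_recl /= hN (_ : f0.+2%:R - (f0 - N).+1%:R - N%:R - 1 + 0%:R = 0).
    by rewrite mul0r mulr0 scale0r.
  rewrite (_ : f0.+2%:R = (f0 - N).+1%:R + N%:R + 1 :> K) ?mulr0n; first by ring.
  by rewrite -natrD -[1]/(1%:R) -natrD; congr _%:R; lia.
rewrite !subn0 (_ : (f0.+2 - 2 * (f0 - N).+1)%N = (f0 - 2 * (f0 - N))%N) => [h|]; last by lia.
apply: (subsp_cancel (smod_sub hM) _ h).
have : f0.+2 ^_ (2 * (f0 - N).+1 - 0) != 0%N by rewrite -lt0n ffact_gt0; lia.
by move=> hff; rewrite /qc big_ord0 bin0 !mulf_neq0 ?expf_neq0 ?pnatr_eq0 ?oppr_eq0 ?oner_eq0 ?bet_neq0.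
Qed.

(** By [singular0], M contains some omega^j x_p^(d - 2j); in a regular degree its Laplacian is
    nonzero unless j = 0. *)
Lemma harmonic_sing M (d : nat) w u : regular d -> smod M -> (forall v, M v -> Hd d v) ->
  M u -> u <> 0 -> Wt w u -> inner X p \/ 0 <= w -> M (xp p d).
Proof.
move=> rg hM MH Mu u0 uw cond.
have MS v : M v -> Sdg d v by move=> /MH[].
have [j jd Mj] := singular0 hp hpp hM MS Mu u0 uw cond.
case: j jd Mj => [|j] jd Mj; first by move: Mj; rewrite muln0 subn0.
have [_] := MH _ Mj; rewrite (Lap_iter_H _ (Hd_xp hp hpp _)) => /eqP.
rewrite scaler_eq0 mulf_eq0 pnatr_eq0 /= => /orP[|/eqP h]; last by case: (iter_xp_neq0 hp hpp h).
have := rg j.+1; rewrite (_ : (1 <= j.+1 <= d./2)%N); last by lia.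
move=> /(_ isT); rewrite subr_eq0 -natrD (_ : (d - 2 * j.+1 + j)%N = (d - 1 - j.+1)%N) => [/negPf->//|]; lia.
Qed.
End OneVector.

Section Main.
Variable p : 'I_D.
Hypotheses (hp : par X p = false) (hpp : p^s != p).
Local Notation ps := (p^s).

Let hps : par X ps = false. Proof. by rewrite par_st. Qed.
Let hpps : ps^s != ps. Proof. by rewrite stK eq_sym. Qed.

Lemma wo_ps f : wtop X ps f = - wtop X p f.
Proof. by rewrite !woE stK opprB. Qed.

Lemma Wt_ps w f : Wt X p w f -> Wt X ps (- w) f.
Proof. by rewrite /Wt wo_ps => ->; rewrite intrN; lmod. Qed.

Lemma inner_ps : inner X p -> inner X ps.
Proof. by move=> [c hc /andP[c1 c2]]; exists c => //; rewrite stK c2. Qed.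

Lemma zero_subsp : subsp (fun v : V => v = 0).
Proof. by split=> // k _ _ -> ->; lmod. Qed.

(** With an inner even index both powers come from [harmonic_sing] directly. Otherwise the sign of
    the weight decides which of p, ps can be used, and [xp_swap] supplies the other power. *)
Lemma both_xp M (d : nat) u : inner X p \/ (forall j : nat, (j < d)%N -> j%:R != rho + 1) ->
  regular d -> smod M -> (forall v, M v -> Hd d v) -> M u -> u <> 0 -> M (xp p d) /\ M (xp ps d).
Proof.
move=> cond rg hM MH Mu u0.
have MS v : M v -> Sdg d v by move=> /MH[].
have [u' [w [Mu' nu' uw']]] := weight_vec hp hpp hM zero_subsp MS Mu u0.
case: cond => [inn|hj].
  split; first by apply: (harmonic_sing hp hpp rg hM MH Mu' nu' uw'); left.
  by apply: (harmonic_sing hps hpps rg hM MH Mu' nu' (Wt_ps uw')); left; apply: inner_ps.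
have [w0|w0] := leP 0 w.
  have h : M (xp p d) by apply: (harmonic_sing hp hpp rg hM MH Mu' nu' uw'); right.
  by split=> //; apply: (xp_swap hps hpps hM hj); rewrite stK.
have h : M (xp ps d).
  by apply: (harmonic_sing hps hpps rg hM MH Mu' nu' (Wt_ps uw')); right; lia.
by split=> //; apply: (xp_swap hp hpp hM hj).
Qed.

(** In a regular degree S^d is H_d + L S^(d-2), and the second term is orthogonal to H_d; hence a
    separating vector may be replaced by its harmonic part. *)
Lemma regular_sep M (d : nat) h : regular d -> smod M -> (forall v, M v -> Hd d v) -> Hd d h -> ~ M h ->
  exists g, [/\ Hd d g, forall v, M v -> sf v g = 0 & sf h g != 0].
Proof.
move=> rg hM MH hh nMh.
have MS v : M v -> Sdg d v by move=> /MH[].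
have [g [gd gM gh]] := separL (smod_sub hM) MS hh.1 nMh.
case: d rg MH hh MS gd => [|[|d]] rg MH hh MS gd.
- by exists g; split=> //; split=> //; apply: Lap_low gd.
- by exists g; split=> //; split=> //; apply: Lap_low gd.
have [g0 [g1 [hg0 g1d gE]]] := split_regular rg gd.
exists g0; split=> // [v Mv|].
  by have := gM v Mv; rewrite gE sfDr -sf_Lap (MH _ Mv).2 sf0l addr0.
by move: gh; rewrite gE sfDr -sf_Lap hh.2 sf0l addr0.
Qed.

(* Irreducibility by duality: if M were proper, its orthogonal in H_d would be  *)
(* a nonzero submodule, and x_p^d, x_p*^d would be orthogonal.                  *)
Lemma Hd_irr M (d : nat) u : inner X p \/ (forall j : nat, (j < d)%N -> j%:R != rho + 1) ->
  regular d -> smod M -> (forall v, M v -> Hd d v) -> M u -> u <> 0 -> forall h, Hd d h -> M h.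
Proof.
move=> cond rg hM MH Mu u0 h hh; apply: contrapT => nMh.
have [g0 [hg0 g0M g0h]] := regular_sep rg hM MH hh nMh.
have hM' := smod_perp hM (smod_Hd X d).
have g00 : g0 <> 0 by move=> g00; move: g0h; rewrite g00 sf0r eqxx.
have [||[_ h1] _] := both_xp (M := fun v => Hd d v /\ forall u, M u -> sf u v = 0) cond rg hM' _ _ g00.
- by move=> v [].
- by split.
have [_ h2] := both_xp cond rg hM MH Mu u0.
by have := sf_xp d hp; rewrite h1 // eqxx.
Qed.

Section Critical.
Variables (N f0 : nat).
Hypotheses (hN : rho = N%:R) (hf : (N <= f0 <= 2 * N)%N).
Local Notation t := (f0 - N)%N.
Local Notation e := (f0 - 2 * t)%N.
Local Notation LsH := (fun u => exists2 h, Hd e h & u = iter t.+1 Lo h).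

Lemma smod_LsH : smod LsH.
Proof. by apply: smod_iter; apply: smod_Hd. Qed.

Lemma low_cond : forall j : nat, (j < e)%N -> j%:R != rho + 1.
Proof. by move=> j je; rewrite hN -[1]/(1%:R) -natrD eqr_nat; lia. Qed.

Lemma low_regular : regular e. Proof. by apply: (regular_low hp hpp hN hf); lia. Qed.

Lemma LsH_min M v : smod M -> Hd e v -> v <> 0 -> M (iter t.+1 Lo v) -> forall u, LsH u -> M u.
Proof.
move=> hM hv v0 Mv u [h hh ->].
have h1 := smod_preiter t.+1 hM (smod_Hd X e).
by have [||] := Hd_irr (M := fun u => Hd e u /\ M (iter t.+1 Lo u)) (u := v) (or_intror low_cond) low_regular h1 _ _ v0 hh => // w [].
Qed.

Lemma LsH_Hd u : LsH u -> Hd f0.+2 u.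
Proof. by move=> [h hh ->]; apply: (crit_top hp hpp hN hf). Qed.

Lemma Hd_Ad u : Hd f0.+2 u -> Ad f0.+2 u.
Proof. by move=> [h1 h2]; split=> //; rewrite h2 Lo0 Lap0. Qed.

(** On A_d the square of LΩ is 0, so a vector omega^j x^(d - 2j) in M has lam d j = 0, that is, j =
    0 or j = s. From j = 0 the raising operator of the dual index leads to j = s by [xp_to_low]. *)
Lemma socle_step (p' : 'I_D) w M u : par X p' = false -> p'^s != p' -> smod M ->
  (forall v, M v -> Ad f0.+2 v) -> M u -> u <> 0 -> Wt X p' w u -> 0 <= w -> forall v, LsH v -> M v.
Proof.
move=> hp' hpp' hM MA Mu u0 uw w0.
have MS v : M v -> Sdg f0.+2 v by move=> /MA[].
have [j jd Mj] := singular0 hp' hpp' hM MS Mu u0 uw (or_intror w0).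
have hMlow : M (iter t.+1 Lo (xp p' e)).
  have : j = 0%N \/ j = t.+1.
    have [_ h0] := MA _ Mj.
    have : T0 (T0 (iter j Lo (xp p' (f0.+2 - 2 * j)))) = 0 by rewrite !T0E h0 Lo0.
    move: (T0_xp hp' hpp' jd); set y := iter j Lo _ => hT.
    have -> : T0 (T0 y) = (lam f0.+2 j * lam f0.+2 j) *: y.
      by rewrite -scalerA; apply: (etrans (congr1 T0 hT)); rewrite linearZ /=; congr (_ *: _).
    move=> /eqP.
    rewrite scaler_eq0 => /orP[|/eqP h]; last by case: (iter_xp_neq0 hp' hpp' h).
    rewrite mulf_eq0 orbb /lam mulf_eq0 pnatr_eq0 => /orP[/eqP|]; first by left.
    rewrite hN -natrB; last by lia.
    rewrite -addrA -opprD -[1 + _]/(1%:R + N%:R) -natrD subr_eq0 eqr_nat => /eqP h; right.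
    by move: jd h {hT}; rewrite {y}; clear -hf; lia.
  case=> jE; last by move: Mj; rewrite jE (_ : (f0.+2 - 2 * t.+1)%N = e) //; lia.
  have h : M (xp p' f0.+2) by move: Mj; rewrite jE muln0 subn0.
  have := @xp_to_low p'^s _ _ M N f0 hN hf hM; rewrite stK par_st hp'; apply=> //.
  by rewrite eq_sym.
apply: (LsH_min hM _ _ hMlow); first exact: Hd_xp.
exact: xp_neq0.
Qed.

(** A weight vector has nonnegative weight for p or for ps, so this covers m = 2 as well. *)
Lemma socle_min M u : smod M -> (forall v, M v -> Ad f0.+2 v) -> M u -> u <> 0 ->
  forall v, LsH v -> M v.
Proof.
move=> hM MA Mu u0.
have MS v : M v -> Sdg f0.+2 v by move=> /MA[].
have [u' [w [Mu' nu' uw']]] := weight_vec hp hpp hM zero_subsp MS Mu u0.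
have [w0|w0] := leP 0 w; first exact: (socle_step hp hpp hM MA Mu' nu' uw').
by apply: (socle_step hps hpps hM MA Mu' nu' (Wt_ps uw')); lia.
Qed.

(** Testing g against L^(t+1) h' means testing Ωg = L^t h against L^t h'. By [crit_pair] this is a
    nonzero multiple of the pairing of h' with h, which is nondegenerate on H_e. *)
Lemma perp_LsH g : Ad f0.+2 g -> (forall v, LsH v -> sf v g = 0) -> Hd f0.+2 g.
Proof.
move=> hg h0; have [h hh hL] := crit_ALap hp hpp hN hf hg; split; first by case: hg.
rewrite hL (_ : h = 0) ?iter_Lo0 //.
apply: (Hd_nd low_regular hh) => h' hh'.
have [c c0 hc] := crit_pair hp hpp hN hf hh' hh.
apply/eqP; have : sf (iter t.+1 Lo h') g = 0 by apply: h0; exists h'.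
by rewrite iterS sf_Lo hL hc => /eqP; rewrite mulf_eq0 (negPf c0).
Qed.

Lemma perp_LsH_l g : Ad f0.+2 g -> (forall v, LsH v -> sf g v = 0) -> Hd f0.+2 g.
Proof.
move=> hg h0; have [h hh hL] := crit_ALap hp hpp hN hf hg; split; first by case: hg.
rewrite hL (_ : h = 0) ?iter_Lo0 //.
apply: (Hd_ndl low_regular hh) => h' hh'.
have [c c0 hc] := crit_pair hp hpp hN hf hh hh'.
apply/eqP; have : sf g (iter t.+1 Lo h') = 0 by apply: h0; exists h'.
by rewrite iterS -sf_Lap hL hc => /eqP; rewrite mulf_eq0 (negPf c0).
Qed.

Lemma LsH_perp_Hd v h : LsH v -> Hd f0.+2 h -> sf h v = 0 /\ sf v h = 0.
Proof.
by move=> [x hx ->] hh; rewrite iterS -sf_Lap hh.2 sf_Lo hh.2 sf0l sf0r.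
Qed.

Lemma Ad_sep M x : smod M -> (forall v, M v -> Ad f0.+2 v) -> Ad f0.+2 x -> ~ M x ->
  exists g, [/\ Ad f0.+2 g, forall v, M v -> sf v g = 0 & sf x g != 0].
Proof.
move=> hM MA hx nx; have MS v : M v -> Sdg f0.+2 v by move=> /MA[].
have [g [gd gM gx]] := separL (smod_sub hM) MS hx.1 nx.
have [a [w [ha hw gE]]] := crit_Asplit hp hpp hN hf gd.
exists a; split=> // [v Mv|].
  by have := gM v Mv; rewrite gE sfDr (crit_perp_r (MA _ Mv) hw) addr0.
by move: gx; rewrite gE sfDr (crit_perp_r hx hw) addr0.
Qed.

(** The orthogonal of a proper submodule M in A_d is nonzero, so it contains L^s H_e by [socle_min];
    and what is orthogonal to L^s H_e is harmonic. *)
Lemma head_max M x : smod M -> (forall v, M v -> Ad f0.+2 v) -> Ad f0.+2 x -> ~ M x ->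
  forall v, M v -> Hd f0.+2 v.
Proof.
move=> hM MA hx nx v Mv; have [g [hg gM gx]] := Ad_sep hM MA hx nx.
apply: perp_LsH_l; first exact: MA.
have hM' := smod_perp hM (smod_Ad X f0.+2).
move=> y hy; have [|||_] := socle_min (M := fun v => Ad f0.+2 v /\ forall u, M u -> sf u v = 0) (u := g) hM' _ _ _ hy.
- by move=> z [].
- by split.
- by move=> g0; move: gx; rewrite g0 sf0r eqxx.
by apply.
Qed.

(** Raising modulo L^s H_e gives a vector to which [singular] applies. Divisibility by omega^s would
    put a harmonic vector into L^s H_e, and among the omega^j x^(d - 2j) with j < s only j = 0 is
    harmonic. *)
Lemma quot_sing (p' : 'I_D) w M u : par X p' = false -> p'^s != p' -> smod M ->
  (forall v, M v -> Hd f0.+2 v) -> M u -> ~ LsH u -> Wt X p' w u -> inner X p' \/ 0 <= w -> M (xp p' f0.+2).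
Proof.
move=> hp' hpp' hM MH Mu nu uw cond.
have MS v : M v -> Sdg f0.+2 v by move=> /MH[].
have [u' [w' [Mu' nu' uw' ww' hF]]] := raise hp' hpp' hM (smod_sub smod_LsH) MS Mu nu uw.
have cond' : inner X p' \/ 0 <= w' by case: cond; [left|right; lia].
have [|[g [sd gd] ug]|[j [k [js jd uk]]]] := singular hp' hpp' (s := t.+1) cond' (MS _ Mu') uw'.
- by move=> b b1 b2; have [h _ ->] := hF b b1 b2; exists h.
- case: nu'; exists g => //.
  have ed : (f0.+2 - 2 * t.+1)%N = e by lia.
  rewrite ed in gd; split=> //.
  have [_] := MH _ Mu'; rewrite ug (Lap_iter_Lo _ gd) hN.
  (* Because e + t = N the Laplacian of L^s g is L^s (Ωg), so g itself is harmonic. *)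
  rewrite (_ : (e%:R + t%:R - N%:R : K) = 0) ?mulr0 ?scale0r ?addr0; last first.
    by rewrite -natrD -natrB; [rewrite (_ : (e + t - N)%N = 0%N) //|]; lia.
  by move=> h; apply: (iter_Lo_inj hp hpp (n := t.+1)); rewrite h iter_Lo0.
have k0 : k != 0.
  by apply: contra_notN nu' => /eqP k0; rewrite uk k0 scale0r; exists 0; rewrite ?iter_Lo0 //; apply: subsp0 (Hd_subsp X e).
have Mj : M (iter j Lo (xp p' (f0.+2 - 2 * j))).
  by apply: (@subsp_cancel _ _ M (smod_sub hM) k) => //; rewrite -uk.
case: j js jd Mj {uk} => [|j] js jd Mj; first by move: Mj; rewrite muln0 subn0.
have [_] := MH _ Mj; rewrite (Lap_iter_H _ (Hd_xp hp' hpp' _)) => /eqP.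
rewrite scaler_eq0 mulf_eq0 pnatr_eq0 /= => /orP[|/eqP h]; last by case: (iter_xp_neq0 hp' hpp' h).
by rewrite hN -natrD subr_eq0 eqr_nat => /eqP; lia.
Qed.

Lemma Hd_sep M x : smod M -> (forall v, LsH v -> M v) -> (forall v, M v -> Hd f0.+2 v) -> Hd f0.+2 x -> ~ M x ->
  exists g, [/\ Hd f0.+2 g, ~ LsH g, forall v, M v -> sf v g = 0 & sf x g != 0].
Proof.
move=> hM LM MH hx nx.
have MA v : M v -> Ad f0.+2 v by move=> /MH/Hd_Ad.
have [g [hg gM gx]] := Ad_sep hM MA (Hd_Ad hx) nx.
exists g; split=> //; first by apply: perp_LsH => // v /LM/gM.
by move=> hL; move: gx; rewrite (LsH_perp_Hd hL hx).1 eqxx.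
Qed.

Lemma quot_irr M u : inner X p -> smod M -> (forall v, LsH v -> M v) -> (forall v, M v -> Hd f0.+2 v) ->
  M u -> ~ LsH u -> forall h, Hd f0.+2 h -> M h.
Proof.
move=> inn hM LM MH Mu nu h hh; apply: contrapT => nMh.
have getx p' : par X p' = false -> p'^s != p' -> inner X p' -> forall M' v, smod M' ->
   (forall v, M' v -> Hd f0.+2 v) -> M' v -> ~ LsH v -> M' (xp p' f0.+2).
  move=> hp' hpp' inn' M' v hM' MH' Mv nv.
  have MS y : M' y -> Sdg f0.+2 y by move=> /MH'[].
  have [u' [w [Mu' nu' uw']]] := weight_vec hp' hpp' hM' (smod_sub smod_LsH) MS Mv nv.
  by apply: (quot_sing hp' hpp' hM' MH' Mu' nu' uw'); left.
have [g [hg ng gM gh]] := Hd_sep hM LM MH hh nMh.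
have hM' := smod_perp hM (smod_Hd X f0.+2).
have [||_ h1] := getx p hp hpp inn (fun v => Hd f0.+2 v /\ forall u, M u -> sf u v = 0) g hM' _ _ ng.
- by move=> v [].
- by split.
have h2 := getx ps hps hpps (inner_ps inn) M u hM MH Mu nu.
by have := sf_xp f0.+2 hp; rewrite h1 // eqxx.
Qed.
End Critical.
End Main.
End Irreducibility.

(** * The case m = 2 *)

Section TwoEven.
Variables (K : numFieldType) (D : nat) (V : lmodType K) (X : fock D V).
Implicit Types (a b c e : 'I_D) (f g h u v : V) (k : K).

Local Notation mu := (mul X).
Local Notation de := (der X).
Local Notation "a ^s" := (st X a) (at level 2, format "a ^s").
Local Notation be := (bet X).
Local Notation P := (par_op X).
Local Notation one := (one X).
Local Notation gam := (gam X).
Local Notation Lo := (Lo X).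
Local Notation Lap := (Lap X).
Local Notation rho := (rho X).
Local Notation wd := (wd X).
Local Notation Sdg := (Sdg X).

Local Notation Hd := (Hd X).

Definition nu a : {linear V -> V} := (mu a \o de a)%FUN.
Lemma nuE a f : nu a f = mu a (de a f). Proof. by []. Qed.

Lemma nu_wd a s : par X a = false -> nu a (wd s) = (count_mem a s)%:R *: wd s.
Proof.
move=> ha; rewrite nuE; elim: s => [|b s IH] /=; first by rewrite der_one mu0 scale0r.
case: (altP (b =P a)) => [->|ba] /=.
  by rewrite dm_self // muD IH natrD muZ; lmod.
by rewrite dm_evenl 1?eq_sym // mm_even // IH muZ add0n.
Qed.

Lemma mu_odd_mem a s : par X a = true -> a \in s -> mu a (wd s) = 0.
Proof.
move=> ha; elim: s => //= b s IH; rewrite inE; case: (altP (a =P b)) => [<- _|ab /= /IH h].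
  have := mm X a a (wd s); rewrite ksgn_aa ha expr1 scaleN1r => /eqP.
  by rewrite -subr_eq0 opprK -mulr2n -scaler_nat scaler_eq0 pnatr_eq0 => /eqP.
by rewrite mm h mu0 scaler0.
Qed.

Lemma wd_odd_uniq s : all (par X) s -> ~~ uniq s -> wd s = 0.
Proof.
elim: s => //= a s IH /andP[ha hs]; rewrite negb_and negbK => /orP[h|/(IH hs) ->]; last exact: mu0.
exact: mu_odd_mem.
Qed.

Lemma de_mu_inj a f : par X a = false -> de a (mu a f) = 0 -> f = 0.
Proof.
move=> ha h; apply: contrapT => f0.
have [n h1 h2] := @nil_min _ _ _ X a (fun g => g = 0) f erefl f0.
have := iter_de_mu f n ha; rewrite iterSr h h2 mu0 add0r.
have -> : iter n (de a) 0 = 0 by elim: n {h1 h2} => //= j ->; rewrite de0.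
by move/esym/eqP; rewrite scaler_eq0 pnatr_eq0 /= => /eqP.
Qed.

Section P.
Variable p : 'I_D.
Hypotheses (hp : par X p = false) (hpp : p^s != p).
Local Notation ps := (p^s).
Local Notation wo := (wtop X p).
Local Notation Wt := (Wt X p).
Let hps : par X ps = false. Proof. by rewrite par_st. Qed.
Let hpps : p != ps. Proof. by rewrite eq_sym. Qed.
Let b0 : be p != 0. Proof. exact: bet_neq0. Qed.

(** Multiplication by x_p x_ps. A vector of weight 0 is a polynomial in this product with
    coefficients in [Uk], and [nn] counts the factors x_p and x_ps. *)
Definition Yo f := mu p (mu ps f).
Arguments Yo : simpl never.
Fact Yo_linear : linear Yo. Proof. by move=> k f g; rewrite /Yo !linE. Qed.
HB.instance Definition _ := GRing.isLinear.Build K V V _ Yo Yo_linear.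
Lemma YoP k f g : Yo (k *: f + g) = k *: Yo f + Yo g. Proof. exact: linearP. Qed.
Lemma YoD f g : Yo (f + g) = Yo f + Yo g. Proof. exact: linearD. Qed.
Lemma YoE f : Yo f = mu p (mu ps f). Proof. by []. Qed.
Definition nn f := nu p f + nu ps f.

Lemma nnE f : nn f = mu p (de p f) + mu ps (de ps f). Proof. by []. Qed.

Lemma nn_lin k f g : nn (k *: f + g) = k *: nn f + nn g.
Proof. by rewrite !nnE !linE; lmod. Qed.

Lemma nn_Yo f : nn (Yo f) = Yo (nn f) + 2 *: Yo f.
Proof.
rewrite !nnE !YoE !linE dm_self // dm_evenl // [de ps (mu p _)]dm_evenl // dm_self //.
by rewrite !linE ![mu ps (mu p _)](mm_even _ _ hps); lmod.
Qed.

Lemma Lap_Yo f : Lap (Yo f) = Yo (Lap f) + be p *: (f + nn f).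
Proof.
rewrite !YoE !nnE Lap_mul Lap_mul stK bes_be hp expr0 mul1r dm_self // !linE.
by lmod.
Qed.

Lemma wo_Yo f : wo (Yo f) = Yo (wo f).
Proof.
rewrite !YoE !wo_mu // !linE /wt !eqxx (negPf hpps) (negPf hpp) /= sub0r subr0 intrN.
by move: (1%Z%:~R : K) => x; lmod.
Qed.

Lemma Yo_Lo f : Yo (Lo f) = Lo (Yo f).
Proof. by rewrite !YoE !mul_Lo. Qed.

Lemma iter_YoP (k : nat) (c : K) f g : iter k Yo (c *: f + g) = c *: iter k Yo f + iter k Yo g.
Proof. by elim: k => //= k ->; rewrite linearP. Qed.
Lemma iter_Yo0 (k : nat) : iter k Yo 0 = 0.
Proof. by elim: k => //= k ->; rewrite linear0. Qed.
Lemma iter_YoZ (k : nat) (c : K) f : iter k Yo (c *: f) = c *: iter k Yo f.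
Proof. by have := iter_YoP k c f 0; rewrite iter_Yo0 !addr0. Qed.
Lemma iter_YoD (k : nat) f g : iter k Yo (f + g) = iter k Yo f + iter k Yo g.
Proof. by have := iter_YoP k 1 f g; rewrite !scale1r. Qed.

Lemma nn_iter_Yo (k : nat) f : nn (iter k Yo f) = iter k Yo (nn f) + (2 * k%:R) *: iter k Yo f.
Proof.
elim: k => [|k IH]; first by rewrite mulr0 scale0r addr0.
by rewrite iterS nn_Yo IH linearD linearZ -!iterS /= mulrSr; lmod.
Qed.

Lemma Lap_iter_Yo (k : nat) f : Lap (iter k.+1 Yo f) = iter k.+1 Yo (Lap f) +
  (k.+1%:R * be p) *: iter k Yo (k.+1%:R *: f + nn f).
Proof.
elim: k => [|k IH]; first by rewrite [iter 1 _ _]/= Lap_Yo /= mul1r scale1r.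
rewrite iterS Lap_Yo IH linearD linearZ -!iterS nn_iter_Yo [iter k.+1]lock iterS -!lock /=.
rewrite !iter_YoP !linearD !linearZ -!iterS /= [k.+2%:R]mulrSr [2 * _]mulrC; move: (k.+1%:R) => z; lmod.
Qed.

Lemma Sdg_Yo (d : nat) f : Sdg d f -> Sdg d.+2 (Yo f).
Proof. by move=> fd; rewrite YoE; do 2! apply: Sdg_mu. Qed.
Lemma Sdg_iter_Yo (d k : nat) f : Sdg d f -> Sdg (d + 2 * k) (iter k Yo f).
Proof.
move=> fd; elim: k => [|k IH] /=; first by rewrite muln0 addn0.
by rewrite mulnS addnCA add2n; apply: Sdg_Yo.
Qed.

(* Uk is the exterior algebra on the indices other than p and p*. *)
Definition Uk f := de p f = 0 /\ de ps f = 0.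

Lemma Uk_subsp : subsp Uk.
Proof.
split; first by rewrite /Uk !de0.
by move=> k u v [h1 h2] [h3 h4]; rewrite /Uk !linE h1 h2 h3 h4; split; lmod.
Qed.
Lemma Uk_nn f : Uk f -> nn f = 0.
Proof. by move=> [h1 h2]; rewrite nnE h1 h2 !mu0 addr0. Qed.
Lemma Uk_Lap f : Uk f -> Uk (Lap f).
Proof. by move=> [h1 h2]; rewrite /Uk -!Lap_der h1 h2 Lap0. Qed.
Lemma Uk_iter_Lap (k' : nat) f : Uk f -> Uk (iter k' Lap f).
Proof. by move=> h; elim: k' => //= k' IH; apply: Uk_Lap. Qed.
Lemma Uk_wo f : Uk f -> Wt 0 f.
Proof. by move=> [h1 h2]; rewrite /Wt (woE X p) h1 h2 !mu0; lmod. Qed.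
Lemma Yo_Uk0 f : Uk (Yo f) -> f = 0.
Proof. by move=> [/(de_mu_inj hp) h _]; apply: (mu_inj hps h). Qed.
Lemma Yo_inj f : Yo f = 0 -> f = 0.
Proof. by move/(mu_inj hp)/(mu_inj hps). Qed.
Lemma iter_Yo_inj (k' : nat) f : iter k' Yo f = 0 -> f = 0.
Proof. by elim: k' => //= k' IH /Yo_inj. Qed.

Lemma Wt_wd (w : int) s : wts X p s = w -> Wt w (wd s).
Proof. by move=> <-; rewrite /Wt wo_wd. Qed.

Lemma Wt_subsp (w : int) : subsp (Wt w).
Proof.
split; first by rewrite /Wt scaler0 -{1}(scale0r (0 : V)) woZ scale0r.
by move=> k u v; rewrite /Wt woD woZ => -> ->; lmod.
Qed.

(** In a word of weight 0 the letters p and ps occur equally often, so a word containing p can be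
    divided by x_p x_ps. *)
Lemma weight0_split (d : nat) f : Sdg d f -> Wt 0 f -> exists f1 f0, [/\ f = Yo f1 + f0,
  Uk f0, Sdg d f0, Wt 0 f1 & f1 = 0 \/ exists2 d', d = d'.+2 & Sdg d' f1].
Proof.
move=> fd fw; have [l ->] := Wt_words hp hpp fd fw.
elim: l => [|x l [f1 [f0 [IH h1 h2 h3 h4]]]].
  exists 0, 0; rewrite big_nil linear0 addr0; split=> //; first exact: (subsp0 Uk_subsp).
  - exact: Sdg0.
  - exact: (subsp0 (Wt_subsp 0)).
  - by left.
rewrite big_cons; case: ifP => [/andP[/eqP xd /eqP xw]|_]; last by exists f1, f0.
have [px|px] := boolP (p \in x.2).
  have psx : ps \in rem p x.2.
    have : (0 < count_mem p x.2)%N -> wts X p x.2 = 0 -> (0 < count_mem ps x.2)%N by rewrite /wts; lia.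
    by rewrite mem_count count_rem px /= eq_sym (negPf hpp) subn0 -mem_count; apply.
  have xE := wd_rem hp px; rewrite (wd_rem hps psx) -YoE in xE.
  have dE : d = (size (rem ps (rem p x.2))).+2.
    rewrite -xd (perm_size (perm_to_rem px)) /= (perm_size (perm_to_rem psx)) //.
  exists (x.1 *: wd (rem ps (rem p x.2)) + f1), f0; split=> //.
  - by rewrite xE IH linearD linearZ /=; lmod.
  - apply: (subspL (Wt_subsp 0)) => //.
    have : Wt 0 (Yo (wd (rem ps (rem p x.2)))) by rewrite -xE; apply: Wt_wd.
    rewrite /Wt wo_Yo scale0r => /Yo_inj ->; lmod.
  right; exists (size (rem ps (rem p x.2))) => //.
  apply: Sdg_lin; first exact: Eu_wd.
  case: h4 => [->|[d' dE' hd']]; first exact: Sdg0.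
  by have -> : size (rem ps (rem p x.2)) = d' by rewrite dE' in dE; case: dE.
have psx : ps \notin x.2.
  by move: px xw; rewrite !mem_count /wts; lia.
exists f1, (x.1 *: wd x.2 + f0); split=> //; first by rewrite IH; lmod.
  by apply: (subspL Uk_subsp) => //; split; apply: de_wd.
by apply: Sdg_lin => //; rewrite -xd; apply: Eu_wd.
Qed.

Lemma Wt_iter_Yo (w : int) (k : nat) f : Wt w f -> Wt w (iter k Yo f).
Proof. by move=> h; elim: k => //= k IH; rewrite /Wt wo_Yo IH linearZ. Qed.
Lemma Wt_iter_Lo (w : int) (k : nat) f : Wt w f -> Wt w (iter k Lo f).
Proof. by move=> h; elim: k => //= k IH; rewrite /Wt wo_Lo // IH LoZ. Qed.

(** With f = Yo f1 + f0 the equation becomes Yo z = c f0 for a nonzero c. Since f0 does not involve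
    x_p or x_ps, both sides vanish; then f = Yo f1, and the argument repeats with k + 1 in lower
    degree. *)
Lemma harm_Yo0 (k : nat) (d : nat) f : Sdg d f -> Wt 0 f -> Lap (iter k.+1 Yo f) = 0 -> f = 0.
Proof.
have [n] := ubnP d; elim: n k d f => // n IH k d f dn fd fw hL.
have [f1 [f0 [fE h1 h2 h3 h4]]] := weight0_split fd fw.
have [L LE] : exists L, L = Lap f by exists (Lap f).
pose z := L + (k.+1%:R * be p) *: ((k.+1%:R + 2) *: f1 + nn f1).
have key : Yo z = - (k.+1%:R * be p * k.+1%:R) *: f0.
  move: hL; rewrite Lap_iter_Yo -LE iterSr -iter_YoZ -iter_YoD => /iter_Yo_inj h.
  have hn : nn f = Yo (nn f1) + 2 *: Yo f1.
    by rewrite fE -[Yo f1]scale1r nn_lin nn_Yo (Uk_nn h1) !scale1r addr0.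
  apply/eqP; rewrite -subr_eq0 -h hn fE /z linearD linearZ linearD linearZ /=; apply/eqP.
  move: (k.+1%:R) => x; lmod.
have z0 : z = 0 by apply: Yo_Uk0; rewrite key; apply: (subspZ Uk_subsp).
have f00 : f0 = 0.
  move/eqP: key; rewrite z0 linear0 eq_sym scaler_eq0 oppr_eq0 !mulf_eq0 (negPf b0) !pnatr_eq0 /=.
  by move/eqP.
rewrite fE f00 addr0; case: h4 => [->|[d' dE hd']]; first exact: linear0.
suff -> : f1 = 0 by exact: linear0.
apply: (IH k.+1 d' f1) => //; first by lia.
by rewrite iterSr -hL fE f00 addr0.
Qed.

(** The consequence that matters: a harmonic vector of weight 0 is determined by its part free of
    x_p and x_ps. *)
Lemma harm_Yo (d : nat) f z : Hd d f -> Wt 0 f -> f = Yo z -> f = 0.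
Proof.
move=> [fd hL] fw fz; have [f1 [f0 [fE h1 h2 h3 h4]]] := weight0_split fd fw.
have fz0 : f0 = Yo (-1 *: f1 + z) by rewrite YoP -fz fE; lmod.
have f00 : f0 = 0.
  by rewrite fz0 [-1 *: f1 + z]Yo_Uk0 ?linear0 // -fz0.
move: hL; rewrite fE f00 addr0 => hL.
case: h4 => [->|[d' dE hd']]; first exact: linear0.
by rewrite (@harm_Yo0 0 d' f1) ?linear0.
Qed.

Section Dim.
Variable N : nat.
Hypotheses (hN : rho = N%:R) (hev : forall a, a != p -> a != ps -> par X a = true).
Local Notation n := N.+1.

Lemma card_inner : #|[pred b | (b != p) && (b != ps)]| = (2 * n)%N.
Proof.
have := sum_inner_sgn hp hpp; rewrite (eq_bigr (fun _ => -1)); last first.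
  by move=> b /andP[b1 b2]; rewrite hev.
rewrite sumr_const hN => h; apply/eqP; rewrite -(eqr_nat K) natrM [n%:R]mulrSr.
move: h; rewrite mulNrn => h; apply/eqP/oppr_inj; apply: (etrans h); ring.
Qed.

Lemma Uk_bound (d : nat) f : Sdg d f -> Uk f -> (2 * n < d)%N -> f = 0.
Proof.
move=> fd [u1 u2] dn; have [l fl] := (Sdg_words X d f).1 fd.
have c a : par X a = false -> forall s, nu a (wd s) = (count_mem a s)%:R *: wd s.
  by move=> ha s; apply: nu_wd.
have f1 := eigen_words (Q := fun s => size s == d) (t := 0) (c p hp) _ fl.
have f2 := eigen_words (Q := fun s => (size s == d) && ((count_mem p s)%:R == 0 :> K)) (t := 0) (c ps hps) _ (f1 _).
rewrite f2; [|by rewrite nuE u2 mu0 scale0r|by rewrite nuE u1 mu0 scale0r].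
rewrite big1 // => x /andP[/andP[/eqP xd]]; rewrite !pnatr_eq0 => h1 h2.
have hx b : b \in x.2 -> (b != p) && (b != ps).
  by move=> bx; apply/andP; split; apply: contraTneq bx => ->; rewrite mem_count lt0n negbK.
rewrite wd_odd_uniq ?scaler0 //.
  by apply/allP => b /hx/andP[b1 b2]; apply: hev.
apply/negP => /card_uniqP xu; have : (#|x.2| <= #|[pred b | (b != p) && (b != ps)]|)%N.
  by apply/subset_leq_card/subsetP => b /hx.
by rewrite xu card_inner xd leqNgt dn.
Qed.

(** The derivative along p lowers degree and weight by 1 and preserves harmonicity, which reduces to
    w = 0. There the part free of x_p and x_ps vanishes by degree, and it determines f. *)
Lemma harm_weight_pos (d w : nat) f : Hd d f -> Wt w f -> (2 * n + w < d)%N -> f = 0.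
Proof.
elim: w d f => [|w IH] d f [fd hL] fw dw.
  have [f1 [f0 [fE h1 h2 h3 h4]]] := weight0_split fd fw.
  have f00 : f0 = 0 by apply: (Uk_bound h2 h1); lia.
  rewrite fE f00 addr0; case: h4 => [->|[d' dE hd']]; first exact: linear0.
  suff -> : f1 = 0 by exact: linear0.
  by apply: (@harm_Yo0 0 d') => //=; move: hL; rewrite fE f00 addr0.
case: d fd dw => // d fd dw.
have h : de p f = 0.
  apply: (IH d) => //; last by lia.
    by split; [apply: Sdg_de|rewrite Lap_der hL de0].
  rewrite /Wt wo_de // fw linE (wt_p hpp) -addn1 PoszD intrD; lmod.
have [g fE] := Wt_div hp hpp fd fw isT.
by rewrite fE; move: h; rewrite fE => /(de_mu_inj hp) ->; rewrite mu0.
Qed.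

(* multiplication by the odd part of omega *)
Definition sg f := Lo f - (be p)^-1 *: Yo f.
Fact sg_linear : linear sg.
Proof. by move=> k f g; rewrite /sg LoD LoZ linearP; lmod. Qed.
HB.instance Definition _ := GRing.isLinear.Build K V V _ sg sg_linear.

Let gp : gam p = (be p)^-1. Proof. by apply: (mulIf b0); rewrite gambe hp mulVf. Qed.
Let gps : gam ps = (be p)^-1. Proof. by rewrite gam_st hp gp expr0 mul1r. Qed.

Lemma Uk_sg f : Uk f -> Uk (sg f).
Proof.
move=> [h1 h2]; split; rewrite /sg !linE YoE der_Lo ?h1 ?h2 Lo0 ?gp ?gps.
  by rewrite dm_self // dm_evenl // h1 !mu0; lmod.
by rewrite [de ps (mu p _)]dm_evenl // dm_self // h2 stK !mu0 !addr0; lmod.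
Qed.

Lemma Lap_sg (d : nat) f : Uk f -> Sdg d f -> Lap (sg f) = sg (Lap f) + (d%:R - n%:R) *: f.
Proof.
move=> uf fd; rewrite /sg LapD LapN LapZ Lap_Yo (Uk_nn uf) Lap_Lo fd hN addr0 scalerDr scalerA mulVf //.
rewrite [n%:R]mulrSr; lmod.
Qed.

Lemma Sdg_sg (d : nat) f : Sdg d f -> Sdg d.+2 (sg f).
Proof. by move=> fd; apply: SdgB; [apply: Sdg_Lo|apply: SdgZ; apply: Sdg_Yo]. Qed.

Lemma iter_sg (k : nat) (c : K) f g : iter k sg (c *: f + g) = c *: iter k sg f + iter k sg g.
Proof. by elim: k => //= k ->; rewrite linearP. Qed.
Lemma iter_sgZ (k : nat) (c : K) f : iter k sg (c *: f) = c *: iter k sg f.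
Proof. by elim: k => //= k ->; rewrite linearZ. Qed.
Lemma Uk_iter_sg (k : nat) f : Uk f -> Uk (iter k sg f).
Proof. by move=> h; elim: k => //= k IH; apply: Uk_sg. Qed.

Lemma Sdg_iter_Lap (d k : nat) f : Sdg (d + 2 * k) f -> Sdg d (iter k Lap f).
Proof.
elim: k d => [|k IH] d; first by rewrite muln0 addn0.
by move=> h; apply: Sdg_Lap; apply: IH; rewrite (_ : (d.+2 + 2 * k)%N = (d + 2 * k.+1)%N) //; lia.
Qed.

(** On the exterior algebra [sg] and [Lap] generate an sl2 by [Lap_sg]; this is the standard string
    computation from a vector killed by [sg]. *)
Lemma sg_prim (i k : nat) g : Uk g -> Sdg (n + i) g -> sg g = 0 -> (k < i <= n)%N ->
  sg (iter k.+1 Lap g) = - (k.+1%:R * (i%:R - k%:R)) *: iter k Lap g.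
Proof.
move=> ug gd g0; elim: k => [|k IH] /andP[ki ni].
  have := Lap_sg ug gd; rewrite g0 Lap0 /= natrD subr0 mul1r => /esym/eqP.
  by rewrite addr_eq0 => /eqP ->; lmod.
have dk : Sdg (n + i - 2 * k.+1) (iter k.+1 Lap g).
  by apply: Sdg_iter_Lap; rewrite subnK //; lia.
have := Lap_sg (Uk_iter_Lap k.+1 ug) dk; rewrite IH; last by lia.
rewrite LapZ -!iterS => /esym/eqP; rewrite natrB; last by lia.
rewrite addrC -subr_eq0 => /eqP h; apply/eqP; rewrite -subr_eq0 -{}h natrM natrD [k.+2%:R]mulrSr [k.+1%:R]mulrSr.
by apply/eqP; lmod.
Qed.

Lemma sg_string (i k : nat) g : Uk g -> Sdg (n + i) g -> sg g = 0 -> (k <= i <= n)%N ->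
  exists2 c, c != 0 & iter k sg (iter k Lap g) = c *: g.
Proof.
move=> ug gd g0; elim: k => [|k IH] /andP[ki ni]; first by exists 1; rewrite ?oner_eq0 ?scale1r.
have [|c c0 hc] := IH; first by lia.
exists (- (k.+1%:R * (i%:R - k%:R)) * c).
  by rewrite mulf_neq0 // oppr_eq0 mulf_neq0 ?pnatr_eq0 // subr_eq0 eqr_nat; lia.
rewrite iterSr (sg_prim ug gd g0) ?ki //.
by rewrite iter_sgZ hc scalerA.
Qed.

(** Surjectivity in the hard Lefschetz theorem. The image of g under [sg] is treated by induction,
    which corrects g to a vector killed by [sg]; such a vector is recovered from its [Lap]-string by
    [sg_string]. *)
Lemma lefschetz (e : nat) g : (e <= n)%N -> Uk g -> Sdg (2 * n - e) g ->
  exists h, [/\ Uk h, Sdg e h & g = iter (n - e) sg h].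
Proof.
have [m] := ubnP e; elim: m e g => // m IH e g em en ug gd.
(* For e < 2 the degree of [sg g] exceeds 2n, so it is 0. Otherwise [sg g] lies opposite to degree e
   - 2, where the induction hypothesis applies. *)
have [h' [uh' hd' hE']] : exists h', [/\ Uk h', Sdg e h' & sg g = iter (n - e).+1 sg h'].
  have [e2|e2] := ltnP e 2.
    exists 0; split; [exact: (subsp0 Uk_subsp)|exact: Sdg0|].
    have -> : sg g = 0 by apply: (Uk_bound (Sdg_sg gd) (Uk_sg ug)); lia.
    by elim: (_.+1) => //= k <-; rewrite linear0.
  case: e e2 em en gd => [|[|e]] // _ em en gd.
  have gd' : Sdg (2 * n - e) (sg g).
    by have := Sdg_sg gd; rewrite (_ : (2 * n - e.+2).+2 = (2 * n - e)%N) //; lia.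
  have [||h1 [uh1 hd1 E1]] := IH e (sg g) _ _ (Uk_sg ug) gd'; [lia|lia|].
  exists (sg h1); split; [exact: Uk_sg|exact: Sdg_sg|].
  by rewrite E1 -iterSr; congr (iter _ _ _); lia.
pose g' := g - iter (n - e) sg h'.
have ug' : Uk g' by apply: (subspB Uk_subsp) => //; apply: Uk_iter_sg.
have g'0 : sg g' = 0 by rewrite linearB /= hE' -iterS subrr.
have gd' : Sdg (n + (n - e)) g'.
  have -> : (n + (n - e))%N = (2 * n - e)%N by lia.
  apply: SdgB => //; have -> : (2 * n - e)%N = (e + 2 * (n - e))%N by lia.
  by elim: (n - e)%N => [|k IHk] /=; rewrite ?muln0 ?addn0 // mulnS addnCA add2n; apply: Sdg_sg.
have [|c c0 hc] := sg_string (k := (n - e)%N) ug' gd' g'0; first by lia.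
exists (c^-1 *: iter (n - e) Lap g' + h'); split.
- by apply: (subspL Uk_subsp) => //; apply: Uk_iter_Lap.
- by apply: Sdg_lin => //; apply: Sdg_iter_Lap; rewrite (_ : (e + _)%N = (n + (n - e))%N) //; lia.
by rewrite iter_sg hc scalerA mulVf // scale1r subrK.
Qed.

(** The extension is a finite series in the Yo^k Lap^k u: the term for k + 1 cancels the Laplacian
    left by the term for k and leaves one with a further [Lap], until the degree is exhausted. *)
Lemma harm_ext (d : nat) u : Sdg d u -> Uk u -> exists h, [/\ Hd d h, Wt 0 h & exists y, h = u + Yo y].
Proof.
move=> ud uu.
have [f [f1 [y fE] fw f2]] : exists f, [/\ Sdg d f, exists y, f = u + Yo y, Wt 0 f & exists c : K, Lap f = c *: iter d Yo (iter d.+1 Lap u)].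
  suff H (k : nat) : (2 * k <= d)%N -> exists f, [/\ Sdg d f, exists y, f = u + Yo y, Wt 0 f & exists c : K, Lap f = c *: iter k Yo (iter k.+1 Lap u)].
    have [|f [f1 f2 fw [c hc]]] := H d./2; first by lia.
    exists f; split=> //; exists 0; rewrite scale0r hc.
    have -> : iter (d./2).+1 Lap u = 0.
      have h : Sdg (d - 2 * d./2) (iter d./2 Lap u) by apply: Sdg_iter_Lap; rewrite subnK //; lia.
      by rewrite iterS (Lap_low _ h) //; lia.
    by rewrite iter_Yo0 scaler0.
  elim: k => [|k IH] kd.
    by exists u; split=> //; [exists 0; rewrite linear0 addr0|exact: Uk_wo|exists 1; rewrite scale1r].
  have [|f [f1 [y fE] fw [c hc]]] := IH; first by lia.
  pose u' := iter k.+1 Lap u.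
  have uu' : Uk u' by apply: Uk_iter_Lap.
  have k0 : k.+1%:R * be p * k.+1%:R != 0 by rewrite !mulf_neq0 ?pnatr_eq0.
  exists (f - (c / (k.+1%:R * be p * k.+1%:R)) *: iter k.+1 Yo u'); split.
  - apply: SdgB => //; apply: SdgZ.
    have -> : d = (d - 2 * k.+1 + 2 * k.+1)%N by lia.
    by apply: Sdg_iter_Yo; apply: Sdg_iter_Lap; rewrite subnK.
  - by exists (- (c / (k.+1%:R * be p * k.+1%:R)) *: iter k Yo u' + y); rewrite fE YoP iterS; lmod.
  - rewrite addrC -scaleNr; apply: (subspL (Wt_subsp 0)) => //; apply: Wt_iter_Yo; exact: Uk_wo.
  exists (- (c / (k.+1%:R * be p * k.+1%:R))).
  rewrite LapD LapN LapZ hc Lap_iter_Yo (Uk_nn uu') addr0 iter_YoZ -iterS -/u'.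
  set w := c / _; have cw : c = w * (k.+1%:R * be p * k.+1%:R) by rewrite /w mulfVK.
  by clearbody w; rewrite {1}cw; lmod.
exists f; split=> //; last by exists y.
split=> //; case: f2 => c ->.
suff -> : iter d.+1 Lap u = 0 by rewrite iter_Yo0 scaler0.
have H : forall (k d' : nat) v, (d' < 2 * k)%N -> Sdg d' v -> iter k Lap v = 0.
  elim=> [//|k IH] d' v dk vd; rewrite iterSr.
  case: d' dk vd => [|[|d']] dk vd; first 2 last.
  - by apply: (IH d'); [lia|apply: Sdg_Lap].
  - by rewrite (Lap_low _ vd) //; elim: (k) => //= j ->; rewrite Lap0.
  - by rewrite (Lap_low _ vd) //; elim: (k) => //= j ->; rewrite Lap0.
by apply: (H _ d); first lia.
Qed.

Lemma iter_Lo_sg (k : nat) h : exists y, iter k Lo h = iter k sg h + Yo y.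
Proof.
elim: k => [|k [y IH]]; first by exists 0; rewrite linear0 addr0.
exists (Lo y + (be p)^-1 *: iter k sg h); have h2 : Yo (Lo y + (be p)^-1 *: iter k sg h) = Yo (Lo y) + (be p)^-1 *: Yo (iter k sg h).
  by rewrite linearD linearZ.
by rewrite !iterS IH LoD h2 Yo_Lo /sg; lmod.
Qed.

Section Critical.
Variable f0 : nat.
Hypothesis hf : (N <= f0 <= 2 * N)%N.
Local Notation t := (f0 - N)%N.
Local Notation e := (f0 - 2 * t)%N.

(** The part of f free of x_p and x_ps has degree 2n - e, so it is sg^s h0 by [lefschetz]. If h is
    the harmonic extension of h0, then f and L^s h are harmonic of weight 0 with the same such part,
    hence equal. *)
Lemma weight0_LsH f : Hd f0.+2 f -> Wt 0 f -> exists2 h, Hd e h & f = iter t.+1 Lo h.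
Proof.
move=> [fd hL] fw; have [f1 [g [fE h1 h2 h3 h4]]] := weight0_split fd fw.
have [||h0 [uh0 hd0 hE0]] := lefschetz (e := e) _ h1.
- by lia.
- by rewrite (_ : (2 * n - e)%N = f0.+2) //; lia.
have [h [hh hw [y hE]]] := harm_ext hd0 uh0.
have [y' hy'] := iter_Lo_sg t.+1 h0.
have YL (k : nat) z : exists z', iter k Lo (Yo z) = Yo z'.
  by exists (iter k Lo z); elim: k => //= k ->; rewrite Yo_Lo.
have [z hz] := YL t.+1 y.
have ht := crit_top hp hpp hN hf hh.
exists h => //; apply/eqP; rewrite -subr_eq0; apply/eqP.
apply: (@harm_Yo f0.+2 _ (-1 *: (y' + z) + f1)).
- by apply: (subspB (Hd_subsp X _)).
- by apply: (subspB (Wt_subsp 0)) => //; apply: Wt_iter_Lo.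
have ne : (n - e)%N = t.+1 by lia.
by rewrite hE iter_LoD hz hy' fE hE0 ne YoP YoD; lmod.
Qed.
End Critical.
End Dim.
End P.
End TwoEven.

(** * The halves of H_d of positive and negative weight *)

Section Halves.
Variables (K : numFieldType) (D : nat) (V : lmodType K) (X : fock D V).
Implicit Types (a b c e : 'I_D) (f g h u v : V) (k : K).

Local Notation mu := (mul X).
Local Notation de := (der X).
Local Notation "a ^s" := (st X a) (at level 2, format "a ^s").
Local Notation be := (bet X).
Local Notation P := (par_op X).
Local Notation one := (one X).
Local Notation q := (ksgn X).
Local Notation gam := (gam X).
Local Notation Lo := (Lo X).
Local Notation Lap := (Lap X).
Local Notation Fo := (Fo X).
Local Notation rho := (rho X).
Local Notation wd := (wd X).
Local Notation Sdg := (Sdg X).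
Local Notation sf := (sf X).

Local Notation Hd := (Hd X).
Local Notation xp := (xp X).
Local Notation smod := (smod X).

Lemma sf_Wt (p : 'I_D) (w w' : int) f g : par X p = false -> Wt X p w f -> Wt X p w' g -> w + w' != 0 -> sf f g = 0.
Proof.
move=> hp fw gw ww; have := sf_Fo X p p^s f g; rewrite !(Fo_wo hp) par_st addbb /= fw gw !sfE.
move/eqP; rewrite -subr_eq0 opprK -mulrDr -mulrDl -intrD !mulf_eq0 (negPf (bet_neq0 _ _)) intr_eq0 (negPf ww) /=.
by move/eqP.
Qed.

(* The span of Z and of the vectors of positive weight in H_d. *)
Definition Pos Z d (p : 'I_D) v := forall S : V -> Prop, subsp S -> (forall z, Z z -> S z) ->
  (forall (w : int) x, 0 < w -> Hd d x -> Wt X p w x -> S x) -> S v.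

Section Half.
Variables (Z : V -> Prop) (d : nat).
Hypotheses (hZ : smod Z) (ZH : forall z, Z z -> Hd d z)
  (Zperp : forall z h, Z z -> Hd d h -> sf h z = 0 /\ sf z h = 0).
Hypothesis sep : forall M x, smod M -> (forall z, Z z -> M z) -> (forall v, M v -> Hd d v) ->
  Hd d x -> ~ M x -> exists g, [/\ Hd d g, forall v, M v -> sf v g = 0 & sf x g != 0].

Lemma Z_perp x : Hd d x -> (forall g, Hd d g -> sf x g = 0) -> Z x.
Proof.
move=> hx h; apply: contrapT => nZ; have [g [hg _]] := sep hZ (fun z hz => hz) ZH hx nZ.
by rewrite h // eqxx.
Qed.

Section OneSide.
Variable p : 'I_D.
Hypotheses (hp : par X p = false) (hpp : p^s != p).
Local Notation ps := (p^s).
Hypothesis w0Z : forall f, Hd d f -> Wt X p 0 f -> Z f.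
Hypothesis sing : forall p', p' = p \/ p' = ps -> forall M u (w : int), smod M -> (forall v, M v -> Hd d v) ->
  M u -> ~ Z u -> Wt X p' w u -> 0 <= w -> M (xp p' d).
Let hps : par X ps = false. Proof. by rewrite par_st. Qed.
Let hpps : ps^s != ps. Proof. by rewrite stK eq_sym. Qed.

Lemma Pos_subsp q : subsp (Pos Z d q).
Proof.
split=> [S hS _ _|k u v hu hv S hS h1 h2]; first exact: subsp0.
by apply: subspL => //; [apply: hu|apply: hv].
Qed.

Lemma Z_Pos q z : Z z -> Pos Z d q z. Proof. by move=> hz S _ h _; apply: h. Qed.
Lemma Pos_weight q (w : int) x : 0 < w -> Hd d x -> Wt X q w x -> Pos Z d q x.
Proof. by move=> w0 hx xw S _ _ h; apply: (h w). Qed.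
Lemma Pos_Hd q v : Pos Z d q v -> Hd d v.
Proof. by apply=> //; exact: Hd_subsp. Qed.

Lemma Wt_P (w : int) f : Wt X p w f -> Wt X p w (P f).
Proof.
move=> fw; apply: (scalerI (bet_neq0 X p)); rewrite -(Fo_wo hp).
by have := par_Fo X p ps f; rewrite par_st addbb expr0 scale1r => <-; rewrite (Fo_wo hp) fw !PZ.
Qed.

(** The only F_ab lowering the weight by more than 1 has a = b = ps, and it is 0. So a positive
    weight becomes nonnegative, and weight 0 already lies in Z. *)
Lemma smod_Pos : smod (Pos Z d p).
Proof.
case: (hZ) => sZ PZ' FZ; split; first exact: Pos_subsp.
- move=> u /(_ (fun v => Pos Z d p (P v))); apply.
  + split=> [|k v v' h1 h2]; rewrite ?P0; first exact: (subsp0 (Pos_subsp p)).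
    by rewrite PD PZ; apply: (subspL (Pos_subsp p)).
  + by move=> z hz; apply: Z_Pos; apply: PZ'.
  move=> w x wpos hx xw; apply: (Pos_weight wpos); last exact: Wt_P.
  by case: (smod_Hd X d) => _ h _; apply: h.
move=> a b u /(_ (fun v => Pos Z d p (Fo a b v))); apply.
- split=> [|k v v' h1 h2]; rewrite ?Fo0; first exact: (subsp0 (Pos_subsp p)).
  by rewrite FoD FoZ; apply: (subspL (Pos_subsp p)).
- by move=> z hz; apply: Z_Pos; apply: FZ.
move=> w x wpos hx xw.
have [aps|ab] := boolP ((a == ps) && (b == ps)).
  case/andP: aps => /eqP-> /eqP->; rewrite Fo_pp //; exact: (subsp0 (Pos_subsp p)).
have fw : Wt X p (w + (wt X p a + wt X p b)) (Fo a b x).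
  by rewrite /Wt wo_Fo // xw FoZ -scalerDl -intrD.
have hF : Hd d (Fo a b x) by case: (smod_Hd X d) => _ _; apply.
have : 0 <= w + (wt X p a + wt X p b).
  have wb c : - 1 <= wt X p c by rewrite /wt; case: (c == p); case: (c == ps).
  have wb' c : c != ps -> 0 <= wt X p c by move=> /negPf cc; rewrite /wt cc; case: (c == p).
  move: ab; rewrite negb_and => /orP[/wb'|/wb'] h; [have := wb b|have := wb a]; lia.
rewrite le_eqVlt => /orP[/eqP e0|lt0]; last exact: (Pos_weight lt0).
by apply: Z_Pos; apply: w0Z; rewrite // e0.
Qed.

(** Such a u can pair nontrivially only with weight -w >= 0, while vectors of positive weight are
    orthogonal to all nonnegative weights. Hence u is orthogonal to H_d, and so in Z. *)
Lemma Pos_nonpos (w : int) u : Pos Z d p u -> Wt X p w u -> w <= 0 -> Z u.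
Proof.
move=> hu uw w_le; apply: Z_perp; first exact: Pos_Hd hu.
move=> g hg; apply: contrapT => nz.
have hS : subsp (fun g => sf u g = 0).
  by split=> [|k v v' h1 h2]; rewrite !sfE // h1 h2 mulr0 addr0.
have MS v : Hd d v -> Sdg d v by case.
have [g' [w' [hg' nz' gw']]] := weight_vec hp hpp (smod_Hd X d) hS MS hg nz.
apply: nz'; have [ww|ww] := eqVneq (w + w') 0; last exact: (sf_Wt hp uw gw').
apply: (hu (fun u => sf u g' = 0)).
- by split=> [|k v v' h1 h2]; rewrite !sfE // h1 h2 mulr0 addr0.
- by move=> z hz; case: (Zperp hz hg').
by move=> w1 x w1p hx xw1; apply: (sf_Wt hp xw1 gw'); lia.
Qed.

(** M contains x_p^d because its weights outside Z are positive. If M were proper, its orthogonal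
    would contain a vector of negative weight outside Z, hence x_ps^d, which pairs nontrivially with
    x_p^d. *)
Lemma Pos_irr M u : smod M -> (forall v, M v -> Pos Z d p v) -> (forall z, Z z -> M z) -> M u -> ~ Z u ->
  forall h, Pos Z d p h -> M h.
Proof.
move=> hM MP ZM Mu nu h hh; apply: contrapT => nMh.
have MH v : M v -> Hd d v by move=> /MP/Pos_Hd.
have MS v : M v -> Sdg d v by move=> /MH[].
have [u' [w [Mu' nu' uw']]] := weight_vec hp hpp hM (smod_sub hZ) MS Mu nu.
have wpos : 0 < w by rewrite ltNge; apply/negP => w_le; apply: nu'; apply: (Pos_nonpos _ uw') => //; apply: MP.
have hx : M (xp p d) by apply: (sing _ hM MH Mu' nu' uw'); [left|apply: ltW].
have [g [hg gM gh]] := sep hM ZM MH (Pos_Hd hh) nMh.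
have hM' := smod_perp hM (smod_Hd X d).
have M'H v : (Hd d v /\ forall u, M u -> sf u v = 0) -> Hd d v by case.
have M'S v : (Hd d v /\ forall u, M u -> sf u v = 0) -> Sdg d v by case=> -[].
have hS : subsp (fun g => sf h g = 0).
  by split=> [|k v v' h1 h2]; rewrite !sfE // h1 h2 mulr0 addr0.
have nz : ~ sf h g = 0 by move/eqP; rewrite (negPf gh).
have [g' [w' [[hg' gM'] nz' gw']]] := weight_vec hp hpp hM' hS M'S (conj hg gM) nz.
have w'neg : w' < 0.
  rewrite ltNge; apply/negP => w'_ge; apply: nz'; apply: (hh (fun h => sf h g' = 0)).
  - by split=> [|k v v' h1 h2]; rewrite !sfE // h1 h2 mulr0 addr0.
  - by move=> z hz; case: (Zperp hz hg').
  by move=> w1 x w1p hx1 xw1; apply: (sf_Wt hp xw1 gw'); lia.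
have ng : ~ Z g' by move=> zg; apply: nz'; case: (Zperp zg (Pos_Hd hh)).
have [_ h1] : Hd d (xp ps d) /\ forall u, M u -> sf u (xp ps d) = 0.
  apply: (sing _ hM' M'H (conj hg' gM') ng (Wt_ps gw')); first by right.
  lia.
by have := sf_xp d hps; rewrite stK h1 // eqxx.
Qed.
End OneSide.

Lemma Hd_split (p : 'I_D) v : par X p = false -> p^s != p -> (forall f, Hd d f -> Wt X p 0 f -> Z f) ->
  Hd d v -> exists a b : V, [/\ Pos Z d p a, Pos Z d p^s b & v = a + b].
Proof.
move=> hp hpp w0Z hv; apply: contrapT => nv.
have hS : subsp (fun v => exists a b : V, [/\ Pos Z d p a, Pos Z d p^s b & v = a + b]).
  split; first by exists 0, 0; split; rewrite ?addr0 //; apply: (subsp0 (Pos_subsp _)).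
  move=> k _ _ [a [b [ha hb ->]]] [a' [b' [ha' hb' ->]]].
  by exists (k *: a + a'), (k *: b + b'); split; [apply: (subspL (Pos_subsp _))..|lmod].
have MS u : Hd d u -> Sdg d u by case.
have [u [w [hu nu uw]]] := weight_vec hp hpp (smod_Hd X d) hS MS hv nv.
apply: nu; have [w0|w0|w0] := ltgtP w 0.
- exists 0, u; rewrite add0r; split=> //; first exact: (subsp0 (Pos_subsp _)).
  by apply: (Pos_weight _ hu (Wt_ps uw)); lia.
- exists u, 0; rewrite addr0; split=> //; last exact: (subsp0 (Pos_subsp _)).
  exact: (Pos_weight w0 hu uw).
exists u, 0; rewrite addr0; split=> //; last exact: (subsp0 (Pos_subsp _)).
by apply: Z_Pos; apply: w0Z; rewrite // -w0.
Qed.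

Lemma Pos_cap (p : 'I_D) v : par X p = false -> p^s != p -> (forall f, Hd d f -> Wt X p 0 f -> Z f) ->
  Pos Z d p v -> Pos Z d p^s v -> Z v.
Proof.
move=> hp hpp w0Z v1 v2; apply: contrapT => nv.
have hps : par X p^s = false by rewrite par_st.
have hpps : p^s^s != p^s by rewrite stK eq_sym.
have Wps q w f : par X q = false -> q^s != q -> Wt X q w f -> Wt X q^s (- w) f.
  by move=> hq hqq; apply: Wt_ps.
have w0Z' f : Hd d f -> Wt X p^s 0 f -> Z f.
  by move=> hf /(Wps _ _ _ hps hpps); rewrite stK oppr0; apply: w0Z.
have hM : smod (fun v => Pos Z d p v /\ Pos Z d p^s v).
  have [h1 h2 h3] := smod_Pos hp hpp w0Z; have [h4 h5 h6] := smod_Pos hps hpps w0Z'.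
  split=> [|u [? ?]|a b u [? ?]]; [|by split; [apply: h2|apply: h5]|by split; [apply: h3|apply: h6]].
  split; first by split; [apply: (subsp0 h1)|apply: (subsp0 h4)].
  by move=> k u w [? ?] [? ?]; split; [apply: (subspL h1)|apply: (subspL h4)].
have MS u : Pos Z d p u /\ Pos Z d p^s u -> Sdg d u by case=> /Pos_Hd[].
have [u [w [[u1 u2] nu uw]]] := weight_vec hp hpp hM (smod_sub hZ) MS (conj v1 v2) nv.
apply: nu; have [w0|w0] := leP w 0; first exact: (Pos_nonpos hp hpp u1 uw).
by apply: (Pos_nonpos hps hpps u2 (Wps _ _ _ hp hpp uw)); lia.
Qed.
End Half.

(** For h odd under [st], the action of the element of the Cartan subalgebra with diagonal h. *)
Definition hop (h : 'I_D -> K) f := \sum_a h a *: mu a (de a f).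
Fact hop_linear (h : 'I_D -> K) : linear (hop h).
Proof.
move=> k f g; rewrite /hop scaler_sumr -big_split; apply: eq_bigr => a _ /=.
by rewrite !linE; lmod.
Qed.
HB.instance Definition _ (h : 'I_D -> K) := GRing.isLinear.Build K V V _ (hop h) (hop_linear h).

Lemma hop_mu (h : 'I_D -> K) b f : hop h (mu b f) = mu b (hop h f) + h b *: mu b f.
Proof.
rewrite /hop mu_sum /= -(sum_delta (fun a => h a *: mu a f) b) -big_split /=.
apply: eq_bigr => a _; rewrite dm !linE [mu b (mu a _)]mm ksgnC.
by case: eqP => [->|_]; lmod.
Qed.

Lemma hopZ (h : 'I_D -> K) k f : hop h (k *: f) = k *: hop h f. Proof. exact: linearZ. Qed.

Lemma hop_Lo (h : 'I_D -> K) f : (forall a, h a^s = - h a) -> hop h (Lo f) = Lo (hop h f).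
Proof.
move=> hs; rewrite !LoE hopZ [hop h (\sum__ _)]linear_sum; congr (_ *: _); apply: eq_bigr => a _ /=.
by rewrite hopZ !hop_mu !linE hs; lmod.
Qed.

Lemma hop_wd (h : 'I_D -> K) s : hop h (wd s) = (\sum_(a <- s) h a) *: wd s.
Proof.
elim: s => [|a s IH] /=.
  by rewrite big_nil scale0r /hop big1 // => a _; rewrite der_one mu0 scaler0.
by rewrite hop_mu IH big_cons linE; lmod.
Qed.

Lemma par_wd s : P (wd s) = (-1) ^+ (count (par X) s) *: wd s.
Proof.
elim: s => [|a s IH] /=; first by rewrite par_one expr0 scale1r.
by rewrite par_mul IH linE scalerA -exprD.
Qed.

Lemma mu_de_wd a c s : par X a = true -> a \in s -> a != c -> mu a (de c (wd s)) = 0.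
Proof.
move=> ha as_ ac; have := dm X c a (wd s); rewrite (mu_odd_mem ha as_) de0.
rewrite eq_sym (negPf ac) scale0r add0r => h.
by rewrite -(ksgnKs X c a (mu a _)) -h scaler0.
Qed.

Lemma de_wd_anti a b s : b \notin s -> de b (de a (wd s)) = 0.
Proof. by move=> bs; rewrite dd de_wd // de0 scaler0. Qed.

Lemma Lap_wd s : (forall a, a \in s -> a^s \notin s) -> Lap (wd s) = 0.
Proof.
move=> hs; rewrite LapE big1 ?scaler0 // => a _.
have [/hs h|h] := boolP (a \in s); first by rewrite de_wd_anti ?scaler0.
by rewrite de_wd // de0 scaler0.
Qed.

Lemma sf_wd_dual s : uniq (filter (par X) s) -> (forall a, a \in s -> a^s != a) -> sf (wd s) (wd (map (st X) s)) != 0.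
Proof.
elim: s => [|a s IH]; first by rewrite /= sf_one vac_one oner_eq0.
move=> us hs; have us' : uniq (filter (par X) s) by move: us => /=; case: ifP => //= _ /andP[].
have hs' b : b \in s -> b^s != b by move=> bs; apply: hs; rewrite inE bs orbT.
rewrite [wd (a :: s)]/= [map _ _]/= [wd (_ :: _)]/= sf_mu.
have [k k0 ->] : exists2 k : K, k != 0 & pe X (par X a) (wd s) = k *: wd s.
  case: (par X a); rewrite /=; first by exists ((-1) ^+ (count (par X) s)); rewrite ?signr_eq0 ?par_wd.
  by exists 1; rewrite ?oner_eq0 ?scale1r.
have [k' k'0 ->] : exists2 k : K, k != 0 & de a^s (mu a^s (wd (map (st X) s))) = k *: wd (map (st X) s).
  case ha: (par X a).
    have na : a \notin s by move: us; rewrite /= ha /= mem_filter ha /= => /andP[].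
    exists 1; rewrite ?oner_eq0 // dm eqxx de_wd ?mu0 ?scaler0 ?addr0 //.
    by rewrite mem_map //; apply: can_inj (stK X).
  have has : par X a^s = false by rewrite par_st.
  exists ((count_mem a^s (map (st X) s)).+1%:R); rewrite ?pnatr_eq0 //.
  by rewrite dm_self // -nuE nu_wd // mulrSr; lmod.
by rewrite !sfE !mulf_neq0 ?bet_neq0 ?IH.
Qed.

(** * An explicit harmonic vector of negative p-weight *)

Section HighestWeight.
Variable p : 'I_D.
Hypotheses (hp : par X p = false) (hpp : p^s != p).
Local Notation ps := (p^s).
Local Notation Yo := (Yo X p).
Let hps : par X ps = false. Proof. by rewrite par_st. Qed.
Let b0 : be p != 0. Proof. exact: bet_neq0. Qed.

Lemma Fo_Yo_inner a b f : a != p -> a != ps -> b != p -> b != ps -> Fo a b (Yo f) = Yo (Fo a b f).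
Proof.
move=> a1 a2 b1 b2; have h c e g : c != p -> c != ps -> (e == p) || (e == ps) ->
  mu c (de e^s g) = mu c (de e^s g) by [].
have hs c : c != p -> c != ps -> (c^s != p) && (c^s != ps) by move=> c1 c2; rewrite !st_eq stK c2 c1.
have hd c g : c != p -> c != ps -> de c^s (Yo g) = Yo (de c^s g).
  by move=> c1 c2; case/andP: (hs c c1 c2) => c3 c4; rewrite YoE !dm_evenr.
have hm c g : mu c (Yo g) = Yo (mu c g) by rewrite !YoE -!(mm_even _ _ hp) -!(mm_even _ _ hps).
by rewrite !FoE !hd // !hm -scaleNr -scaleNr YoP -[in RHS]/(Yo (_ *: _)) [Yo (_ *: _)]linearZ.
Qed.

Section Vector.
Variables (N aa : nat) (ths rs : seq 'I_D).
Hypotheses (hN : rho = N%:R) (ha : (0 < aa)%N) (hsz : (size ths + size rs)%N = N.+1).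
Hypotheses (hu : uniq (ths ++ rs)) (hin : forall x, x \in ths ++ rs -> [/\ x != p, x != ps & par X x])
   (hiso : forall x, x \in ths ++ rs -> x^s \notin ths ++ rs).
Local Notation J := (size rs).
Local Notation uu := (wd (nseq aa ps ++ ths)).

Lemma uu_mem x : x \in nseq aa ps ++ ths -> x = ps \/ x \in ths.
Proof. by rewrite mem_cat mem_nseq => /orP[/andP[_ /eqP]|]; [left|right]. Qed.

Lemma Lap_uu : Lap uu = 0.
Proof.
apply: Lap_wd => a /uu_mem ma; apply/negP => /uu_mem ma'.
case: ma => [ap|am]; last first.
  have am' : a \in ths ++ rs by rewrite mem_cat am.
  have [h1 h2 _] := hin am'; case: ma' => [/eqP|h]; first by rewrite (inj_eq (can_inj (stK X))) (negPf h1).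
  by have := hiso am'; rewrite mem_cat h.
case: ma' => [/eqP|h]; first by rewrite ap stK eq_sym (negPf hpp).
by have [] := hin (x := a^s); rewrite ?mem_cat ?h // ap stK eqxx.
Qed.

Lemma count_p : count_mem p (nseq aa ps ++ ths) = 0%N.
Proof.
rewrite count_cat count_nseq /= eq_sym eq_sym (negPf hpp) mul0n add0n.
by apply/count_memPn/negP => h; have [] := hin (x := p); rewrite ?mem_cat ?h // eqxx.
Qed.
Lemma count_ps : count_mem ps (nseq aa ps ++ ths) = aa.
Proof.
rewrite count_cat count_nseq /= eqxx mul1n (_ : count_mem ps ths = 0%N) ?addn0 //.
by apply/count_memPn/negP => h; have [] := hin (x := ps); rewrite ?mem_cat ?h ?eqxx.
Qed.

Lemma nn_uu : nn X p uu = aa%:R *: uu.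
Proof. by rewrite /nn !nu_wd // count_p count_ps scale0r add0r. Qed.

(* The recursion is the condition that [hwv J] be harmonic; see [Lap_hwv]. *)
Fixpoint cv (k : nat) : K :=
  if k is j.+1 then - cv j * ((J - j)%:R * (aa + j)%:R) / (j.+1%:R * be p * (aa + j.+1)%:R) else 1.
(** Each term replaces some of the J factors omega by x_p x_ps, so all have degree aa + size ths +
    2J. The common factor is x_ps^aa times odd vectors from an isotropic set. It is used with aa = 1
    in critical degrees, and with [ths] empty in high ones. *)
Definition hwv (m : nat) := \sum_(k < m.+1) cv k *: iter (J - k) Lo (iter k Yo uu).

Lemma hwvS m : hwv m.+1 = hwv m + cv m.+1 *: iter (J - m.+1) Lo (iter m.+1 Yo uu).
Proof. by rewrite /hwv big_ord_recr. Qed.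

Lemma Sdg_uu : Sdg (aa + size ths) uu.
Proof. by have := Eu_wd X (nseq aa ps ++ ths); rewrite size_cat size_nseq. Qed.

Lemma Lap_iter_Lo_gen (i d : nat) f : Sdg d f ->
  Lap (iter i Lo f) = iter i Lo (Lap f) + (i%:R * (d%:R + i%:R - 1 - rho)) *: iter i.-1 Lo f.
Proof.
move=> fd; case: i => [|i]; first by rewrite mul0r scale0r addr0.
by rewrite (Lap_iter_Lo _ fd) /= [i.+1%:R]mulrSr; congr (_ + _ *: _); ring.
Qed.

(** The partial sums telescope: the remainder after m terms is cancelled by the Laplacian of
    Yo^(m+1) uu, and at m = J the factor J - m makes the last remainder 0. *)
Lemma Lap_hwv m : (m <= J)%N -> Lap (hwv m) = (cv m * ((J - m)%:R * (aa + m)%:R)) *: iter (J - m).-1 Lo (iter m Yo uu).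
Proof.
have hd (k : nat) : Sdg (aa + size ths + 2 * k) (iter k Yo uu) by apply: Sdg_iter_Yo; apply: Sdg_uu.
(* By [hsz] the number of factors in [ths] and J add up to N + 1, which turns the scalar of
   [Lap_iter_Lo_gen] into (J - k)(aa + k). *)
have coef (k : nat) : (k <= J)%N -> (J - k)%:R * ((aa + size ths + 2 * k)%:R + (J - k)%:R - 1 - rho) = (J - k)%:R * (aa + k)%:R :> K.
  move=> kJ; rewrite hN; congr (_ * _); rewrite -natrD.
  have -> : (aa + size ths + 2 * k + (J - k))%N = (aa + k + N.+1)%N by move: hsz kJ; clear; lia.
  by rewrite natrD [N.+1%:R]mulrSr; ring.
elim: m => [|m IH] mJ.
  have c0 := coef 0%N isT; rewrite subn0 in c0.
  by rewrite /hwv big_ord1 subn0 scale1r (Lap_iter_Lo_gen _ (hd 0%N)) c0 [iter 0 _ _]/= Lap_uu iter_Lo0 add0r mul1r.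
rewrite hwvS LapD IH; last exact: ltnW.
rewrite LapZ (Lap_iter_Lo_gen _ (hd m.+1)) coef // scalerDr addrA.
set W := _ *: _ + _ *: iter _ Lo (Lap _); suff -> : W = 0 by rewrite add0r scalerA.
rewrite /W (Lap_iter_Yo hp hpp) Lap_uu iter_Yo0 add0r nn_uu -scalerDl iter_YoZ scalerA iter_LoZ scalerA.
rewrite (_ : (J - m).-1 = (J - m.+1)%N); last by rewrite subnS.
rewrite -scalerDl (_ : _ + _ = 0) ?scale0r //= -natrD [(m.+1 + aa)%N]addnC.
have h1 : m.+1%:R * be p * (aa + m.+1)%:R != 0 by rewrite !mulf_neq0 ?pnatr_eq0 // addnS.
by rewrite mulfVK // mulNr subrr.
Qed.

Local Notation v := (hwv J).

Lemma Hd_hwv : Hd (aa + size ths + 2 * J) v.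
Proof.
split; last by rewrite Lap_hwv // subnn mul0r mulr0 scale0r.
apply: Sdg_sum => k _; apply: SdgZ.
have -> : (aa + size ths + 2 * J)%N = (aa + size ths + 2 * k + 2 * (J - k))%N by have := ltn_ord k; clear; lia.
by apply: Sdg_iter_Lo; apply: Sdg_iter_Yo; apply: Sdg_uu.
Qed.

Lemma iter_comm_lin (T : {linear V -> V}) (k : K) : (forall f, T (Lo f) = Lo (T f)) -> (forall f, T (Yo f) = Yo (T f)) ->
  T uu = k *: uu -> T v = k *: v.
Proof.
move=> h1 h2 h3; rewrite linear_sum scaler_sumr; apply: eq_bigr => i _ /=.
have g1 (m : nat) f : T (iter m Lo f) = iter m Lo (T f) by elim: m => //= m IH; rewrite h1 IH.
have g2 (m : nat) f : T (iter m Yo f) = iter m Yo (T f) by elim: m => //= m IH; rewrite h2 IH.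
by rewrite linearZ /= g1 g2 h3 iter_YoZ iter_LoZ !scalerA mulrC.
Qed.

Lemma hop_hwv (h : 'I_D -> K) : (forall a, h a^s = - h a) -> hop h v = (- aa%:R * h p + \sum_(x <- ths) h x) *: v.
Proof.
move=> hs; apply: iter_comm_lin.
- by move=> f; apply: hop_Lo.
- by move=> f /=; rewrite !YoE !hop_mu hs !linE; lmod.
rewrite /= hop_wd big_cat; congr ((_ + _) *: _).
by elim: (aa) => [|m IH] /=; rewrite ?big_nil ?big_cons ?IH ?hs ?oppr0 ?mul0r // mulrSr; ring.
Qed.

Lemma Wt_hwv : Wt X p (- aa%:Z) v.
Proof.
apply: iter_comm_lin.
- by move=> f; apply: wo_Lo.
- by move=> f; apply: wo_Yo.
by rewrite /= wo_wd // /wts count_p count_ps sub0r.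
Qed.

Lemma par_hwv : P v = (-1) ^+ (size ths) *: v.
Proof.
apply: iter_comm_lin.
- exact: par_Lo.
- by move=> f; rewrite /= !YoE !par_mul par_st hp /= !linE !expr0 !scale1r.
rewrite par_wd count_cat count_nseq hps mul0n add0n; congr ((-1) ^+ _ *: _).
apply/eqP; rewrite -all_count; apply/allP => x hx; have [] := hin (x := x) => //.
by rewrite mem_cat hx.
Qed.

(** Removing one factor of the odd product and multiplying by another factor of the same product
    gives 0, since odd vectors square to 0. *)
Lemma Fo_hwv a b : a != p -> a != ps -> b != p -> b != ps ->
  (b^s \in ths -> a \in ths /\ a != b^s) -> (a^s \in ths -> b \in ths /\ b != a^s) -> Fo a b v = 0.
Proof.
move=> a1 a2 b1 b2 h1 h2; rewrite -(scale0r v); apply: iter_comm_lin.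
- by move=> f; apply: Fo_Lo.
- by move=> f; apply: Fo_Yo_inner.
have aux c e : e != p -> (e^s \in ths -> c \in ths /\ c != e^s) -> mu c (de e^s uu) = 0.
  move=> e1 he; have [es|es] := boolP (e^s \in ths).
    have [cs ce] := he es; apply: mu_de_wd => //; last by rewrite mem_cat cs orbT.
    by have [] := hin (x := c); rewrite ?mem_cat ?cs.
  rewrite de_wd ?mu0 //; apply/negP => /uu_mem[/eqP|h]; last by rewrite h in es.
  by rewrite (inj_eq (can_inj (stK X))) (negPf e1).
by rewrite /= FoE !aux // !scaler0 subrr scale0r.
Qed.

(** Derivatives along the duals of a list. Each strips at most one power of omega, so J of them
    leave L^(J+1) h divisible by omega; this detects non-divisibility. *)
Definition dels (l : seq 'I_D) f := foldl (fun g r => de r^s g) f l.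
Lemma dels_lin l k f g : dels l (k *: f + g) = k *: dels l f + dels l g.
Proof. by elim: l f g => //= r l IH f g; rewrite !linE IH. Qed.
Lemma dels0 l : dels l 0 = 0.
Proof. by elim: l => //= r l IH; rewrite de0. Qed.

Lemma dels_Lo l z : exists z', dels l (iter (size l).+1 Lo z) = Lo z'.
Proof.
elim: l z => [|r l IH] z; first by exists z.
have [z' hz'] : exists z', de r^s (iter (size l).+2 Lo z) = iter (size l).+1 Lo z'.
  elim: (size l).+1 {IH} => [|m [z' hm]]; first by exists (Lo (de r^s z) + gam r^s *: mu r^s^s z); rewrite /= der_Lo.
  exists (z' + gam r^s *: mu r^s^s z).
  have h (j : nat) a f : mu a (iter j Lo f) = iter j Lo (mu a f) by elim: j => //= j <-; rewrite mul_Lo.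
  by rewrite iterS der_Lo hm h iter_LoD iter_LoZ -iterS.
by have [z2 hz2] := IH z'; exists z2; rewrite /= -hz2 -hz'.
Qed.

Lemma de_iter_Lo r (i : nat) f : de r f = 0 -> de r (iter i.+1 Lo f) = (i.+1%:R * gam r) *: iter i Lo (mu r^s f).
Proof.
move=> rf; elim: i => [|i IH]; first by rewrite /= der_Lo rf Lo0 add0r mul1r.
rewrite iterS der_Lo IH LoZ -iterS (_ : mu r^s (iter i.+1 Lo f) = iter i.+1 Lo (mu r^s f)).
  by rewrite -scalerDl [i.+2%:R]mulrSr; congr (_ *: _); ring.
by elim: (i.+1) => //= m <-; rewrite mul_Lo.
Qed.

(** Each derivative must hit a fresh factor omega, since it kills f and the vectors already
    produced. With i < [size l] the factors run out. *)
Lemma dels_iter l (i : nat) f : (forall r, r \in l -> de r^s f = 0) ->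
  (forall r r', r \in l -> r' \in l -> r^s != r') -> (i <= size l)%N ->
  exists2 c : K, (c != 0) = (i == size l) & dels l (iter i Lo f) = c *: foldl (fun g r => mu r g) f l.
Proof.
elim: l i f => [|r l IH] i f h1 h2 il.
  by case: i il => // _; exists 1; rewrite ?oner_eq0 ?scale1r.
case: i il => [|i] il /=.
  by exists 0; rewrite ?eqxx // h1 ?mem_head // dels0 scale0r.
rewrite -[Lo _]/(iter i.+1 Lo f) de_iter_Lo ?h1 ?mem_head // stK.
have [|||c c0 hc] := IH i (mu r f).
- move=> r' r'l; rewrite dm (_ : r'^s == r = false).
    by rewrite h1 ?inE ?r'l ?orbT // mu0 scale0r scaler0 addr0.
  by apply: negbTE; apply: h2; rewrite inE ?eqxx ?r'l ?orbT.
- by move=> x y xl yl; apply: h2; rewrite inE ?xl ?yl orbT.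
- by [].
exists (i.+1%:R * gam r^s * c).
  by rewrite !mulf_eq0 negb_or c0 (negPf (gam_neq0 _ _)) pnatr_eq0.
by have := dels_lin l (i.+1%:R * gam r^s) (iter i Lo (mu r f)) 0; rewrite dels0 !addr0 => ->; rewrite hc scalerA.
Qed.

Lemma foldl_mu l f : foldl (fun g r => mu r g) f l = foldr (fun r g => mu r g) f (rev l).
Proof. by rewrite -[in LHS](revK l) foldl_rev. Qed.

(** Only the term k = 0 contains J factors omega, so after the derivatives a single word in
    isotropic letters is left. Its dual word is harmonic, hence orthogonal to the image of [Lo], but
    pairs nontrivially with it. *)
Lemma hwv_nd z : dels rs v <> Lo z.
Proof.
have rsh r : r \in rs -> [/\ r != p, r != ps, par X r & r \in ths ++ rs].
  by move=> rr; have rm : r \in ths ++ rs; [rewrite mem_cat rr orbT|have [] := hin rm].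
have auxJ (j k : nat) : (k <= j)%N -> (j - k == j)%N = (k == 0%N) by lia.
have dk (k : nat) : (k <= J)%N -> exists2 c : K, (c != 0) = (k == 0%N) &
      dels rs (iter (J - k) Lo (iter k Yo uu)) = c *: foldl (fun g r => mu r g) (iter k Yo uu) rs.
  move=> kJ; have [|||c h1 h2] := @dels_iter rs (J - k) (iter k Yo uu).
  - move=> r rr; have [r1 r2 r3 r4] := rsh r rr.
    have r0 : de r^s uu = 0.
      rewrite de_wd //; apply/negP => /uu_mem[/eqP|h].
        by rewrite (inj_eq (can_inj (stK X))) (negPf r1).
      by have := hiso r4; rewrite mem_cat h.
    elim: (k) => //= m IH; rewrite YoE !dm_evenr ?IH ?mu0 //; first by rewrite (inj_eq (can_inj (stK X))).
    by rewrite st_eq.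
  - move=> r r' rr rr'; have [_ _ _ r4] := rsh r rr; have := hiso r4.
    by apply: contraNneq => ->; have [] := rsh r' rr'.
  - exact: leq_subr.
  by exists c => //; rewrite h1 auxJ.
have [c c0 ->] : exists2 c : K, c != 0 & dels rs v = c *: wd (rev rs ++ nseq aa ps ++ ths).
  suff H m : (m <= J)%N -> exists2 c : K, c != 0 & dels rs (hwv m) = c *: wd (rev rs ++ nseq aa ps ++ ths) by apply: H.
  elim: m => [|m IH] mJ.
    have [c hc h] := dk 0%N isT; exists c; first by rewrite hc.
    have := dels_lin rs 1 (iter J Lo uu) 0; rewrite dels0 !addr0 !scale1r subn0 in h *.
    by rewrite /hwv big_ord1 scale1r subn0 h foldl_mu -foldr_cat.
  have [c c0 hc] := IH (ltnW mJ); exists c => //.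
  have [c' c'0 h] := dk m.+1 mJ.
  rewrite hwvS addrC dels_lin h hc.
  by move/negbFE/eqP: c'0 => ->; rewrite scale0r scaler0 add0r.
pose s := rev rs ++ nseq aa ps ++ ths.
have sm x : x \in s -> x = ps \/ x \in ths ++ rs.
  rewrite !mem_cat mem_rev => /orP[->|]; first by right; rewrite orbT.
  by rewrite -mem_cat => /uu_mem[|->]; [left|right].
have siso x : x \in s -> x^s \notin s.
  move=> xs; apply/negP => /sm ma'; case: (sm x xs) => [ap|am]; last first.
    have [h1 h2 _] := hin am; case: ma' => [/eqP|h]; first by rewrite (inj_eq (can_inj (stK X))) (negPf h1).
    by have := hiso am; rewrite h.
  case: ma' => [/eqP|h]; first by rewrite ap stK eq_sym (negPf hpp).
  by have [] := hin h; rewrite ap stK eqxx.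
have su : uniq (filter (par X) s).
  rewrite /s !filter_cat (_ : [seq x <- nseq aa ps | par X x] = [::]) ?cat0s; last first.
    by apply/nilP; rewrite /nilp size_filter count_nseq hps mul0n.
  rewrite filter_rev uniq_catC -filter_rev -filter_cat filter_uniq // cat_uniq rev_uniq.
  by have := hu; rewrite cat_uniq => /and3P[-> h ->]; rewrite andbT /=; apply: contra h => /hasP[x]; rewrite mem_rev => h1 h2; apply/hasP; exists x.
have sd x : x \in s -> x^s != x by move=> xs; apply: contraNneq (siso x xs) => ->.
have := sf_wd_dual su sd; have L0 : Lap (wd (map (st X) s)) = 0.
  by apply: Lap_wd => _ /mapP[x xs ->]; rewrite (mem_map (can_inj (stK X))); apply: siso.
move=> nz /(congr1 (fun g => sf g (wd (map (st X) s)))) /eqP.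
by rewrite sf_Lo L0 !sfE mulf_eq0 (negPf c0) (negPf nz).
Qed.

Lemma hwv_notin h : v <> iter J.+1 Lo h.
Proof. by move=> vh; have [z hz] := dels_Lo rs h; apply: (@hwv_nd z); rewrite vh. Qed.

Lemma hwv_neq0 : v <> 0.
Proof. by move=> v0; apply: (@hwv_nd 0); rewrite v0 dels0 Lo0. Qed.
End Vector.
End HighestWeight.
End Halves.

(** * The action of osp and the quotient by 1 - omega *)

Section Spanning.
Variables (K : numFieldType) (D : nat) (V : lmodType K) (X : fock D V).
Implicit Types (a b c e : 'I_D) (f g h u v : V) (k : K).

Local Notation mu := (mul X).
Local Notation de := (der X).
Local Notation "a ^s" := (st X a) (at level 2, format "a ^s").
Local Notation be := (bet X).
Local Notation q := (ksgn X).
Local Notation Lo := (Lo X).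
Local Notation Fo := (Fo X).
Local Notation Sdg := (Sdg X).

(** The hypothesis is invariance of the form in coordinates; it makes the two terms of each F_ab
    contribute equally, whence the factor 1/2. *)
Lemma sum_Fo_act (x : 'I_D -> 'I_D -> K) f :
  (forall a b, x b a^s * be b = - (q a b * be a * x a b^s)) ->
  2^-1 *: \sum_a \sum_b (x a b^s / be b) *: Fo a b f = \sum_a \sum_b x a b *: mu a (de b f).
Proof.
move=> hx; set S := RHS.
have e1 : \sum_a \sum_b x a b^s *: mu a (de b^s f) = S.
  by apply: eq_bigr => a _; rewrite [RHS](reindex_inj (can_inj (stK X))).
have e2 : \sum_a \sum_b (x a b^s / be b * (q a b * be a)) *: mu b (de a^s f) = - S.
  rewrite -e1 exchange_big -sumrN; apply: eq_bigr => a _; rewrite -sumrN; apply: eq_bigr => b _ /=.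
  rewrite -scaleNr; congr (_ *: _); apply: (mulIf (bet_neq0 X a)).
  rewrite mulrAC mulfVK ?bet_neq0 // mulrC [q b a]ksgnC mulNr.
  have := hx a b; have := ksgnK X a b; move: (q a b) => y hy h.
  have -> : x a b^s * be a = - (y * (x b a^s * be b)) by rewrite h; ring: hy.
  by ring.
rewrite (eq_bigr (fun a => \sum_b (x a b^s *: mu a (de b^s f)) - \sum_b (x a b^s / be b * (q a b * be a)) *: mu b (de a^s f))).
  by rewrite sumrB e1 e2 opprK half2.
move=> a _; rewrite -sumrB; apply: eq_bigr => b _.
by rewrite FoE scalerBr !scalerA mulfVK ?bet_neq0.
Qed.

Lemma graded_uniq (k : nat) (g : nat -> V) : (forall d, Sdg d (g d)) -> \sum_(d < k) g d = 0 ->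
  forall d, (d < k)%N -> g d = 0.
Proof.
move=> hg h0 d dk; apply: (sf_ndl (hg d)) => x xd.
rewrite -(sf0l X x) -h0 sf_suml (bigD1 (Ordinal dk)) //= big1 ?addr0 // => i id.
by apply: (sf_deg (hg i) xd); apply: contraNneq id => id; apply/eqP/val_inj.
Qed.

Section Quotient.
Variables (M : nat -> V -> Prop) (D0 : nat).
Hypotheses (Msub : forall d, subsp (M d)) (MS : forall d u, M d u -> Sdg d u).
(** The last condition lets M vanish in the small degrees that do not occur in the decomposition of
    a large S^d. *)
Hypothesis hdec : forall d : nat, (D0 <= d)%N -> exists r : nat,
  [/\ forall u, Sdg d u -> exists a : 'I_r -> V, (forall i : 'I_r, M (d - 2 * i) (a i)) /\ u = \sum_(i < r) iter i Lo (a i),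
      forall a : 'I_r -> V, (forall i : 'I_r, M (d - 2 * i) (a i)) -> \sum_(i < r) iter i Lo (a i) = 0 -> forall i, a i = 0,
      (r <= d./2.+1)%N
    & forall (i : nat) u, (r <= i <= d./2)%N -> M (d - 2 * i) u -> u = 0].

Let good u := exists (k : nat) (F : nat -> V), (forall d, M d (F d)) /\ exists v, u - \sum_(d < k) F d = v - Lo v.

Let cut (k : nat) (F : nat -> V) (d : nat) := if (d < k)%N then F d else 0.
Lemma cut_M (k0 : nat) F : (forall d, M d (F d)) -> forall d, M d (cut k0 F d).
Proof. by move=> h d; rewrite /cut; case: ifP => _; [apply: h|apply: subsp0]. Qed.
Lemma cut_sum (k0 l0 : nat) (F : nat -> V) : (k0 <= l0)%N -> \sum_(d < l0) cut k0 F d = \sum_(d < k0) F d.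
Proof.
move=> kl; rewrite -(big_mkord xpredT (cut k0 F)) (big_cat_nat (n := k0)) //= [X in _ + X]big1_seq.
  by rewrite addr0 big_mkord; apply: eq_bigr => i _; rewrite /cut ltn_ord.
by move=> i; rewrite mem_index_iota /cut => /andP[_ /andP[h _]]; rewrite ltnNge h.
Qed.

Lemma good_D u v : good u -> good v -> good (u + v).
Proof.
move=> [k1 [F [hF [x hx]]]] [k2 [G [hG [y hy]]]]; exists (k1 + k2)%N, (fun d => cut k1 F d + cut k2 G d); split.
  by move=> d; apply: subspD => //; apply: cut_M.
exists (x + y); rewrite big_split /= !cut_sum ?leq_addr ?leq_addl // LoD.
apply: (@etrans _ _ ((u - \sum_(d < k1) F d) + (v - \sum_(d < k2) G d))); first by lmod.
by rewrite hx hy; lmod.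
Qed.

Lemma good_ideal u v : good u -> good (u + (v - Lo v)).
Proof.
move=> [k1 [F [hF [x hx]]]]; exists k1, F; split=> //; exists (x + v).
by rewrite LoD addrAC hx; lmod.
Qed.

Lemma iter_mod (n : nat) u : exists v, u - iter n Lo u = v - Lo v.
Proof.
elim: n => [|n [v hv]]; first by exists 0; rewrite Lo0 !subrr.
exists (v + iter n Lo u); rewrite iterS LoD.
apply: (@etrans _ _ ((u - iter n Lo u) + (iter n Lo u - Lo (iter n Lo u)))); first by lmod.
by rewrite hv; lmod.
Qed.

Lemma good_M d u : M d u -> good u.
Proof.
move=> hu; exists d.+1, (fun e : nat => if e == d then u else 0); split.
  by move=> e; case: eqP => [->|_] //; apply: subsp0.
exists 0; rewrite Lo0 subrr (bigD1 ord_max) //= eqxx big1 ?addr0 ?subrr // => i.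
by rewrite -val_eqE /= => /negPf ->.
Qed.

Lemma quot_surj u : good u.
Proof.
have good0 : good 0 by apply: (@good_M 0%N); apply: subsp0.
have gsum (r : nat) (a : 'I_r -> V) : (forall i, good (a i)) -> good (\sum_i a i).
  by move=> h; elim/big_ind: _ => // ? ? ? ?; apply: good_D.
have [n [F [hF ->]]] := sum_deg X u; apply: (gsum) => i.
have [v hv] := iter_mod D0 (F i).
have -> : F i = iter D0 Lo (F i) + (v - Lo v) by rewrite -hv; lmod.
apply: good_ideal; have hd := Sdg_iter_Lo D0 (hF i).
have [|r [h1 _ _ _]] := hdec (d := (i + 2 * D0)%N); first by lia.
have [a [ha ->]] := h1 _ hd; apply: gsum => j.
have [w hw] := iter_mod j (a j).
have -> : iter j Lo (a j) = a j + (- w - Lo (- w)).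
  apply: (@etrans _ _ (a j - (a j - iter j Lo (a j)))); first by lmod.
  by rewrite hw LoN; lmod.
by apply/good_ideal/good_M/ha.
Qed.

Lemma quot_inj (k : nat) (F : nat -> V) v : (forall d, M d (F d)) -> \sum_(d < k) F d = v - Lo v ->
  \sum_(d < k) F d = 0.
Proof.
move=> hF hv; have [n [G [hG vE]]] := sum_deg X v.
pose F' := cut k F; pose G' d := if insub d is Some i then G i else 0.
have hF' d : M d (F' d) by apply: cut_M.
have hG' d : Sdg d (G' d) by rewrite /G'; case: insubP => [i _ <-|_]; [apply: hG|apply: Sdg0].
(* The homogeneous components of the relation, with zero terms added so that both sides run over all
   degrees. *)
have rel d : F' d = G' d - (if d is e.+2 then Lo (G' e) else 0).
  pose K1 := (k + n + d).+2.
  pose g (e : nat) := F' e - G' e + (if e is e'.+2 then Lo (G' e') else 0).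
  have hg (e : nat) : Sdg e (g e).
    apply: SdgD; first by apply: SdgB => //; apply/MS/hF'.
    by case: e => [|[|e]]; [apply: Sdg0|apply: Sdg0|apply: Sdg_Lo].
  have sumG (l0 : nat) : (n <= l0)%N -> \sum_(e < l0) G' e = v.
    move=> nl; rewrite vE -(big_mkord xpredT G') (big_cat_nat (n := n)) //= [X in _ + X]big1_seq.
      rewrite addr0 big_mkord; apply: eq_bigr => i _; rewrite /G'.
      by case: insubP => [j _ /val_inj -> //|]; rewrite ltn_ord.
    move=> i; rewrite mem_index_iota /G' => /andP[_ /andP[h _]].
    by case: insubP => // j; rewrite ltnNge h.
  have s0 : \sum_(e < K1) g e = 0.
    rewrite !big_split /= sumrN cut_sum; last by rewrite /K1; lia.
    rewrite hv sumG; last by rewrite /K1; lia.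
    rewrite !big_ord_recl /= !add0r -[X in _ + X]Lo_sum sumG; last by lia.
    by lmod.
  have := graded_uniq hg s0 (d := d); rewrite /g => h.
  by apply/eqP; rewrite -subr_eq0 opprB [_ - G' d]addrC addrA h //; rewrite /K1; lia.
have tel (c T : nat) : (c < 2)%N -> G' (c + 2 * T)%N = \sum_(i < T.+1) iter i Lo (F' (c + 2 * T - 2 * i)%N).
  move=> c2; elim: T => [|T IH].
    rewrite big_ord1 muln0 addn0 subn0 /= rel.
    by case: c c2 => [|[|c]] // _; rewrite subr0.
  rewrite big_ord_recl /= muln0 subn0 rel.
  have -> : (c + 2 * T.+1)%N = (c + 2 * T).+2 by lia.
  rewrite IH Lo_sum.
  rewrite (eq_bigr (fun i : 'I_T.+1 => Lo (iter i Lo (F' (c + 2 * T - 2 * i)%N)))); first by rewrite subrK.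
  by move=> i _; rewrite /bump /= add1n; congr (Lo (iter _ _ (F' _))); lia.
have F0 d : F' d = 0.
  (* The degree [d2] is at least [D0] and exceeds every degree of v, so [G' d2] is 0; the component
     [F' d] occurs there at position D0 + n. *)
  pose T := (d./2 + D0 + n)%N; pose d2 := (odd d + 2 * T)%N.
  have DE : d2 = (d + 2 * (D0 + n))%N by rewrite /d2 /T -[in RHS](odd_double_half d); lia.
  have [|r [_ h2 h3 h4]] := hdec (d := d2); first by rewrite DE; lia.
  have TE : d2./2 = T by rewrite /d2; lia.
  rewrite TE in h3 h4.
  have G0 : G' d2 = 0 by rewrite /G'; case: insubP => // j; rewrite DE; lia.
  have c2 : (odd d < 2)%N by case: (odd d).
  have := tel (odd d) T c2; rewrite -/d2 G0 => /esym s0.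
  have s1 : \sum_(i < r) iter i Lo (F' (d2 - 2 * i)%N) = 0.
    rewrite -[RHS]s0 -!(big_mkord xpredT (fun i => iter i Lo (F' (d2 - 2 * i)%N))) [RHS](big_cat_nat (n := r)) //=.
    rewrite [X in _ = _ + X]big1_seq ?addr0 // => i; rewrite mem_index_iota => /andP[_ /andP[ri iT]].
    by rewrite (h4 i _ _ (hF' _)) ?iter_Lo0 // ri -ltnS.
  have := h2 (fun i : 'I_r => F' (d2 - 2 * i)%N) (fun i => hF' _) s1 => h5.
  have dE : d = (d2 - 2 * (D0 + n))%N by rewrite DE addnK.
  have [ir|ir] := ltnP (D0 + n) r; first by have := h5 (Ordinal ir); rewrite /= -dE.
  have := h4 (D0 + n)%N (F' d); rewrite -dE; apply; last exact: hF'.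
  by rewrite ir /T; lia.
by rewrite -(cut_sum F (leqnn k)) big1 // => i _; exact: F0.
Qed.
End Quotient.
End Spanning.

(** * Homomorphisms, isomorphisms of subquotients and duality for the abstract operators *)

Section Modules.
Variables (K : numFieldType) (D : nat) (V : lmodType K) (X : fock D V).
Implicit Types (a b c e : 'I_D) (f g h u v : V) (k : K).

Local Notation "a ^s" := (st X a) (at level 2, format "a ^s").
Local Notation P := (par_op X).
Local Notation Lo := (Lo X).
Local Notation Lap := (Lap X).
Local Notation Fo := (Fo X).
Local Notation rho := (rho X).
Local Notation Sdg := (Sdg X).
Local Notation sf := (sf X).

Local Notation Ad := (Ad X).
Local Notation smod := (smod X).
Local Notation lam := (lam X).

Definition mhom (T : V -> V) := [/\ forall k u v, T (k *: u + v) = k *: T u + T v,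
  forall u, T (P u) = P (T u) & forall a b u, T (Fo a b u) = Fo a b (T u)].

Lemma mhom_id : mhom id. Proof. by []. Qed.
Lemma mhom_comp T T' : mhom T -> mhom T' -> mhom (fun u => T (T' u)).
Proof. by move=> [h1 h2 h3] [h4 h5 h6]; split=> *; rewrite ?h4 ?h1 ?h5 ?h2 ?h6 ?h3. Qed.
Lemma mhom_Lo : mhom Lo.
Proof. by split=> *; rewrite ?LoD ?LoZ ?par_Lo ?Fo_Lo. Qed.
Lemma mhom_Lap : mhom Lap.
Proof. by split=> *; rewrite ?LapD ?LapZ ?par_Lap ?Fo_Lap. Qed.
Lemma mhom_iter n : mhom (iter n Lo).
Proof. by split=> *; rewrite ?iter_LoD ?iter_LoZ ?par_iter_Lo ?Fo_iter_Lo. Qed.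

Definition actF (x : 'I_D -> 'I_D -> K) f := 2^-1 *: \sum_a \sum_b x a b *: Fo a b f.

Lemma actF_lin x k u v : actF x (k *: u + v) = k *: actF x u + actF x v.
Proof.
rewrite /actF scalerA mulrC -scalerA -scalerDr [k *: \sum_a _]scaler_sumr -big_split /=; congr (_ *: _).
apply: eq_bigr => a _; rewrite [k *: \sum_b _]scaler_sumr -big_split /=; apply: eq_bigr => b _.
by rewrite FoD FoZ scalerDr !scalerA mulrC.
Qed.
Lemma smod_actF M x u : smod M -> M u -> M (actF x u).
Proof.
move=> [sM _ hF] hu; apply: subspZ => //; apply: subsp_sum => // a _; apply: subsp_sum => // b _.
by apply: subspZ => //; apply: hF.
Qed.
Section Hom.
Variable T : V -> V.
Hypothesis hT : mhom T.
Lemma mhom0 : T 0 = 0.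
Proof. by case: hT => h _ _; have := h (- 1) 0 0; rewrite scaler0 addr0 scaleN1r addNr. Qed.
Lemma mhomD u v : T (u + v) = T u + T v.
Proof. by case: hT => h _ _; rewrite -[u]scale1r h !scale1r. Qed.
Lemma mhomZ k u : T (k *: u) = k *: T u.
Proof. by case: hT => h _ _; rewrite -[k *: u]addr0 h mhom0 addr0. Qed.
Lemma mhomB u v : T (u - v) = T u - T v.
Proof. by rewrite -scaleN1r mhomD mhomZ scaleN1r. Qed.
Lemma mhom_sum (I : finType) (F : I -> V) : T (\sum_i F i) = \sum_i T (F i).
Proof. by elim/big_rec2: _ => [|i y z _ <-]; rewrite ?mhom0 ?mhomD. Qed.
Lemma mhom_actF x u : T (actF x u) = actF x (T u).
Proof.
rewrite /actF mhomZ mhom_sum; congr (_ *: _); apply: eq_bigr => a _.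
by rewrite mhom_sum; apply: eq_bigr => b _; rewrite mhomZ; case: hT => _ _ ->.
Qed.
End Hom.

Lemma smod_zero : smod (fun v : V => v = 0).
Proof.
split; first by split=> // k u v -> ->; rewrite scaler0 addr0.
  by move=> u ->; rewrite P0.
by move=> a b u ->; rewrite Fo0.
Qed.

Definition phomog (p : bool) u := P u = (-1) ^+ p *: u.

(* The relation "theta u is congruent to psi h modulo J" descends to an         *)
(* isomorphism from M1 / N1 onto M2 / N2.                                       *)
Section Relation.
Variables (th ps : V -> V) (M1 N1 M2 N2 J : V -> Prop).
Hypotheses (hth : mhom th) (hps : mhom ps) (sM1 : smod M1) (sM2 : smod M2) (sJ : smod J).
Hypotheses (h1 : forall u, M1 u -> exists2 h, M2 h & J (th u - ps h))
  (h2 : forall h, M2 h -> exists2 u, M1 u & J (th u - ps h))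
  (h3 : forall z, M2 z -> J (ps z) -> N2 z)
  (h4 : forall u h, M1 u -> M2 h -> J (th u - ps h) -> (N2 h <-> N1 u)).

Lemma relation_iso : exists phi : V -> V,
  [/\ forall u, M1 u -> M2 (phi u),
      forall k u v, M1 u -> M1 v -> N2 (phi (k *: u + v) - (k *: phi u + phi v)),
      forall p u, M1 u -> phomog p u -> N2 (phi u - 2^-1 *: (phi u + (-1) ^+ p *: P (phi u))),
      forall x u, M1 u -> N2 (phi (actF x u) - actF x (phi u))
    & (forall u, M1 u -> (N2 (phi u) <-> N1 u)) /\
      (forall w, M2 w -> exists2 u, M1 u & N2 (w - phi u))].
Proof.
have [|phi hphi] := @choice _ _ (fun u h => M1 u -> M2 h /\ J (th u - ps h)).
  move=> u; case: (pselect (M1 u)) => [/[dup] hu /h1 [h hh hj]|hu]; first by exists h.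
  by exists 0.
have [[jM1 jM2] jJ] := (smod_sub sM1, smod_sub sM2, smod_sub sJ).
exists phi; split; [by move=> u /hphi[]| | | |split].
- move=> k u v hu hv; have [a1 a2] := hphi _ hu; have [b1 b2] := hphi _ hv.
  have [c1 c2] := hphi _ (subspL jM1 k hu hv); apply: h3.
    by apply: subspB => //; apply: subspL.
  have -> : ps (phi (k *: u + v) - (k *: phi u + phi v)) =
    k *: (th u - ps (phi u)) + (th v - ps (phi v)) - (th (k *: u + v) - ps (phi (k *: u + v))).
    rewrite (mhomB hps) !(mhomD hps) !(mhomZ hps) !(mhomD hth) !(mhomZ hth).
    move: (ps _) (ps _) (ps _) (th _) (th _) => *; lmod.
  by apply: subspB => //; apply: subspL.
- move=> p u hu hp; have [a1 a2] := hphi _ hu; apply: h3.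
    apply: subspB => //; apply: subspZ => //; apply: subspD => //; apply: subspZ => //.
    by case: sM2 => _ h _; apply: h.
  have sg : (-1) ^+ p * (-1) ^+ p = 1 :> K by rewrite -expr2 sqrr_sign.
  have e1 : th u = (-1) ^+ p *: P (th u).
    by case: hth => _ <- _; rewrite hp (mhomZ hth) scalerA sg scale1r.
  have -> : ps (phi u - 2^-1 *: (phi u + (-1) ^+ p *: P (phi u))) =
    2^-1 *: ((-1) ^+ p *: P (th u - ps (phi u)) - (th u - ps (phi u))).
    rewrite (mhomB hps) (mhomZ hps) (mhomD hps) (mhomZ hps) PD PN [_ ^+ p *: (_ - _)]scalerBr -e1.
    have -> : ps (P (phi u)) = P (ps (phi u)) by case: hps.
    have aux k x y z : y - 2^-1 *: (y + k *: x) = 2^-1 *: (z - k *: x - (z - y)).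
      by rewrite -{1}[y]half2 -scalerBr; congr (_ *: _); lmod.
    exact: aux.
  apply: subspZ => //; apply: subspB => //; apply: subspZ => //; case: sJ => _ h _; exact: h.
- move=> x u hu; have [a1 a2] := hphi _ hu; have [b1 b2] := hphi _ (smod_actF x sM1 hu); apply: h3.
    by apply: subspB => //; apply: smod_actF.
  have -> : ps (phi (actF x u) - actF x (phi u)) = actF x (th u - ps (phi u)) - (th (actF x u) - ps (phi (actF x u))).
    rewrite (mhomB hps) (mhom_actF hps) (mhom_actF hth).
    rewrite -[th u - _]addrC -[X in X + th u]scaleN1r actF_lin.
    by move: (actF _ _) (actF _ _) (ps _) => *; lmod.
  by apply: subspB => //; apply: smod_actF.
- by move=> u hu; have [a1 a2] := hphi _ hu; apply: h4.
move=> w hw; have [u hu hj] := h2 hw; exists u => //; have [a1 a2] := hphi _ hu.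
apply: h3; first exact: subspB.
have -> : ps (w - phi u) = (th u - ps (phi u)) - (th u - ps w) by rewrite (mhomB hps); lmod.
exact: subspB.
Qed.
End Relation.

Lemma sf_actF (p : bool) x u v : (forall a b, x a b != 0 -> par X a (+) par X b = p) ->
  sf (actF x u) v = - sf (pe X p u) (actF x v).
Proof.
move=> hx; rewrite /actF sfZl sfZr -mulrN sf_suml sf_sumr -sumrN; congr (_ * _).
apply: eq_bigr => a _; rewrite sf_suml sf_sumr -sumrN; apply: eq_bigr => b _.
rewrite sfZl sfZr -mulrN; have [->|/hx ab] := eqVneq (x a b) 0; first by rewrite !mul0r.
by rewrite sf_Fo ab.
Qed.

Lemma homog_pe (p t : bool) u : phomog p u -> pe X t u = (-1) ^+ (t && p) *: u.
Proof. by case: t => //= _; rewrite scale1r. Qed.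

Lemma sf_homog (p t : bool) u v : phomog p u -> phomog t v -> p != t -> sf u v = 0.
Proof.
move=> hu hv pt; have := sf_par X u v; rewrite hu hv sfZl sfZr mulrA -signr_addb.
have -> : p (+) t = true by case: (p) (t) pt => [] [].
by rewrite expr1 mulN1r => h; apply/eqP; rewrite -[_ == 0]/((2 == 0)%N || (_ == 0)) -mulrn_eq0 mulr2n -{1}h addNr.
Qed.

Section Isotropic.
Variable p : 'I_D.
Hypotheses (hp : par X p = false) (hpp : p^s != p).

Lemma decomp_dsum (d k0 : nat) (M : 'I_k0 -> V -> Prop) : (k0 <= d./2.+1)%N ->
  (forall i j : nat, (i < j < k0)%N -> (d%:R - i%:R - j%:R - 1 : K) != rho) ->
  \prod_(i < d./2.+1) ('X - (lam d i)%:P) %| \prod_(j < k0) Gq (lam d j) ->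
  (forall (i : 'I_k0) u, M i u <-> Ad (d - 2 * i) u) ->
  [/\ forall (i : 'I_k0) u, u = 0 -> exists2 v, M i v & u = iter i Lo v,
      forall u, Sdg d u <-> exists2 f : 'I_k0 -> V,
         (forall i : 'I_k0, exists2 v, M i v & f i = iter i Lo v) & u - \sum_i f i = 0
    & forall f : 'I_k0 -> V, (forall i : 'I_k0, exists2 v, M i v & f i = iter i Lo v) -> \sum_i f i = 0 ->
       forall i, f i = 0].
Proof.
move=> kd c3 dv hM; split.
- by move=> i u ->; exists 0; [exact: (hM _ _).2 (subsp0 (Ad_subsp _ _))|rewrite iter_Lo0].
- move=> u; split=> [hu|[f hf /eqP]].
    have [a [ha ->]] := decomp hp hpp kd c3 dv hu.
    exists (fun i : 'I_k0 => iter i Lo (a i)); last by rewrite subrr.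
    by move=> i; exists (a i) => //; apply/hM.
  rewrite subr_eq0 => /eqP ->; apply: Sdg_sum => i _; have [v /hM [hv _] ->] := hf i.
  have := Sdg_iter_Lo i hv; rewrite subnK //; have := ltn_ord i; lia.
move=> f hf s0 i.
have [|a ha] := @choice _ _ (fun (i : 'I_k0) v => Ad (d - 2 * i) v /\ f i = iter i Lo v).
  move=> j.
  by have [v /hM hv ->] := hf j; exists v.
rewrite (ha i).2 (decomp_uniq hp hpp kd c3 (a := a)) ?iter_Lo0 //; first by move=> j; case: (ha j).
by rewrite -[RHS]s0; apply: eq_bigr => j _; rewrite (ha j).2.
Qed.

Lemma xp_not_Lo d g : xp X p d <> Lo g.
Proof.
move=> h; have := sf_xp d hp; rewrite h -sf_Lap Lap_xp ?sf0l ?eqxx //.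
  by rewrite par_st.
by rewrite stK eq_sym.
Qed.

Section Critical.
Variables (N f0 : nat).
Hypotheses (hN : rho = N%:R) (hf : (N <= f0 <= 2 * N)%N).

Lemma Ad_nd u : Ad f0.+2 u -> (forall v, Ad f0.+2 v -> sf u v = 0) -> u = 0.
Proof.
move=> hu h0; apply: (sf_ndl hu.1) => g hg.
have [a [w [ha hw ->]]] := crit_Asplit hp hpp hN hf hg.
by rewrite sfDr h0 // (crit_perp_r hu hw) // addr0.
Qed.

(** A functional is determined up to scale by its kernel. A vector g separating x from that kernel
    is replaced by its A_d-part, since the rest L w is orthogonal to A_d, and is then rescaled at
    x. *)
Lemma Ad_riesz (F : V -> K) : (forall k u v, Ad f0.+2 u -> Ad f0.+2 v -> F (k *: u + v) = k * F u + F v) ->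
  exists2 u, Ad f0.+2 u & forall v, Ad f0.+2 v -> sf u v = F v.
Proof.
move=> hF; have sA := Ad_subsp X f0.+2.
have F0 : F 0 = 0 by have := hF (-1) 0 0 (subsp0 sA) (subsp0 sA); rewrite scaler0 addr0 mulN1r addNr.
case: (pselect (forall v, Ad f0.+2 v -> F v = 0)) => [h|/existsNP [x /not_implyP [hx Fx]]].
  by exists 0; [apply: subsp0|move=> v hv; rewrite sf0l h].
pose Kf v := Ad f0.+2 v /\ F v = 0.
have sK : subsp Kf.
  split; first by split=> //; apply: subsp0.
  by move=> k u v [u1 u2] [v1 v2]; split; [apply: subspL|rewrite hF // u2 v2 mulr0 addr0].
have [|||g [hg g0 gx]] := @separR _ _ _ X f0.+2 Kf x sK; rewrite /Kf.
- by move=> u [[]].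
- by case: hx.
- by case.
have [a [w [ha hw ge]]] := crit_Asplit hp hpp hN hf hg.
have e1 v : Ad f0.+2 v -> sf a v = sf g v by move=> hv; rewrite ge sfDl (crit_perp_l hv hw) // addr0.
exists ((F x / sf g x) *: a); first exact: subspZ.
move=> v hv; rewrite sfZl e1 //.
have /g0 : Kf (v - (F v / F x) *: x).
  split; first by apply: subspB => //; apply: subspZ.
  rewrite -scaleNr addrC hF // mulNr mulfVK ?addNr //; exact/eqP.
rewrite sfDr sfNr sfZr => /eqP; rewrite subr_eq0 => /eqP ->.
rewrite [_ * sf g x]mulrC mulrA mulfVK // mulrC mulfVK //; exact/eqP.
Qed.

End Critical.
End Isotropic.
End Modules.

(** * The splitting of H_d for m = 2 and raising operators on its highest weight vectors *)

Section HalfData.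
Variables (K : numFieldType) (D : nat) (V : lmodType K) (X : fock D V).
Implicit Types (a b c e : 'I_D) (f g h u v : V) (k : K).

Local Notation mu := (mul X).
Local Notation "a ^s" := (st X a) (at level 2, format "a ^s").
Local Notation be := (bet X).
Local Notation P := (par_op X).
Local Notation q := (ksgn X).
Local Notation Lo := (Lo X).
Local Notation Fo := (Fo X).
Local Notation rho := (rho X).
Local Notation wd := (wd X).
Local Notation sf := (sf X).

Local Notation Hd := (Hd X).
Local Notation smod := (smod X).
Local Notation regular := (regular X).
Local Notation xp := (xp X).
Local Notation actF := (actF X).
Local Notation Pos := (Pos X).

Lemma dsum_bool (M N Q1 Q2 : V -> Prop) : subsp N -> subsp M -> subsp Q1 -> subsp Q2 ->
  (forall u, N u -> Q1 u) -> (forall u, N u -> Q2 u) -> (forall u, Q1 u -> M u) -> (forall u, Q2 u -> M u) ->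
  (forall u, M u -> exists a b : V, [/\ Q1 a, Q2 b & u = a + b]) ->
  (forall a b : V, Q1 a -> Q2 b -> N (a + b) -> N a) ->
  let Q := fun b : bool => if b then Q1 else Q2 in
  [/\ forall (i : bool) u, N u -> Q i u,
      forall u, M u <-> exists2 f : bool -> V, (forall i, Q i (f i)) & N (u - \sum_i f i)
    & forall f : bool -> V, (forall i, Q i (f i)) -> N (\sum_i f i) -> forall i, N (f i)].
Proof.
move=> sN sM s1 s2 n1 n2 m1 m2 dec uni Q; split; first by case=> u; [apply: n1|apply: n2].
  move=> u; split=> [/dec [a [b [ha hb ->]]]|[f hf]].
    by exists (fun i : bool => if i then a else b); [case|rewrite big_bool subrr; apply: subsp0].
  rewrite big_bool => h; rewrite -(subrK (f true + f false) u); apply: subspD => //.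
    exact/m1/n1.
  by apply: subspD => //; [apply/m1/(hf true)|apply/m2/(hf false)].
move=> f hf; rewrite big_bool => h; have h1 := uni _ _ (hf true) (hf false) h; case=> //.
by rewrite -(addKr (f true) (f false)) addrC; apply: subspB.
Qed.

(* What the decomposition of H_d into a part of positive and a part of         *)
(* negative weights requires of Z; it is used for Z = L^s H_(d-2s) and Z = 0.   *)
Record half_data (Z : V -> Prop) (d : nat) (p : 'I_D) : Prop := HalfData {
  half_mod : smod Z;
  half_Hd : forall z, Z z -> Hd d z;
  half_perp : forall z h, Z z -> Hd d h -> sf h z = 0 /\ sf z h = 0;
  half_sep : forall M x, smod M -> (forall z, Z z -> M z) -> (forall v, M v -> Hd d v) ->
    Hd d x -> ~ M x -> exists g, [/\ Hd d g, forall v, M v -> sf v g = 0 & sf x g != 0];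
  half_w0 : forall f, Hd d f -> Wt X p 0 f -> Z f;
  half_sing : forall p', p' = p \/ p' = p^s -> forall M u (w : int), smod M -> (forall v, M v -> Hd d v) ->
    M u -> ~ Z u -> Wt X p' w u -> 0 <= w -> M (xp p' d) }.

Section Isotropic.
Variable p : 'I_D.
Hypotheses (hp : par X p = false) (hpp : p^s != p).
Local Notation ps := (p^s).
Let hps : par X ps = false. Proof. by rewrite par_st. Qed.
Let hpps : ps^s != ps. Proof. by rewrite stK eq_sym. Qed.

Lemma half_swap Z d : half_data Z d p -> half_data Z d ps.
Proof.
move=> [h1 h2 h3 h4 h5 h6]; split=> //.
  by move=> f hf /Wt_ps; rewrite stK oppr0; apply: h5.
by move=> p' hp'; apply: h6; case: hp' => ->; [right|left; rewrite stK].
Qed.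

Lemma half_Pos Z d : half_data Z d p -> smod (Pos Z d p).
Proof. by move=> [h1 h2 h3 h4 h5 h6]; apply: smod_Pos. Qed.

Lemma half_irr Z d M u : half_data Z d p -> smod M -> (forall v, M v -> Pos Z d p v) ->
  (forall z, Z z -> M z) -> M u -> ~ Z u -> forall h, Pos Z d p h -> M h.
Proof. move=> [h1 h2 h3 h4 h5 h6] sM MP ZM Mu nu; exact: (Pos_irr h1 h2 h3 h4 hp hpp h6 sM MP ZM Mu nu). Qed.

Lemma half_xp Z d : half_data Z d p -> (0 < d)%N -> Pos Z d p (xp p d).
Proof.
move=> h d0; apply: (Pos_weight (w := d)); first by [].
  exact: Hd_xp.
exact: wo_xp.
Qed.

Lemma half_dsum Z d : half_data Z d p ->
  let Q := fun b : bool => if b then Pos Z d p else Pos Z d ps in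
  [/\ forall (i : bool) u, Z u -> Q i u,
      forall u, Hd d u <-> exists2 f : bool -> V, (forall i, Q i (f i)) & Z (u - \sum_i f i)
    & forall f : bool -> V, (forall i, Q i (f i)) -> Z (\sum_i f i) -> forall i, Z (f i)].
Proof.
move=> hh; have [h1 h2 h3 h4 h5 h6] := hh; have s0 := smod_sub h1.
apply: dsum_bool; rewrite ?(smod_sub h1) //.
- exact: Hd_subsp.
- exact: Pos_subsp.
- exact: Pos_subsp.
- by move=> u; apply: Z_Pos.
- by move=> u; apply: Z_Pos.
- by move=> u; apply: Pos_Hd.
- by move=> u; apply: Pos_Hd.
- by move=> u; apply: Hd_split.
move=> a b ha hb hab; apply: (Pos_cap h1 h2 h3 h4 hp hpp h5 ha).
rewrite -(addrK b a); apply: (subspB (Pos_subsp X Z d ps)) => //; exact: Z_Pos.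
Qed.

Section TwoEven.
Variable N : nat.
Hypotheses (hN : rho = N%:R) (hev : forall a, a != p -> a != ps -> par X a = true).

Lemma half_high d : (2 * N.+1 < d)%N -> half_data (fun v => v = 0) d p.
Proof.
move=> dN; have rg : regular d by apply: (@regular_high _ _ _ X p hp hpp N N hN); lia.
split.
- exact: smod_zero.
- by move=> z ->; apply: subsp0; apply: Hd_subsp.
- by move=> z h -> _; rewrite sf0l sf0r.
- by move=> M x sM _; apply: regular_sep.
- by move=> f hf h0; apply: (harm_weight_pos hp hpp hN hev hf h0); rewrite addn0.
move=> p' hp' M u w sM MH Mu u0 uw w0.
by case: hp' uw => -> uw; apply: (harmonic_sing _ _ rg sM MH Mu u0 uw); rewrite ?hps ?hpps //; right.
Qed.

Section Critical.
Variable f0 : nat.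
Hypothesis hf : (N <= f0 <= 2 * N)%N.
Local Notation t := (f0 - N)%N.
Local Notation e := (f0 - 2 * t)%N.
Local Notation LsH := (fun u => exists2 h, Hd e h & u = iter t.+1 Lo h).

Lemma half_crit : half_data LsH f0.+2 p.
Proof.
split.
- exact: smod_LsH.
- by move=> z; apply: (LsH_Hd hp hpp hN hf).
- by move=> z h; apply: LsH_perp_Hd.
- move=> M x sM hM MH hx nx; have [g [g1 _ g2 g3]] := Hd_sep hp hpp hN hf sM hM MH hx nx.
  by exists g.
- by move=> f; apply: (weight0_LsH hp hpp hN hev hf).
move=> p' hp' M u w sM MH Mu u0 uw w0.
case: hp' uw => -> uw; apply: (quot_sing hp hpp hN hf (w := w) (u := u)); rewrite ?hps ?hpps //; by right.
Qed.
End Critical.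

Section Highest.
Variables (aa : nat) (ths rs : seq 'I_D).
Hypotheses (ha : (0 < aa)%N) (hsz : (size ths + size rs)%N = N.+1).
Hypotheses (hu : uniq (ths ++ rs)) (hin : forall x, x \in ths ++ rs -> [/\ x != p, x != ps & par X x])
   (hiso : forall x, x \in ths ++ rs -> x^s \notin ths ++ rs).
Local Notation vv := (hwv X p aa ths rs (size rs)).
Local Notation dd := (aa + size ths + 2 * size rs)%N.
Variables (hz : 'I_D -> int).
Hypotheses (hzs : forall a, hz a^s = - hz a)
  (hths : forall a b, a != p -> a != ps -> b \in ths -> hz b < hz a -> a \in ths).

Lemma FoC a b f : Fo a b f = - q a b *: Fo b a f.
Proof.
rewrite !FoE [q b a](ksgnC X); move: (q a b) (ksgnK X a b) (mu a _) (mu b _) => y hy g h.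
transitivity ((y * y * be b) *: g - (y * be a) *: h); first by rewrite hy mul1r.
lmod.
Qed.

(** Positive height excludes the pairs formed by p and ps, and p-weight 0 or 1 excludes p with p, ps
    with ps, and ps with an inner index. There remain F_pb, covered by the hypothesis, and inner
    pairs, which annihilate the vector because [ths] is closed upward for the height. *)
Lemma actF_hwv (Z : V -> Prop) (x : 'I_D -> 'I_D -> K) : subsp Z ->
  (forall a b, x a b != 0 -> 0 < hz a + hz b /\ 0 <= wt X p a + wt X p b <= 1) ->
  (forall b, b != p -> b != ps -> Z (Fo p b vv)) -> Z (actF x vv).
Proof.
move=> sZ hx hZ; apply: subspZ => //; apply: subsp_sum => // a _; apply: subsp_sum => // b _.
have [->|/hx [h0 hw]] := eqVneq (x a b) 0; first by rewrite scale0r; apply: subsp0.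
apply: subspZ => //.
have w1 := wt_p hpp; have w2 : wt X p ps = -1 by rewrite wt_st w1.
have side c d : c = p \/ c = ps -> 0 < hz c + hz d -> 0 <= wt X p c + wt X p d <= 1 -> c = p /\ (d != p) && (d != ps).
  case=> ->.
    rewrite w1 => hh ww; split=> //; apply/andP; split; apply/eqP => E; rewrite E in hh ww.
      by move: ww; rewrite w1.
    by move: hh; rewrite hzs subrr ltxx.
  rewrite w2 => hh ww; have [dE|dp] := eqVneq d p.
    by move: hh; rewrite dE hzs addNr ltxx.
  have [dE|dps] := eqVneq d ps; first by move: ww; rewrite dE w2.
  by move: ww; rewrite wt_neq.
have [/eqP|a1] := boolP ((a == p) || (a == ps)).
  move=> aE; have [|-> /andP[b1 b2]] := side a b _ h0 hw; last exact: hZ.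
  by move/eqP/orP: aE => [] /eqP ->; [left|right].
have [bE|b1] := boolP ((b == p) || (b == ps)).
  have [|||-> /andP[b1 b2]] := side b a _; rewrite 1?addrC //.
    by move/orP: bE => [] /eqP ->; [left|right].
  rewrite FoC; apply: subspZ => //; exact: hZ.
move: a1 b1; rewrite !negb_or => /andP[a1 a2] /andP[b1 b2].
rewrite Fo_hwv //; first exact: subsp0.
  move=> bt; have lt : hz b^s < hz a by rewrite hzs; lia.
  split; first exact: hths lt.
  by apply/eqP => E; move: lt; rewrite E ltxx.
move=> bt; have lt : hz a^s < hz b by rewrite hzs; lia.
split; first exact: hths lt.
by apply/eqP => E; move: lt; rewrite E ltxx.
Qed.

Lemma hwv_Fo_wt b : b != p -> b != ps -> Hd dd (Fo p b vv) /\ Wt X p (- aa%:Z + 1) (Fo p b vv).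
Proof.
move=> b1 b2; split; last by apply: Wt_Fo => //; apply: Wt_hwv.
have hv := Hd_hwv hp hpp aa hN hsz hin hiso.
by have [_ _ h] := smod_Hd X dd; apply: h.
Qed.
End Highest.
End TwoEven.

Lemma actF_xp (x : 'I_D -> 'I_D -> K) d : (forall a b, x a b != 0 -> a != ps /\ b != ps) -> actF x (xp p d) = 0.
Proof.
move=> hx; rewrite /actF /actF big1 ?scaler0 // => a _; apply: big1 => b _.
have [->|/hx [a1 b1]] := eqVneq (x a b) 0; first by rewrite scale0r.
by rewrite FoE !de_xp ?linE ?scaler0 ?subr0 ?scaler0 // st_eq.
Qed.

Lemma hop_xp (h : 'I_D -> K) d : hop X h (xp p d) = (d%:R * h p) *: xp p d.
Proof.
rewrite [xp p d](_ : _ = wd (nseq d p)); last by elim: d => //= d; rewrite /xp /= => ->.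
rewrite hop_wd; congr (_ *: _); elim: d => [|d IH]; rewrite ?big_nil ?mul0r //= big_cons IH -natr1.
by rewrite mulrDl mul1r addrC.
Qed.

Lemma par_xp d : P (xp p d) = xp p d.
Proof.
rewrite [xp p d](_ : _ = wd (nseq d p)); last by elim: d => //= d; rewrite /xp /= => ->.
by rewrite par_wd count_nseq hp scale1r.
Qed.
End Isotropic.
End HalfData.

Section StructureTheorems.
Variables (K : numFieldType) (D : nat) (V : lmodType K) (X : fock D V).
Implicit Types (a b c e : 'I_D) (f g h u v : V) (k : K).

Local Notation mu := (mul X).
Local Notation de := (der X).
Local Notation "a ^s" := (st X a) (at level 2, format "a ^s").
Local Notation P := (par_op X).
Local Notation Lo := (Lo X).
Local Notation Fo := (Fo X).
Local Notation rho := (rho X).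
Local Notation Sdg := (Sdg X).
Local Notation sf := (sf X).

Local Notation Hd := (Hd X).
Local Notation Ad := (Ad X).
Local Notation Wd := (Wd X).
Local Notation smod := (smod X).
Local Notation xp := (xp X).
Local Notation lam := (lam X).

Lemma sf_inj u v : (forall g, sf u g = sf v g) -> u = v.
Proof.
move=> h; apply/eqP; rewrite -subr_eq0; apply/eqP; apply: (sf_lrad (X := X)) => g.
by rewrite sfDl sfNl h subrr.
Qed.

Lemma parity_parts u g : -1 *: (2^-1 *: (u + (-1) ^+ true *: g)) + 2^-1 *: (u + (-1) ^+ false *: g) = g.
Proof. by rewrite -{3}[g]half2 scalerA mulrC -scalerA -scalerDr; congr (_ *: _); lmod. Qed.

Lemma subsp_modsum (M : V -> Prop) (I : finType) u (f : I -> V) : subsp M ->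
  M (u - \sum_i f i) -> (forall i, M (f i)) -> M u.
Proof.
by move=> sM h hf; rewrite -(subrK (\sum_i f i) u); apply: subspD => //; apply: subsp_sum.
Qed.
Lemma sub_sum1 u : u - \sum_(i < 1) u = 0.
Proof. by rewrite big_ord1 subrr. Qed.
Lemma sum_bool2 (f : bool -> V) : \sum_i f i = \sum_(i < 2) f (i == ord0).
Proof. by rewrite big_bool !big_ord_recl big_ord0 addr0. Qed.

Lemma sub_sum_single (i : bool) u : u - \sum_(j : bool) (if j == i then u else 0) = 0.
Proof. by rewrite -big_mkcond big_pred1_eq subrr. Qed.
Lemma sum_bool_opp u : \sum_(j : bool) (if j then u else - u) = 0.
Proof. by rewrite -[RHS](subrr u) big_bool. Qed.
Lemma sfP_l w k u v : sf (k *: u + v) w = k * sf u w + sf v w.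
Proof. by rewrite sfDl sfZl. Qed.
Lemma sfP_r w k u v : sf w (k *: u + v) = k * sf w u + sf w v.
Proof. by rewrite sfDr sfZr. Qed.

Lemma phomog_part (t : bool) u : phomog X t (2^-1 *: (u + (-1) ^+ t *: P u)).
Proof.
by rewrite /phomog PZ PD PZ par_opK scalerA mulrC -scalerA; congr (_ *: _); rewrite scalerDr scalerA -expr2 sqrr_sign scale1r addrC.
Qed.

Lemma smod_ideal : smod (fun u => exists v, u = v - Lo v).
Proof.
split; first split.
- by exists 0; rewrite Lo0 subrr.
- by move=> k u v [x ->] [y ->]; exists (k *: x + y); rewrite LoD LoZ; lmod.
- by move=> u [x ->]; exists (P x); rewrite PD PN par_Lo.
by move=> a b u [x ->]; exists (Fo a b x); rewrite FoD FoN Fo_Lo.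
Qed.

Lemma hop_diag (h : 'I_D -> K) f : \sum_a \sum_b (h a *+ (a == b)) *: mu a (de b f) = hop X h f.
Proof.
apply: eq_bigr => a _; rewrite (bigD1 a) //= eqxx mulr1n big1 ?addr0 // => b ba.
by rewrite eq_sym (negPf ba) mulr0n scale0r.
Qed.

Lemma smod_sum (M : nat -> V -> Prop) : (forall d, smod (M d)) ->
  smod (fun u => exists (k : nat) (F : nat -> V), (forall d, M d (F d)) /\ u = \sum_(d < k) F d).
Proof.
move=> sM; have s0 d := smod_sub (sM d).
split; first split.
- by exists 0%N, (fun=> 0); split; [move=> d; apply: subsp0|rewrite big_ord0].
- move=> k u v [k1 [F [hF ->]]] [k2 [G [hG ->]]].
  exists (maxn k1 k2), (fun d => k *: (if (d < k1)%N then F d else 0) + (if (d < k2)%N then G d else 0)).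
  split; first by move=> d; apply: subspL => //; case: ifP => // _; apply: subsp0.
  rewrite big_split -scaler_sumr /=; congr (_ *: _ + _).
    exact: (esym (cut_sum F (leq_maxl k1 k2))).
  exact: (esym (cut_sum G (leq_maxr k1 k2))).
- move=> u [k [F [hF ->]]]; exists k, (fun d => P (F d)); split; first by move=> d; case: (sM d) => _ h _; apply: h.
  by elim/big_rec2: _ => [|i y z _ <-]; rewrite ?P0 ?PD.
move=> a b u [k [F [hF ->]]]; exists k, (fun d => Fo a b (F d)).
by split; [move=> d; case: (sM d) => _ _; apply|rewrite Fo_sum].
Qed.

Section Isotropic.
Variable p : 'I_D.
Hypotheses (hp : par X p = false) (hpp : p^s != p).

Lemma decomp_quot (d k0 : nat) (M : nat -> V -> Prop) : (k0 <= d./2.+1)%N ->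
  (forall i j : nat, (i < j < k0)%N -> (d%:R - i%:R - j%:R - 1 : K) != rho) ->
  \prod_(i < d./2.+1) ('X - (lam d i)%:P) %| \prod_(j < k0) Gq (lam d j) ->
  (forall (i : nat) u, (i < k0)%N -> M (d - 2 * i)%N u <-> Ad (d - 2 * i) u) ->
  (forall (i : nat) u, (k0 <= i <= d./2)%N -> M (d - 2 * i)%N u -> u = 0) ->
  exists r : nat,
  [/\ forall u, Sdg d u -> exists a : 'I_r -> V, (forall i : 'I_r, M (d - 2 * i)%N (a i)) /\ u = \sum_(i < r) iter i Lo (a i),
      forall a : 'I_r -> V, (forall i : 'I_r, M (d - 2 * i)%N (a i)) -> \sum_(i < r) iter i Lo (a i) = 0 -> forall i, a i = 0,
      (r <= d./2.+1)%N
    & forall (i : nat) u, (r <= i <= d./2)%N -> M (d - 2 * i)%N u -> u = 0].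
Proof.
move=> kd c3 dv hM h0; exists k0; split=> //.
  move=> u hu; have [a [ha ->]] := decomp hp hpp kd c3 dv hu; exists a; split=> // i.
  exact/(hM _ _ (ltn_ord i)).
move=> a ha; apply: (decomp_uniq hp hpp kd c3) => i; exact/(hM _ _ (ltn_ord i)).
Qed.

Section Critical.
Variables (N f0 : nat).
Hypotheses (hN : rho = N%:R) (hf : (N <= f0 <= 2 * N)%N).
Local Notation t := (f0 - N)%N.
Local Notation e := (f0 - 2 * t)%N.
Local Notation LsH := (fun u => exists2 h, Hd e h & u = iter t.+1 Lo h).

Lemma crit_dsum_W :
  let Q := fun b : bool => if b then (fun u => exists2 h, Hd e h & u = iter t Lo h) else Wd f0 in
  [/\ forall (i : bool) u, u = 0 -> Q i u,
      forall u, Sdg f0 u <-> exists2 f : bool -> V, (forall i, Q i (f i)) & u - \sum_i f i = 0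
    & forall f : bool -> V, (forall i, Q i (f i)) -> \sum_i f i = 0 -> forall i, f i = 0].
Proof.
have s1 : subsp (fun u => exists2 h, Hd e h & u = iter t Lo h).
  by apply: (@smod_sub _ _ _ X); apply: smod_iter; apply: smod_Hd.
apply: (@dsum_bool _ _ (Sdg f0) (fun v : V => v = 0)) => //.
- exact: (smod_sub (smod_zero X)).
- exact: Sdg_subsp.
- exact: Wd_subsp.
- by move=> u ->; exact: (subsp0 s1).
- by move=> u ->; apply: subsp0; apply: Wd_subsp.
- move=> u [h [hh _] ->]; have := Sdg_iter_Lo t hh; rewrite subnK //; lia.
- by move=> u; apply: Wd_Sdg.
- move=> u /(crit_Wsplit hp hpp hN hf) [h [w [hh hw ->]]]; exists (iter t Lo h), w; split=> //.
  by exists h.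
by move=> a b [h hh ->] hb /(crit_W0 hp hpp hN hf hh hb) [-> _]; rewrite iter_Lo0.
Qed.

Lemma crit_dsum_A :
  let Q := fun b : bool => if b then Ad f0.+2 else (fun u => exists2 h, Wd f0 h & u = iter 1 Lo h) in
  [/\ forall (i : bool) u, u = 0 -> Q i u,
      forall u, Sdg f0.+2 u <-> exists2 f : bool -> V, (forall i, Q i (f i)) & u - \sum_i f i = 0
    & forall f : bool -> V, (forall i, Q i (f i)) -> \sum_i f i = 0 -> forall i, f i = 0].
Proof.
have s1 : subsp (fun u => exists2 h, Wd f0 h & u = iter 1 Lo h).
  by apply: (@smod_sub _ _ _ X); apply: smod_iter; apply: smod_Wd.
apply: (@dsum_bool _ _ (Sdg f0.+2) (fun v : V => v = 0)) => //.
- exact: (smod_sub (smod_zero X)).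
- exact: Sdg_subsp.
- exact: Ad_subsp.
- by move=> u ->; apply: subsp0; apply: Ad_subsp.
- by move=> u ->; exact: (subsp0 s1).
- by move=> u [].
- by move=> u [h /Wd_Sdg hh ->]; apply: Sdg_Lo.
- move=> u /(crit_Asplit hp hpp hN hf) [a [w [ha hw ->]]]; exists a, (Lo w); split=> //.
  by exists w.
move=> a b ha [w hw ->] /eqP; rewrite addr_eq0 /= => /eqP aE.
have : Ad f0.+2 (Lo w) by rewrite -[Lo w]opprK -aE; apply: subspN => //; apply: Ad_subsp.
by move/(crit_AW0 hp hpp hN hf hw) => w0; rewrite aE w0 Lo0 oppr0.
Qed.

Lemma xp_notin_LsH : ~ LsH (xp p f0.+2).
Proof. by case=> h _; exact: xp_not_Lo. Qed.

Lemma LsH_xp : LsH (iter t.+1 Lo (xp p e)) /\ iter t.+1 Lo (xp p e) <> 0.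
Proof.
split; first by exists (xp p e) => //; apply: Hd_xp.
exact: iter_xp_neq0.
Qed.
End Critical.
End Isotropic.
End StructureTheorems.

(** * The supersymmetric algebra of V *)

Opaque lshift rshift.

HB.lock Definition gmul (R : realType) (m n : nat) (a : 'I_(m + (n + n))) (f : superSym R m n)
  : superSym R m n := smul (gen R a) f.
HB.lock Definition gder (R : realType) (m n : nat) (b : 'I_(m + (n + n))) (f : superSym R m n)
  : superSym R m n := sder b f.
HB.lock Definition sgn_below (R : realType) (m n : nat) (j : 'I_(n + n)) (I : {set 'I_(n + n)})
  : {mpoly R[i][m]} := (-1) ^+ #|[set k in I | (k < j)%N]|.
HB.lock Definition co (R : realType) (m n : nat) (f : superSym R m n) (I : {set 'I_(n + n)})
  : {mpoly R[i][m]} := f I.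
HB.lock Definition pw (R : realType) (m n : nat) (e : bool) (f : superSym R m n)
  : superSym R m n := [ffun I : {set 'I_(n + n)} => (-1) ^+ (e && odd #|I|) *: f I].

Section Calculus.
Variables (R : realType) (m n : nat).
Local Notation C := (R[i]).
Local Notation SV := (superSym R m n).
Local Notation E := {set 'I_(n + n)}.
Local Notation dimV := (m + (n + n))%N.
Implicit Types (f g h : SV) (I J K : E) (a b c : 'I_dimV).

Lemma split_case a : {i : 'I_m | a = lshift (n + n) i} + {j | a = rshift m j}.
Proof. by rewrite -(splitK a); case: (split a) => k; [left|right]; exists k. Qed.

Lemma splitL (i : 'I_m) : split (lshift (n + n) i) = inl i.
Proof. exact: (unsplitK (inl i)). Qed.
Lemma splitR (j : 'I_(n + n)) : split (rshift m j) = inr j.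
Proof. exact: (unsplitK (inr j)). Qed.

Lemma vparL (i : 'I_m) : @vpar m n (lshift (n + n) i) = false.
Proof. by rewrite /vpar splitL. Qed.
Lemma vparR (j : 'I_(n + n)) : @vpar m n (rshift m j) = true.
Proof. by rewrite /vpar splitR. Qed.

Fact mul_linear a : linear (@gmul R m n a).
Proof.
move=> k f g; rewrite unlock; apply/ffunP=> J; rewrite !ffunE /= scaler_sumr -big_split /=.
apply: eq_bigr => I _; rewrite !ffunE mulrDr mulrDr -!scalerAr.
by [].
Qed.
HB.instance Definition _ a := GRing.isLinear.Build C SV SV _ (@gmul R m n a) (mul_linear a).

Fact der_linear a : linear (@gder R m n a).
Proof.
move=> k f g; rewrite unlock /sder; case: split => j; apply/ffunP=> J; rewrite !ffunE.
  by rewrite linearP.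
by case: ifP => _; rewrite ?scaler0 ?addr0 // mulrDr -scalerAr.
Qed.
HB.instance Definition _ a := GRing.isLinear.Build C SV SV _ (@gder R m n a) (der_linear a).

Lemma coP f g : (forall I, co f I = co g I) -> f = g.
Proof. by rewrite unlock => fg; apply/ffunP=> I; apply: fg. Qed.

Lemma coZD (k : C) f g I : co (k *: f + g) I = k *: co f I + co g I.
Proof. by rewrite unlock !ffunE. Qed.
Lemma coZ (k : C) f I : co (k *: f) I = k *: co f I.
Proof. by rewrite unlock !ffunE. Qed.
Lemma coD f g I : co (f + g) I = co f I + co g I.
Proof. by rewrite unlock !ffunE. Qed.
Lemma coN f I : co (- f) I = - co f I.
Proof. by rewrite unlock !ffunE. Qed.
Lemma co0 I : co (0 : SV) I = 0.
Proof. by rewrite unlock !ffunE. Qed.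

Lemma co_mulL i f I : co (gmul (lshift _ i) f) I = 'X_i * co f I.
Proof.
rewrite [co]unlock [gmul]unlock ffunE (bigD1 set0) ?sub0set //= big1 ?addr0; last first.
  move=> J /andP[_ /negPf J0]; rewrite /gen splitL ffunE J0 mul0r mulr0 //.
rewrite /gen splitL ffunE eqxx setD0 /inversions big_set0 expr0 mul1r //.
Qed.

Lemma co_mulR j f I :
  co (gmul (rshift _ j) f) I = if j \in I then sgn_below R m j (I :\ j) * co f (I :\ j) else 0.
Proof.
rewrite [co]unlock [gmul]unlock ffunE; have [jI|jI] := boolP (j \in I); last first.
  rewrite big1 // => J JI; rewrite /gen splitR ffunE.
  case: eqP => [JE|_]; last by rewrite mul0r mulr0.
  by rewrite JE sub1set (negPf jI) in JI.
rewrite (bigD1 [set j]) ?sub1set //= big1 ?addr0; last first.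
  move=> J /andP[_ /negPf J0]; rewrite /gen splitR ffunE J0 mul0r mulr0 //.
by rewrite /gen splitR ffunE eqxx mul1r /inversions big_set1 [sgn_below]unlock.
Qed.

Lemma co_derL i f I : co (gder (lshift _ i) f) I = (co f I)^`M(i).
Proof. by rewrite [co]unlock [gder]unlock /sder splitL ffunE. Qed.

Lemma co_derR j f I :
  co (gder (rshift _ j) f) I = if j \in I then 0 else sgn_below R m j I * co f (j |: I).
Proof. by rewrite [co]unlock [gder]unlock [sgn_below]unlock /sder splitR ffunE. Qed.

Fact pw_linear e : linear (@pw R m n e).
Proof.
rewrite unlock => k f g; apply/ffunP=> I; rewrite !ffunE scalerDr !scalerA; congr (_ + _).
by rewrite mulrC.
Qed.
HB.instance Definition _ e := GRing.isLinear.Build C SV SV _ (@pw R m n e) (pw_linear e).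

Lemma co_pw e f I : co (pw e f) I = (-1) ^+ (e && odd #|I|) *: co f I.
Proof. by rewrite [co]unlock [pw]unlock ffunE. Qed.

Lemma sg_sign j I : exists b : bool, sgn_below R m j I = (-1) ^+ b.
Proof. by exists (odd #|[set k in I | (k < j)%N]|); rewrite [sgn_below]unlock signr_odd. Qed.

Lemma sgU1 j l I : l \notin I -> sgn_below R m j (l |: I) = (-1) ^+ (l < j)%N * sgn_below R m j I.
Proof.
move=> lI; rewrite [sgn_below]unlock -exprD; congr (_ ^+ _).
case: (ltnP l j) => lj.
  rewrite (_ : [set k in _ | _] = l |: [set k in I | (k < j)%N]).
    by rewrite cardsU1 inE (negPf lI).
  by apply/setP=> k; rewrite !inE; case: eqP => [->|].
rewrite add0n; congr #|pred_of_set _|; apply/setP=> k; rewrite !inE.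
by case: eqP => [->|] //=; rewrite ltnNge lj /= andbF.
Qed.

Lemma sgn2 (b : bool) : (-1) ^+ b * (-1) ^+ b = 1 :> {mpoly C[m]}.
Proof. by case: b; rewrite ?expr1 ?mulrNN mulr1. Qed.

Lemma sgD1 j l I : l \in I -> sgn_below R m j (I :\ l) = (-1) ^+ (l < j)%N * sgn_below R m j I.
Proof. by move=> lI; rewrite -{2}(setD1K lI) sgU1 ?setD11 // mulrA sgn2 mul1r. Qed.

Lemma sgs j I : sgn_below R m j I * sgn_below R m j I = 1.
Proof. by rewrite unlock -expr2 sqrr_sign. Qed.

Lemma sg_swap (j l : 'I_(n+n)) : j != l ->
  (-1) ^+ (l < j)%N = - (-1) ^+ (j < l)%N :> {mpoly C[m]}.
Proof.
rewrite -val_eqE /=; case: (ltngtP j l) => //= _ _; by rewrite ?expr0 ?expr1 ?opprK.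
Qed.

Definition qs a b : C := (-1) ^+ (vpar a && vpar b).

End Calculus.

Section Calculus.
Variables (R : realType) (m n : nat).
Local Notation C := (R[i]).
Local Notation SV := (superSym R m n).
Local Notation E := {set 'I_(n + n)}.
Local Notation dimV := (m + (n + n))%N.
Local Notation sg := (@sgn_below R m n).
Local Notation vpar := (@vpar m n).
Implicit Types (f g h : SV) (I J K : E) (a b c : 'I_dimV).

Definition coE := (@coZ R m n, @coD R m n, @coN R m n, @co0 R m n).

Lemma gmul_gmul a b f : gmul a (gmul b f) = (-1) ^+ (vpar a && vpar b) *: gmul b (gmul a f).
Proof.
apply: coP => I.
case: (split_case a) => [] [i ->]; case: (split_case b) => [] [k ->];
  rewrite ?vparL ?vparR /= ?expr0 ?scale1r ?expr1 ?scaleN1r ?coN ?co_mulL ?co_mulR ?co_mulL.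
- by rewrite mulrCA.
- by case: ifP => // _; rewrite ?mulr0 // mulrCA.
- by case: ifP => _; rewrite ?mulr0 // mulrCA.
rewrite !inE.
case: (altP (i =P k)) => [->|ik].
  by rewrite eqxx /= !mulr0 !if_same oppr0.
rewrite [k == i]eq_sym (negPf ik) /=.
case: ifP => iI; case: ifP => kI; rewrite /= ?mulr0 ?oppr0 //.
have iIk: i \in I :\ k by rewrite !inE ik.
have -> : I :\ i :\ k = I :\ k :\ i by apply/setP=> x; rewrite !inE andbCA.
rewrite (sgD1 R m i iI) (sgD1 R m k iIk) (sgD1 R m i iIk) (sgD1 R m i kI) (sgD1 R m k kI).
rewrite !ltnn (sg_swap R m ik) !mul1r.
move: (sg _ _) (sg _ _) (co _ _) (_ ^+ _) => x y z t; ring.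
Qed.

Lemma mderiv_sg i j I p : (sg j I * p)^`M(i) = sg j I * p^`M(i).
Proof. by have [[] ->] := sg_sign R m j I; rewrite ?expr0 ?expr1 ?mul1r ?mulN1r ?mderivN. Qed.

Lemma gder_gder a b f : gder a (gder b f) = (-1) ^+ (vpar a && vpar b) *: gder b (gder a f).
Proof.
apply: coP => I.
case: (split_case a) => [] [i ->]; case: (split_case b) => [] [k ->];
  rewrite ?vparL ?vparR /= ?expr0 ?scale1r ?expr1 ?scaleN1r ?coN ?co_derL ?co_derR ?co_derL.
- by rewrite mderiv_comm.
- by case: ifP => // _; rewrite ?linear0 // mderiv_sg.
- by case: ifP => // _; rewrite ?linear0 // mderiv_sg.
rewrite !inE.
case: (altP (i =P k)) => [->|ik].
  by rewrite eqxx /= !mulr0 !if_same oppr0.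
rewrite (eq_sym k) (negPf ik) /=.
case: ifP => iI; case: ifP => kI; rewrite /= ?mulr0 ?oppr0 //.
have -> : k |: (i |: I) = i |: (k |: I) by rewrite setUCA.
rewrite (@sgU1 R m n i k) ?kI // (@sgU1 R m n k i) ?iI // (sg_swap R m ik).
move: (sg _ _) (sg _ _) (co _ _) (_ ^+ _) => x y z t; ring.
Qed.

Lemma gder_gmul a b f : gder a (gmul b f) =
  (a == b)%:R *: f + (-1) ^+ (vpar a && vpar b) *: gmul b (gder a f).
Proof.
apply: coP => I.
case: (split_case a) => [] [i ->]; case: (split_case b) => [] [k ->];
  rewrite ?vparL ?vparR /= ?expr0 ?scale1r ?expr1 ?scaleN1r !coE.
- rewrite co_derL !co_mulL co_derL mderivM mderivX mnm1E eq_lshift eq_sym.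
  congr (_ + _); case: eqP => [->|_]; rewrite ?scale0r ?mul0r //.
  by rewrite -[X in 'X_[X - _]]addm0 addmC addmK mpolyX0 !scale1r mul1r.
- rewrite eq_lrshift scale0r add0r co_derL !co_mulR; case: ifP; rewrite ?linear0 // => kI.
  by rewrite mderiv_sg co_derL.
- rewrite eq_rlshift scale0r add0r co_derR !co_mulL co_derR; case: ifP; rewrite ?mulr0 // => iI.
  by rewrite mulrCA.
rewrite co_derR !co_mulR eq_rshift !inE co_derR.
case: (altP (i =P k)) => [->|ik].
  rewrite eqxx /= scale1r; case: ifP => kI.
    by rewrite in_setD1 eqxx /= setD1K // mulrA sgs mul1r subrr.
  by rewrite setU1K ?kI // mulrA sgs mul1r oppr0 addr0.
rewrite [k == i]eq_sym (negPf ik) scale0r add0r /=.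
case: (boolP (k \in I)) => kI; last by rewrite mulr0 oppr0 if_same.
have -> : (i \in I :\ k) = (i \in I) by rewrite in_setD1 ik.
case: (boolP (i \in I)) => iI; first by rewrite mulr0 oppr0.
have -> : (i |: I) :\ k = i |: (I :\ k).
  by apply/setP=> x; rewrite !inE; case: (altP (x =P i)) => [->|]; rewrite ?ik ?orbF //= andbF.
rewrite (@sgU1 R m n k i) ?in_setD1 ?ik //= (sgD1 R m k kI) (sgD1 R m i kI) ltnn mul1r (sg_swap R m ik).
move: (sg _ _) (sg _ _) (co _ _) (_ ^+ _) => x y z t; ring.
Qed.

Lemma gmulP a (x : C) f g : gmul a (x *: f + g) = x *: gmul a f + gmul a g. Proof. exact: linearP. Qed.
Lemma gderP a (x : C) f g : gder a (x *: f + g) = x *: gder a f + gder a g. Proof. exact: linearP. Qed.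
Lemma gder0 a : gder a (0 : SV) = 0. Proof. exact: linear0. Qed.
Lemma gderZ a (x : C) f : gder a (x *: f) = x *: gder a f. Proof. exact: linearZ. Qed.
Lemma pwP (e : bool) (x : C) f g : pw e (x *: f + g) = x *: pw e f + pw e g. Proof. exact: linearP. Qed.
Lemma gmul0 a : gmul a (0 : SV) = 0. Proof. exact: linear0. Qed.
Lemma pw0 (e : bool) : pw e (0 : SV) = 0. Proof. exact: linear0. Qed.

Lemma gpw_gmul a f : pw true (gmul a f) = (-1) ^+ vpar a *: gmul a (pw true f).
Proof.
apply: coP => I; case: (split_case a) => [] [i ->]; rewrite ?vparL ?vparR co_pw coZ /=.
  by rewrite !co_mulL co_pw expr0 scale1r -scalerAr.
rewrite !co_mulR; case: ifP => iI; last by rewrite !scaler0.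
rewrite co_pw -scalerAr scalerA (cardsD1 i I) iI /= add0n expr1.
by case: odd; rewrite /= ?expr0 ?expr1 ?mulN1r ?scaleN1r ?scale1r ?mulr1 ?opprK ?scaleNr ?scale1r.
Qed.

Lemma gpw_gder a f : pw true (gder a f) = (-1) ^+ vpar a *: gder a (pw true f).
Proof.
apply: coP => I; case: (split_case a) => [] [i ->]; rewrite ?vparL ?vparR co_pw coZ /=.
  by rewrite !co_derL co_pw expr0 scale1r mderivZ.
rewrite !co_derR; case: ifP => iI; first by rewrite !scaler0.
rewrite co_pw -scalerAr scalerA cardsU1 iI /=.
by case: odd; rewrite /= ?expr0 ?expr1 ?mulN1r ?scaleN1r ?scale1r ?mulr1 ?opprK ?scaleNr ?scale1r.
Qed.

Lemma pwK f : pw true (pw true f) = f.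
Proof. by apply: coP => I; rewrite !co_pw scalerA -expr2 sqrr_sign scale1r. Qed.

Lemma co_sone I : co (sone R m n) I = (I == set0)%:R.
Proof. by rewrite [co]unlock ffunE; case: eqP. Qed.

Lemma pw_one : pw true (sone R m n) = sone R m n.
Proof.
apply: coP => I; rewrite co_pw co_sone; case: eqP => [->|_]; last by rewrite scaler0.
by rewrite cards0 expr0 scale1r.
Qed.

Lemma gder_one a : gder a (sone R m n) = 0.
Proof.
apply: coP => I; case: (split_case a) => [] [i ->]; rewrite co0 ?co_derL ?co_derR !co_sone.
  by case: eqP => _; rewrite ?linear0 // mderivC.
case: ifP => // iI; rewrite (_ : (i |: I == set0) = false) ?mulr0 //.
by apply/eqP => /setP/(_ i); rewrite !inE eqxx.
Qed.

Definition single (I : E) (p : {mpoly C[m]}) : SV := [ffun J => if J == I then p else 0].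
Lemma co_single I p J : co (single I p) J = if J == I then p else 0.
Proof. by rewrite [co]unlock ffunE. Qed.

Lemma single_lin I (k : C) p r : single I (k *: p + r) = k *: single I p + single I r.
Proof. by apply: coP => J; rewrite !coE !co_single; case: eqP; rewrite ?scaler0 ?addr0. Qed.

Lemma single0 I : single I 0 = 0.
Proof. by apply: coP => J; rewrite co0 co_single if_same. Qed.

Lemma gmulL_single i I p : gmul (lshift _ i) (single I p) = single I ('X_i * p).
Proof. by apply: coP => J; rewrite co_mulL !co_single; case: eqP; rewrite ?mulr0. Qed.

Lemma gmulR_single j I p : gmul (rshift _ j) (single I p) =
  if j \in I then 0 else single (j |: I) (sg j I * p).
Proof.
apply: coP => J; rewrite co_mulR co_single.
have [jJ|jJ] := boolP (j \in J); last first.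
  case: ifP => jI; rewrite ?co0 // co_single; case: eqP => // JE.
  by rewrite JE !inE eqxx in jJ.
case: (altP (J :\ j =P I)) => [<-|ne].
  by rewrite in_setD1 eqxx /= co_single setD1K // eqxx.
case: ifP => jI; rewrite ?co0 ?mulr0 // co_single; case: eqP => // JE.
by rewrite JE setU1K ?jI ?eqxx in ne.
Qed.

Lemma sum_single f : f = \sum_I single I (co f I).
Proof.
apply/ffunP => J; rewrite sum_ffunE (bigD1 J) //= ffunE eqxx big1 ?addr0; first by rewrite [co]unlock.
by move=> I /negPf IJ; rewrite ffunE eq_sym IJ.
Qed.

Lemma sv_ind0 (Q : SV -> Prop) : Q 0 ->
  (forall (k : C) u v, Q u -> Q v -> Q (k *: u + v)) ->
  (forall I k, Q (single I 'X_[k])) -> forall u, Q u.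
Proof.
move=> Q0 Ql0 Qs u; rewrite (sum_single u).
elim/big_rec: _ => // I v _ Qv; rewrite -[single _ _]scale1r; apply: (Ql0) => //.
elim/mpolyind: (co u I) => [|c k p _ _ IH]; first by rewrite single0.
by rewrite single_lin; apply: Ql0.
Qed.

Lemma sv_ind (Q : SV -> Prop) : Q (sone R m n) ->
  (forall (k : C) u v, Q u -> Q v -> Q (k *: u + v)) ->
  (forall a u, Q u -> Q (gmul a u)) -> forall u, Q u.
Proof.
move=> Q1 Ql Qm; have Q0 : Q 0.
  by have := Ql (-1) _ _ Q1 Q1; rewrite scaleN1r addNr.
apply: sv_ind0 => // I k.
have [N] := ubnP #|I|; elim: N I => // N IH I IN.
have [->|[j jI]] := set_0Vmem I; last first.
  have h : Q (single (I :\ j) 'X_[k]) by apply: IH; rewrite (cardsD1 j) jI in IN.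
  have := Qm (rshift _ j) _ h; rewrite gmulR_single in_setD1 eqxx /= setD1K //.
  have [[] ->] := sg_sign R m j (I :\ j); rewrite ?expr0 ?expr1 ?mul1r // mulN1r => h'.
  have := Ql (-1) _ _ h' Q0; rewrite addr0.
  have -> : single I (- 'X_[k]) = - single I 'X_[k].
    by apply: coP => J; rewrite coN !co_single; case: eqP; rewrite ?oppr0.
  by rewrite scaleN1r opprK.
clear IH IN I N; have [d] := ubnP (mdeg k); elim: d k => // d IHk k kd.
have [i ki|k0] := pickP (fun i => k i != 0%N); last first.
  have -> : k = 0%MM by apply/mnmP => i; rewrite mnm0E; apply/eqP; have := k0 i => /negbFE.
  suff <- : sone R m n = single set0 'X_[0] by [].
  by apply: coP => J; rewrite co_single co_sone mpolyX0; case: eqP.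
have kE : k = (U_(i) + (k - U_(i)))%MM.
  by rewrite addmC submK // lep1mP.
have := Qm (lshift _ i) (single set0 'X_[(k - U_(i))%MM]); rewrite gmulL_single -mpolyXD -kE; apply.
by apply: IHk; rewrite kE mdegD mdeg1 in kd.
Qed.

Definition geps f : C := (co f set0)@_0%MM.
Lemma geps_lin (k : C) f g : geps (k *: f + g) = k * geps f + geps g.
Proof. by rewrite /geps coZD mcoeffD mcoeffZ. Qed.
Lemma geps_one : geps (sone R m n) = 1.
Proof. by rewrite /geps co_sone eqxx mcoeff1 eqxx. Qed.
Lemma geps_mul a f : geps (gmul a f) = 0.
Proof.
rewrite /geps; case: (split_case a) => [] [i ->]; rewrite ?co_mulL ?co_mulR ?inE ?mcoeff0 //.
by rewrite rmorphM /= mcoeffX mnm1_eq0 mul0r.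
Qed.
End Calculus.

Definition star (m n : nat) (a : 'I_(m + (n + n))) : 'I_(m + (n + n)) :=
  match split a with inl i => lshift (n + n) (rev_ord i) | inr j => rshift m (rev_ord j) end.
HB.lock Definition ct (R : realType) (m n : nat) (B : 'M[R[i]]_(m + (n + n))) a (f : superSym R m n)
  : superSym R m n := B a (star a) *: gder (star a) f.

(** * The induced form on S(V) as an iterated contraction *)

Section Form.
Variables (R : realType) (m n : nat).
Local Notation C := (R[i]).
Local Notation SV := (superSym R m n).
Local Notation E := {set 'I_(n + n)}.
Local Notation dimV := (m + (n + n))%N.
Local Notation sg := (@sgn_below R m n).
Local Notation vpar := (@vpar m n).
Implicit Types (f g h : SV) (I J : E) (a b c : 'I_dimV).

Local Notation star := (@star m n).
Lemma starL (i : 'I_m) : star (lshift (n + n) i) = lshift (n + n) (rev_ord i).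
Proof. by rewrite /star splitL. Qed.
Lemma starR (j : 'I_(n + n)) : star (rshift m j) = rshift m (rev_ord j).
Proof. by rewrite /star splitR. Qed.
Lemma starK : involutive star.
Proof.
by move=> a; case: (split_case a) => [] [i ->]; rewrite ?starL ?starR ?starL ?rev_ordK.
Qed.
Lemma vpar_star a : vpar (star a) = vpar a.
Proof. by case: (split_case a) => [] [i ->]; rewrite ?starL ?starR ?vparL ?vparR. Qed.
Lemma star_eq a b : (star a == b) = (a == star b).
Proof. by rewrite -{1}(starK b) (inj_eq (can_inj starK)). Qed.

Section Antidiagonal.
Variable B : 'M[C]_dimV.
Hypotheses (Banti : forall a b, b != star a -> B a b = 0)
  (Bsym : forall a b, B b a = (-1) ^+ (vpar a && vpar b) * B a b).
Definition bt a : C := B a (star a).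

Lemma bt_star a : bt (star a) = (-1) ^+ vpar a * bt a.
Proof. by rewrite /bt starK Bsym vpar_star andbb. Qed.

Lemma contractE a f : contract B a f = bt a *: gder (star a) f.
Proof.
rewrite /contract (bigD1 (star a)) //= big1 ?addr0; first by rewrite unlock.
by move=> b /Banti ->; rewrite scale0r.
Qed.
Local Notation ct := (@ct R m n B).
Lemma ctE a f : ct a f = bt a *: gder (star a) f. Proof. by rewrite unlock. Qed.
Lemma ctP a (x : C) f g : ct a (x *: f + g) = x *: ct a f + ct a g.
Proof. by rewrite !ctE gderP scalerDr !scalerA [_ * x]mulrC. Qed.
Lemma ct0 a : ct a 0 = 0. Proof. by rewrite ctE gder0 scaler0. Qed.
Lemma ctZ a (x : C) f : ct a (x *: f) = x *: ct a f.
Proof. by have := ctP a x f 0; rewrite ct0 !addr0. Qed.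
Lemma ct_ct a b f : ct a (ct b f) = (-1) ^+ (vpar a && vpar b) *: ct b (ct a f).
Proof.
rewrite !ctE !gderZ gder_gder !vpar_star !scalerA; congr (_ *: _).
by rewrite mulrC [bt b * _]mulrC.
Qed.
Lemma ctL (i : 'I_m) a f : ct a (ct (lshift _ i) f) = ct (lshift _ i) (ct a f).
Proof. by rewrite ct_ct vparL andbF scale1r. Qed.

Definition cev (k : 'X_{1..m}) l g := foldr (fun i g => iter (k i) (ct (lshift (n + n) i)) g) g l.
Definition cod (s : seq 'I_(n + n)) g := foldr (fun j g => ct (rshift m j) g) g s.

Lemma contract_monE k I g : contract_mon B k I g = cev k (enum 'I_m) (cod (enum I) g).
Proof.
have h a : contract B a = ct a :> (SV -> SV) by apply: funext => f; rewrite contractE ctE.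
rewrite /contract_mon /cev /cod; congr foldr.
  by apply: funext => i; apply: funext => f; rewrite h.
by elim: (enum I) => //= j s ->; rewrite h.
Qed.

Lemma cev_lin k l (x : C) f g : cev k l (x *: f + g) = x *: cev k l f + cev k l g.
Proof. by elim: l => //= i l ->; elim: (k i) => //= j ->; rewrite ctP. Qed.
Lemma cod_lin l (x : C) f g : cod l (x *: f + g) = x *: cod l f + cod l g.
Proof. by elim: l => //= i l ->; rewrite ctP. Qed.

Lemma cev_ct k l i g : cev k l (ct (lshift _ i) g) = ct (lshift _ i) (cev k l g).
Proof. by elim: l => //= x l ->; elim: (k x) => //= j ->; rewrite ctL. Qed.
Lemma cod_ctL l i g : cod l (ct (lshift _ i) g) = ct (lshift _ i) (cod l g).
Proof. by elim: l => //= x l ->; rewrite ctL. Qed.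

Lemma cev_U0 k l i g : i \notin l -> cev (U_(i) + k)%MM l g = cev k l g.
Proof.
elim: l => //= x l IH; rewrite inE negb_or => /andP[ix /IH ->].
by rewrite mnmDE mnm1E (negPf ix).
Qed.
Lemma cev_U k l i g : uniq l -> i \in l -> cev (U_(i) + k)%MM l g = cev k l (ct (lshift _ i) g).
Proof.
elim: l => //= x l IH /andP[xl ul]; rewrite inE => /orP[/eqP ix|il].
  by rewrite -ix in xl *; rewrite cev_U0 // mnmDE mnm1E eqxx add1n cev_ct -iterSr.
rewrite IH // mnmDE mnm1E (_ : (i == x) = false) //.
by apply: contraNF xl => /eqP <-.
Qed.

Lemma contract_monU k I i g : contract_mon B (U_(i) + k)%MM I g = contract_mon B k I (ct (lshift _ i) g).
Proof. by rewrite !contract_monE cev_U ?enum_uniq ?mem_enum // cod_ctL. Qed.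

Lemma cod_ctR s j g : cod s (ct (rshift _ j) g) = (-1) ^+ size s *: ct (rshift _ j) (cod s g).
Proof.
elim: s => [|x s IH] /=; first by rewrite scale1r.
by rewrite IH ctZ ct_ct !vparR /= scalerA -exprSr.
Qed.

Lemma ctR0 j g : ct (rshift _ j) (ct (rshift _ j) g) = 0.
Proof.
have := ct_ct (rshift m j) (rshift m j) g; rewrite !vparR /= expr1 scaleN1r => /eqP.
by rewrite -subr_eq0 opprK -mulr2n -scaler_nat scaler_eq0 pnatr_eq0 => /eqP.
Qed.

Lemma cod_mem0 s j g : j \in s -> cod s (ct (rshift _ j) g) = 0.
Proof.
elim: s => //= x s IH; rewrite inE => /orP[/eqP <-|/IH ->]; last by rewrite ct0.
by rewrite cod_ctR ctZ ctR0 scaler0.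
Qed.

Local Notation rl := (relpre (@nat_of_ord (n + n)) ltn).
(** Contractions by odd generators anticommute, and the one for j has to pass those of the larger
    indices of I. *)
Lemma cod_U1 (l : seq 'I_(n + n)) I (j : 'I_(n + n)) g : sorted rl l -> j \in l -> j \notin I ->
  cod [seq k <- l | k \in j |: I] g =
  (-1) ^+ size [seq k : 'I_(n + n) <- l | (j < k)%N && (k \in I)] *: cod [seq k <- l | k \in I] (ct (rshift _ j) g).
Proof.
move=> sl jl jI; have tr : transitive rl by move=> x y z; apply: ltn_trans.
elim: l sl jl => //= x l IH; rewrite path_sortedE // => /andP[/allP ax sl].
rewrite inE; have [jx _|xj /= jl] := eqVneq j x.
  rewrite -jx in ax *; have jl' : j \notin l by apply/negP => /ax /=; rewrite ltnn.
  have e1 : [seq k <- l | k \in j |: I] = [seq k <- l | k \in I].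
    apply: eq_in_filter => k kl; rewrite !inE; case: eqP => // kj; by rewrite -kj kl in jl'.
  rewrite !inE eqxx (negPf jI) /= ltnn /= e1.
  have -> : [seq k : 'I_(n + n) <- l | (j < k)%N && (k \in I)] = [seq k <- l | k \in I].
    by apply: eq_in_filter => k /ax /= ->.
  by rewrite cod_ctR scalerA -expr2 sqrr_sign scale1r.
have xlj : (x < j)%N by have := ax j jl.
rewrite !inE [x == j]eq_sym (negPf xj) ltnNge (ltnW xlj) /=.
by case: ifP => /= _; rewrite IH // ctZ.
Qed.

Lemma enum_setE (N : nat) (I : {set 'I_N}) : enum I = [seq k <- enum 'I_N | k \in I].
Proof. by rewrite {1}/enum_mem -enumT; apply: eq_filter => k. Qed.

Lemma contract_monU1 k j I g : j \notin I -> contract_mon B k (j |: I) g =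
  (-1) ^+ #|[set l in I | (j < l)%N]| *: contract_mon B k I (ct (rshift _ j) g).
Proof.
move=> jI; rewrite !contract_monE !enum_setE cod_U1 ?mem_enum //; last first.
  by rewrite -sorted_map val_enum_ord iota_ltn_sorted.
set h := cod _ _; set z := (-1) ^+ _; have := cev_lin k (enum 'I_m) z h 0.
have c0 : cev k (enum 'I_m) 0 = 0.
  by elim: (enum _) => //= i s ->; elim: (k i) => //= q ->; rewrite ct0.
rewrite c0 !addr0 => ->; congr ((-1) ^+ _ *: _).
by rewrite cardE enum_setE; congr size; apply: eq_filter => x; rewrite !inE andbC.
Qed.

Lemma contract_mon_mem k j I g : j \in I -> contract_mon B k I (ct (rshift _ j) g) = 0.
Proof.
move=> jI; rewrite contract_monE cod_mem0 ?mem_enum //.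
by elim: (enum _) => //= i s ->; elim: (k i) => //= q ->; rewrite ct0.
Qed.

Lemma contract_mon_lin k I (x : C) f g :
  contract_mon B k I (x *: f + g) = x *: contract_mon B k I f + contract_mon B k I g.
Proof. by rewrite !contract_monE cod_lin cev_lin. Qed.

Definition msum (F : 'X_{1..m} -> C) (p : {mpoly C[m]}) := \sum_(k <- msupp p) p@_k * F k.
Lemma msum_wide F p r : uniq r -> {subset msupp p <= r} -> msum F p = \sum_(k <- r) p@_k * F k.
Proof.
move=> ur sr; rewrite [RHS](bigID (mem (msupp p))) /= [X in _ + X]big1 ?addr0; last first.
  by move=> k kp; rewrite memN_msupp_eq0 // mul0r.
rewrite -big_filter; apply: perm_big; apply: uniq_perm; rewrite ?msupp_uniq ?filter_uniq // => k.
by rewrite mem_filter; case: (boolP (k \in msupp p)) => // /sr ->.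
Qed.
Lemma msum_lin F (x : C) p r : msum F (x *: p + r) = x * msum F p + msum F r.
Proof.
pose l := undup (msupp (x *: p + r) ++ msupp p ++ msupp r).
rewrite !(@msum_wide _ _ l) ?undup_uniq //; try by move=> k kp; rewrite mem_undup !mem_cat kp ?orbT.
by rewrite mulr_sumr -big_split; apply: eq_bigr => k _; rewrite /= mcoeffD mcoeffZ mulrDl mulrA.
Qed.
Lemma msum0 F : msum F 0 = 0. Proof. by rewrite /msum msupp0 big_nil. Qed.

Lemma sformE f g : sform B f g = \sum_I msum (fun k => geps (contract_mon B k I g)) (co f I).
Proof. by rewrite [co]unlock /sform /msum /geps [co]unlock. Qed.

Lemma sform_linl (x : C) f g h : sform B (x *: f + g) h = x * sform B f h + sform B g h.
Proof.
by rewrite !sformE mulr_sumr -big_split; apply: eq_bigr => I _; rewrite coZD msum_lin.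
Qed.
Lemma sform_linr (x : C) f g h : sform B h (x *: f + g) = x * sform B h f + sform B h g.
Proof.
rewrite !sformE mulr_sumr -big_split; apply: eq_bigr => I _; rewrite /msum mulr_sumr -big_split.
by apply: eq_bigr => k _; rewrite /= contract_mon_lin geps_lin; ring.
Qed.

Lemma sform_single I p g : sform B (single I p) g = msum (fun k => geps (contract_mon B k I g)) p.
Proof.
rewrite sformE (bigD1 I) //= co_single eqxx big1 ?addr0 // => J /negPf JI.
by rewrite co_single JI msum0.
Qed.

Lemma msumX F k : msum F 'X_[k] = F k.
Proof. by rewrite /msum msuppX big_seq1 mcoeffX eqxx mul1r. Qed.

Lemma sform_one g : sform B (sone R m n) g = geps g.
Proof.
have -> : sone R m n = single set0 'X_[0].
  by apply: coP => J; rewrite co_single co_sone mpolyX0; case: eqP.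
rewrite sform_single msumX contract_monE enum_set0 /=; congr geps.
by elim: (enum _) => //= i s ->; rewrite mnm0E.
Qed.

Lemma sform0 g : sform B 0 g = 0.
Proof. by have := sform_linl (-1) (0 : SV) 0 g; rewrite scaler0 addr0 mulN1r addNr. Qed.
Lemma sformZ (x : C) f g : sform B (x *: f) g = x * sform B f g.
Proof. by have := sform_linl x f 0 g; rewrite sform0 !addr0. Qed.
(** For an odd generator, multiplication gives the sign counting the indices of I below it and
    contraction the sign counting those above it. Together they are (-1)^#|I|, the parity
    automorphism. *)
Lemma sform_mul a f g : sform B (gmul a f) g = sform B (if vpar a then pw true f else f) (bt a *: gder (star a) g).
Proof.
rewrite -ctE; elim/sv_ind0: f => [|x u v hu hv|I k].
- by rewrite gmul0 sform0; case: (vpar a); rewrite ?pw0 sform0.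
- rewrite gmulP sform_linl hu hv; case: ifP => _; last by rewrite sform_linl.
  by rewrite pwP sform_linl.
case: (split_case a) => [] [i ->]; rewrite ?vparL ?vparR.
  by rewrite gmulL_single -mpolyXD !sform_single !msumX contract_monU.
have -> : pw true (single I 'X_[k]) = (-1) ^+ #|I| *: single I ('X_[k] : {mpoly C[m]}).
  apply: coP => J; rewrite co_pw coZ co_single; case: eqP => [->|_]; last by rewrite !scaler0.
  by rewrite /= signr_odd.
rewrite gmulR_single sformZ sform_single msumX; case: ifP => iI.
  rewrite sform0 contract_mon_mem //.
  have -> : geps (0 : SV) = 0 by rewrite /geps co0 mcoeff0.
  by rewrite mulr0.
have -> : single (i |: I) (sg i I * 'X_[k]) = (-1) ^+ #|[set k in I | (k < i)%N]| *: single (i |: I) ('X_[k] : {mpoly C[m]}).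
  apply: coP => J; rewrite coZ !co_single; case: eqP => _; rewrite ?scaler0 //.
  by rewrite [sgn_below]unlock -[in LHS]signr_odd -[in RHS]signr_odd; case: odd; rewrite ?expr0 ?expr1 ?mul1r ?mulN1r ?scale1r ?scaleN1r.
rewrite sformZ sform_single msumX contract_monU1 ?iI //.
have gZ (x : C) (u : SV) : geps (x *: u) = x * geps u by rewrite /geps coZ mcoeffZ.
rewrite gZ mulrA -exprD; congr ((-1) ^+ _ * _).
rewrite -(cardsID [set l : 'I_(n + n) | (l < i)%N] I); congr (_ + _)%N; apply: eq_card => x; rewrite !inE //.
case: (ltngtP x i) => xi; rewrite /= ?andbT ?andbF //.
by apply/esym/negbTE; move/val_inj: xi => ->; rewrite iI.
Qed.
End Antidiagonal.
End Form.

Lemma half_scale (K : numFieldType) (V : lmodType K) (u : V) : 2^-1 *: (u + u) = u.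
Proof. by rewrite -mulr2n -scaler_nat scalerA mulVf ?scale1r // pnatr_eq0. Qed.

Section Signs.
Variables (K : comNzRingType) (a b : bool) (x y : K).
Lemma sign_aux1 : (true%:R * y - (-1) ^+ (a && b) * false%:R * x) * x +
  (-1) ^+ ((a (+) b) && b) * ((-1) ^+ b * y * (false%:R * y - (-1) ^+ (a && b) * true%:R * x)) = 0.
Proof. by case: a; case: b; rewrite /= ?expr0 ?expr1; ring. Qed.
Lemma sign_aux2 : (false%:R * y - (-1) ^+ (a && b) * true%:R * x) * y +
  (-1) ^+ ((a (+) b) && a) * ((-1) ^+ a * x * (true%:R * y - (-1) ^+ (a && b) * false%:R * x)) = 0.
Proof. by case: a; case: b; rewrite /= ?expr0 ?expr1; ring. Qed.
Lemma sign_aux3 : (true%:R * x - (-1) ^+ (a && a) * true%:R * x) * x +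
  (-1) ^+ ((a (+) a) && a) * ((-1) ^+ a * x * (true%:R * x - (-1) ^+ (a && a) * true%:R * x)) = 0.
Proof. by case: a; rewrite /= ?expr0 ?expr1; ring. Qed.
End Signs.

(** * The product of S(V) and matrices preserving a form *)

Section Osp.
Variables (R : realType) (m n : nat).
Local Notation C := (R[i]).
Local Notation SV := (superSym R m n).
Local Notation E := {set 'I_(n + n)}.
Local Notation dimV := (m + (n + n))%N.
Local Notation sg := (@sgn_below R m n).
Local Notation vpar := (@vpar m n).
Local Notation star := (@star m n).
Local Notation preserves := (@preserves R m n).
Implicit Types (f g h : SV) (I J : E) (a b c : 'I_dimV) (X B G : 'M[C]_dimV).

Lemma co_smul f g I : co (smul f g) I = \sum_(J : E | J \subset I) (-1) ^+ inversions J (I :\: J) * (co f J * co g (I :\: J)).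
Proof. by rewrite [co]unlock ffunE. Qed.

Lemma smul_linl (k : C) f g h : smul (k *: f + g) h = k *: smul f h + smul g h.
Proof.
apply: coP => I; rewrite coZD !co_smul scaler_sumr -big_split; apply: eq_bigr => J _ /=.
by rewrite coZD mulrDl mulrDr -!scalerAl -scalerAr.
Qed.

(** For an odd generator the subsets containing i are reindexed by J -> i |: J; the sign agrees
    because the indices below i split into those inside and those outside J. *)
Lemma smul_gmul a f g : smul (gmul a f) g = gmul a (smul f g).
Proof.
apply: coP => I; case: (split_case a) => [] [i ->].
  rewrite co_mulL !co_smul mulr_sumr; apply: eq_bigr => J _.
  by rewrite co_mulL -mulrA mulrCA.
rewrite co_mulR co_smul; case: ifP => iI; last first.
  rewrite big1 // => J JI; rewrite co_mulR; case: ifP => iJ; rewrite ?mul0r ?mulr0 //.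
  by rewrite (subsetP JI) in iI.
rewrite (bigID (fun J : E => i \in J)) /= [X in _ + X]big1 ?addr0; last first.
  by move=> J /andP[_ /negPf iJ]; rewrite co_mulR iJ mul0r mulr0.
rewrite co_smul mulr_sumr (reindex_onto (fun J : E => i |: J) (fun J : E => J :\ i)) /=; last first.
  by move=> J /andP[_ iJ]; rewrite setD1K.
apply: eq_big => J; last first.
  move=> /andP[/andP[JI _] /eqP JE].
  have iJ : i \notin J by rewrite -JE in_setD1 eqxx.
  rewrite co_mulR setU11 JE.
  have -> : I :\: (i |: J) = (I :\ i) :\: J by rewrite setDDl.
  set L := _ :\: J; rewrite /inversions big_setU1 // exprD -/(inversions J L).
  have -> : sg i (I :\ i) = (-1) ^+ #|[set j in L | (j < i)%N]| * sg i J.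
    rewrite [sgn_below]unlock -exprD; congr (_ ^+ _).
    rewrite -(cardsID J [set k in I :\ i | (k < i)%N]) addnC; congr (_ + _)%N; apply: eq_card => x; rewrite !inE.
      by rewrite andbA.
    have [xJ|] := boolP (x \in J); rewrite ?andbF // andbT.
    have xI : x \in I by apply: (subsetP JI); rewrite inE xJ orbT.
    by rewrite xI andbT; case: eqP xJ iJ => [->->|].
  move: (_ ^+ _) (_ ^+ _) (sg _ _) (co _ _) (co _ _) => x y z u v; ring.
rewrite setU11 andbT subsetD1 subUset sub1set iI /=.
case: (boolP (J \subset I)) => //= JI; have [iJ|iJ] := boolP (i \in J).
  by apply/eqP => JE; rewrite -JE in_setD1 eqxx in iJ.
by rewrite setU1K // eqxx.
Qed.

Lemma smul_one f : smul (sone R m n) f = f.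
Proof.
apply: coP => I; rewrite co_smul (bigD1 set0) ?sub0set //= big1 ?addr0.
  by rewrite co_sone eqxx setD0 /inversions big_set0 expr0 !mul1r.
by move=> J /andP[_ /negPf J0]; rewrite co_sone J0 mul0r mulr0.
Qed.

Lemma gen_gmul a : gen R a = gmul a (sone R m n).
Proof.
apply: coP => I; rewrite [co]unlock /gen; case: (split_case a) => [] [i ->]; rewrite ?splitL ?splitR ffunE.
  by have := co_mulL i (sone R m n) I; rewrite co_sone [co]unlock => ->; case: eqP; rewrite ?mulr1 ?mulr0.
have := co_mulR i (sone R m n) I; rewrite co_sone [co]unlock => ->.
case: (altP (I =P [set i])) => [->|ne].
  rewrite inE eqxx setDv eqxx mulr1 [sgn_below]unlock (_ : [set _ in _ | _] = set0) ?cards0 ?expr0 //.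
  by apply/setP => x; rewrite !inE.
case: ifP => // iI; case: eqP => [h|]; last by rewrite mulr0.
by rewrite -(setD1K iI) h setU0 eqxx in ne.
Qed.

Lemma actE X f : act X f = \sum_a \sum_b X a b *: gmul a (gder b f).
Proof. by rewrite [gmul]unlock [gder]unlock. Qed.

Section Forms.
Variable G : 'M[C]_dimV.
Hypotheses (Ganti : forall a b, b != star a -> G a b = 0)
  (Gsym : forall a b, G b a = (-1) ^+ (vpar a && vpar b) * G a b).
Local Notation bt := (@bt R m n G).

Lemma preservesE p X : preserves p X G <-> forall u v,
  X (star v) u * bt (star v) + (-1) ^+ (p && vpar u) * (bt u * X (star u) v) = 0.
Proof.
have h u v : \sum_c X c u * G c v + (-1) ^+ (p && vpar u) * \sum_c G u c * X c v =
    X (star v) u * bt (star v) + (-1) ^+ (p && vpar u) * (bt u * X (star u) v).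
  rewrite (bigD1 (star v)) //= big1 ?addr0; last first.
    by move=> c cv; rewrite Ganti ?mulr0 // eq_sym star_eq.
  rewrite (bigD1 (star u)) //= [X in _ * (_ + X)]big1 ?addr0; last first.
    by move=> c cu; rewrite Ganti // mul0r.
  by rewrite /bt starK.
by split=> H u v; [rewrite -h; apply: H|rewrite h; apply: H].
Qed.

(* the matrix of F_ab *)
Definition Xm a b : 'M[C]_dimV := \matrix_(x, y)
  (((x == a) && (y == star b))%:R * bt b - (-1) ^+ (vpar a && vpar b) * ((x == b) && (y == star a))%:R * bt a).

Lemma Xm_homog a b : glhomog (vpar a (+) vpar b) (Xm a b).
Proof.
move=> x y; rewrite mxE.
case h1: ((x == a) && (y == star b)).
  by move: h1 => /andP[/eqP-> /eqP->]; rewrite vpar_star.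
case h2: ((x == b) && (y == star a)).
  by move: h2 => /andP[/eqP-> /eqP->]; rewrite vpar_star addbC.
by rewrite mulr0 !mul0r subrr eqxx.
Qed.

Lemma Xm_preserves a b : preserves (vpar a (+) vpar b) (Xm a b) G.
Proof.
apply/preservesE => u v; rewrite !mxE.
have -> : (u == star b) = (star u == b) by rewrite star_eq.
have -> : (u == star a) = (star u == a) by rewrite star_eq.
have -> : (v == star b) = (star v == b) by rewrite star_eq.
have -> : (v == star a) = (star v == a) by rewrite star_eq.
have -> : bt u = (-1) ^+ vpar (star u) * bt (star u) by rewrite -(bt_star Gsym) starK.
rewrite -{1}(vpar_star u); move: (star u) (star v) => {}u {}v.
rewrite [(u == b) && _]andbC [(u == a) && _]andbC.
case h1: ((v == a) && (u == b)); case h2: ((v == b) && (u == a)).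
- move: h1 h2 => /andP[/eqP-> /eqP->] /andP[/eqP-> _]; exact: sign_aux3.
- by move: h1 => /andP[/eqP-> /eqP->]; apply: sign_aux1.
- by move: h2 => /andP[/eqP-> /eqP->]; apply: sign_aux2.
by rewrite !(mulr0, mul0r, subr0, addr0).
Qed.
End Forms.
End Osp.

(** * Invariant forms are multiples of the standard form; S(V) as a [fock] structure *)

Section Inv.
Variables (R : realType) (m n : nat).
Local Notation C := (R[i]).
Local Notation SV := (superSym R m n).
Local Notation E := {set 'I_(n + n)}.
Local Notation dimV := (m + (n + n))%N.
Local Notation vpar := (@vpar m n).
Local Notation star := (@star m n).
Local Notation preserves := (@preserves R m n).
Local Notation osp := (@osp R m n).
Local Notation stdform := (@stdform R m n).
Implicit Types (f g h : SV) (I J : E) (a b c : 'I_dimV) (X B G : 'M[C]_dimV).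

Lemma stdLL (i k : 'I_m) : stdform (lshift _ i) (lshift _ k) = (i == rev_ord k)%:R.
Proof. by rewrite /stdform block_mxEul mxE. Qed.
Lemma stdLR (i : 'I_m) j : stdform (lshift _ i) (rshift _ j) = 0.
Proof. by rewrite /stdform block_mxEur mxE. Qed.
Lemma stdRL (i : 'I_m) j : stdform (rshift _ j) (lshift _ i) = 0.
Proof. by rewrite /stdform block_mxEdl mxE. Qed.
Lemma stdRR (j k : 'I_(n + n)) : stdform (rshift _ j) (rshift _ k) =
  if j == rev_ord k then (-1) ^+ (n <= j)%N else 0.
Proof. by rewrite /stdform block_mxEdr mxE. Qed.

Lemma std_anti a b : b != star a -> stdform a b = 0.
Proof.
case: (split_case a) => [] [i ->]; case: (split_case b) => [] [k ->]; rewrite ?starL ?starR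
  ?stdLL ?stdLR ?stdRL ?stdRR // ?eq_lshift ?eq_rshift => h.
  by rewrite (_ : i == _ = false) //; apply: contraNF h => /eqP ->; rewrite rev_ordK.
by rewrite (_ : i == _ = false) //; apply: contraNF h => /eqP ->; rewrite rev_ordK.
Qed.

Lemma std_sym a b : stdform b a = (-1) ^+ (vpar a && vpar b) * stdform a b.
Proof.
case: (split_case a) => [] [i ->]; case: (split_case b) => [] [k ->]; rewrite
  ?stdLL ?stdLR ?stdRL ?stdRR ?vparL ?vparR /= ?mulr0 ?expr0 ?mul1r //.
  by rewrite (_ : (k == rev_ord i) = (i == rev_ord k)) //; apply/eqP/eqP => ->; rewrite rev_ordK.
rewrite expr1 mulN1r; case: (altP (k =P rev_ord i)) => [->|ki].
  rewrite rev_ordK eqxx /= (_ : (n <= n + n - i.+1)%N = ~~ (n <= i)%N).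
    by case: (n <= i)%N; rewrite /= ?expr0 ?expr1 ?opprK.
  by have := ltn_ord i; lia.
rewrite (_ : i == _ = false) ?oppr0 //; apply: contraNF ki => /eqP ->.
by rewrite rev_ordK.
Qed.

Lemma std_bt a : bt stdform a != 0.
Proof.
rewrite /bt; case: (split_case a) => [] [i ->]; rewrite ?starL ?starR ?stdLL ?stdRR rev_ordK eqxx.
  by rewrite oner_eq0.
by rewrite signr_eq0.
Qed.

Definition dgm (h : 'I_dimV -> C) : 'M[C]_dimV := diag_mx (\row_a h a).
Lemma dgmE (h : 'I_dimV -> C) a b : dgm h a b = h a *+ (a == b). Proof. by rewrite !mxE. Qed.

Lemma cartan_dgm (h : 'I_dimV -> C) : (forall a, h (star a) = - h a) -> cartan (dgm h).
Proof.
move=> hs; split; last exact: diag_mx_is_diag.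
split=> [a b|].
  by rewrite dgmE; have [->|_] := eqVneq a b; rewrite ?addbb // mulr0n eqxx.
apply/(preservesE std_anti) => u v; rewrite /= expr0 mul1r !dgmE !hs.
have [->|uv] := eqVneq v (star u); last first.
  by rewrite star_eq (negPf uv) /= !mulr0n mul0r mulr0 addr0.
by rewrite !starK !eqxx /= !mulr1n hs opprK [h u * _]mulrC mulrN subrr.
Qed.

Lemma cartanP (H : 'M[C]_dimV) : cartan H -> exists2 h : 'I_dimV -> C, (forall a, h (star a) = - h a) & H = dgm h.
Proof.
move=> [[_ hp] hd]; exists (fun a => H a a) => [a|]; last first.
  apply/matrixP => a b; rewrite dgmE; have [->|ab] := eqVneq a b; first by rewrite mulr1n.
  by rewrite mulr0n; apply: (is_diag_mxP hd); rewrite /=.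
have := ((preservesE std_anti) false H).1 hp a (star a); rewrite starK /= expr0 mul1r mulrC -mulrDr => /eqP.
by rewrite mulf_eq0 (negPf (std_bt a)) /= addrC addr_eq0 => /eqP.
Qed.

(* A cocharacter that is positive on the simple roots of b and takes distinct    *)
(* values on the e_a.                                                           *)
Definition hz a : int := match split a with
  inl i => (m%:Z - 1 - 2 * (i : nat)%:Z) * (2 * n%:Z) | inr j => 2 * n%:Z - 1 - 2 * (j : nat)%:Z end.
Lemma hzL (i : 'I_m) : hz (lshift _ i) = (m%:Z - 1 - 2 * (i : nat)%:Z) * (2 * n%:Z).
Proof. by rewrite /hz splitL. Qed.
Lemma hzR (j : 'I_(n + n)) : hz (rshift m j) = 2 * n%:Z - 1 - 2 * (j : nat)%:Z.
Proof. by rewrite /hz splitR. Qed.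

Lemma hz_star a : hz (star a) = - hz a.
Proof.
case: (split_case a) => [] [i ->]; rewrite ?starL ?starR ?hzL ?hzR /=; have hi := ltn_ord i.
  have e : ((m - i.+1)%N)%:Z = m%:Z - 1 - (i : nat)%:Z by lia.
  by rewrite e; ring.
have e : ((n + n - i.+1)%N)%:Z = n%:Z + n%:Z - 1 - (i : nat)%:Z by lia.
by rewrite e; ring.
Qed.

Lemma hz_mix (t : int) (N j : nat) : (j < N + N)%N -> t * (2 * N%:Z) != 2 * N%:Z - 1 - 2 * j%:Z.
Proof.
move=> jN; apply/eqP => h; have [t0|t1|t0] : [\/ t = 0, 1 <= t | t <= -1].
- have : t = 0 \/ (1 <= t \/ t <= -1) by lia.
  by case=> [?|[?|?]]; [apply: Or31|apply: Or32|apply: Or33].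
- by rewrite t0 mul0r in h; lia.
- by have : 0 <= (t - 1) * (2 * N%:Z) by [apply: mulr_ge0; lia]; rewrite mulrBl h; lia.
- by have : 0 <= (- 1 - t) * (2 * N%:Z) by [apply: mulr_ge0; lia]; rewrite mulrBl h; lia.
Qed.

Lemma hz_eq a b : (0 < n)%N -> hz a + hz b = 0 -> b = star a.
Proof.
move=> n0; case: (split_case a) => [] [i ->]; case: (split_case b) => [] [k ->];
  rewrite ?starL ?starR ?hzL ?hzR; have hi := ltn_ord i; have hk := ltn_ord k.
- rewrite -mulrDl => /eqP; rewrite mulf_eq0 => /orP[/eqP h|]; last by lia.
  by congr lshift; apply: val_inj => /=; lia.
- move=> /eqP; rewrite addr_eq0 => /eqP h; have := @hz_mix (- (m%:Z - 1 - 2 * (i : nat)%:Z)) n k hk.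
  by rewrite mulNr h opprK eqxx.
- move=> /eqP; rewrite addrC addr_eq0 => /eqP h; have := @hz_mix (- (m%:Z - 1 - 2 * (k : nat)%:Z)) n i hi.
  by rewrite mulNr h opprK eqxx.
by move=> h; congr rshift; apply: val_inj => /=; lia.
Qed.

Section Form.
Variable B : 'M[C]_dimV.
Hypotheses (hB : invariant_form B) (hn : (0 < n)%N).

Lemma Bsym a b : B b a = (-1) ^+ (vpar a && vpar b) * B a b.
Proof. exact: form_supersymmetric hB _ _. Qed.

(** Invariance under the Cartan element with entries [hz] gives (hz a + hz b) B a b = 0, and the sum
    vanishes only for dual indices. *)
Lemma Banti a b : b != star a -> B a b = 0.
Proof.
move=> ab; pose h a : C := (hz a)%:~R.
have hc : cartan (dgm h) by apply: cartan_dgm => c; rewrite /h hz_star intrN.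
have := form_invariant hB hc.1 a b; rewrite /= expr0 mul1r.
rewrite (bigD1 a) //= big1 ?addr0; last by move=> c /negPf ca; rewrite dgmE ca mulr0n mul0r.
rewrite (bigD1 b) //= [X in _ + (_ + X)]big1 ?addr0; last by move=> c /negPf ca; rewrite dgmE ca mulr0n mulr0.
rewrite !dgmE !eqxx !mulr1n [B a b * _]mulrC -mulrDl => /eqP; rewrite mulf_eq0 => /orP[|/eqP//].
rewrite -intrD intr_eq0 => /eqP /(hz_eq hn) bE; by rewrite bE eqxx in ab.
Qed.

(** The F_ab formed with the standard form lie in osp, and invariance of B under them makes B
    proportional to that form. Consequently the F_ab formed with B lie in osp too ([osp_Xm]). *)
Lemma bt_prop a b : bt B a * bt stdform b = bt stdform a * bt B b.
Proof.
have [->|ab] := eqVneq a b; first by rewrite mulrC.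
have hX : osp (vpar a (+) vpar b) (Xm stdform a b).
  by split; [apply: Xm_homog|apply: Xm_preserves; [exact: std_anti|exact: std_sym]].
have := ((preservesE Banti) _ _).1 (form_invariant hB hX) (star b) (star a).
rewrite !mxE !starK !eqxx [b == a]eq_sym (negPf ab) /= (bt_star Bsym b) vpar_star.
have aux (K : comNzRingType) (pa pb : bool) (x y z t : K) : (1%:R * y - (-1) ^+ (pa && pb) * 0%:R * x) * z +
   (-1) ^+ ((pa (+) pb) && pb) * ((-1) ^+ pb * t * (0%:R * y - (-1) ^+ (pa && pb) * 1%:R * x)) = y * z - x * t.
  by case: pa; case: pb; rewrite /= ?expr0 ?expr1; ring.
by rewrite aux => /eqP; rewrite subr_eq0 mulrC => /eqP.
Qed.

Lemma bt_neq0 a : bt B a != 0.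
Proof.
have h := mulmxV (form_nondegenerate hB); apply/eqP => h0.
have := congr1 (fun M : 'M_dimV => M a a) h; rewrite !mxE eqxx (bigD1 (star a)) //= big1 ?addr0.
  by rewrite -/(bt B a) h0 mul0r => /esym/eqP; rewrite oner_eq0.
by move=> c /Banti ->; rewrite mul0r.
Qed.

Lemma osp_Xm a b : osp (vpar a (+) vpar b) (Xm B a b).
Proof.
split; first exact: Xm_homog.
have XE : Xm B a b = (bt B a / bt stdform a) *: Xm stdform a b.
  have h c : bt B c = bt B a / bt stdform a * bt stdform c.
    by rewrite mulrAC bt_prop mulrAC mulfV ?mul1r // std_bt.
  apply/matrixP => x y; rewrite !mxE [bt B b]h {2}[bt B a]h mulrBr.
  by congr (_ - _); rewrite mulrCA.
have hs := Xm_preserves std_anti std_sym a b.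
move=> u v; have := congr1 ( *%R (bt B a / bt stdform a)) (hs u v); rewrite mulr0; apply: etrans.
have XB x y : Xm B a b x y = bt B a / bt stdform a * Xm stdform a b x y by rewrite {1}XE mxE.
have e1 : \sum_c Xm B a b c u * stdform c v = bt B a / bt stdform a * \sum_c Xm stdform a b c u * stdform c v.
  by rewrite mulr_sumr; apply: eq_bigr => c _; rewrite XB mulrA.
have e2 : \sum_c stdform u c * Xm B a b c v = bt B a / bt stdform a * \sum_c stdform u c * Xm stdform a b c v.
  by rewrite mulr_sumr; apply: eq_bigr => c _; rewrite XB mulrCA.
by rewrite e1 e2 mulrDr; congr (_ + _); rewrite mulrCA.
Qed.

Definition cfock : fock dimV (superSym R m n : lmodType C) :=
  @Fock C dimV SV vpar star (bt B) (fun a => [the {linear SV -> SV} of gmul a]) (fun a => [the {linear SV -> SV} of gder a])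
   [the {linear SV -> SV} of pw true] (sone R m n) (@geps R m n) (sform B)
   (@starK m n) (@vpar_star m n) bt_neq0 (bt_star Bsym) (@gder_gmul R m n) (@gmul_gmul R m n) (@gder_gder R m n)
   (@gpw_gmul R m n) (@gpw_gder R m n) (@pwK R m n) (@pw_one R m n) (@gder_one R m n) (@sv_ind R m n)
   (@geps_lin R m n) (@geps_one R m n) (@geps_mul R m n) (@sform_linl R m n B) (@sform_linr R m n B Banti)
   (@sform_one R m n B Banti) (@sform_mul R m n B Banti).

Local Notation X0 := cfock.

Lemma invmx_entry a c : invmx B a c = (c == star a)%:R * (bt B (star a))^-1.
Proof.
pose G : 'M[C]_dimV := \matrix_(x, y) ((y == star x)%:R * (bt B (star x))^-1).
have BG : B *m G = 1%:M.
  apply/matrixP => x y; rewrite !mxE (bigD1 (star x)) //= big1 ?addr0.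
    by rewrite !mxE starK -/(bt B x) mulrCA mulfV ?bt_neq0 // mulr1 eq_sym.
  by move=> c' /Banti ->; rewrite mul0r.
have -> : invmx B = G.
  by rewrite -[LHS]mulmx1 -BG mulKmx //; exact: form_nondegenerate hB.
by rewrite mxE.
Qed.

Lemma smul_gen2 a c f : smul (smul (gen R a) (gen R c)) f = gmul a (gmul c f).
Proof. by rewrite !gen_gmul smul_gmul smul_one !smul_gmul smul_one. Qed.

Lemma smul_zero f : smul (0 : SV) f = 0.
Proof. by have := smul_linl (-1) (0 : SV) 0 f; rewrite scaler0 addr0 scaleN1r addNr. Qed.
Lemma smul_Z (k : C) u f : smul (k *: u) f = k *: smul u f.
Proof. by have := smul_linl k u 0 f; rewrite smul_zero !addr0. Qed.
Lemma smul_D u v f : smul (u + v) f = smul u f + smul v f.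
Proof. by have := smul_linl 1 u v f; rewrite !scale1r. Qed.
Lemma smul_sum (I : Type) (r : seq I) (F : I -> SV) f : smul (\sum_(i <- r) F i) f = \sum_(i <- r) smul (F i) f.
Proof. by elim/big_rec2: _ => [|i y x _ <-]; rewrite ?smul_zero ?smul_D. Qed.

Lemma Lomega_Lo f : Lomega B f = Lo X0 f.
Proof.
rewrite LoE /Lomega /omega smul_Z smul_sum; congr (_ *: _); apply: eq_bigr => a _.
rewrite smul_sum (bigD1 (star a)) //= big1 ?addr0; last first.
  by move=> c /negPf ca; rewrite smul_Z invmx_entry ca mul0r scale0r.
by rewrite smul_Z invmx_entry eqxx mul1r smul_gen2 [gam]unlock.
Qed.

Lemma act_Xm a b f : act (Xm B a b) f = Fo X0 a b f.
Proof.
rewrite actE FoE.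
have h (x y : 'I_dimV) (k : C) : \sum_u \sum_v (((u == x) && (v == y))%:R * k) *: gmul u (gder v f) = k *: gmul x (gder y f).
  rewrite (bigD1 x) //= [X in _ + X]big1 ?addr0; last first.
    by move=> u /negPf ux; rewrite big1 // => v _; rewrite ux mul0r scale0r.
  rewrite (bigD1 y) //= [X in _ + X]big1 ?addr0; last first.
    by move=> v /negPf vy; rewrite vy andbF mul0r scale0r.
  by rewrite !eqxx mul1r.
rewrite -(h a (star b) (bt B b)) [ksgn]unlock -[in RHS](h b (star a) _) -sumrB; apply: eq_bigr => u _.
rewrite -sumrB; apply: eq_bigr => v _; rewrite mxE scalerBl; congr (_ - _ *: _).
by rewrite -mulrA mulrCA.
Qed.

Lemma act_Fo p X f : osp p X ->
  act X f = 2^-1 *: \sum_a \sum_b (X a (star b) / bt B b) *: Fo X0 a b f.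
Proof.
move=> hX; have hp := ((preservesE Banti) _ _).1 (form_invariant hB hX).
have hh : glhomog p X by case: hX.
have H := @sum_Fo_act C dimV SV X0 (fun a b => X a b) f.
rewrite actE; symmetry; apply: H => a b.
have := hp (star a) (star b); rewrite !starK vpar_star (bt_star Bsym a) => /eqP.
rewrite addr_eq0 => /eqP h; apply: (etrans h); rewrite [ksgn]unlock /=; congr (- _).
have [->|/hh pE] := eqVneq (X a (star b)) 0; first by rewrite !mulr0.
rewrite vpar_star in pE; rewrite -pE !mulrA; congr (_ * _ * _).
by case: (vpar a) (vpar b) => [] [] /=; rewrite ?expr0 ?expr1 ?mulr1 ?mulrNN ?mulr1 ?mul1r.
Qed.

Lemma spart_P p f : spart p f = 2^-1 *: (f + (-1) ^+ p *: pw true f).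
Proof.
apply: coP => I; rewrite coZ coD coZ co_pw [co]unlock ffunE.
have hh (u : {mpoly C[m]}) : 2^-1 *: (u + u) = u by exact: half_scale.
by case: (odd _); case: p; rewrite /= ?expr0 ?expr1 ?scaleN1r ?scale1r ?opprK ?subrr ?scaler0 ?hh.
Qed.

Lemma shomogP p f : shomog p f <-> pw true f = (-1) ^+ p *: f.
Proof.
split=> [h|h I].
  apply: coP => I; rewrite co_pw coZ [co]unlock; case: (altP (odd #|I| =P p)) => [<-//|/h ->].
  by rewrite !scaler0.
move=> oI; have := congr1 (fun u => co u I) h; rewrite /= co_pw coZ [co]unlock => /eqP.
rewrite -subr_eq0 -scalerBl scaler_eq0 => /orP[|/eqP//].
by case: (odd _) p oI {h} => [] [] //= _; rewrite ?expr0 ?expr1 -?opprD ?oppr_eq0 ?opprK -[1 + 1]/(2%:R) pnatr_eq0.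
Qed.

Lemma rho_cfock : rho X0 = n%:R - m%:R / 2.
Proof.
rewrite rhoE big_split_ord /=.
have -> : \sum_(i < m) (-1) ^+ (@Defs.vpar m n (lshift (n + n) i)) = m%:R :> C.
  by rewrite (eq_bigr (fun _ => 1)) ?sumr_const ?card_ord // => i _; rewrite vparL.
have -> : \sum_(i < n + n) (-1) ^+ (@Defs.vpar m n (rshift m i)) = - (n%:R + n%:R) :> C.
  rewrite (eq_bigr (fun _ => -1)) => [|i _]; last by rewrite vparR.
  by rewrite sumr_const card_ord mulNrn natrD.
by field.
Qed.

Lemma SdE d f : Sd d f <-> forall I, ((#|I| <= d)%N -> co f I \is (d - #|I|)%N.-homog)
             /\ ((d < #|I|)%N -> co f I = 0).
Proof. by rewrite [co]unlock. Qed.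

Lemma Sd_lin d (k : C) f g : Sd d f -> Sd d g -> Sd d (k *: f + g).
Proof.
move=> hu hv I; have [h1 h2] := hu I; have [h3 h4] := hv I; rewrite !ffunE; split=> h.
  by rewrite dhomogD ?dhomogZ ?h1 ?h3.
by rewrite h2 // h4 // scaler0 addr0.
Qed.
Lemma Sd_0 d : Sd d (0 : SV).
Proof. by move=> I; rewrite ffunE; split=> // _; exact: dhomog0. Qed.

Lemma Sd_gmul d a f : Sd d f -> Sd d.+1 (gmul a f).
Proof.
move=> /SdE hf; apply/SdE => I; have [h1 h2] := hf I.
case: (split_case a) => [] [i ->]; rewrite ?co_mulL ?co_mulR.
  split=> Id.
    have [Id'|Id'] := leqP #|I| d.
      rewrite subSn // -add1n; apply: dhomogM; last exact: h1.
      by rewrite dhomogX; apply/eqP; rewrite /= mdeg1.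
    by rewrite h2 // mulr0 dhomog0.
  by rewrite h2 ?mulr0 //; lia.
case: ifP => iI; last by split=> // _; exact: dhomog0.
have [h3 h4] := hf (I :\ i); rewrite (cardsD1 i I) iI add1n.
split=> Id.
  rewrite subSS -[(d - _)%N]add0n; apply: dhomogM; last exact: h3.
  have [b ->] := sg_sign R m i (I :\ i); rewrite -[(-1) ^+ b]mulr1.
  by case: b; rewrite ?expr0 ?expr1 ?mul1r ?mulN1r ?dhomogN; exact: dhomog1.
by rewrite h4 ?mulr0.
Qed.

Lemma Sdg_one0 : Sdg X0 0 (sone R m n).
Proof. by have := Eu_wd X0 [::]. Qed.

Lemma single_sign I (e : bool) (p : {mpoly C[m]}) : single I ((-1) ^+ e * p) = (-1) ^+ e *: single I p.
Proof.
apply: coP => J; rewrite coZ !co_single; case: eqP => _; last by rewrite scaler0.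
by case: e; rewrite ?expr0 ?expr1 ?mul1r ?mulN1r ?scale1r ?scaleN1r.
Qed.

Lemma Sdg_single I k : Sdg X0 (mdeg k + #|I|) (single I 'X_[k]).
Proof.
have [N] := ubnP #|I|; elim: N I => // N IH I IN.
have [->|[j jI]] := set_0Vmem I; last first.
  have jI' : (#|I :\ j| < N)%N by rewrite (cardsD1 j) jI in IN.
  have h := Sdg_mu (rshift m j) (IH _ jI').
  have [e he] := sg_sign R m j (I :\ j).
  have hE : gmul (rshift m j) (single (I :\ j) ('X_[k] : {mpoly C[m]})) = (-1) ^+ e *: single I 'X_[k].
    by rewrite gmulR_single in_setD1 eqxx /= setD1K // he single_sign.
  have -> : single I 'X_[k] = (-1) ^+ e *: gmul (rshift m j) (single (I :\ j) ('X_[k] : {mpoly C[m]})).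
    by rewrite hE scalerA -expr2 sqrr_sign scale1r.
  by apply: SdgZ; rewrite (cardsD1 j I) jI add1n addnS.
rewrite cards0 addn0; clear IH IN I N; have [d] := ubnP (mdeg k); elim: d k => // d IHk k kd.
have [i ki|k0] := pickP (fun i => k i != 0%N); last first.
  have -> : k = 0%MM by apply/mnmP => i; rewrite mnm0E; apply/eqP; have := k0 i => /negbFE.
  have -> : single set0 'X_[0] = sone R m n.
    by apply: coP => J; rewrite co_single co_sone mpolyX0; case: eqP.
  by rewrite mdeg0; exact: Sdg_one0.
have kE : k = (U_(i) + (k - U_(i)))%MM.
  by rewrite addmC submK // lep1mP.
have kd' : (mdeg (k - U_(i))%MM < d)%N by rewrite kE mdegD mdeg1 in kd.
have := Sdg_mu (lshift (n + n) i) (IHk _ kd').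
rewrite [X in Sdg _ _ X -> _](_ : _ = single set0 'X_[k]); last first.
  by rewrite [LHS]gmulL_single -mpolyXD -kE.
by rewrite {3}kE mdegD mdeg1 add1n.
Qed.

Lemma Sd_Sdg d f : Sd d f <-> Sdg X0 d f.
Proof.
split=> [/SdE hf|/Sdg_words[l ->]].
  rewrite (sum_single f); apply: Sdg_sum => I _.
  rewrite (mpolyE (co f I)); have [h1 h2] := hf I.
  have [Id|Id] := leqP #|I| d; last first.
    rewrite -(mpolyE (co f I)) h2 // single0; exact: Sdg0.
  have hs : forall (r : seq 'X_{1..m}), (forall k, k \in r -> (mdeg k + #|I|)%N = d) ->
      Sdg X0 d (single I (\sum_(k <- r) (co f I)@_k *: 'X_[k])).
    elim=> [|k r IH] hr; first by rewrite big_nil single0; exact: Sdg0.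
    rewrite big_cons single_lin; apply: Sdg_lin; last by apply: IH => x xr; apply: hr; rewrite inE xr orbT.
    by rewrite -(hr k (mem_head _ _)); exact: Sdg_single.
  by apply: hs => k kf; rewrite (dhomog_mf (h1 Id) kf) subnK.
have w s : Sd (size s) (wd X0 s).
  elim: s => [|a s IH]; last exact: Sd_gmul.
  apply/SdE => I; rewrite [wd _ _]/(sone R m n) co_sone; case: eqP => [->|_]; last by split=> // _; exact: dhomog0.
  by rewrite cards0; split=> // _; exact: dhomog1.
elim: l => [|x l IH]; first by rewrite big_nil; exact: Sd_0.
rewrite big_cons; case: ifP => [/eqP xd|_]; last exact: IH.
by apply: Sd_lin; [rewrite -xd; apply: w|exact: IH].
Qed.
End Form.
End Inv.

Transparent lshift rshift.

(** * Modules *)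

(* All that is used below of the model of S(V); X itself stays abstract. *)
Record realizes (R : realType) (m n : nat) (B : 'M[R[i]]_(m + (n + n)))
    (X : fock (m + (n + n)) (superSym R m n : lmodType R[i])) : Prop := Realizes {
  rz_par : forall a, par X a = vpar a;
  rz_st : forall a, st X a = star a;
  rz_Lo : Lomega B = Lo X;
  rz_Sd : forall d, Sd d = Sdg X d;
  rz_sf : forall f g, sform B f g = sf X f g;
  rz_spart : forall p f, spart p f = 2^-1 *: (f + (-1) ^+ p *: par_op X f);
  rz_shomog : forall p f, shomog p f <-> phomog X p f;
  rz_act : forall p Y f, osp p Y -> act Y f = actF X (fun a b => Y a (st X b) / bet X b) f;
  rz_Fo : forall a b, exists2 Y, osp (vpar a (+) vpar b) Y & forall f, act Y f = Fo X a b f;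
  rz_hop : forall h, (forall a, h (star a) = - h a) -> forall f, act (dgm h) f = hop X h f;
  rz_ideal : forall v, smul (sone R m n - omega B) v = v - Lo X v;
  rz_rho : rho X = n%:R - m%:R / 2 }.

Section Exists.
Variables (R : realType) (m n : nat).
Local Notation C := (R[i]).
Local Notation dimV := (m + (n + n))%N.
Lemma realizes_exists (B : 'M[C]_dimV) : invariant_form B -> (0 < n)%N ->
  exists X : fock dimV (superSym R m n : lmodType C), realizes B X.
Proof.
move=> hB hn; exists (cfock hB hn); split.
- by [].
- by [].
- by apply/funext => f; apply: Lomega_Lo.
- by move=> d; apply/funext => f; apply/propext; apply: Sd_Sdg.
- by [].
- by move=> p f; apply: spart_P.
- by move=> p f; apply: shomogP.
- by move=> p Y f; apply: act_Fo.
- move=> a b; exists (Xm B a b); first exact: osp_Xm.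
  by move=> f; apply: act_Xm.
- move=> h hh f; rewrite actE; under eq_bigr do under eq_bigr do rewrite dgmE.
  exact: (hop_diag (cfock hB hn)).
- move=> v; rewrite smul_D smul_one; congr (_ + _); rewrite -[- omega B]scaleN1r smul_Z scaleN1r; congr (- _).
  exact: Lomega_Lo.
exact: rho_cfock.
Qed.
End Exists.

(** * Translation between osp-modules and the operators F_ab *)

Section Bridge.
Variables (R : realType) (m n : nat).
Local Notation C := (R[i]).
Local Notation dimV := (m + (n + n))%N.
Local Notation SV := (superSym R m n).
Variables (B : 'M[C]_dimV) (X : fock dimV (SV : lmodType C)).
Hypothesis rz : realizes B X.
Implicit Types (M N Q J : SV -> Prop).

Lemma submodE M : is_submod M <-> smod X M.
Proof.
split=> [[h0 h1 h2 h3]|sM].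
  split; first by split.
    move=> u hu; rewrite -[par_op X u](parity_parts u (par_op X u)).
    by apply: h1; rewrite -(rz_spart rz); apply: h2.
  by move=> a b u hu; have [Y hY <-] := rz_Fo rz a b; apply: h3 hY hu.
have s0 := smod_sub sM; have [_ hP _] := sM; split.
- exact: (subsp0 s0).
- by move=> c u v; apply: (subspL s0).
- move=> p u hu; rewrite (rz_spart rz); apply: (subspZ s0); apply: (subspD s0) => //.
  by apply: (subspZ s0); apply: hP.
by move=> p Y u hY hu; rewrite (rz_act rz _ hY); apply: smod_actF.
Qed.

Lemma is_subquotI M N : smod X M -> smod X N -> incl N M -> is_subquot M N.
Proof. by move=> sM sN NM; split=> //; apply/submodE. Qed.

Lemma irreducibleI M N : smod X M -> smod X N -> incl N M -> ~ incl M N ->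
  (forall Q u, smod X Q -> incl N Q -> incl Q M -> Q u -> ~ N u -> incl M Q) -> irreducible M N.
Proof.
move=> sM sN NM MN h; split; [exact: is_subquotI|exact: MN|].
move=> Q /submodE sQ NQ QM.
case: (pselect (incl Q N)) => [QN|/existsNP [u /not_implyP [Qu Nu]]].
  by left=> u; split; [apply: QN|apply: NQ].
by right=> v; split; [apply: QM|apply: (h Q u)].
Qed.

Lemma sqiso_relation (th ps : SV -> SV) M1 N1 M2 N2 J : mhom X th -> mhom X ps ->
  smod X M1 -> smod X N1 -> incl N1 M1 -> smod X M2 -> smod X N2 -> incl N2 M2 -> smod X J ->
  (forall u, M1 u -> exists2 h, M2 h & J (th u - ps h)) ->
  (forall h, M2 h -> exists2 u, M1 u & J (th u - ps h)) ->
  (forall z, M2 z -> J (ps z) -> N2 z) ->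
  (forall u h, M1 u -> M2 h -> J (th u - ps h) -> (N2 h <-> N1 u)) -> sqiso M1 N1 M2 N2.
Proof.
move=> hth hps sM1 sN1 i1 sM2 sN2 i2 sJ h1 h2 h3 h4.
have [phi [p1 p2 p3 p4 [p5 p6]]] := relation_iso hth hps sM1 sM2 sJ h1 h2 h3 h4.
exists phi; split => //; try exact: is_subquotI.
  move=> p u hu /(rz_shomog rz) hp; exists (2^-1 *: (phi u + (-1) ^+ p *: par_op X (phi u))).
    by apply/(rz_shomog rz); apply: phomog_part.
  exact: p3.
by move=> p Y u hY hu; rewrite !(rz_act rz _ hY); apply: p4.
Qed.

Lemma sqiso_same M N : smod X M -> smod X N -> incl N M -> sqiso M N M N.
Proof.
move=> sM sN NM; apply: (@sqiso_relation id id M N M N N) => //; try exact: mhom_id.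
- by move=> u hu; exists u => //; rewrite subrr; apply: (subsp0 (smod_sub sN)).
- by move=> u hu; exists u => //; rewrite subrr; apply: (subsp0 (smod_sub sN)).
move=> u h _ _ uh; split=> hN; last first.
  by rewrite -[h](subKr u); apply: (subspB (smod_sub sN)).
by rewrite -[u](subrK h); apply: (subspD (smod_sub sN)).
Qed.

Lemma hom_induces_iso (th : SV -> SV) M1 M2 : mhom X th -> smod X M1 -> smod X M2 ->
  (forall u, M1 u -> M2 (th u)) -> (forall u, M1 u -> th u = 0 -> u = 0) ->
  (forall v, M2 v -> exists2 u, M1 u & th u = v) -> induces_iso th M1 zeroS M2 zeroS.
Proof.
move=> hth sM1 sM2 h1 h2 h3; have [t1 t2 t3] := hth.
have s0 := smod_zero X; have z1 M : smod X M -> incl zeroS M.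
  by move=> sM u ->; apply: (subsp0 (smod_sub sM)).
have d0 (u : SV) : zeroS (u - u) by exact: subrr.
split=> //; [by apply: is_subquotI; auto|by apply: is_subquotI; auto| | | | |].
- by move=> c u v _ _; rewrite t1; exact: d0.
- move=> p u hu /(rz_shomog rz) hp; exists (th u); last exact: d0.
  by apply/(rz_shomog rz); rewrite /phomog -t2 hp; exact: (mhomZ hth).
- move=> p Y u hY hu; rewrite !(rz_act rz _ hY) (mhom_actF hth); exact: d0.
- by move=> u hu; split=> [/h2|->]; [apply|exact: (mhom0 hth)].
by move=> w hw; have [u hu <-] := h3 w hw; exists u => //; exact: d0.
Qed.

Lemma coef_neq0 p (Y : 'M[C]_dimV) a b : osp p Y -> Y a (st X b) / bet X b != 0 ->
  par X a (+) par X b = p.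
Proof.
move=> [hY _] h; have := hY a (star b); rewrite !(rz_par rz) vpar_star -(rz_st rz); apply.
by apply: contraNneq h => ->; rewrite mul0r.
Qed.
End Bridge.

(** * Irreducibility, head, socle and self-duality of A_d *)

Section Modules.
Variables (R : realType) (m n : nat).
Local Notation C := (R[i]).
Local Notation dimV := (m + (n + n))%N.
Local Notation SV := (superSym R m n).
Variables (B : 'M[C]_dimV) (X : fock dimV (SV : lmodType C)).
Hypothesis rz : realizes B X.
Variable p : 'I_dimV.
Hypotheses (hp : par X p = false) (hpp : st X p != p).
Implicit Types (M N Q J : SV -> Prop) (u v : SV).
Local Notation smod := (smod X).
Local Notation Hd := (Hd X).
Local Notation Ad := (Ad X).
Local Notation Lo := (Lo X).

Lemma zero_in M : smod M -> incl zeroS M.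
Proof. by move=> sM u ->; apply: (subsp0 (smod_sub sM)). Qed.

Lemma dsum_decomp (d k0 : nat) (M : 'I_k0 -> SV -> Prop) : (k0 <= d./2.+1)%N ->
  (forall i j : nat, (i < j < k0)%N -> (d%:R - i%:R - j%:R - 1 : C) != rho X) ->
  \prod_(i < d./2.+1) ('X - (lam X d i)%:P) %| \prod_(j < k0) Gq (lam X d j) ->
  (forall (i : 'I_k0) u, M i u <-> Ad (d - 2 * i) u) ->
  dsum (Sd d) zeroS (fun i : 'I_k0 => Lpow B i (M i)).
Proof. by move=> h1 h2 h3 h4; rewrite (rz_Sd rz) /Lpow (rz_Lo rz); exact: (decomp_dsum hp hpp h1 h2 h3 h4). Qed.

Lemma irr_Hd d : inner X p \/ (forall j : nat, (j < d)%N -> j%:R != rho X + 1) -> regular X d ->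
  irreducible (Hd d) zeroS.
Proof.
move=> hi hr; apply: (irreducibleI rz).
- exact: smod_Hd.
- exact: smod_zero.
- by apply: zero_in; apply: smod_Hd.
- by move=> h; have := h _ (Hd_xp hp hpp d); exact: xp_neq0.
by move=> Q u sQ _ QM Qu nu; exact: (Hd_irr hp hpp hi hr sQ QM Qu nu).
Qed.

Section Critical.
Variables (N f0 : nat).
Hypotheses (hN : rho X = N%:R) (hf : (N <= f0 <= 2 * N)%N).
Local Notation t := (f0 - N)%N.
Local Notation e := (f0 - 2 * t)%N.
Local Notation LsH := (fun u : SV => exists2 h, Hd e h & u = iter t.+1 Lo h).

Let sA : smod (Ad f0.+2) := smod_Ad X f0.+2.
Let sH : smod (Hd f0.+2) := smod_Hd X f0.+2.
Let sE : smod (Hd e) := smod_Hd X e.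
Let s0 : smod zeroS := smod_zero X.
Let sL : smod LsH := smod_LsH X N f0.
Let HA : incl (Hd f0.+2) (Ad f0.+2). Proof. by move=> u; exact: Hd_Ad. Qed.
Let LH : incl LsH (Hd f0.+2). Proof. by move=> u; exact: (LsH_Hd hp hpp hN hf). Qed.
Let LA : incl LsH (Ad f0.+2). Proof. by move=> u /LH /HA. Qed.

Lemma irr_low : irreducible (Hd e) zeroS.
Proof. by apply: irr_Hd; [right; exact: (low_cond hp hpp hN hf)|exact: (low_regular hp hpp hN hf)]. Qed.

Lemma irr_LsH : irreducible LsH zeroS.
Proof.
have ns : ~ incl LsH zeroS by move=> h; have [h1 h2] := LsH_xp hp hpp N f0; exact: (h2 (h _ h1)).
apply: (irreducibleI rz sL s0 (zero_in sL) ns) => Q u sQ _ QL Qu nu; have [h hh uE] := QL u Qu; rewrite uE in Qu.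
apply: (LsH_min hp hpp hN hf sQ hh _ Qu) => h0; apply: nu.
by rewrite uE h0; exact: iter_Lo0.
Qed.

Lemma A_notin_H : ~ incl (Ad f0.+2) (Hd f0.+2).
Proof.
move=> h; have [x hx] := crit_Asurj hp hpp hN hf (Hd_xp hp hpp e).
have [_ ->] := h x hx; apply/nesym; exact: iter_xp_neq0.
Qed.

Lemma irr_head : irreducible (Ad f0.+2) (Hd f0.+2).
Proof.
apply: (irreducibleI rz sA sH HA A_notin_H) => Q u sQ _ QA Qu nu x Ax; apply: contrapT => nQ.
exact: (nu (head_max hp hpp hN hf sQ QA Ax nQ Qu)).
Qed.

(** H_d is the only maximal submodule, since by [head_max] every proper submodule is contained in
    it. *)
Lemma radicalE : radical (Ad f0.+2) = Hd f0.+2.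
Proof.
apply/funext => u; apply/propext; split=> [[_ h]|hu]; first exact: h irr_head.
split=> [|Q [[_ sQ QA] AQ hQ]]; first exact: HA.
move/(submodE rz): sQ => sQ.
have [x /not_implyP [Ax Qx]] : exists x, ~ (Ad f0.+2 x -> Q x) by apply/existsNP.
have QH : incl Q (Hd f0.+2) := head_max hp hpp hN hf sQ QA Ax Qx.
have [h|h] := hQ (Hd f0.+2) ((submodE rz _).2 sH) QH HA; first exact/h.
by case: A_notin_H => v /h.
Qed.

Lemma socle0E : socle (Ad f0.+2) zeroS = LsH.
Proof.
apply/funext => u; apply/propext; split=> [[k [Q [f [hQ hu]]]]|hu]; last first.
  exists 1%N, (fun=> LsH), (fun=> u); split; last exact: sub_sum1.
  by move=> i; split=> //; exact: irr_LsH.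
apply: (subsp_modsum (smod_sub sL) (f := f)); first exact: (zero_in sL hu).
move=> i; have [[[sQ _ _] nQ irrQ] QA Qf] := hQ i.
move/(submodE rz): sQ => sQ.
have [x /not_implyP [Qx x0]] : exists x, ~ (Q i x -> zeroS x) by apply/existsNP.
have LQ : incl LsH (Q i) := socle_min hp hpp hN hf sQ QA Qx x0.
have [h|h] := irrQ _ ((submodE rz _).2 sL) (zero_in sL) LQ; last exact/h.
by have [h1 h2] := LsH_xp hp hpp N f0; case: h2; apply/h.
Qed.

(** The hypothesis is the semisimplicity of H_d / L^s H_e. A simple submodule not inside H_d would
    be A_d / L^s H_e by [head_max], but H_d lies strictly between. *)
Lemma socle1E : incl (Hd f0.+2) (socle (Ad f0.+2) LsH) -> socle (Ad f0.+2) LsH = Hd f0.+2.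
Proof.
move=> hs; apply/funext => u; apply/propext; split=> [[k [Q [f [hQ hu]]]]|]; last exact: hs.
apply: (subsp_modsum (smod_sub sH) (f := f)); first exact: LH.
move=> i; have [[[sQ _ _] nQ irrQ] QA Qf] := hQ i.
move/(submodE rz): sQ => sQ.
case: (pselect (incl (Q i) (Hd f0.+2))) => [|/existsNP [x /not_implyP [Qx nx]]]; first exact.
have AQ : incl (Ad f0.+2) (Q i).
  move=> y Ay; apply: contrapT => ny; exact: (nx (head_max hp hpp hN hf sQ QA Ay ny Qx)).
have [h|h] := irrQ _ ((submodE rz _).2 sH) LH (fun v hv => AQ _ (HA hv)).
  case: (@xp_notin_LsH _ _ _ _ _ hp hpp N f0); apply/h; exact: (Hd_xp hp hpp).
exact/h.
Qed.

Lemma socle2E : socle (Ad f0.+2) (Hd f0.+2) = Ad f0.+2.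
Proof.
apply/funext => u; apply/propext; split=> [[k [Q [f [hQ hu]]]]|hu].
  apply: (subsp_modsum (smod_sub sA) (f := f)); first exact: HA.
  by move=> i; have [_ QA Qf] := hQ i; apply: QA.
exists 1%N, (fun=> Ad f0.+2), (fun=> u); split; last by rewrite sub_sum1; apply: (subsp0 (smod_sub sH)).
by move=> i; split=> //; exact: irr_head.
Qed.

(** The isomorphism is the relation Ωu = L^t h; no section of the injective map L^t is needed. *)
Lemma iso_head : sqiso (Ad f0.+2) (Hd f0.+2) (Hd e) zeroS.
Proof.
apply: (sqiso_relation rz (mhom_Lap X) (mhom_iter X t) sA sH HA sE s0 (zero_in sE) s0).
- move=> u /(crit_ALap hp hpp hN hf) [h hh ->]; exists h => //; exact: subrr.
- move=> h /(crit_Asurj hp hpp hN hf) [x hx xE]; exists x => //; rewrite xE; exact: subrr.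
- move=> z _ hz; apply: (iter_Lo_inj hp hpp (n := t)); rewrite iter_Lo0; exact: hz.
move=> u h hu _ /(@subr0_eq _ _ _) uh; split=> [h0|[_ u0]].
  by split; [case: hu|rewrite uh h0; exact: iter_Lo0].
by apply: (iter_Lo_inj hp hpp (n := t)); rewrite iter_Lo0 -uh.
Qed.

Lemma iso_socle : sqiso LsH zeroS (Hd e) zeroS.
Proof.
apply: (sqiso_relation rz (mhom_id X) (mhom_iter X t.+1) sL s0 (zero_in sL) sE s0 (zero_in sE) s0).
- move=> u [h hh ->]; exists h => //; exact: subrr.
- move=> h hh; exists (iter t.+1 Lo h); last exact: subrr.
  by exists h.
- move=> z _ hz; apply: (iter_Lo_inj hp hpp (n := t.+1)); rewrite iter_Lo0; exact: hz.
move=> u h hu _ /(@subr0_eq _ _ _) uh; split=> [h0|u0].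
  by rewrite /zeroS uh h0; exact: iter_Lo0.
by apply: (iter_Lo_inj hp hpp (n := t.+1)); rewrite iter_Lo0 -uh.
Qed.

Lemma Ad_selfdual : selfdual (Ad f0.+2).
Proof.
split; first exact/(submodE rz).
exists (sf X); split.
- move=> u _; split=> c v w _ _; [exact: (sfP_r X)|exact: (sfP_l X)].
- move=> a b u v _ _ /(rz_shomog rz) hu /(rz_shomog rz) hv ab; exact: (sf_homog hu hv ab).
- move=> a b Y u v hY _ _ /(rz_shomog rz) hu; rewrite !(rz_act rz _ hY).
  rewrite (sf_actF (p := a) u v); last by move=> c c'; exact: (coef_neq0 rz hY).
  by rewrite (homog_pe a hu) sfZl addNr.
- by move=> u hu h; exact: (Ad_nd hp hpp hN hf hu h).
by move=> F hF; exact: (Ad_riesz hp hpp hN hf hF).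
Qed.

(** Two nonzero summands would both contain the simple module L^s H_e. *)
Lemma Ad_indec : indecomposable (Ad f0.+2) zeroS.
Proof.
split; [by apply: (is_subquotI rz) => //; exact: zero_in| |].
  by move=> h; have [h1 h2] := LsH_xp hp hpp N f0; case: h2; apply: h; apply: LA.
move=> Q1 Q2 /(submodE rz) s1 /(submodE rz) s2 [_ hd hu].
case: (pselect (incl Q1 zeroS)) => [h|/existsNP [x /not_implyP [Qx x0]]].
  by left=> u; split; [apply: h|apply: zero_in].
case: (pselect (incl Q2 zeroS)) => [h|/existsNP [y /not_implyP [Qy y0]]].
  by right=> u; split; [apply: h|apply: zero_in].
have QA (i : bool) : incl (if i then Q1 else Q2) (Ad f0.+2).
  move=> u hu'; apply/hd; exists (fun j => if j == i then u else 0).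
    by move=> j; case: eqP => [->|_] //; case: j; [apply: (subsp0 (smod_sub s1))|apply: (subsp0 (smod_sub s2))].
  exact: sub_sum_single.
have [h1 h2] := LsH_xp hp hpp N f0; set z := iter _ _ _ in h1 h2.
have z1 := socle_min hp hpp hN hf s1 (QA true) Qx x0 h1.
have z2 := socle_min hp hpp hN hf s2 (QA false) Qy y0 h1.
have [] := h2; apply: (hu (fun i : bool => if i then z else - z) _ _ true).
  by case=> //; apply: (subspN (smod_sub s2)).
exact: sum_bool_opp.
Qed.

End Critical.
End Modules.

(** * Roots, heights and the highest weight vectors x_p^d *)

Section Weights.
Variables (R : realType) (m n : nat).
Local Notation C := (R[i]).
Local Notation dimV := (m + (n + n))%N.
Local Notation SV := (superSym R m n).
Local Notation hz := (@hz m n).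
Local Notation star := (@star m n).

Lemma diag_entryE (h : 'I_dimV -> C) (k : nat) a : nat_of_ord a = k -> diag_entry k (dgm h) = h a.
Proof. by move=> <-; rewrite /diag_entry valK dgmE eqxx. Qed.

Lemma root_coef (alpha : 'M[C]_dimV -> C) q Y a b (h : 'I_dimV -> C) : root_vector alpha q Y ->
  (forall c, h (star c) = - h c) -> Y a (star b) != 0 -> h a + h b = alpha (dgm h).
Proof.
move=> [_ hY] hs Yab; have /matrixP /(_ a (star b)) := hY _ (cartan_dgm hs).
rewrite /dgm mul_diag_mx mul_mx_diag !mxE hs mulrN opprK [Y _ _ * _]mulrC -mulrDl.
by move/(mulIf Yab).
Qed.

Lemma hz_simple r (alpha : 'M[C]_dimV -> C) : m = (2 * r)%N -> (0 < r)%N -> (0 < n)%N -> simple_root r alpha ->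
  exists2 k : nat, (0 < k)%N & alpha (dgm (fun a => (hz a)%:~R)) = k%:R.
Proof.
move=> mr r0 n0.
have hL (i : nat) (hi : (i < m)%N) (H : nat) : H = i -> diag_entry H (dgm (fun a => (hz a)%:~R)) =
    ((m%:Z - 1 - 2 * i%:Z) * (2 * n%:Z))%:~R :> C.
  by move=> ->; rewrite (@diag_entryE _ i (lshift (n + n) (Ordinal hi))) // hzL.
have hR (j : nat) (hj : (j < n + n)%N) (H : nat) : H = (m + j)%N -> diag_entry H (dgm (fun a => (hz a)%:~R)) =
    (2 * n%:Z - 1 - 2 * j%:Z)%:~R :> C.
  by move=> ->; rewrite (@diag_entryE _ (m + j) (rshift m (Ordinal hj))) // hzR.
have aux (z : int) (k : nat) : z = k -> z%:~R = k%:R :> C by move=> ->.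
case=> [i ir||j jn|].
(* Neighbouring even indices differ by 2 in the first factor of [hz], whose second factor is 2n. *)
- exists (4 * n)%N; first lia.
  rewrite /eps (hL i.-1) ?(hL i) -?intrB; try lia.
  have [i' iE] : exists i', i = i'.+1 by exists i.-1; lia.
  apply: aux; rewrite iE /=; set x := m%:Z; set y := n%:Z; set z := i'%:Z.
  have -> : i'.+1%:Z = z + 1 by lia.
  have -> : (4 * n)%N%:Z = 4 * y by lia.
  by ring.
- exists 1%N => //; rewrite /eps /delta (hL r.-1) ?(hR 0%N) -?intrB; try lia.
  apply: (aux _ 1%N); rewrite (_ : m%:Z - 1 - 2 * r.-1%:Z = 1); lia.
- exists 2%N => //; rewrite /delta (hR j.-1) ?(hR j) -?intrB; try lia.
  by apply: aux; lia.
exists 2%N => //; rewrite /delta (hR n.-1) -?intrM; try lia.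
by rewrite -[2](_ : 2%:~R = _) // -intrM; apply: aux; lia.
Qed.

Lemma hz_max (p a : 'I_dimV) : nat_of_ord p = 0%N -> (1 < m)%N -> hz a <= hz p.
Proof.
move=> p0 m1; have m0 : (0 < m)%N by lia.
have -> : p = lshift _ (Ordinal m0) by apply: val_inj.
rewrite hzL /=; case: (split_case a) => [] [i ->]; rewrite ?hzL ?hzR.
  by apply: ler_wpM2r; lia.
have : 1 * (2 * n%:Z) <= (m%:Z - 1 - 2 * 0%:Z) * (2 * n%:Z) by apply: ler_wpM2r; lia.
lia.
Qed.

Variables (B : 'M[C]_dimV) (X : fock dimV (SV : lmodType C)).
Hypothesis rz : realizes B X.
Variable p : 'I_dimV.
Hypotheses (p0 : nat_of_ord p = 0%N) (m1 : (1 < m)%N) (n0 : (0 < n)%N).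

Let pE : exists m0 : (0 < m)%N, p = lshift _ (Ordinal m0).
Proof. have m0 : (0 < m)%N by lia. by exists m0; apply: val_inj; rewrite /= p0. Qed.

Lemma par_p : par X p = false.
Proof. by rewrite (rz_par rz); have [m0 ->] := pE; rewrite vparL. Qed.
Lemma st_p_neq : st X p != p.
Proof.
rewrite (rz_st rz); have [m0 ->] := pE; rewrite starL -val_eqE /=; lia.
Qed.
Lemma inner_p : (2 < m)%N -> inner X p.
Proof.
move=> m2; have h1 : (1 < m)%N by lia.
exists (lshift _ (Ordinal h1)); first by rewrite (rz_par rz) vparL.
rewrite (rz_st rz); have [m0 ->] := pE; rewrite starL -!val_eqE /=; lia.
Qed.
Lemma outer_odd : m = 2%N -> forall a, a != p -> a != st X p -> par X a = true.
Proof.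
move=> m2 a; rewrite (rz_st rz) (rz_par rz); have [m0 ->] := pE; rewrite starL.
case: (split_case a) => [] [i ->]; last by rewrite vparR.
rewrite -!val_eqE /=; have := ltn_ord i; lia.
Qed.

Lemma eps1E (h : 'I_dimV -> C) : eps 1 (dgm h) = h p.
Proof. exact: diag_entryE. Qed.

(** Since p has the greatest height, no F_ab of positive height involves ps, and only those could
    act nontrivially on x_p^d. *)
Lemma xp_hw r (lam : 'M[C]_dimV -> C) (d : nat) (M N : SV -> Prop) : m = (2 * r)%N ->
  (forall h, lam (dgm h) = d%:R * h p) -> smod X N ->
  M (xp X p d) -> ~ N (xp X p d) -> hwvector r lam false M N (xp X p d).
Proof.
move=> mr hlam sN Mx Nx; have N0 := subsp0 (smod_sub sN); split=> //.
- by apply/(rz_shomog rz); rewrite /phomog (par_xp par_p) scale1r.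
- move=> alpha q Y ha hY; rewrite (rz_act rz _ hY.1) actF_xp //; first exact: par_p.
  move=> a b hab; have Yab : Y a (star b) != 0.
    by rewrite -(rz_st rz); apply: contraNneq hab => ->; rewrite mul0r.
  have r0 : (0 < r)%N by lia.
  have [k k0 kE] := hz_simple mr r0 n0 ha.
  have := root_coef (h := fun c => (hz c)%:~R) hY _ Yab; rewrite kE => /(_ _)/= hab'.
  have {}hab' : hz a + hz b = k.
    apply: (@intr_inj C); rewrite intrD hab' // => c; by rewrite hz_star intrN.
  by split; apply/eqP => E; move: hab'; rewrite E (rz_st rz) hz_star;
    [have := hz_max b p0 m1|have := hz_max a p0 m1]; lia.
move=> H /cartanP [h hs ->]; rewrite hlam (rz_hop rz hs) hop_xp subrr; exact: N0.
Qed.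

Lemma quotient_iso (M : nat -> SV -> Prop) (D0 : nat) : (forall d, smod X (M d)) ->
  (forall d u, M d u -> Sdg X d u) ->
  (forall d : nat, (D0 <= d)%N -> exists r : nat,
    [/\ forall u, Sdg X d u -> exists a : 'I_r -> SV, (forall i : 'I_r, M (d - 2 * i)%N (a i)) /\ u = \sum_(i < r) iter i (Lo X) (a i),
      forall a : 'I_r -> SV, (forall i : 'I_r, M (d - 2 * i)%N (a i)) -> \sum_(i < r) iter i (Lo X) (a i) = 0 -> forall i, a i = 0,
      (r <= d./2.+1)%N
    & forall (i : nat) u, (r <= i <= d./2)%N -> M (d - 2 * i)%N u -> u = 0]) ->
  sqiso fullS (ideal_one_sub_omega B) (infsum M) zeroS.
Proof.
move=> sM MS hdec; have s0 d := smod_sub (sM d).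
have -> : ideal_one_sub_omega B = fun u => exists v, u = v - Lo X v.
  by apply/funext => u; apply/propext; split=> [] [v ->]; exists v; rewrite (rz_ideal rz).
have sI := smod_ideal X; have sS := smod_sum sM.
have sF : smod X fullS by split.
have inj u : infsum M u -> (exists v, u = v - Lo X v) -> u = 0.
  by move=> [k [F [hF ->]]] [v hv]; exact: (quot_inj s0 MS hdec hF hv).
have sZ := smod_zero X.
apply: (sqiso_relation rz (mhom_id X) (mhom_id X) sF sI _ sS sZ (zero_in sS) sI) => //.
- move=> u _; have [k [F [hF hv]]] := quot_surj s0 hdec u.
  by exists (\sum_(d < k) F d) => //; exists k, F.
- by move=> h _; exists h => //; rewrite subrr; apply: (subsp0 (smod_sub sI)).
move=> u h _ hh uh; split=> [h0|hu].
  by move: uh; rewrite [X in _ - X]h0 subr0.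
by apply: inj => //; rewrite -[h](subKr u); apply: (subspB (smod_sub sI)).
Qed.
End Weights.

(** * Highest weight modules for m = 2 *)

Section TwoEvenModules.
Variables (R : realType) (m n : nat).
Local Notation C := (R[i]).
Local Notation dimV := (m + (n + n))%N.
Local Notation SV := (superSym R m n).
Local Notation hz := (@hz m n).
Local Notation star := (@star m n).
Variables (B : 'M[C]_dimV) (X : fock dimV (SV : lmodType C)).
Hypothesis rz : realizes B X.
Variable p : 'I_dimV.
Hypotheses (p0 : nat_of_ord p = 0%N) (m2 : m = 2%N) (n0 : (0 < n)%N).
Variable N : nat.
Hypotheses (nN : n = N.+1) (hN : rho X = N%:R).
Local Notation ps := (st X p).
Let m1 : (1 < m)%N. Proof. by rewrite m2. Qed.
Let hp := par_p rz p0 m1 n0.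
Let hpp := st_p_neq rz p0 m1 n0.
Let hev := outer_odd rz p0 m1 n0 m2.

(** Odd indices counted from 0; for j < n the weight is delta_(j+1). The default p is not reached
    for j < 2n. *)
Definition dlt (j : nat) : 'I_dimV := insubd p (m + j)%N.
Lemma val_dlt j : (j < n + n)%N -> nat_of_ord (dlt j) = (m + j)%N.
Proof. by move=> h; rewrite /dlt val_insubd ltn_add2l h. Qed.
Lemma dlt_rshift j (hj : (j < n + n)%N) : dlt j = rshift m (Ordinal hj).
Proof. by apply: val_inj; rewrite /= val_dlt. Qed.

Let val_ps : nat_of_ord ps = 1%N.
Proof.
rewrite (rz_st rz); have m0 : (0 < m)%N by lia.
have -> : p = lshift _ (Ordinal m0) by apply: val_inj; rewrite /= p0.
by rewrite starL /=; lia.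
Qed.

Lemma inner_dlt a : a != p -> a != ps -> exists2 j, (j < n + n)%N & a = dlt j.
Proof.
rewrite -!val_eqE /= p0 val_ps => a0 a1; have ha := ltn_ord a.
exists (a - m)%N; first by lia.
by apply: val_inj; rewrite /= val_dlt; lia.
Qed.

Lemma hz_dlt j : (j < n + n)%N -> hz (dlt j) = 2 * n%:Z - 1 - 2 * j%:Z.
Proof. by move=> hj; rewrite dlt_rshift hzR. Qed.

Lemma wt_simple (alpha : 'M[C]_dimV -> C) : simple_root 1 alpha ->
  exists2 k : nat, (k <= 1)%N & alpha (dgm (fun a => (wt X p a)%:~R)) = k%:R.
Proof.
have hL : eps 1 (dgm (fun a => (wt X p a)%:~R)) = 1 :> C.
  by rewrite /eps (@diag_entryE _ _ _ _ 0 p) // (wt_p hpp).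
have hR (j : nat) : (0 < j <= n)%N -> delta j (dgm (fun a => (wt X p a)%:~R)) = 0 :> C.
  move=> hj; rewrite /delta (@diag_entryE _ _ _ _ _ (dlt j.-1)) ?val_dlt; try lia.
  rewrite wt_neq // -val_eqE /= val_dlt ?p0 ?val_ps; lia.
case=> [i ir||j jn|].
- lia.
- by exists 1%N => //; rewrite hL hR // subr0.
- by exists 0%N => //; rewrite !hR ?subr0 //; lia.
by exists 0%N => //; rewrite hR ?mulr0 //; lia.
Qed.

Section Vector.
Variables (q aa : nat).
Hypotheses (qn : (q <= n)%N) (ha : (0 < aa)%N).
(** The letters of weights delta_1, ..., delta_q. Together with [rs] they contain one odd index from
    each dual pair. *)
Definition ths := [seq dlt j | j <- iota 0 q].
Definition rs := [seq dlt j | j <- iota q (n - q)].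
Local Notation vv := (hwv X p aa ths rs (size rs)).

Lemma ths_rs : ths ++ rs = [seq dlt j | j <- iota 0 n].
Proof. by rewrite -map_cat -{1}[q]add0n -iotaD subnKC. Qed.
Lemma size_rs : size rs = (n - q)%N. Proof. by rewrite size_map size_iota. Qed.
Lemma size_ths : size ths = q. Proof. by rewrite size_map size_iota. Qed.
Lemma mem_ths_rs x : x \in ths ++ rs -> exists2 j, (j < n)%N & x = dlt j.
Proof. by rewrite ths_rs => /mapP [j]; rewrite mem_iota add0n => jn ->; exists j. Qed.
Lemma hsz : (size ths + size rs)%N = N.+1.
Proof. by rewrite size_ths size_rs subnKC. Qed.
Lemma huniq : uniq (ths ++ rs).
Proof.
rewrite ths_rs map_inj_in_uniq ?iota_uniq // => i j; rewrite !mem_iota !add0n => hi hj /(congr1 val) /=.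
by rewrite !val_dlt; lia.
Qed.
Lemma hin x : x \in ths ++ rs -> [/\ x != p, x != ps & par X x].
Proof.
move=> /mem_ths_rs [j jn ->]; have hj : (j < n + n)%N by lia.
rewrite -!val_eqE /= val_dlt // p0 val_ps (rz_par rz) dlt_rshift vparR; split=> //; lia.
Qed.
Lemma hiso x : x \in ths ++ rs -> st X x \notin ths ++ rs.
Proof.
move=> /mem_ths_rs [j jn ->]; apply/negP => /mem_ths_rs [k kn].
have hj : (j < n + n)%N by lia. have hk : (k < n + n)%N by lia.
by rewrite (rz_st rz) !dlt_rshift starR => /(congr1 val) /=; lia.
Qed.

Lemma vv_Hd : Hd X (aa + q + 2 * (n - q)) vv.
Proof. by have := Hd_hwv hp hpp aa hN hsz hin hiso; rewrite size_ths size_rs. Qed.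

(** A simple root is positive on the height and 0 or 1 on the p-weight, and [ths] consists of the q
    odd indices of greatest height: these are the requirements of [actF_hwv]. *)
Lemma hwv_hw (lam : 'M[C]_dimV -> C) (M Z : SV -> Prop) : smod X Z ->
  (forall h, lam (dgm h) = - aa%:R * h p + \sum_(1 <= j < q.+1) delta j (dgm h)) ->
  (forall b, b != p -> b != ps -> Z (Fo X p b vv)) -> M vv -> ~ Z vv -> hwvector 1 lam (odd q) M Z vv.
Proof.
move=> sZ hlam hZ Mv Zv; have Z0 := subsp0 (smod_sub sZ); split=> //.
- by apply/(rz_shomog rz); rewrite /phomog (par_hwv hp aa hin) size_ths -signr_odd.
- move=> alpha t Y hal hY; rewrite (rz_act rz _ hY.1).
  apply: (actF_hwv hp hpp ha hsz huniq hin (hz := hz)) => //; first by move=> a; rewrite (rz_st rz) hz_star.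
  + move=> a b a1 a2 /mapP [j]; rewrite mem_iota add0n /= => jq ->.
    have [k hk ->] := inner_dlt a1 a2; rewrite !hz_dlt //; last by lia.
    move=> jk; apply/mapP; exists k => //; rewrite mem_iota add0n /=; lia.
  + exact: (smod_sub sZ).
  move=> a b hab; have Yab : Y a (star b) != 0.
    by rewrite -(rz_st rz); apply: contraNneq hab => ->; rewrite mul0r.
  have [k k0 kE] := hz_simple (m := m) (r := 1) m2 isT n0 hal.
  have [l l1 lE] := wt_simple hal.
  have := root_coef (h := fun c => (hz c)%:~R) hY _ Yab; rewrite kE -intrD => h1.
  have := root_coef (h := fun c => (wt X p c)%:~R) hY _ Yab; rewrite lE -intrD => h2.
  have {}h1 : hz a + hz b = k by apply: (@intr_inj C); apply: h1 => c; rewrite hz_star intrN.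
  have {}h2 : wt X p a + wt X p b = l.
    by apply: (@intr_inj C); apply: h2 => c; rewrite -(rz_st rz) wt_st intrN.
  by rewrite h1 h2; split; lia.
move=> H /cartanP [h hs ->]; rewrite hlam (rz_hop rz hs).
have hs' a : h (st X a) = - h a by rewrite (rz_st rz) hs.
rewrite hop_hwv //.
suff -> : \sum_(x <- ths) h x = \sum_(1 <= j < q.+1) delta j (dgm h) by rewrite subrr.
rewrite big_add1 /= big_map /index_iota subn0 !big_seq; apply: eq_bigr => j; rewrite mem_iota add0n /= => jq.
by rewrite /delta (@diag_entryE _ _ _ _ _ (dlt j)) //= val_dlt //; lia.
Qed.
End Vector.

Local Notation Pos := (Pos X).

Lemma half_irreducible (Z : SV -> Prop) d p' : p' = p \/ p' = ps -> half_data X Z d p -> (0 < d)%N -> ~ Z (xp X p' d) ->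
  irreducible (Pos Z d p') Z.
Proof.
move=> pE hd d0 nx.
have [hp' hpp'] : par X p' = false /\ st X p' != p'.
  by case: pE => ->; split=> //; rewrite ?par_st ?stK // eq_sym.
have hd' : half_data X Z d p' by case: pE => -> //; apply: half_swap.
have sP := half_Pos hp' hpp' hd'.
apply: (irreducibleI rz sP (half_mod hd')).
- by move=> z; apply: Z_Pos.
- by move=> h; apply: nx; apply: h; apply: half_xp.
move=> Q u sQ ZQ QP Qu nu v; exact: (half_irr hp' hpp' hd' sQ QP ZQ Qu nu).
Qed.

(** The explicit vector has degree aa + q + 2(n - q) and p-weight -aa, so it lies in the half
    belonging to ps; its parity is that of the number q of odd factors. *)
Lemma two_halves (Z : SV -> Prop) (d : nat) (lam1 lam2 : 'M[C]_dimV -> C) (q aa : nat) :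
  half_data X Z d p -> (0 < d)%N -> ~ Z (xp X p d) -> ~ Z (xp X ps d) ->
  (q <= n)%N -> (0 < aa)%N -> d = (aa + q + 2 * (n - q))%N ->
  (forall h, lam1 (dgm h) = d%:R * h p) ->
  (forall h, lam2 (dgm h) = - aa%:R * h p + \sum_(1 <= j < q.+1) delta j (dgm h)) ->
  (forall b, b != p -> b != ps -> Z (Fo X p b (hwv X p aa (ths q) (rs q) (size (rs q))))) ->
  ~ Z (hwv X p aa (ths q) (rs q) (size (rs q))) ->
  exists P1 P2 : SV -> Prop, [/\ dsum2 (Hd X d) Z P1 P2,
    is_Lb 1 false lam1 P1 Z & is_Lb 1 (odd q) lam2 P2 Z].
Proof.
move=> hd d0 x1 x2 qn aa0 dE l1 l2 hF hv.
exists (Pos Z d p), (Pos Z d ps); split.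
- exact: (half_dsum hp hpp hd).
- split; first by apply: half_irreducible => //; left.
  exists (xp X p d); apply: (xp_hw rz p0 m1 n0 (r := 1)) => //; first exact: half_mod hd.
  exact: half_xp.
split; first by apply: half_irreducible => //; right.
exists (hwv X p aa (ths q) (rs q) (size (rs q))); apply: hwv_hw => //; first exact: half_mod hd.
have vH : Hd X d (hwv X p aa (ths q) (rs q) (size (rs q))) by rewrite dE; apply: vv_Hd.
apply: (Pos_weight (w := aa)) => //.
by have := Wt_ps (Wt_hwv hp hpp aa (hin qn aa0)); rewrite opprK.
Qed.
End TwoEvenModules.

(** * Generic, low and high degrees *)

Section Parts.
Variables (R : realType) (m n : nat).
Local Notation C := (R[i]).
Local Notation dimV := (m + (n + n))%N.
Local Notation SV := (superSym R m n).
Variables (B : 'M[C]_dimV) (X : fock dimV (SV : lmodType C)).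
Hypothesis rz : realizes B X.
Variable p : 'I_dimV.
Hypotheses (p0 : nat_of_ord p = 0%N) (m1 : (1 < m)%N) (n0 : (0 < n)%N).
Local Notation ps := (st X p).
Let hp := par_p rz p0 m1 n0.
Let hpp := st_p_neq rz p0 m1 n0.
Local Notation Hd := (Hd X).
Local Notation Ad := (Ad X).
Local Notation rho := (rho X).

Lemma Hd_Ad_regular d u : regular X d -> Hd d u <-> Ad d u.
Proof.
move=> rg; split=> [[h1 h2]|h].
  by split=> //; rewrite h2 Lo0 Lap0.
by split; [case: h|exact: (Ad_regular rg h)].
Qed.

Lemma c3_nat (d i j : nat) : (i + j < d)%N -> (d%:R - i%:R - j%:R - 1 : C) = (d - i - j - 1)%N%:R.
Proof. by move=> h; rewrite !natrB //; lia. Qed.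

Lemma dsum_Hd d : (forall i j : nat, (i < j < d./2.+1)%N -> (d%:R - i%:R - j%:R - 1 : C) != rho) ->
  (forall i : nat, (i <= d./2)%N -> regular X (d - 2 * i)) ->
  dsum (Sd d) zeroS (fun i : 'I_(d %/ 2).+1 => Lpow B i (Hd (d - 2 * i))).
Proof.
move=> c3 rg; rewrite divn2.
apply: (dsum_decomp rz hp hpp _ c3 (dvd_full X d)) => // i u.
by apply: Hd_Ad_regular; apply: rg; rewrite -ltnS.
Qed.

Lemma structure_generic : (forall k : nat, k%:R != rho) -> inner X p ->
  (forall d : nat,
      dsum (Sd d) zeroS (fun i : 'I_(d %/ 2).+1 => Lpow B i (Hd (d - 2 * i)))
      /\ irreducible (Hd d) zeroS)
    /\ sqiso fullS (ideal_one_sub_omega B) (infsum Hd) zeroS.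
Proof.
move=> hr hi; have rg d : regular X d by move=> j _; apply: hr.
have c3 (d i j : nat) : (i < j < d./2.+1)%N -> (d%:R - i%:R - j%:R - 1 : C) != rho.
  by move=> h; rewrite c3_nat ?hr //; lia.
split=> [d|].
  by split; [apply: dsum_Hd => // i j; apply: c3|apply: (irr_Hd rz hp hpp); [left|]].
apply: (@quotient_iso _ _ _ _ _ rz Hd 0) => [d|d u []|d _] //; first exact: smod_Hd.
apply: (@decomp_quot _ _ _ X p hp hpp d d./2.+1) => //.
- by move=> i j; apply: c3.
- exact: dvd_full.
- by move=> i u _; apply: Hd_Ad_regular.
by move=> i u; lia.
Qed.

Section PartB.
Variable N : nat.
Hypothesis hN : rho = N%:R.
Let hf : (N <= N <= 2 * N)%N. Proof. lia. Qed.

Lemma structure_low d : (d <= N.+1)%N ->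
  dsum (Sd d) zeroS (fun i : 'I_(d %/ 2).+1 => Lpow B i (Hd (d - 2 * i))) /\ irreducible (Hd d) zeroS.
Proof.
move=> dN; have rg i : (i <= N.+1)%N -> regular X i := fun h => regular_low hp hpp hN hf h.
split.
  apply: dsum_Hd => [i j h|i h]; last by apply: rg; lia.
  by rewrite c3_nat ?hN ?eqr_nat; lia.
apply: (irr_Hd rz hp hpp); last exact: rg.
by right=> j jd; rewrite hN -[1]/(1%:R) -natrD eqr_nat; lia.
Qed.

Lemma Ad_bottom : same (Ad N.+1) (Hd N.+1).
Proof. by move=> u; apply: iff_sym; apply: Hd_Ad_regular; exact: (regular_low hp hpp hN hf). Qed.

Section High.
Variable d : nat.
Hypothesis hd : (2 * N + 2 < d)%N.
Local Notation k0 := ((d - N - 1) %/ 2).+1.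
Let rgh i : (2 * N + 2 < i)%N -> regular X i. Proof. exact: (regular_high hp hpp hN hf). Qed.
Let hk0 : (k0 <= d./2.+1)%N. Proof. lia. Qed.
Let c3 (i j : nat) : (i < j < k0)%N -> (d%:R - i%:R - j%:R - 1 : C) != rho.
Proof. by move=> h; rewrite c3_nat ?hN ?eqr_nat; lia. Qed.
Let hdv : \prod_(i < d./2.+1) ('X - (lam X d i)%:P) %| \prod_(j < k0) Gq (lam X d j).
Proof. by apply: (dvd_half hp hpp hN); lia. Qed.

Lemma structure_high t : t = ((d - 2 * N - 3) %/ 2)%N ->
  dsum (Sd d) zeroS (fun i : 'I_k0 => Lpow B i (if (i <= t)%N then Hd (d - 2 * i) else Ad (d - 2 * i)%N)).
Proof.
move=> tE; apply: (dsum_decomp rz hp hpp hk0 c3 hdv) => i u.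
case: ifP => // it; apply: Hd_Ad_regular; apply: rgh; lia.
Qed.

Lemma irr_Hd_high : inner X p -> irreducible (Hd d) zeroS.
Proof. by move=> hi; apply: (irr_Hd rz hp hpp); [left|apply: rgh]. Qed.

Lemma decomp_high (M : nat -> SV -> Prop) :
  M = (fun e => if (e < N.+1)%N then zeroS else if (e <= 2 * N + 2)%N then Ad e else Hd e) ->
  exists r : nat,
    [/\ forall u, Sdg X d u -> exists a : 'I_r -> SV, (forall i : 'I_r, M (d - 2 * i)%N (a i)) /\ u = \sum_(i < r) iter i (Lo X) (a i),
      forall a : 'I_r -> SV, (forall i : 'I_r, M (d - 2 * i)%N (a i)) -> \sum_(i < r) iter i (Lo X) (a i) = 0 -> forall i, a i = 0,
      (r <= d./2.+1)%N
    & forall (i : nat) u, (r <= i <= d./2)%N -> M (d - 2 * i)%N u -> u = 0].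
Proof.
move=> ME; apply: (@decomp_quot _ _ _ X p hp hpp d k0 M hk0 c3 hdv) => i u ik; rewrite ME.
  rewrite ifN; last lia.
  by case: ifP => // h; apply: Hd_Ad_regular; apply: rgh; lia.
by rewrite ifT //; lia.
Qed.

Lemma halves_Hd_high (lam2 : 'M[C]_dimV -> C) : m = 2%N -> n = N.+1 ->
  (forall H, lam2 H = ((2 * n)%N%:R - d%:R) * eps 1 H) ->
  exists P1 P2 : SV -> Prop,
    [/\ dsum2 (Hd d) zeroS P1 P2, is_Lb 1 false (fun H => d%:R * eps 1 H) P1 zeroS
      & is_Lb 1 false lam2 P2 zeroS].
Proof.
move=> m2 nN hlam; have hev := outer_odd rz p0 m1 n0 m2.
have hps : par X ps = false by rewrite par_st.
have hpps : st X ps != ps by rewrite stK eq_sym.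
have qn : (0 <= n)%N by []. have aa0 : (0 < d - 2 * n)%N by lia.
have hs := hsz p nN qn.
have hin' := hin rz p0 m2 n0 nN qn aa0.
have hiso' := hiso rz p0 m2 n0 nN qn aa0.
have hun := huniq rz p0 m2 n0 nN qn aa0.
(* With q = 0 the vector has degree aa + 2n, which forces aa = d - 2n. *)
apply: (two_halves rz p0 m2 n0 nN hN (q := 0) (aa := d - 2 * n)) => //.
- apply: (half_high hp hpp hN hev); lia.
- lia.
- exact: xp_neq0.
- exact: xp_neq0.
- lia.
- by move=> h; rewrite (eps1E p0).
- move=> h; rewrite hlam (eps1E p0) big_geq // addr0; congr (_ * _).
  rewrite natrB ?opprB //; lia.
(* F_pb raises the p-weight to 1 - aa, that is, aa - 1 with respect to ps; as d > 2n + (aa - 1),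
   harmonic vectors of this weight vanish. *)
- move=> b b1 b2.
  have [h1 h2] := hwv_Fo_wt hp hpp hN (d - 2 * n) hs hin' hiso' b1 b2.
  apply: (harm_weight_pos hps hpps hN _ (d := d) (w := (d - 2 * n).-1)).
  + by move=> a a1; rewrite stK => a2; apply: hev.
  + move: h1; rewrite size_ths size_rs; congr (Hd _ _); lia.
  + by move: (Wt_ps h2); congr (Wt X _ _ _); lia.
  lia.
exact: (hwv_neq0 hp hpp aa0 hs hun hin' hiso').
Qed.
End High.
End PartB.
End Parts.

(** * Module structure in the critical degrees *)

Section CriticalDegrees.
Variables (R : realType) (m n : nat).
Local Notation C := (R[i]).
Local Notation dimV := (m + (n + n))%N.
Local Notation SV := (superSym R m n).
Variables (B : 'M[C]_dimV) (X : fock dimV (SV : lmodType C)).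
Hypothesis rz : realizes B X.
Variable p : 'I_dimV.
Hypotheses (p0 : nat_of_ord p = 0%N) (m1 : (1 < m)%N) (n0 : (0 < n)%N).
Local Notation ps := (st X p).
Let hp := par_p rz p0 m1 n0.
Let hpp := st_p_neq rz p0 m1 n0.
Local Notation Hd := (Hd X).
Local Notation Ad := (Ad X).
Local Notation Wd := (Wd X).
Local Notation rho := (rho X).
Variables (N f0 : nat).
Hypotheses (hN : rho = N%:R) (hf : (N <= f0 <= 2 * N)%N).
Local Notation t := (f0 - N)%N.
Local Notation e := (f0 - 2 * t)%N.
Local Notation LsH := (fun u : SV => exists2 h, Hd e h & u = iter t.+1 (Lo X) h).

Lemma LpowE i (M : SV -> Prop) : Lpow B i M = fun u => exists2 h, M h & u = iter i (Lo X) h.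
Proof. by rewrite /Lpow (rz_Lo rz). Qed.

Lemma irr_middle : inner X p -> irreducible (Hd f0.+2) LsH.
Proof.
move=> hi; have LH : incl LsH (Hd f0.+2) by move=> u; exact: (LsH_Hd hp hpp hN hf).
have nH : ~ incl (Hd f0.+2) LsH.
  by move=> h; exact: (xp_notin_LsH hp hpp (h _ (Hd_xp hp hpp f0.+2))).
apply: (irreducibleI rz (smod_Hd X f0.+2) (smod_LsH X N f0) LH nH) => Q u sQ LQ QH Qu nu h.
exact: (quot_irr hp hpp hN hf hi sQ LQ QH Qu nu).
Qed.

Lemma middle_two : m = 2%N -> n = N.+1 -> exists P1 P2 : SV -> Prop,
  [/\ dsum2 (Hd f0.+2) LsH P1 P2, is_Lb 1 false (fun H => f0.+2%:R * eps 1 H) P1 LsH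
    & is_Lb 1 (odd e.+1) (fun H => - eps 1 H + \sum_(1 <= j < e.+2) delta j H) P2 LsH].
Proof.
move=> m2 nN; have hev := outer_odd rz p0 m1 n0 m2.
have hps : par X ps = false by rewrite par_st.
have hpps : st X ps != ps by rewrite stK eq_sym.
have qn : (e.+1 <= n)%N by lia.
have hs := hsz p nN qn.
have hin' := hin rz p0 m2 n0 nN qn (ltn0Sn 0).
have hiso' := hiso rz p0 m2 n0 nN qn (ltn0Sn 0).
have hun := huniq rz p0 m2 n0 nN qn (ltn0Sn 0).
(* The choice aa = 1, q = e + 1 gives degree 2n - e = f0 + 2 and weight -epsilon_1 + delta_1 + ... +
   delta_(e+1). *)
apply: (two_halves rz p0 m2 n0 nN hN (Z := LsH) (q := e.+1) (aa := 1)) => //.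
- exact: (half_crit hp hpp hN hev hf).
- exact: (xp_notin_LsH hp hpp).
- exact: (xp_notin_LsH hps hpps).
- lia.
- by move=> h; rewrite (eps1E p0).
- by move=> h; rewrite (eps1E p0) mulN1r.
(* F_pb carries the weight from -1 to 0, and harmonic vectors of weight 0 lie in L^s H_e. *)
- move=> b b1 b2; have [h1 h2] := hwv_Fo_wt hp hpp hN 1 hs hin' hiso' b1 b2.
  apply: (weight0_LsH hp hpp hN hev hf) => //.
  by move: h1; rewrite size_ths size_rs; congr (Hd _ _); lia.
case=> h _ vE; apply: (hwv_notin hp hpp (ltn0Sn 0) hs hun hin' hiso' (h := h)).
(* Here [size rs] = n - e - 1 = t, so the power t + 1 = s is exactly the one excluded by
   [hwv_notin]. *)
rewrite vE; apply: (f_equal (fun k => iter k.+1 (Lo X) h)); rewrite size_rs; lia.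
Qed.

(** Semisimplicity of Q_d: it is simple if there is an inner even index, and for m = 2 it is the sum
    of the two halves. *)
Lemma socle1_sub : inner X p \/ m = 2%N /\ n = N.+1 -> incl (Hd f0.+2) (socle (Ad f0.+2) LsH).
Proof.
have HA : incl (Hd f0.+2) (Ad f0.+2) by move=> u; exact: Hd_Ad.
have L0 := subsp0 (smod_sub (smod_LsH X N f0)).
case=> [hi u hu|[m2 nN] u hu].
  exists 1%N, (fun=> Hd f0.+2), (fun=> u); split; last by rewrite sub_sum1.
  by move=> i; split=> //; exact: irr_middle.
have [P1 [P2 [[_ hd _] [i1 _] [i2 _]]]] := middle_two m2 nN.
have [f hf1 hf2] := (hd u).1 hu.
exists 2%N, (fun i : 'I_2 => if i == ord0 then P1 else P2), (fun i : 'I_2 => f (i == ord0)).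
split; last by rewrite -sum_bool2.
move=> i; split; last exact: (hf1 (i == ord0)).
  by case: (i == ord0).
move=> v hv; apply: HA; apply/hd; exists (fun j => if j == (i == ord0) then v else 0); last by rewrite sub_sum_single.
move=> j; case: eqP => [->|_]; first by [].
by case: j; [case: i1 => -[/(submodE rz) s1 _ _] _ _; apply: (subsp0 (smod_sub s1))
            |case: i2 => -[/(submodE rz) s1 _ _] _ _; apply: (subsp0 (smod_sub s1))].
Qed.

Lemma structure_critical : inner X p \/ m = 2%N /\ n = N.+1 ->
  let Hlow := Hd e in
  let L := Lpow B t.+1 Hlow in
  (is_submod (Wd f0) /\ is_submod (Ad f0.+2))
  /\ dsum2 (Sd f0) zeroS (Lpow B t Hlow) (Wd f0)
  /\ dsum2 (Sd f0.+2) zeroS (Ad f0.+2) (Lpow B 1 (Wd f0))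
  /\ induces_iso (fun u => Lap X (Lomega B u)) (Wd f0) zeroS (Wd f0) zeroS
  /\ incl (Hd f0.+2) (Ad f0.+2)
  /\ selfdual (Ad f0.+2)
  /\ indecomposable (Ad f0.+2) zeroS
  /\ (irreducible (Ad f0.+2) (radical (Ad f0.+2)) /\ sqiso (Ad f0.+2) (radical (Ad f0.+2)) Hlow zeroS)
  /\ (irreducible (socle (Ad f0.+2) zeroS) zeroS /\ sqiso (socle (Ad f0.+2) zeroS) zeroS Hlow zeroS)
  /\ [/\ same (socfil (Ad f0.+2) 3) (Ad f0.+2),
         sqiso (socfil (Ad f0.+2) 3) (socfil (Ad f0.+2) 2) Hlow zeroS,
         sqiso (socfil (Ad f0.+2) 2) (socfil (Ad f0.+2) 1) (Hd f0.+2) L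
       & sqiso (socfil (Ad f0.+2) 1) (socfil (Ad f0.+2) 0) Hlow zeroS].
Proof.
move=> hr Hlow; rewrite !LpowE => L.
have s1 : socfil (Ad f0.+2) 1 = LsH := socle0E rz hp hpp hN hf.
have s2 : socfil (Ad f0.+2) 2 = Hd f0.+2.
  have -> : socfil (Ad f0.+2) 2 = socle (Ad f0.+2) (socfil (Ad f0.+2) 1) by [].
  by rewrite s1; apply: (socle1E rz hp hpp hN hf); apply: socle1_sub.
have s3 : socfil (Ad f0.+2) 3 = Ad f0.+2.
  have -> : socfil (Ad f0.+2) 3 = socle (Ad f0.+2) (socfil (Ad f0.+2) 2) by [].
  by rewrite s2; exact: (socle2E rz hp hpp hN hf).
have HA : incl (Hd f0.+2) (Ad f0.+2) by move=> u; exact: Hd_Ad.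
split; first by split; apply/(submodE rz); [exact: smod_Wd|exact: smod_Ad].
split; first by rewrite (rz_Sd rz); exact: (crit_dsum_W hp hpp hN hf).
split; first by rewrite (rz_Sd rz); exact: (crit_dsum_A hp hpp hN hf).
split.
  rewrite (rz_Lo rz); have sW := smod_Wd X f0.
  apply: (hom_induces_iso rz _ sW sW).
  - exact: (mhom_comp (mhom_Lap X) (mhom_Lo X)).
  - by move=> u hu; exists u => //; exact: (Wd_Sdg hu).
  - by move=> u; exact: (crit_Winj hp hpp hN hf).
  by move=> v; exact: (crit_Wsurj hp hpp hN hf).
split; first exact: HA.
split; first exact: (Ad_selfdual rz hp hpp hN hf).
split; first exact: (Ad_indec rz hp hpp hN hf).
split; first by rewrite (radicalE rz hp hpp hN hf); split; [exact: (irr_head rz hp hpp hN hf)|exact: (iso_head rz hp hpp hN hf)].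
have iso1 := iso_socle rz hp hpp N f0.
split; first by rewrite -[socle _ _]/(socfil (Ad f0.+2) 1) s1; split; [exact: (irr_LsH rz hp hpp hN hf)|exact: iso1].
split.
- by rewrite s3.
- by rewrite s3 s2; exact: (iso_head rz hp hpp hN hf).
- rewrite s2 s1; apply: (sqiso_same rz (smod_Hd X f0.+2) (smod_LsH X N f0)).
  by move=> u; exact: (LsH_Hd hp hpp hN hf).
by rewrite s1; exact: iso1.
Qed.

Lemma low_Lb r : m = (2 * r)%N -> is_Lb r false (fun H => e%:R * eps 1 H) (Hd e) zeroS.
Proof.
move=> mr; split; first exact: (irr_low rz hp hpp hN hf).
exists (xp X p e); apply: (xp_hw rz p0 m1 n0 mr) => //.
- by move=> h; rewrite (eps1E p0).
- exact: smod_zero.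
- exact: Hd_xp.
exact: xp_neq0.
Qed.

Lemma middle_Lb r : m = (2 * r)%N -> inner X p ->
  is_Lb r false (fun H => f0.+2%:R * eps 1 H) (Hd f0.+2) (Lpow B t.+1 (Hd e)).
Proof.
move=> mr hi; rewrite LpowE; split; first exact: irr_middle.
exists (xp X p f0.+2); apply: (xp_hw rz p0 m1 n0 mr) => //.
- by move=> h; rewrite (eps1E p0).
- exact: smod_LsH.
- exact: Hd_xp.
exact: (xp_notin_LsH hp hpp).
Qed.
End CriticalDegrees.

Theorem mainTheorem2 (R : realType) (m n : nat)
    (hm : (2 <= m)%N) (hn : (1 <= n)%N)
    (B : 'M[R[i]]_(m + (n + n))) (hB : invariant_form B)
    (Omega : {linear superSym R m n -> superSym R m n})
    (hOmega : is_laplacian B Omega) :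
  (* (A) *)
  (odd m \/ (2 * n < m)%N ->
    (forall d : nat,
      dsum (Sd d) zeroS
        (fun i : 'I_(d %/ 2).+1 => Lpow B i (harm Omega (d - 2 * i)))
      /\ irreducible (harm Omega d) zeroS)
    /\ sqiso fullS (ideal_one_sub_omega B) (infsum (harm Omega)) zeroS)
  /\
  (* (B) *)
  (forall r : nat, m = (2 * r)%N -> (r <= n)%N ->
    (* (B1) *)
    (forall d : nat, (d <= n - r + 1)%N ->
      dsum (Sd d) zeroS
        (fun i : 'I_(d %/ 2).+1 => Lpow B i (harm Omega (d - 2 * i)))
      /\ irreducible (harm Omega d) zeroS)
    /\
    exists W A : nat -> superSym R m n -> Prop,
      same (A (n - r + 1)%N) (harm Omega (n - r + 1))
      /\
      (* (B2) *)
      (forall d s : nat,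
        (n - r + 2 <= d <= 2 * (n - r) + 2)%N -> s = (d - (n - r) - 1)%N ->
        let Hlow := harm Omega (d - 2 * s) in
        let LsH := Lpow B s Hlow in
        (is_submod (W (d - 2)%N) /\ is_submod (A d))
        /\ dsum2 (Sd (d - 2)) zeroS (Lpow B (s - 1) Hlow) (W (d - 2)%N)
        /\ dsum2 (Sd d) zeroS (A d) (Lpow B 1 (W (d - 2)%N))
        /\ induces_iso (fun u => Omega (Lomega B u))
             (W (d - 2)%N) zeroS (W (d - 2)%N) zeroS
        /\ incl (harm Omega d) (A d)
        /\ selfdual (A d)
        /\ indecomposable (A d) zeroS
        (* irreducible head and socle *)
        /\ (irreducible (A d) (radical (A d))
            /\ sqiso (A d) (radical (A d)) Hlow zeroS)
        /\ (irreducible (socle (A d) zeroS) zeroS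
            /\ sqiso (socle (A d) zeroS) zeroS Hlow zeroS)
        (* the layers of the socle filtration, from top to bottom *)
        /\ [/\ same (socfil (A d) 3) (A d),
               sqiso (socfil (A d) 3) (socfil (A d) 2) Hlow zeroS,
               sqiso (socfil (A d) 2) (socfil (A d) 1)
                     (harm Omega d) LsH
             & sqiso (socfil (A d) 1) (socfil (A d) 0) Hlow zeroS]
        /\ is_Lb r false (fun H => (d - 2 * s)%N%:R * eps 1 H) Hlow zeroS
        /\ ((2 <= r)%N ->
             is_Lb r false (fun H => d%:R * eps 1 H) (harm Omega d) LsH)
        /\ (r = 1%N ->
             exists P1 P2 : superSym R m n -> Prop,
             [/\ dsum2 (harm Omega d) LsH P1 P2,
                 is_Lb r false (fun H => d%:R * eps 1 H) P1 LsH
               & is_Lb r (odd (d - 2 * s + 1))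
                   (fun H => - eps 1 H
                     + \sum_(1 <= j < (d - 2 * s + 1).+1) delta j H) P2 LsH]))
      /\
      (* (B3) *)
      (forall d t : nat,
        (2 * (n - r) + 2 < d)%N -> t = ((d - 2 * (n - r) - 3) %/ 2)%N ->
        dsum (Sd d) zeroS
          (fun i : 'I_((d - (n - r) - 1) %/ 2).+1 =>
             Lpow B i (if (i <= t)%N then harm Omega (d - 2 * i)
                       else A (d - 2 * i)%N))
        /\ ((2 <= r)%N -> irreducible (harm Omega d) zeroS)
        /\ (r = 1%N ->
             exists (P1 P2 : superSym R m n -> Prop) (p1 p2 : bool),
             [/\ dsum2 (harm Omega d) zeroS P1 P2,
                 is_Lb r p1 (fun H => d%:R * eps 1 H) P1 zeroS
               & is_Lb r p2 (fun H => ((2 * n)%N%:R - d%:R) * eps 1 H)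
                   P2 zeroS]))
      /\
      (* (B4) *)
      sqiso fullS (ideal_one_sub_omega B)
        (infsum (fun d =>
           if (d < n - r + 1)%N then zeroS
           else if (d <= 2 * (n - r) + 2)%N then A d
           else harm Omega d)) zeroS).
Proof.
have m1 : (1 < m)%N := hm. have n0 : (0 < n)%N := hn. have m0 : (0 < m)%N by exact: ltnW.
have [X rz] := realizes_exists hB n0.
pose p : 'I_(m + (n + n)) := lshift (n + n) (Ordinal m0).
have p0 : nat_of_ord p = 0%N by [].
have hp := par_p rz p0 m1 n0; have hpp := st_p_neq rz p0 m1 n0.
have rhoE := rz_rho rz.
(* Both operators are adjoint to multiplication by omega for the same nondegenerate form. *)
have eO : (Omega : superSym R m n -> superSym R m n) = Lap X.
  apply/funext => u; apply: (sf_inj (X := X)) => g.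
  by rewrite sf_Lap -!(rz_sf rz) hOmega (rz_Lo rz).
have hE : harm Omega = Hd X.
  by apply/funext => d; apply/funext => u; rewrite /harm (rz_Sd rz) eO.
rewrite hE; split=> [hA|r mr rn].
  apply: (structure_generic rz p0 m1 n0); last first.
    apply: (inner_p rz p0 m1 n0); case: hA => [|]; first by case: (m) hm => [|[|[|k]]].
    lia.
  (* For m odd rho is not an integer, and for m > 2n it is negative; in neither case is it a natural
     number. *)
  move=> k; rewrite rhoE; apply/eqP => /(congr1 ( *%R^~ 2)).
  rewrite mulrBl mulfVK ?pnatr_eq0 // => /eqP; rewrite eq_sym subr_eq -[2]/(2%:R) -!natrM -natrD eqr_nat => /eqP.
  by case: hA; lia.
have hN : rho X = (n - r)%N%:R.
  by rewrite rhoE natrB // mr natrM mulrAC divff ?mul1r // pnatr_eq0.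
set N := (n - r)%N in hN *.
have hr2 : (2 <= r)%N -> inner X p by move=> r2; apply: (inner_p rz p0 m1 n0); lia.
have hr1 : r = 1%N -> m = 2%N /\ n = N.+1 by move=> r1; rewrite /N; lia.
have hr : inner X p \/ m = 2%N /\ n = N.+1.
  have [r2|r2] := leqP 2 r; first by left; exact: hr2.
  by right; apply: hr1; lia.
rewrite !addn1; split; first by move=> d dN; exact: (structure_low rz p0 m1 n0 hN dN).
exists (Wd X), (Ad X); split; first exact: (Ad_bottom rz p0 m1 n0 hN).
split; [|split].
- move=> d s dN sE.
  have [f0 dE] : exists f0, d = f0.+2 by exists (d - 2)%N; lia.
  have hf : (N <= f0 <= 2 * N)%N by lia.
  have {}sE : s = (f0 - N).+1 by lia.
  have eE : (d - 2 * s)%N = (f0 - 2 * (f0 - N))%N by lia.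
  have d2 : (d - 2)%N = f0 by lia.
  have s1 : (s - 1)%N = (f0 - N)%N by lia.
  rewrite eE d2 s1 eO => Hlow LsH; rewrite /LsH /Hlow {LsH Hlow} sE dE ?addn1.
  have [b1 [b2 [b3 [b4 [b5 [b6 [b7 [b8 [b9 b10]]]]]]]]] := structure_critical rz p0 m1 n0 hN hf hr.
  do 10![split; first by []].
  split; first exact: (low_Lb rz p0 m1 n0 hN hf mr).
  split; first by move=> r2; exact: (middle_Lb rz p0 m1 n0 hN hf mr (hr2 r2)).
  move=> r1; have [m2 nN] := hr1 r1; rewrite r1 (LpowE rz).
  exact: (middle_two rz p0 m1 n0 hN hf m2 nN).
- move=> d t dN tE; split; first exact: (structure_high rz p0 m1 n0 hN dN tE).
  split; first by move=> r2; exact: (irr_Hd_high rz p0 m1 n0 hN dN (hr2 r2)).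
  move=> r1; have [m2 nN] := hr1 r1.
  have [P1 [P2 [h1 h2 h3]]] := halves_Hd_high rz p0 m1 n0 hN dN
    (lam2 := fun H => ((2 * n)%N%:R - d%:R) * eps 1 H) m2 nN (fun H => erefl).
  by exists P1, P2, false, false; rewrite r1; split.
set M := (fun d : nat => _).
have ME : M = (fun e => if (e < N.+1)%N then zeroS else if (e <= 2 * N + 2)%N then Ad X e else Hd X e) by [].
(* From degree 2N + 3 on, S^d decomposes into the summands collected in [M]. *)
apply: (quotient_iso rz (M := M) (D0 := 2 * N + 3)).
- move=> d; rewrite ME; case: ifP => _; first exact: smod_zero.
  by case: ifP => _; [exact: smod_Ad|exact: smod_Hd].
- move=> d u; rewrite ME; case: ifP => _; first by move=> ->; exact: Sdg0.
  by case: ifP => _ [].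
move=> d dN; apply: (decomp_high rz p0 m1 n0 hN _ ME); lia.
Qed.
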